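(* Let $D_B\supseteq D_A=D$, $\dim\ker A=n<\infty$, let $\lambda A+B$ be a regular pencil of index $\nu$, and let $f\in C(\mathbb R_+\times D,Y)$ have the structure $$f(t,x)=(Q_1+Q_{20})f(t,x)+\sum_{s=1}^{\nu-2}Q_{2\Sigma,s}f\Big(t,\sum_{j=1}^{\nu-1}x_{2j}^{(j+1)}+\sum_{j=s}^{\nu-2}x_{2\wedge,j}\Big)+\sum_{s=1}^{\nu-1}Q_{2s}^{(s+1)}f\Big(t,\sum_{j=s}^{\nu-1}x_{2j}^{(j+1)}\Big).$$ Assume that there exist open sets $M_{20}\subseteq D_{20}$, $M_{2j}^{(j+1)}\subseteq D_{2j}^{(j+1)}$ and $M_{2\wedge,j}\subseteq D_{2\wedge,j}$ ($j=1,\dots,\nu-2$), $M_{2(\nu-1)}=M_{2(\nu-1)}^{(\nu)}\subseteq D_{2(\nu-1)}$ such that, for $s=1,\dots,\nu-2$, $$Q_{2s}^{(s+1)}f\in C^{\nu-2}\Big(\mathbb R_+\times\big(\dot{+}_{i=s}^{\nu-1}M_{2i}^{(i+1)}\big),Y_{2s}^{(s+1)}\Big),\quad Q_{2\Sigma,s}f\in C^s\Big(\mathbb R_+\times\big(\dot{+}_{i=1}^{\nu-1}M_{2i}^{(i+1)}\,\dot{+}\,\dot{+}_{i=s}^{\nu-2}M_{2\wedge,i}\big),Y_{2\Sigma,s}\Big),$$ and $Q_{2(\nu-1)}f\in C^{\nu-1}(\mathbb R_+\times M_{2(\nu-1)},Y_{2(\nu-1)})$, and such that, with $M_{2\Sigma}=\dot{+}_{i=1}^{\nu-1}M_{2i}^{(i+1)}\,\dot{+}\,\dot{+}_{i=1}^{\nu-2}M_{2\wedge,i}$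 and $M=D_1\dot{+}M_{20}\dot{+}M_{2\Sigma}$, the following conditions hold. 1.a. For each $t\in\mathbb R_+$ there exists a unique $x_{2(\nu-1)}\in M_{2(\nu-1)}$ such that $F_{2(\nu-1)}(t,x_{2(\nu-1)})=0$. 1.b. For each $s=1,\dots,\nu-2$: for each $t\in\mathbb R_+$, $x_{2j}^{(j+1)}\in M_{2j}^{(j+1)}$, $j=s+1,\dots,\nu-1$, there exists a unique $x_{2s}^{(s+1)}\in M_{2s}^{(s+1)}$ such that $F_{2s}^{(s+1)}=0$ at $(t,x_{2j}^{(j+1)},j=s,\dots,\nu-1)$. 1.c. For each $t\in\mathbb R_+$, $x_{2j}^{(j+1)}\in M_{2j}^{(j+1)}$, $j=1,\dots,\nu-1$, $d_{2(\nu-1)}\in D_{2(\nu-1)}$ there exists a unique $x_{2\wedge,\nu-2}\in M_{2\wedge,\nu-2}$ such that $F_{2\Sigma,\nu-2}=0$ at these values. 1.d. For each $s=1,\dots,\nu-3$: for each $t\in\mathbb R_+$, $x_{2j}^{(j+1)}\in M_{2j}^{(j+1)}$, $j=1,\dots,\nu-1$, $x_{2\wedge,i}\in M_{2\wedge,i}$, $i=s+1,\dots,\nu-2$, $d_{2\wedge,s+1}\in D_{2\wedge,s+1}$, $d_{2(s+1)}^{(s+2)}\in D_{2(s+1)}^{(s+2)}$ there exists a unique $x_{2\wedge,s}\in M_{2\wedge,s}$ such that $F_{2\Sigma,s}=0$ at these values. 1.e. For each $t\in\mathbb R_+$, $x_1\in D_1$, $x_{2\Sigma}\in M_{2\Sigma}$,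 $d_{2\wedge,1}\in D_{2\wedge,1}$, $d_{21}^{(2)}\in D_{21}^{(2)}$ there exists a unique $x_{20}\in M_{20}$ such that $F_{20}=0$ at these values. 2.a. For any fixed $\hat t\in\mathbb R_+$, $\hat x_{2(\nu-1)}\in M_{2(\nu-1)}$ satisfying $F_{2(\nu-1)}=0$, the operator $[\partial_x(Q_{2(\nu-1)}f)(\hat t,\hat x_{2(\nu-1)})-Q_{2(\nu-1)}B]P_{2(\nu-1)}|_{D_{2(\nu-1)}}:D_{2(\nu-1)}\to Y_{2(\nu-1)}$ has an inverse in $\mathrm L(Y_{2(\nu-1)},D_{2(\nu-1)})$. 2.b. For each $s=1,\dots,\nu-2$: for any fixed $\hat t\in\mathbb R_+$, $\hat x_{2i}^{(i+1)}\in M_{2i}^{(i+1)}$, $i=s,\dots,\nu-1$, satisfying $F_{2s}^{(s+1)}=0$, the operator $[\partial_x(Q_{2s}^{(s+1)}f)(\hat t,\sum_{i=s}^{\nu-1}\hat x_{2i}^{(i+1)})-Q_{2s}^{(s+1)}B]P_{2s}^{(s+1)}|_{D_{2s}^{(s+1)}}:D_{2s}^{(s+1)}\to Y_{2s}^{(s+1)}$ has an inverse in $\mathrm L(Y_{2s}^{(s+1)},D_{2s}^{(s+1)})$. 2.c. For any fixed $\hat t\in\mathbb R_+$, $\hat x_{2j}^{(j+1)}\in M_{2j}^{(j+1)}$, $j=1,\dots,\nu-1$, $\hat x_{2\wedge,\nu-2}\in M_{2\wedge,\nu-2}$, $\hat d_{2(\nu-1)}\in D_{2(\nu-1)}$ satisfying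 $F_{2\Sigma,\nu-2}=0$, the operator $[\partial_x(Q_{2\Sigma,\nu-2}f)(\hat t,\sum_{j=1}^{\nu-1}\hat x_{2j}^{(j+1)}+\hat x_{2\wedge,\nu-2})-Q_{2\Sigma,\nu-2}B]P_{2\wedge,\nu-2}|_{D_{2\wedge,\nu-2}}:D_{2\wedge,\nu-2}\to Y_{2\Sigma,\nu-2}$ has an inverse in $\mathrm L(Y_{2\Sigma,\nu-2},D_{2\wedge,\nu-2})$. 2.d. For each $s=1,\dots,\nu-3$: for any fixed $\hat t\in\mathbb R_+$, $\hat x_{2j}^{(j+1)}\in M_{2j}^{(j+1)}$, $j=1,\dots,\nu-1$, $\hat x_{2\wedge,i}\in M_{2\wedge,i}$, $i=s,\dots,\nu-2$, $\hat d_{2\wedge,s+1}\in D_{2\wedge,s+1}$, $\hat d_{2(s+1)}^{(s+2)}\in D_{2(s+1)}^{(s+2)}$ satisfying $F_{2\Sigma,s}=0$, the operator $[\partial_x(Q_{2\Sigma,s}f)(\hat t,\sum_{j=1}^{\nu-1}\hat x_{2j}^{(j+1)}+\sum_{i=s}^{\nu-2}\hat x_{2\wedge,i})-Q_{2\Sigma,s}B]P_{2\wedge,s}|_{D_{2\wedge,s}}:D_{2\wedge,s}\to Y_{2\Sigma,s}$ has an inverse in $\mathrm L(Y_{2\Sigma,s},D_{2\wedge,s})$. 2.e. One of the following two conditions holds. (i) The components $Q_1f(t,x_1+x_{20}+x_{2\Sigma})$ and $Q_{20}f(t,x_1+x_{20}+x_{2\Sigma})$ satisfy locally a Lipschitz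 condition with respect to $x_1+x_{20}$ on $\mathbb R_+\times M$; and for any fixed $\hat t\in\mathbb R_+$, $\hat x_1\in D_1$, $\hat x_{20}\in M_{20}$, $\hat x_{2\Sigma}\in M_{2\Sigma}$ (put $\hat x=\hat x_1+\hat x_{20}+\hat x_{2\Sigma}$), $\hat d_{21}^{(2)}\in D_{21}^{(2)}$, $\hat d_{2\wedge,1}\in D_{2\wedge,1}$ satisfying $F_{20}=0$ there exist open neighborhoods $U_{\delta_1}(\hat t)\times U_{\delta_2}(\hat x_1)\times U_{\delta_3}(\hat x_{2\Sigma})\times U_{\delta_4}(\hat d_{21}^{(2)})\times U_{\delta_5}(\hat d_{2\wedge,1})=U_\delta(\hat t,\hat x_1,\hat x_{2\Sigma},\hat d_{21}^{(2)},\hat d_{2\wedge,1})\subset\mathbb R_+\times D_1\times D_{2\Sigma}\times D_{21}^{(2)}\times D_{2\wedge,1}$ and $U_\varepsilon(\hat x_{20})\subset D_{20}$ and an operator $\mathrm Z\in\mathrm L(D_{20},Y_{20})$ (depending on $\hat t,\hat x,\hat d_{21}^{(2)},\hat d_{2\wedge,1}$) having an inverse $\mathrm Z^{-1}\in\mathrm L(Y_{20},D_{20})$ such that for each $(t,x_1,x_{2\Sigma},d_{21}^{(2)},d_{2\wedge,1})$ in the former neighborhood and each $x_{20}',x_{20}''\in U_\varepsilon(\hat x_{20})$ $$\big\|F_{20}(t,x_1,x_{20}',x_{2\Sigma},d_{21}^{(2)},d_{2\wedge,1})-F_{20}(t,x_1,x_{20}'',x_{2\Sigma},d_{21}^{(2)},d_{2\wedge,1})-\mathrm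 Z[x_{20}'-x_{20}'']\big\|\le k(\delta,\varepsilon)\|x_{20}'-x_{20}''\|,$$ where $k(\delta,\varepsilon)$ is such that $\lim_{\delta,\varepsilon\to0}k(\delta,\varepsilon)<\|\mathrm Z^{-1}\|^{-1}$ (the numbers $\delta,\varepsilon>0$ depend on the choice of $\hat t,\hat x,\hat d_{21}^{(2)},\hat d_{2\wedge,1}$). (ii) The components $Q_1f(t,x)$ and $Q_{20}f(t,x)$ have continuous partial derivatives with respect to $x$ on $\mathbb R_+\times M$; and for any fixed $\hat t,\hat x_1,\hat x_{20},\hat x_{2\Sigma},\hat d_{21}^{(2)},\hat d_{2\wedge,1}$ as in (i) satisfying $F_{20}=0$, the operator $[\partial_x(Q_{20}f)(\hat t,\hat x)-Q_{20}B]P_{20}|_{D_{20}}:D_{20}\to Y_{20}$ has an inverse in $\mathrm L(Y_{20},D_{20})$. 3. For any fixed $a_1,a_2>0$, $\displaystyle\sup_{t\in[0,a_1],\ x\in M,\ \|x_1\|\le a_2}\|Q_1f(t,x)\|<\infty$ ($x=x_1+x_{20}+x_{2\Sigma}$). 4. There exist a number $R>0$, a functional $V\in C(Y_1,\mathbb R_+)$ of $w_1=\widetilde Ax_1\in Y_1$, and functionals $U\in C(\mathbb R_+,\mathbb R_+)$, $\psi:\mathbb R_+\to\mathbb R_+$ such that $\psi$ is integrable on each finite interval in $\mathbb R_+$, $$\int^\infty\frac{du}{U(u)}=\infty,\qquad\lim_{\|w_1\|\to\infty}V(w_1)=\infty,$$ $V(w_1)$ satisfies a Lipschitz condition on $U_R^c(0)=\{w_1\in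 Y_1:\|w_1\|\ge R\}$, and for each $t\in\mathbb R_+$, $x_{20}\in M_{20}$, $x_{2\Sigma}\in M_{2\Sigma}$, $w_1\in U_R^c(0)$ $$\big\|Q_1f(t,\widetilde A^{-1}w_1+x_{20}+x_{2\Sigma})-Q_1B\widetilde A^{-1}w_1\big\|\le U(V(w_1))\psi(t).$$ Then for each $t_0\in\mathbb R_+$, $x_{0,1}\in D_1$ there exists a unique global solution $x(t)$ of the initial value problem $\frac{d}{dt}[Ax]+Bx=f(t,x)$, $P_1x(t_0)=x_{0,1}$.
   Context: Notation: $\mathbb R_+=[0,\infty)$; $\mathrm L(E,F)$ is the space of bounded linear operators; $\dot{+}$ is direct sum (for subsets of the summands, the set of sums). $\int^\infty h(u)\,du=\infty$ means that $\int_{u_0}^\infty h(u)\,du$ diverges for any $u_0>0$. Setting: $X,Y$ are Banach spaces; $A:D_A\to Y$, $B:D_B\to Y$ are closed linear operators with domains dense in $X$; $\operatorname{range}(A)$ is closed; $D=D_A\cap D_B\neq\{0\}$. The abstract differential-algebraic equation (ADAE) is $\frac{d}{dt}[Ax]+Bx=f(t,x)$, $t>0$. A solution on an interval $J\subseteq\mathbb R_+$ is $x\in C(J,X)$ with $Ax\in C^1(J,Y)$ (if $J=\mathbb R_+$: $Ax\in C^1((0,\infty),Y)$), $x(t)\in D$, satisfying the equation for every $t\in J$. It is global if it exists on $[t_0,\infty)$. As in the underlying local result, solutions of the initial value problem are considered in $M$ (values in $M$). Regular pencil of index $\nu\in\mathbb N$: there is $R>0$ such that for every complex $\lambda$ with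 $|\lambda|>R$ the operator $\lambda A+B:D\to Y$ has an inverse in $\mathrm L(Y,X)$, and $(A+\mu B)^{-1}$ has a pole of order $\nu$ at $\mu=0$ (equivalently, $(\lambda A+B)^{-1}$ has at $\lambda=\infty$ a pole of order $\nu-1$, or a removable singularity if $\nu=1$). For real spaces this is understood via complexification. Projectors: let $\{\varphi_i^1\}_{i=1}^n$ be a basis of $\ker A\cap D$, and $\{\varphi_i^j\}_{i=1,\dots,n}^{j=1,\dots,m_i}\subset D$ a canonical system of root vectors of $A+\mu B$ at $\mu=0$: $A\varphi_i^1=0$, $A\varphi_i^j=-B\varphi_i^{j-1}$ ($j=2,\dots,m_i$), $1\le m_i\le\nu$, $\max_i m_i=\nu$; let $q_i^j\in D_{A^*}\cap D_{B^*}$ satisfy $A^*q_i^{m_i}=0$, $A^*q_i^j=-B^*q_i^{j+1}$ ($j<m_i$), $\langle B\varphi_i^j,q_k^l\rangle=\delta_{ik}\delta_{jl}$. Such systems exist and are fixed. For $s=0,\dots,\nu-1$, $j=s+1,\dots,\nu$: $P_{2s}^{(j)}=\sum_{i:m_i=j}\langle\cdot,B^*q_i^{s+1}\rangle\varphi_i^{s+1}$, $Q_{2s}^{(j)}=\sum_{i:m_i=j}\langle\cdot,q_i^{s+1}\rangle B\varphi_i^{s+1}$, $P_{2s}=\sum_{j=s+1}^\nu P_{2s}^{(j)}$, $Q_{2s}=\sum_{j=s+1}^\nu Q_{2s}^{(j)}$; $P_2=\sum_{s=0}^{\nu-1}P_{2s}$, $Q_2=\sum_{s=0}^{\nu-1}Q_{2s}$,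 $P_1=I-P_2$, $Q_1=I-Q_2$, $P_{2\Sigma}=\sum_{s=1}^{\nu-1}P_{2s}$; $P_{2\wedge,s}=P_{2s}-P_{2s}^{(s+1)}$, $Q_{2\Sigma,s}=Q_{2s}-Q_{2s}^{(s+1)}$ ($s=0,\dots,\nu-2$). These are bounded projectors on $X$ (the $P$'s) and $Y$ (the $Q$'s). $D$ and $Y$ with an index denote the images of $D$ and $Y$ under the projector with the same index: $D_1=P_1D$, $D_{2s}=P_{2s}D$, $D_{2s}^{(j)}=P_{2s}^{(j)}D$, $D_{2\wedge,s}=P_{2\wedge,s}D$, $D_{2\Sigma}=P_{2\Sigma}D$, $Y_1=Q_1Y$, $Y_{2s}=Q_{2s}Y$, $Y_{2s}^{(j)}=Q_{2s}^{(j)}Y$, $Y_{2\Sigma,s}=Q_{2\Sigma,s}Y$; similarly $x_1=P_1x$, $x_{2s}=P_{2s}x$, $x_{2s}^{(j)}=P_{2s}^{(j)}x$, $x_{2\wedge,s}=P_{2\wedge,s}x$, $x_{2\Sigma}=P_{2\Sigma}x$. Thus $x=x_1+x_{20}+x_{2\Sigma}$, $x_{2\Sigma}=\sum_{j=1}^{\nu-1}x_{2j}^{(j+1)}+\sum_{j=1}^{\nu-2}x_{2\wedge,j}$, $x_{2(\nu-1)}=x_{2(\nu-1)}^{(\nu)}$, $Q_{2(\nu-1)}=Q_{2(\nu-1)}^{(\nu)}$. Norms on direct sums are sums of the norms of components. $\widetilde A=A+\sum_{i=1}^n\langle\cdot,B^*q_i^1\rangle B\varphi_i^{m_i}:D\to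 Y$ has an inverse $\widetilde A^{-1}\in\mathrm L(Y,X)$; it coincides with $A$ on $D_1$ and maps $D_1$ onto $Y_1$. Functions: $F_{2(\nu-1)}(t,x_{2(\nu-1)})=Q_{2(\nu-1)}f(t,x_{2(\nu-1)})-Bx_{2(\nu-1)}$ (used for $\nu\ge2$); $F_{2s}^{(s+1)}(t,x_{2j}^{(j+1)},j=s,\dots,\nu-1)=Q_{2s}^{(s+1)}f(t,\sum_{j=s}^{\nu-1}x_{2j}^{(j+1)})-Bx_{2s}^{(s+1)}$, $s=1,\dots,\nu-2$ ($\nu\ge3$); $F_{2\Sigma,\nu-2}(t,x_{2j}^{(j+1)},j=1,\dots,\nu-1,x_{2\wedge,\nu-2},d_{2(\nu-1)})=Q_{2\Sigma,\nu-2}f(t,\sum_{j=1}^{\nu-1}x_{2j}^{(j+1)}+x_{2\wedge,\nu-2})-Bx_{2\wedge,\nu-2}-Ad_{2(\nu-1)}$ ($\nu\ge3$); $F_{2\Sigma,s}(t,x_{2j}^{(j+1)},j=1,\dots,\nu-1,x_{2\wedge,i},i=s,\dots,\nu-2,d_{2(s+1)}^{(s+2)},d_{2\wedge,s+1})=Q_{2\Sigma,s}f(t,\sum_{j=1}^{\nu-1}x_{2j}^{(j+1)}+\sum_{i=s}^{\nu-2}x_{2\wedge,i})-Bx_{2\wedge,s}-A[d_{2(s+1)}^{(s+2)}+d_{2\wedge,s+1}]$, $s=1,\dots,\nu-3$ ($\nu\ge4$); $F_{20}(t,x_1,x_{20},x_{2\Sigma},d_{21}^{(2)},d_{2\wedge,1})=Q_{20}f(t,x_1+x_{20}+x_{2\Sigma})-Bx_{20}-Q_{20}A[d_{21}^{(2)}+d_{2\wedge,1}]$.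 Sums, objects and conditions with index ranges that are empty for the given $\nu$ are absent: for $\nu=2$, $x_{2\wedge,1}=d_{2\wedge,1}=0$; for $\nu=1$, $x_{2\Sigma}=0$, $d_{21}^{(2)}=d_{2\wedge,1}=0$ and, among the data and conditions of types 1 and 2, only $M_{20}$ and the conditions involving $F_{20}$ remain. Locally Lipschitz with respect to $x$ on $J\times M$: for each $(t',x')\in J\times M$ there are open neighborhoods of $t'$, $x'$ and $L\ge0$ with $\|g(t,x^1)-g(t,x^2)\|\le L\|x^1-x^2\|$ for $t$, $x^1,x^2$ in them; ''with respect to $x_1+x_{20}$'' means this for $x^1,x^2$ having the same component $x_{2\Sigma}$. A (global) Lipschitz condition on a set means one constant works on the whole set. Neighborhoods of an endpoint of a time interval are semi-open intervals. *)

(* Defs.v *)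
From HB Require Import structures.
From mathcomp Require Import all_boot all_order all_algebra.
From mathcomp Require Import complex.
From mathcomp Require Import all_classical all_reals all_analysis.

Set Implicit Arguments.
Unset Strict Implicit.
Unset Printing Implicit Defensive.

Import Order.TTheory GRing.Theory Num.Theory.
Import numFieldNormedType.Exports.

Local Open Scope classical_set_scope.
Local Open Scope ring_scope.

(* Banach spaces over the reals and over the complex numbers are treated at
   once: X and Y are complete normed modules over [scalars R k].  The library
   norm of such a module is [scalars R k]-valued; [nrm] is the same norm as an
   element of R. *)

Variant scalar_kind := RealScalars | ComplexScalars.

Definition scalars (R : realType) (k : scalar_kind) : numFieldType :=
  match k with
  | RealScalars => R
  | ComplexScalars => R[i]
  end.

Definition of_real (R : realType) (k : scalar_kind) : R -> scalars R k :=
  match k return R -> scalars R k with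
  | RealScalars => fun x => x
  | ComplexScalars => fun x => x%:C%C
  end.

Definition real_part (R : realType) (k : scalar_kind) : scalars R k -> R :=
  match k return scalars R k -> R with
  | RealScalars => fun x => x
  | ComplexScalars => fun z => complex.Re z
  end.

Arguments of_real {R k} x.
Arguments real_part {R k} z.

Definition nrm (R : realType) (k : scalar_kind)
  (V : normedModType (scalars R k)) (v : V) : R := real_part `|v|.

Section bounded_operators.
Context {R : realType} {K : pzRingType} {E F : lmodType K}.
Variables (normE : E -> R) (normF : F -> R).

Definition bounded_linear_on (U : set E) (T : E -> F) : Prop :=
  (forall (a : K) (u v : E), U u -> U v -> T (a *: u + v) = a *: T u + T v) /\
  (exists C : R, forall u, U u -> normF (T u) <= C * normE u).

End bounded_operators.

Section bounded_inverses.
Context {R : realType} {K : pzRingType} {E F : lmodType K}.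
Variables (normE : E -> R) (normF : F -> R).

(* S, restricted to the subspace W, is the inverse in L(W, U) of T : U -> W. *)
Definition bounded_inverse (U : set E) (W : set F) (T : E -> F) (S : F -> E) :
    Prop :=
  [/\ forall u, U u -> W (T u),
      bounded_linear_on normF normE W S,
      forall w, W w -> U (S w) /\ T (S w) = w
    & forall u, U u -> S (T u) = u].

Definition has_bounded_inverse (U : set E) (W : set F) (T : E -> F) : Prop :=
  exists S : F -> E, bounded_inverse U W T S.

End bounded_inverses.

Definition op_norm (R : realType) (k : scalar_kind)
    (E F : normedModType (scalars R k)) (U : set E) (T : E -> F) : R :=
  sup [set nrm (T u) | u in [set u | U u /\ nrm u <= 1]].

Section complex_pencil.
Context {R : realType} {E F : lmodType R[i]}.
Variables (normE : E -> R) (normF : F -> R).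
Variables (D : set E) (A B : E -> F) (nu : nat).

(* In the second part, T is the sequence of the coefficients of the Laurent
   series of mu |-> (A + mu B)^-1 at 0, numbered from the exponent - nu on. *)
Definition complex_regular_pencil : Prop :=
  (exists2 r : R, 0 < r & forall lambda : R[i], (r%:C)%C < `|lambda| ->
     has_bounded_inverse normE normF D [set: F]
       (fun x => lambda *: A x + B x)) /\
  (exists T : nat -> F -> E,
    [/\ forall i, bounded_linear_on normF normE [set: F] (T i),
        exists y, T 0%N y != 0
      & exists2 r : R, 0 < r & forall mu : R[i], 0 < `|mu| < (r%:C)%C ->
          exists2 S : F -> E,
            bounded_inverse normE normF D [set: F] (fun x => A x + mu *: B x) S
          & forall eps : R, 0 < eps -> exists N : nat, forall m : nat,
              (N <= m)%N -> forall y,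
              normE (mu ^+ nu *: S y - \sum_(i < m) mu ^+ i *: T i y)
                <= eps * normF y]).

End complex_pencil.

Definition complexification (R : realType) (V : lmodType R) : Type :=
  (V * V)%type.

Section complexification.
Context {R : realType} {V : lmodType R}.
Local Notation VC := (complexification V).

HB.instance Definition _ := GRing.Zmodule.copy VC (V * V)%type.

Definition complexification_scale (c : R[i]) (z : VC) : VC :=
  (complex.Re c *: z.1 - complex.Im c *: z.2,
   complex.Re c *: z.2 + complex.Im c *: z.1).

Let scaleA (a b : R[i]) (z : VC) :
  complexification_scale a (complexification_scale b z) =
  complexification_scale (a * b) z.
Proof.
case: a b z => [a a'] [b b'] [u v]; rewrite /complexification_scale /=.
congr pair; rewrite !(scalerBr, scalerDr, scalerBl, scalerDl) !scalerA.
  by rewrite !opprD -!addrA; congr (_ + _); rewrite [RHS]addrC -!addrA addrC.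
by rewrite -!addrA; congr (_ + _); rewrite [RHS]addrC -!addrA.
Qed.

Let scale1 : left_id 1 complexification_scale.
Proof.
by case=> u v; rewrite /complexification_scale /= !scale1r !scale0r subr0 addr0.
Qed.

Let scaleDr : right_distributive complexification_scale +%R.
Proof.
move=> c [u v] [u' v']; rewrite /complexification_scale /=.
congr pair; rewrite /= !scalerDr; last by rewrite addrACA.
by rewrite opprD addrACA.
Qed.

Let scaleDl (z : VC) :
  {morph complexification_scale^~ z : a b / a + b >-> a + b}.
Proof.
case: z => u v [a a'] [b b']; rewrite /complexification_scale /=.
congr pair; rewrite /= !scalerDl; last by rewrite addrACA.
by rewrite opprD addrACA.
Qed.

HB.instance Definition _ := GRing.Zmodule_isLmodule.Build R[i] VC
  scaleA scale1 scaleDr scaleDl.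

End complexification.

(* Any norm of the complexification that restricts to equivalent norms on the
   two summands gives the same bounded operators; the sum is used. *)
Definition complexification_norm (R : realType)
    (V : normedModType (scalars R RealScalars)) (z : complexification V) : R :=
  nrm z.1 + nrm z.2.

Definition complexify (R : realType) (V W : lmodType R) (T : V -> W)
    (z : complexification V) : complexification W := (T z.1, T z.2).

Definition regular_pencil (R : realType) (k : scalar_kind) :
    forall X Y : normedModType (scalars R k),
      set X -> (X -> Y) -> (X -> Y) -> nat -> Prop :=
  match k return forall X Y : normedModType (scalars R k),
      set X -> (X -> Y) -> (X -> Y) -> nat -> Prop with
  | RealScalars => fun X Y D A B nu =>
      complex_regular_pencil
        (@complexification_norm R X) (@complexification_norm R Y)
        [set z | D z.1 /\ D z.2] (complexify A) (complexify B) nu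
  | ComplexScalars => fun X Y D A B nu =>
      complex_regular_pencil
        (@nrm R ComplexScalars X) (@nrm R ComplexScalars Y) D A B nu
  end.

(* The values of [app] outside [dom] are irrelevant. *)
Record operator (R : realType) (k : scalar_kind)
    (X Y : normedModType (scalars R k)) := Operator {
  dom : set X;
  app :> X -> Y
}.

Section unbounded_operators.
Context {R : realType} {k : scalar_kind} {X Y : normedModType (scalars R k)}.
Local Notation K := (scalars R k).
Implicit Types T : operator X Y.

Definition linear_operator T : Prop :=
  [/\ dom T 0,
      forall (a : K) u v, dom T u -> dom T v -> dom T (a *: u + v)
    & forall (a : K) u v, dom T u -> dom T v -> T (a *: u + v) = a *: T u + T v].

Definition closed_operator T : Prop :=
  closed [set z : X * Y | dom T z.1 /\ z.2 = T z.1].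

Definition bounded_functional (V : normedModType K) (q : V -> K) : Prop :=
  bounded_linear_on (F := K^o) (@nrm R k V) (fun z : K => real_part `|z|)
    [set: V] q.

Definition is_adjoint_at T (q : Y -> K) (p : X -> K) : Prop :=
  bounded_functional p /\ forall x, dom T x -> p x = q (T x).

Definition adjoint_dom T : set (Y -> K) :=
  [set q | bounded_functional q /\ exists p, is_adjoint_at T q p].

Definition adjoint T (q : Y -> K) : X -> K :=
  xget (fun=> 0) [set p | is_adjoint_at T q p].

End unbounded_operators.

Section differentiability.
Context {R : realType} {k : scalar_kind} {X Y : normedModType (scalars R k)}.
Local Notation K := (scalars R k).

(* Derivative at t of a curve with respect to J (one-sided at an endpoint). *)
Definition has_derivative_within (J : set R) (u : R -> Y) (t : R) (v : Y) :
    Prop :=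
  (fun s => of_real ((s - t)^-1) *: (u s - u t)) @ within J (dnbhs t) --> v.

(* Partial Frechet derivative with respect to x of a function on R x M, where M
   is an open subset of the linear subspace E. *)
Definition is_partial_x (E M : set X) (g : R -> X -> Y) (t : R) (x : X)
    (L : X -> Y) : Prop :=
  bounded_linear_on (@nrm R k X) (@nrm R k Y) E L /\
  forall eps : R, 0 < eps -> exists2 delta : R, 0 < delta &
    forall x', M x' -> nrm (x' - x) < delta ->
      nrm (g t x' - g t x - L (x' - x)) <= eps * nrm (x' - x).

(* Its values outside E are irrelevant. *)
Definition partial_x (E M : set X) (g : R -> X -> Y) (t : R) (x : X) : X -> Y :=
  xget (fun=> 0) [set L | is_partial_x E M g t x L].

Definition continuously_partially_differentiable (J : set R) (E M : set X)
    (g : R -> X -> Y) : Prop :=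
  (forall t x, J t -> M x -> exists L, is_partial_x E M g t x L) /\
  (forall t x, J t -> M x -> forall eps : R, 0 < eps ->
     exists2 delta : R, 0 < delta &
     forall t' x', J t' -> M x' -> `|t' - t| + nrm (x' - x) < delta ->
     forall h, E h ->
       nrm (partial_x E M g t' x' h - partial_x E M g t x h) <= eps * nrm h).

Definition pair_norm (h : R * X) : R := `|h.1| + nrm h.2.

Definition directions (E : set X) (hs : seq (R * X)) : Prop :=
  forall h, h \in hs -> E h.2.

(* [T t x hs] is the derivative of order [size hs] of g at (t, x), as a
   multilinear map applied to the directions hs, the last differentiation being
   in the first direction of the list.  The remainder of the derivative of order
   j is controlled in the operator norm of j-linear maps.  Derivatives are real
   linear in the pair (t, x) and linear over the scalar field in x. *)
Definition is_jet (m : nat) (J : set R) (E M : set X) (g : R -> X -> Y)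
    (T : R -> X -> seq (R * X) -> Y) : Prop :=
  forall t x, J t -> M x ->
  [/\ T t x [::] = g t x,
      forall (s1 s2 : seq (R * X)) (h h' : R * X) (a : R),
        (size s1 + size s2 < m)%N -> directions E (h :: h' :: s1 ++ s2) ->
        T t x (s1 ++ (a * h.1 + h'.1, of_real a *: h.2 + h'.2) :: s2) =
        of_real a *: T t x (s1 ++ h :: s2) + T t x (s1 ++ h' :: s2),
      forall (s1 s2 : seq (R * X)) (xi : X) (c : K),
        (size s1 + size s2 < m)%N -> E xi -> directions E (s1 ++ s2) ->
        T t x (s1 ++ (0, c *: xi) :: s2) = c *: T t x (s1 ++ (0, xi) :: s2),
      forall j : nat, (j <= m)%N -> exists C : R, forall hs,
        size hs = j -> directions E hs ->
        nrm (T t x hs) <= C * \prod_(h <- hs) pair_norm h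
    & (forall j : nat, (j < m)%N -> forall eps : R, 0 < eps ->
        exists2 delta : R, 0 < delta &
        forall t' x', J t' -> M x' -> pair_norm (t' - t, x' - x) < delta ->
        forall hs, size hs = j -> directions E hs ->
          nrm (T t' x' hs - T t x hs - T t x ((t' - t, x' - x) :: hs)) <=
          eps * pair_norm (t' - t, x' - x) * \prod_(h <- hs) pair_norm h) /\
      (forall eps : R, 0 < eps -> exists2 delta : R, 0 < delta &
        forall t' x', J t' -> M x' -> pair_norm (t' - t, x' - x) < delta ->
        forall hs, size hs = m -> directions E hs ->
          nrm (T t' x' hs - T t x hs) <= eps * \prod_(h <- hs) pair_norm h)].

(* The class C^m on J x M, M being open in the linear subspace E. *)
Definition class_C (m : nat) (J : set R) (E M : set X) (g : R -> X -> Y) :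
    Prop :=
  exists T, is_jet m J E M g T.

(* Local Lipschitz condition on J x M for pairs of points with the same value
   of c. *)
Definition locally_lipschitz_fixing (c : X -> X) (J : set R) (M : set X)
    (g : R -> X -> Y) : Prop :=
  forall t0 x0, J t0 -> M x0 -> exists (U : set R) (V : set X) (L : R),
    [/\ nbhs t0 U, nbhs x0 V, 0 <= L &
      forall t x1 x2, J t -> U t -> M x1 -> V x1 -> M x2 -> V x2 ->
        c x1 = c x2 -> nrm (g t x1 - g t x2) <= L * nrm (x1 - x2)].

Definition open_in (E O : set X) : Prop := exists2 U, open U & O = E `&` U.

Definition sum_set2 (S S' : set X) : set X := [set x + y | x in S & y in S'].

Definition sum_set (a b : nat) (S : nat -> set X) : set X :=
  [set x | exists2 xs : nat -> X,
     forall j, (a <= j < b)%N -> S j (xs j) & x = \sum_(a <= j < b) xs j].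

End differentiability.

(* Root chains of A + mu B at mu = 0: root_phi i j and root_q i j are the vectors
   with lower index i and upper index j, root_rank i is the length of the i-th
   chain; only 1 <= j <= root_rank i is meaningful. *)
Record pencil (R : realType) (k : scalar_kind)
    (X Y : normedModType (scalars R k)) := Pencil {
  opA : operator X Y;
  opB : operator X Y;
  pencil_index : nat;
  dim_ker : nat;
  root_rank : 'I_dim_ker -> nat;
  root_phi : 'I_dim_ker -> nat -> X;
  root_q : 'I_dim_ker -> nat -> Y -> scalars R k
}.

Section adae.
Context {R : realType} {k : scalar_kind} {X Y : normedModType (scalars R k)}.
Local Notation K := (scalars R k).
Variable p : pencil X Y.

Local Notation A := (opA p).
Local Notation B := (opB p).
Local Notation nu := (pencil_index p).
Local Notation n := (dim_ker p).

Definition domD : set X := dom A `&` dom B.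

Definition canonical_root_system : Prop :=
  [/\ (forall x, (domD x /\ A x = 0) <->
         exists c : 'I_n -> K, x = \sum_(i < n) c i *: root_phi i 1%N) /\
      (forall c : 'I_n -> K,
         \sum_(i < n) c i *: root_phi (p := p) i 1%N = 0 -> forall i, c i = 0),
      (forall i : 'I_n, (1 <= root_rank i <= nu)%N) /\
      (exists i : 'I_n, root_rank i = nu),
      (forall (i : 'I_n) j, (1 <= j <= root_rank i)%N -> domD (root_phi i j)) /\
      (forall (i : 'I_n) j, (1 <= j < root_rank i)%N ->
         A (root_phi i j.+1) = - B (root_phi i j)),
      [/\ forall (i : 'I_n) j, (1 <= j <= root_rank i)%N ->
            adjoint_dom A (root_q i j) /\ adjoint_dom B (root_q i j),
          forall (i : 'I_n) x, adjoint A (root_q i (root_rank i)) x = 0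
        & forall (i : 'I_n) j, (1 <= j < root_rank i)%N ->
            forall x, adjoint A (root_q i j) x = - adjoint B (root_q i j.+1) x]
    & forall (i i' : 'I_n) j l, (1 <= j <= root_rank i)%N -> (1 <= l <= root_rank i')%N ->
        root_q i' l (B (root_phi i j)) = ((i == i') && (j == l))%:R].

(* P2sj s j is the projector written with lower index 2s and upper index (j),
   and similarly for Q2sj, D2sj, Y2sj. *)
Definition P2sj (s j : nat) (x : X) : X :=
  \sum_(i < n | root_rank i == j) adjoint B (root_q i s.+1) x *: root_phi i s.+1.
Definition Q2sj (s j : nat) (y : Y) : Y :=
  \sum_(i < n | root_rank i == j) root_q i s.+1 y *: B (root_phi i s.+1).

Definition P2s (s : nat) (x : X) : X := \sum_(s.+1 <= j < nu.+1) P2sj s j x.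
Definition Q2s (s : nat) (y : Y) : Y := \sum_(s.+1 <= j < nu.+1) Q2sj s j y.

Definition P2 (x : X) : X := \sum_(0 <= s < nu) P2s s x.
Definition Q2 (y : Y) : Y := \sum_(0 <= s < nu) Q2s s y.

Definition P1 (x : X) : X := x - P2 x.
Definition Q1 (y : Y) : Y := y - Q2 y.

Definition P2Sigma (x : X) : X := \sum_(1 <= s < nu) P2s s x.
Definition P2wedge (s : nat) (x : X) : X := P2s s x - P2sj s s.+1 x.
Definition Q2Sigma (s : nat) (y : Y) : Y := Q2s s y - Q2sj s s.+1 y.

Definition D1 : set X := P1 @` domD.
Definition D2s (s : nat) : set X := P2s s @` domD.
Definition D2sj (s j : nat) : set X := P2sj s j @` domD.
Definition D2wedge (s : nat) : set X := P2wedge s @` domD.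
Definition D2Sigma : set X := P2Sigma @` domD.

Definition Y1 : set Y := range Q1.
Definition Y2s (s : nat) : set Y := range (Q2s s).
Definition Y2sj (s j : nat) : set Y := range (Q2sj s j).
Definition Y2Sigma (s : nat) : set Y := range (Q2Sigma s).

Definition Atilde (x : X) : Y :=
  A x + \sum_(i < n) adjoint B (root_q i 1%N) x *: B (root_phi i (root_rank i)).

Definition Atilde_inv (y : Y) : X := xget 0 [set x | domD x /\ Atilde x = y].

(* xd and xw denote the families of components written x with lower index 2j and
   upper index (j+1), and with lower index 2^,j; only the entries with an
   admissible index occur in the formulas. *)
Definition sum_diag (s : nat) (xd : nat -> X) : X := \sum_(s <= j < nu) xd j.
Definition sum_wedge (s : nat) (xw : nat -> X) : X :=
  \sum_(s <= j < nu.-1) xw j.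

Definition diag_components (x : X) (j : nat) : X := P2sj j j.+1 x.
Definition wedge_components (x : X) (j : nat) : X := P2wedge j x.

Definition structured (f : R -> X -> Y) : Prop :=
  forall t x, 0 <= t -> domD x ->
    let xd := diag_components x in
    let xw := wedge_components x in
    f t x = (Q1 (f t x) + Q2s 0 (f t x))
      + \sum_(1 <= s < nu.-1) Q2Sigma s (f t (sum_diag 1 xd + sum_wedge s xw))
      + \sum_(1 <= s < nu) Q2sj s s.+1 (f t (sum_diag s xd)).

Definition F2last (f : R -> X -> Y) (t : R) (x : X) : Y :=
  Q2s nu.-1 (f t x) - B x.

Definition F2diag (f : R -> X -> Y) (s : nat) (t : R) (xd : nat -> X) : Y :=
  Q2sj s s.+1 (f t (sum_diag s xd)) - B (xd s).

Definition F2Sigma_last (f : R -> X -> Y) (t : R) (xd : nat -> X) (x d : X) :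
    Y :=
  Q2Sigma nu.-2 (f t (sum_diag 1 xd + x)) - B x - A d.

(* dd and dw are the arguments d with lower index 2(s+1), upper index (s+2), and
   with lower index 2^,s+1. *)
Definition F2Sigma (f : R -> X -> Y) (s : nat) (t : R) (xd xw : nat -> X)
    (dd dw : X) : Y :=
  Q2Sigma s (f t (sum_diag 1 xd + sum_wedge s xw)) - B (xw s) - A (dd + dw).

Definition F20 (f : R -> X -> Y) (t : R) (x1 x20 x2S dd dw : X) : Y :=
  Q2s 0 (f t (x1 + x20 + x2S)) - B x20 - Q2s 0 (A (dd + dw)).

(* The subspaces on which the components of f are considered, and the
   corresponding sets built from Md j and Mw j. *)
Definition E2diag (s : nat) : set X := sum_set s nu (fun j => D2sj j j.+1).
Definition E2wedge (s : nat) : set X := sum_set s nu.-1 D2wedge.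
Definition M2diag (Md : nat -> set X) (s : nat) : set X := sum_set s nu Md.
Definition M2wedge (Mw : nat -> set X) (s : nat) : set X :=
  sum_set s nu.-1 Mw.
Definition M2Sigma (Md Mw : nat -> set X) : set X :=
  sum_set2 (M2diag Md 1) (M2wedge Mw 1).
Definition Mset (M20 : set X) (Md Mw : nat -> set X) : set X :=
  sum_set2 (sum_set2 D1 M20) (M2Sigma Md Mw).

(* The estimate of F20 by an invertible operator Z at a given point.  The bound
   c(delta, eps) is available for all small radii and has a limit as the radii
   tend to 0; the components of delta are the radii of the neighborhoods of t,
   x1, x2S, dd, dw. *)
Definition F20_estimate (f : R -> X -> Y) (t0 : R) (x10 x200 x2S0 dd0 dw0 : X) :
    Prop :=
  exists (Z : X -> Y) (Zinv : Y -> X) (c : ('I_5 -> R) -> R -> R) (l r : R),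
  [/\ bounded_linear_on (@nrm R k X) (@nrm R k Y) (D2s 0) Z,
      bounded_inverse (@nrm R k X) (@nrm R k Y) (D2s 0) (Y2s 0) Z Zinv,
      0 < r /\
      (forall (delta : 'I_5 -> R) (eps : R),
        (forall i, 0 < delta i < r) -> 0 < eps < r ->
        forall t x1 x2S dd dw u v,
          [/\ 0 <= t, D1 x1, D2Sigma x2S, D2sj 1 2 dd & D2wedge 1 dw] ->
          [/\ `|t - t0| < delta 0, nrm (x1 - x10) < delta 1,
              nrm (x2S - x2S0) < delta 2%:R, nrm (dd - dd0) < delta 3%:R
            & nrm (dw - dw0) < delta 4%:R] ->
          D2s 0 u -> nrm (u - x200) < eps -> D2s 0 v -> nrm (v - x200) < eps ->
          nrm (F20 f t x1 u x2S dd dw - F20 f t x1 v x2S dd dw - Z (u - v)) <=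
          c delta eps * nrm (u - v)),
      (forall eta : R, 0 < eta -> exists2 rho : R, 0 < rho &
        forall (delta : 'I_5 -> R) (eps : R),
          (forall i, 0 < delta i < rho) -> 0 < eps < rho ->
          `|c delta eps - l| < eta)
    & l < (op_norm (Y2s 0) Zinv)^-1].

(* The instants at which A x is differentiable and the equation is satisfied:
   if J is the whole half-line, t = 0 is excluded. *)
Definition equation_times (J : set R) : set R :=
  [set t | J t /\ (J = `[0, +oo[%classic -> 0 < t)].

Definition solution (f : R -> X -> Y) (J : set R) (M : set X) (x : R -> X) :
    Prop :=
  [/\ forall t, J t -> domD (x t) /\ M (x t),
      {within J, continuous x}
    & exists v : R -> Y,
      [/\ forall t, equation_times J t ->
            has_derivative_within (equation_times J) (fun s => A (x s)) t (v t),
          {within equation_times J, continuous v}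
        & forall t, equation_times J t -> v t + B (x t) = f t (x t)]].

End adae.

(* Main.v *)
(* The root functionals q_i^j turn the part of the equation in Q_2 Y into scalar
   equations: the q_i^(s+1)-coordinate involves the derivative of the coordinate
   of x on phi_i^(s+2) if s + 1 < m_i, and no derivative if s + 1 = m_i. By the
   structure of f the derivative-free equations can be solved for
   x_(2(nu-1)), x_(2(nu-2))^(nu-1), ..., x_21^(2) in turn, and the remaining
   ones, in which the derivatives are then known, for x_(2wedge,nu-2), ...,
   x_(2wedge,1): each unknown is an implicit function of t, and its order of
   smoothness covers the derivatives consumed in later steps. Thus x_2Sigma is
   a known curve, and x_20 becomes a function chi(t, x_1), continuous in (t, x_1)
   and locally Lipschitz in x_1 by a Newton iteration. Since the pencil is
   regular, A maps D_1 bijectively onto Y_1, and by the open mapping theorem both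
   the inverse and B A^-1 are bounded; hence w = A x_1 solves an ordinary
   differential equation in Y_1 with a locally Lipschitz right-hand side. The
   Lyapunov function V keeps w bounded on bounded time intervals (Osgood's
   criterion), so w is global.

   For t_0 = 0 the equation is not required at t_0, and A x need not be continuous
   there, only x. Uniqueness therefore compares two solutions for t > t_0: their
   difference z = w - w' satisfies |z'| <= C |z|, so it is bounded, has a limit l
   at t_0, and A^-1 l = 0 because x_1 is continuous at t_0. *)

From HB Require Import structures.
Require Import Defs.
From mathcomp Require Import all_boot all_order all_algebra.
From mathcomp Require Import complex ring lra.
From mathcomp Require Import all_classical all_reals all_analysis.
From mathcomp Require Import measurable_realfun.

Set Implicit Arguments.
Unset Strict Implicit.
Unset Printing Implicit Defensive.

Import Order.TTheory GRing.Theory Num.Theory.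
Import numFieldNormedType.Exports.

Local Open Scope classical_set_scope.
Local Open Scope ring_scope.

(** * Module identities and real-valued norms *)

Section module_identities.
Context {K : comNzRingType} {V : lmodType K}.

Inductive vexpr :=
  | VAtom of nat | VZero | VAdd of vexpr & vexpr | VOpp of vexpr
  | VScale of K & vexpr.

Fixpoint veval (env : seq V) (e : vexpr) : V :=
  match e with
  | VAtom n => nth 0 env n
  | VZero => 0
  | VAdd e1 e2 => veval env e1 + veval env e2
  | VOpp e1 => - veval env e1
  | VScale c e1 => c *: veval env e1
  end.

Fixpoint vcoef (e : vexpr) (n : nat) : K :=
  match e with
  | VAtom m => if eqn m n then 1 else 0
  | VZero => 0
  | VAdd e1 e2 => vcoef e1 n + vcoef e2 n
  | VOpp e1 => - vcoef e1 n
  | VScale c e1 => c * vcoef e1 n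
  end.

Lemma vevalE env e : veval env e = \sum_(i < size env) vcoef e i *: nth 0 env i.
Proof.
elim: e => [n||e1 IH1 e2 IH2|e IH|c e IH] /=.
- have [nlt|nge] := ltnP n (size env); last first.
    rewrite nth_default // big1 // => i _; rewrite eqnE.
    by rewrite gtn_eqF ?scale0r // (leq_trans (ltn_ord i)).
  rewrite (bigD1 (Ordinal nlt)) //= eqnE eqxx scale1r big1 ?addr0 // => i.
  by rewrite -val_eqE /= eq_sym => /negbTE->; rewrite scale0r.
- by rewrite big1 // => i _; rewrite scale0r.
- by rewrite IH1 IH2 -big_split; apply: eq_bigr => i _; rewrite scalerDl.
- by rewrite IH -sumrN; apply: eq_bigr => i _; rewrite scaleNr.
- by rewrite IH scaler_sumr; apply: eq_bigr => i _; rewrite scalerA.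
Qed.

Fixpoint vsame (e1 e2 : vexpr) (n : nat) : Prop :=
  if n is m.+1 then vcoef e1 m = vcoef e2 m /\ vsame e1 e2 m else True.

Lemma vec_eq env e1 e2 : vsame e1 e2 (size env) -> veval env e1 = veval env e2.
Proof.
move=> same; rewrite !vevalE; apply: eq_bigr => i _; congr (_ *: _).
elim: (size env) (val i) (ltn_ord i) same => [//|n IH] j /=.
by rewrite ltnS leq_eqVlt => /orP[/eqP->|/IH H] [].
Qed.

End module_identities.

Ltac vec_index env x :=
  lazymatch env with
  | cons x _ => constr:(0%N)
  | cons _ ?env' => let n := vec_index env' x in constr:(S n)
  end.

Ltac vec_mem env x :=
  lazymatch env with
  | nil => constr:(false)
  | cons x _ => constr:(true)
  | cons _ ?env' => vec_mem env' x
  end.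

Ltac vec_atoms env t :=
  lazymatch t with
  | (?a + ?b)%R => let env' := vec_atoms env a in vec_atoms env' b
  | (- ?a)%R => vec_atoms env a
  | (_ *: ?a)%R => vec_atoms env a
  | (0)%R => env
  | _ => lazymatch vec_mem env t with
         | true => env
         | false => constr:(cons t env)
         end
  end.

Ltac vec_reify K env t :=
  lazymatch t with
  | (?a + ?b)%R => let e1 := vec_reify K env a in let e2 := vec_reify K env b in
                 constr:(VAdd e1 e2)
  | (- ?a)%R => let e := vec_reify K env a in constr:(VOpp e)
  | (?c *: ?a)%R => let e := vec_reify K env a in constr:(VScale (K := K) c e)
  | (0)%R => constr:(VZero (K := K))
  | _ => let n := vec_index env t in constr:(VAtom (K := K) n)
  end.

(* Proves an identity of a module by comparing coefficients with [ring]. *)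
Ltac vec K :=
  lazymatch goal with
  | |- @eq ?T ?a ?b =>
    let env0 := constr:(@nil T) in
    let env1 := vec_atoms env0 a in
    let env := vec_atoms env1 b in
    let e1 := vec_reify K env a in
    let e2 := vec_reify K env b in
    refine (@vec_eq K _ env e1 e2 _);
    cbv [vsame vcoef size eqn];
    repeat split; try ring
  end.

Section scalars.
Context {R : realType} {k : scalar_kind}.
Local Notation K := (scalars R k).

Lemma of_real_is_zmod_morphism : zmod_morphism (@of_real R k).
Proof. by case: k => //= x y; rewrite raddfB. Qed.

Lemma of_real_is_monoid_morphism : monoid_morphism (@of_real R k).
Proof. by case: k => //=; split=> [//|x y]; rewrite rmorphM. Qed.

HB.instance Definition _ :=
  GRing.isZmodMorphism.Build R K (@of_real R k) of_real_is_zmod_morphism.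
HB.instance Definition _ :=
  GRing.isMonoidMorphism.Build R K (@of_real R k) of_real_is_monoid_morphism.

Lemma real_part_of_real (a : R) : real_part (of_real a : K) = a.
Proof. by case: k. Qed.

Lemma real_part_normr_of_real (a : R) : real_part `|of_real a : K| = `|a|.
Proof. by case: k => //; rewrite [of_real _]/= normc_def /= expr0n addr0 sqrtr_sqr. Qed.

Lemma real_part_le (a b : K) : a <= b -> real_part a <= real_part b.
Proof. by case: k a b => //= a b; rewrite lecE => /andP[]. Qed.

Lemma real_part_lt (a b : K) : a < b -> real_part a < real_part b.
Proof. by case: k a b => //= a b; rewrite ltcE => /andP[]. Qed.

Lemma real_partD (a b : K) : real_part (a + b) = real_part a + real_part b.
Proof. by case: k a b => //= -[? ?] [? ?]. Qed.

Lemma of_real_real_part (a : K) : 0 <= a -> of_real (real_part a) = a.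
Proof. by case: k a => //= -[a b]; rewrite lecE /= => /andP[/eqP-> _]. Qed.

Lemma of_real_lt (a b : R) : ((of_real a : K) < of_real b) = (a < b).
Proof. by case: k => //=; rewrite ltcE /= eqxx. Qed.

Lemma of_real_ge0 (a : R) : (0 <= (of_real a : K)) = (0 <= a).
Proof. by case: k => //=; rewrite lecE /= eqxx. Qed.

Lemma real_partM_ge0 (a b : K) : 0 <= a -> 0 <= b ->
  real_part (a * b) = real_part a * real_part b.
Proof.
move=> a0 b0; rewrite -{1}(of_real_real_part a0) -{1}(of_real_real_part b0).
by rewrite -rmorphM real_part_of_real.
Qed.

End scalars.

Section real_valued_norm.
Context {R : realType} {k : scalar_kind} {V : normedModType (scalars R k)}.
Local Notation K := (scalars R k).
Implicit Types u v : V.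

Lemma normr_nrm v : `|v| = of_real (nrm v).
Proof. by rewrite /nrm of_real_real_part. Qed.

Lemma nrm_ge0 v : 0 <= nrm v.
Proof. by rewrite -(@of_real_ge0 R k) -normr_nrm. Qed.

Lemma nrm0 : nrm (0 : V) = 0.
Proof. by rewrite /nrm normr0 -(rmorph0 (@of_real R k)) real_part_of_real. Qed.

Lemma nrm_eq0 v : nrm v = 0 -> v = 0.
Proof. by move=> v0; apply/normr0_eq0; rewrite normr_nrm v0 rmorph0. Qed.

Lemma nrm_le0 v : nrm v <= 0 -> v = 0.
Proof. by move=> v0; apply: nrm_eq0; apply: le_anti; rewrite v0 nrm_ge0. Qed.

Lemma nrmD u v : nrm (u + v) <= nrm u + nrm v.
Proof. by rewrite /nrm -real_partD real_part_le // ler_normD. Qed.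

Lemma nrmN v : nrm (- v) = nrm v.
Proof. by rewrite /nrm normrN. Qed.

Lemma nrmC u v : nrm (u - v) = nrm (v - u).
Proof. by rewrite -nrmN opprB. Qed.

Lemma nrmB u v : nrm (u - v) <= nrm u + nrm v.
Proof. by rewrite -(nrmN v) nrmD. Qed.

Lemma nrm_trans w u v : nrm (u - v) <= nrm (u - w) + nrm (w - v).
Proof. by rewrite -{1}(subrK w u) -addrA nrmD. Qed.

Lemma nrm_le_dist u v : nrm u <= nrm v + nrm (u - v).
Proof. by rewrite -{1}(subrK v u) addrC nrmD. Qed.

Lemma nrmZ (c : K) v : nrm (c *: v) = nrm (c : K^o) * nrm v.
Proof. by rewrite /nrm normrZ real_partM_ge0. Qed.

Lemma nrmZr (a : R) v : nrm (of_real a *: v) = `|a| * nrm v.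
Proof. by rewrite nrmZ {1}/nrm real_part_normr_of_real. Qed.

Lemma nrm_sum (I : Type) (s : seq I) (P : pred I) (F : I -> V) :
  nrm (\sum_(i <- s | P i) F i) <= \sum_(i <- s | P i) nrm (F i).
Proof.
elim/big_ind2 : _ => [|u a v b ua vb|//]; first by rewrite nrm0.
by apply: le_trans (nrmD _ _) _; exact: lerD.
Qed.

Lemma nrm_lt_ball u v (e : R) : ball u (of_real e) v <-> nrm (v - u) < e.
Proof.
by rewrite -ball_normE /ball_ /= normr_nrm of_real_lt nrmC.
Qed.

Lemma nbhs_nrmP v (U : set V) :
  nbhs v U <-> exists2 e : R, 0 < e & forall u, nrm (u - v) < e -> U u.
Proof.
split=> [/nbhs_ballP[e /= e0 eU]|[e e0 eU]].
  have er : of_real (real_part e) = e by rewrite of_real_real_part // ltW.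
  exists (real_part e).
    by rewrite -(real_part_of_real (k := k) 0) rmorph0; apply: real_part_lt.
  by move=> u ue; apply: eU; rewrite -er; apply/nrm_lt_ball.
apply/nbhs_ballP; exists (of_real e : K).
  by rewrite /= -(rmorph0 (@of_real R k)) of_real_lt.
by move=> u /nrm_lt_ball/eU.
Qed.

Lemma cvg_nrmP (T : Type) (F : set_system T) (f : T -> V) (l : V) : Filter F ->
  f @ F --> l <-> forall e : R, 0 < e -> \forall x \near F, nrm (f x - l) < e.
Proof.
move=> FF; split=> [fl e e0|fl U /nbhs_nrmP[e e0 eU]].
  by apply: (fl [set u | nrm (u - l) < e]); apply/nbhs_nrmP; exists e.
by near=> x; apply: eU; near: x; exact: fl.
Unshelve. all: by end_near. Qed.

End real_valued_norm.

Section completeness.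
Context {R : realType} {k : scalar_kind}.
Context {V : completeNormedModType (scalars R k)}.

Definition tends (u : nat -> V) (l : V) : Prop :=
  forall e : R, 0 < e -> exists N, forall n, (N <= n)%N -> nrm (u n - l) < e.

Lemma cauchy_tends (u : nat -> V) :
  (forall e : R, 0 < e -> exists N, forall m n, (N <= m)%N -> (N <= n)%N ->
    nrm (u m - u n) < e) -> exists l, tends u l.
Proof.
move=> uC; have : cvg (u @ \oo).
  apply: cauchy_cvg; apply/cauchy_ballP => e e0.
  have er : of_real (real_part e) = e by rewrite of_real_real_part // ltW.
  have [|N uN] := uC (real_part e).
    by rewrite -(real_part_of_real (k := k) 0) rmorph0; apply: real_part_lt.
  pose W : set V := u @` [set n | (N <= n)%N].
  have WN : (u @ \oo) W by exists N => // n Nn; exists n.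
  exists (W, W) => // -[_ _] [/= [m Nm <-] [n Nn <-]].
  by rewrite -er; apply/nrm_lt_ball; apply: uN.
move=> /cvg_ex[l /cvg_nrmP ul]; exists l => e e0.
by have [N _ uN] := ul e e0; exists N => n Nn; apply: uN.
Qed.

Lemma tends_unique (u : nat -> V) l l' : tends u l -> tends u l' -> l = l'.
Proof.
move=> ul ul'; apply/eqP; rewrite -subr_eq0; apply/eqP/nrm_le0.
apply/ler_addgt0Pr => e e0; rewrite add0r.
have e2 : 0 < e / 2 by lra.
have [N uN] := ul _ e2; have [N' uN'] := ul' _ e2.
have := uN (maxn N N') (leq_maxl _ _); have := uN' (maxn N N') (leq_maxr _ _).
have := nrm_trans (u (maxn N N')) l l'; rewrite (nrmC l (u _)); lra.
Qed.

Lemma tends_le (u : nat -> V) l v (C : R) N : tends u l ->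
  (forall n, (N <= n)%N -> nrm (u n - v) <= C) -> nrm (l - v) <= C.
Proof.
move=> ul uC; apply/ler_addgt0Pr => e e0; have [N' uN'] := ul _ e0.
have := uN' (maxn N N') (leq_maxr _ _); have := uC (maxn N N') (leq_maxl _ _).
have := nrm_trans (u (maxn N N')) l v; rewrite (nrmC l (u _)); lra.
Qed.

Lemma geometric_small (q C e : R) : 0 <= q < 1 -> 0 < e ->
  exists N, forall n, (N <= n)%N -> C * q ^+ n < e.
Proof.
move=> /andP[q0 q1] e0.
have : (fun n => C * q ^+ n) @ \oo --> C * 0.
  by apply: cvgMr; apply: cvg_expr; rewrite ger0_norm.
rewrite mulr0 => /cvgrPdist_lt /(_ _ e0)[N _ CN]; exists N => n Nn.
have := CN n Nn; rewrite /= sub0r normrN; apply: le_lt_trans.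
exact: ler_norm.
Qed.

Lemma geometric_dist (u : nat -> V) (C q : R) : 0 <= q < 1 -> 0 <= C ->
  (forall n, nrm (u n.+1 - u n) <= C * q ^+ n) ->
  forall n d, nrm (u (n + d)%N - u n) <= C / (1 - q) * q ^+ n.
Proof.
move=> /andP[q0 q1] C0 uq n d.
have D0 : 0 <= C / (1 - q) by apply: divr_ge0 => //; lra.
have qn0 j : 0 <= q ^+ j by exact: exprn_ge0.
suff: nrm (u (n + d)%N - u n) <= C / (1 - q) * (q ^+ n - q ^+ (n + d)%N).
  have := qn0 (n + d)%N => p H; apply: le_trans H _; apply: ler_wpM2l => //; lra.
elim: d => [|d IH]; first by rewrite addn0 subrr nrm0 subrr mulr0.
rewrite addnS; apply: le_trans (nrm_trans (u (n + d)%N) _ _) _.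
apply: le_trans (lerD (uq _) IH) _; rewrite exprS.
have -> : C * q ^+ (n + d) = C / (1 - q) * ((1 - q) * q ^+ (n + d)).
  by rewrite mulrA divfK //; apply/eqP; lra.
by rewrite -mulrDr; apply: ler_wpM2l => //; lra.
Qed.

Lemma geometric_tends (u : nat -> V) (C q : R) : 0 <= q < 1 -> 0 <= C ->
  (forall n, nrm (u n.+1 - u n) <= C * q ^+ n) ->
  exists2 l, tends u l & forall n, nrm (l - u n) <= C / (1 - q) * q ^+ n.
Proof.
move=> q01 C0 uq; have ug := geometric_dist q01 C0 uq.
have [|l ul] := @cauchy_tends u.
  move=> e e0; have e2 : 0 < e / 2 by lra.
  have [N HN] := geometric_small (C / (1 - q)) q01 e2; exists N => m n Nm Nn.
  have := HN N (leqnn _); have := ug N (m - N)%N; have := ug N (n - N)%N.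
  rewrite !subnKC // => h1 h2 h3.
  by have := nrm_trans (u N) (u m) (u n); rewrite (nrmC (u N)); lra.
exists l => // n; apply: (tends_le (N := n) ul) => m nm.
by rewrite -(subnKC nm).
Qed.

Lemma closed_tends (U : set V) (u : nat -> V) l : closed U ->
  (forall n, U (u n)) -> tends u l -> U l.
Proof.
move=> clU uU ul; rewrite (closure_id U).1 // => W /nbhs_nrmP[e e0 eW].
by have [N uN] := ul _ e0; exists (u N); split=> //; apply: eW; apply: uN.
Qed.

End completeness.

(** * The open mapping theorem *)

Section open_mapping.
Context {R : realType} {k : scalar_kind}.
Context {Y Z : completeNormedModType (scalars R k)}.
Variable G : Y -> Z -> Prop.
Hypothesis G0 : G 0 0.
Hypothesis G_lin : forall (a : R) y z y' z', G y z -> G y' z' ->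
  G (of_real a *: y + y') (of_real a *: z + z').
Hypothesis G_closed : forall yn zn y z, (forall n, G (yn n) (zn n)) ->
  tends yn y -> tends zn z -> G y z.
Let E y := exists z, G y z.
Hypothesis E_closed : forall yn y, (forall n, E (yn n)) -> tends yn y -> E y.

Let B (n : nat) y := exists2 z, G y z & nrm z <= n%:R.

Let G_B y z y' z' : G y z -> G y' z' -> G (y - y') (z - z').
Proof.
move=> g g'; have := G_lin (-1) g' g.
by rewrite rmorphN rmorph1 !scaleN1r ![- _ + _]addrC.
Qed.

Let G_Z (a : R) y z : G y z -> G (of_real a *: y) (of_real a *: z).
Proof. by move=> g; have := G_lin a g G0; rewrite !addr0. Qed.

Let nested_radii (s : nat -> Y * R) :
  (forall n, 0 < (s n).2) ->
  (forall n, nrm ((s n.+1).1 - (s n).1) + (s n.+1).2 <= (s n).2) ->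
  (forall n, (s n.+1).2 <= (s n).2 / 2) ->
  exists2 l, tends (fun n => (s n).1) l & forall n, nrm (l - (s n).1) <= (s n).2.
Proof.
move=> s0 sD s2.
have sg n : (s n).2 <= (s 0%N).2 * 2^-1 ^+ n.
  elim: n => [|n IH]; first by rewrite expr0 mulr1.
  by have := s2 n; rewrite exprS; nra.
have [|||l sl _] := @geometric_tends _ _ _ (fun n => (s n).1) (s 0%N).2 2^-1.
- by apply/andP; split; lra.
- exact/ltW.
- by move=> n; have := sD n; have := sg n; have := s0 n.+1; lra.
exists l => // n; apply: (tends_le (N := n) sl) => m nm.
suff: nrm ((s m).1 - (s n).1) + (s m).2 <= (s n).2 by have := s0 m; lra.
rewrite -(subnKC nm); elim: (m - n)%N => [|d IH].
  by rewrite addn0 subrr nrm0 add0r.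
have := sD (n + d)%N; rewrite addnS.
by have := nrm_trans (s (n + d)%N).1 (s (n + d).+1).1 (s n).1; lra.
Qed.

(* Baire's argument: otherwise nested balls would avoid every B n. *)
Let somewhere_dense : exists n y0 e, [/\ E y0, 0 < e &
  forall y, E y -> nrm (y - y0) < e -> forall d, 0 < d ->
    exists2 b, B n b & nrm (b - y) < d].
Proof.
apply: contrapT => NB.
have step n (s : Y * R) : exists s' : Y * R, E s.1 -> 0 < s.2 ->
    [/\ E s'.1, 0 < s'.2, nrm (s'.1 - s.1) + s'.2 <= s.2, s'.2 <= s.2 / 2 &
        forall b, nrm (b - s'.1) <= s'.2 -> ~ B n b].
  case: s => y0 e /=.
  have [[Ey0 e0]|N] := pselect (E y0 /\ 0 < e); last first.
    by exists (0, 0) => Ey0 e0; case: N.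
  have [y [d [Ey ye d0 yB]]] : exists y d, [/\ E y, nrm (y - y0) < e, 0 < d &
      forall b, nrm (b - y) < d -> ~ B n b].
    apply: contrapT => N; apply: NB; exists n, y0, e; split=> // y Ey ye d d0.
    apply: contrapT => N'; apply: N; exists y, d; split=> // b bd Bb.
    by apply: N'; exists b.
  exists (y, Num.min (d / 2) ((e - nrm (y - y0)) / 2)) => /= _ _.
  have := nrm_ge0 (y - y0) => n0.
  have [m1 m2] : Num.min (d / 2) ((e - nrm (y - y0)) / 2) <= d / 2 /\
     Num.min (d / 2) ((e - nrm (y - y0)) / 2) <= (e - nrm (y - y0)) / 2.
    by rewrite !ge_min !lexx orbT.
  split=> //; [|lra|lra|].
    by rewrite lt_min; apply/andP; split; lra.
  by move=> b bm; apply: yB; lra.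
have [F FP] := choice (fun ns : nat * (Y * R) => step ns.1 ns.2).
pose s := fix s n := if n is m.+1 then F (m, s m) else (0, 1) : Y * R.
have sE n : E (s n).1 /\ 0 < (s n).2.
  elim: n => [|n [IH1 IH2]] /=; first by split; [exists 0 | lra].
  by have [] := FP (n, s n) IH1 IH2.
have sP n := FP (n, s n) (sE n).1 (sE n).2.
have [|||l sl ls] := @nested_radii s; try by move=> n; case: (sP n) => //.
  by move=> n; case: (sE n).
have [z Gz] : E l by apply: (E_closed (fun n => (sE n).1) sl).
pose n := (Num.bound (nrm z)).
have [_ _ _ _] := sP n => /(_ l (ls n.+1)); apply; exists z => //.
by have := Num.Theory.archi_boundP (nrm_ge0 z); rewrite -/n; lra.
Qed.

Let approximate_preimage : exists2 C : R, 0 <= C & forall y, E y ->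
  exists b z, [/\ G b z, nrm (y - b) <= nrm y / 2 & nrm z <= C * nrm y].
Proof.
have [n [y0 [e [[z0 Gy0] e0 H]]]] := somewhere_dense.
exists (2 * n%:R / (e / 2)).
  by rewrite divr_ge0 ?mulr_ge0 ?ler0n //; lra.
move=> y [zy Gy].
have [->|y_neq0] := eqVneq y 0.
  by exists 0, 0; rewrite subrr !nrm0; split => //; lra.
have ny : 0 < nrm y.
  rewrite lt_neqAle nrm_ge0 andbT eq_sym.
  by apply: contra y_neq0 => /eqP/nrm_eq0->.
pose a := (e / 2) / nrm y.
have a0 : 0 < a by rewrite divr_gt0 //; lra.
have aE : a * nrm y = e / 2 by rewrite divfK //; apply/eqP; lra.
have d0 : 0 < a * nrm y / 4 by rewrite aE; lra.
have [||b1 [z1 G1 z1n] b1d] := H (of_real a *: y + y0) _ _ _ d0.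
- by exists (of_real a *: zy + z0); exact: G_lin.
- by rewrite addrK nrmZr gtr0_norm // aE; lra.
have [||b2 [z2 G2 z2n] b2d] := H y0 _ _ _ d0.
- by exists z0.
- by rewrite subrr nrm0.
exists (of_real a^-1 *: (b1 - b2)), (of_real a^-1 *: (z1 - z2)); split.
- by apply: G_Z; exact: G_B.
- have -> : y - of_real a^-1 *: (b1 - b2) =
      of_real a^-1 *: ((of_real a *: y + y0 - b1) + (b2 - y0)).
    have {1}-> : y = of_real a^-1 *: (of_real a *: y).
      by rewrite scalerA -rmorphM mulVf ?gt_eqF // rmorph1 scale1r.
    by set ay := of_real a *: y; vec (scalars R k).
  rewrite nrmZr gtr0_norm ?invr_gt0 // mulrC ler_pdivrMr //.
  apply: le_trans (nrmD _ _) _; rewrite (nrmC _ b1).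
  by move: b1d b2d; rewrite mulrAC (mulrC (nrm y)); lra.
- rewrite nrmZr gtr0_norm ?invr_gt0 //.
  have -> : 2 * n%:R / (e / 2) * nrm y = a^-1 * (2 * n%:R).
    by rewrite /a; field; rewrite !gt_eqF.
  apply: ler_wpM2l; first by rewrite invr_ge0 ltW.
  by apply: le_trans (nrmB _ _) _; lra.
Qed.

Lemma open_mapping : exists2 C : R, 0 <= C & forall y, (exists z, G y z) ->
  exists2 z, G y z & nrm z <= C * nrm y.
Proof.
have [C C0 H] := approximate_preimage; exists (C / (1 - 2^-1)).
  by rewrite divr_ge0 //; lra.
move=> y Ey.
have step y' : exists bz : Y * Z, E y' ->
    [/\ G bz.1 bz.2, nrm (y' - bz.1) <= nrm y' / 2 & nrm bz.2 <= C * nrm y'].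
  have [/H[b [z Hbz]]|N] := pselect (E y'); first by exists (b, z).
  by exists (0, 0).
have [F FP] := choice step.
pose u n := iter n (fun y => y - (F y).1) y.
have Eu n : E (u n).
  elim: n => [//|n IH]; rewrite /u iterS -/(u n).
  have [g _ _] := FP _ IH; case: IH => zn gn.
  by exists (zn - (F (u n)).2); exact: G_B.
have un n : nrm (u n) <= nrm y * 2^-1 ^+ n.
  elim: n => [|n IH]; first by rewrite expr0 mulr1.
  rewrite [u n.+1]iterS -/(u n) exprS; have [_ h _] := FP _ (Eu n).
  by apply: le_trans h _; lra.
pose z n := \sum_(i < n) (F (u i)).2.
have Gz n : G (y - u n) (z n).
  elim: n => [|n IH]; first by rewrite subrr /z big_ord0.
  have [g _ _] := FP _ (Eu n); have := G_lin 1 IH g.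
  rewrite rmorph1 !scale1r /z big_ord_recr /=.
  congr (G _ _); rewrite -/(u n); vec (scalars R k).
have zn n : nrm (z n.+1 - z n) <= C * nrm y * 2^-1 ^+ n.
  rewrite {1}/z big_ord_recr /= addrAC subrr add0r.
  have [_ _ h] := FP _ (Eu n); apply: le_trans h _.
  by rewrite -mulrA; apply: ler_wpM2l.
have [||l zl lz] := geometric_tends _ _ zn.
- by apply/andP; split; lra.
- by rewrite mulr_ge0 ?nrm_ge0.
exists l; last first.
  by have := lz 0%N; rewrite /z big_ord0 subr0 expr0 mulr1 mulrAC.
apply: (G_closed Gz) => // e e0.
have [|N HN] := geometric_small (q := 2^-1) (nrm y) _ e0.
  by apply/andP; split; lra.
exists N => n /HN; apply: le_lt_trans.
by rewrite nrmC opprB addrC subrK.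
Qed.

End open_mapping.

(** * Curves and ordinary differential equations *)

Section real_lemmas.
Context {R : realType}.

Lemma real_induction (P : R -> Prop) (a b : R) :
  (forall t : R, a <= t <= b -> (forall s : R, a <= s < t -> P s) ->
    P t /\ exists2 d : R, 0 < d & forall s : R, t < s < t + d -> s <= b -> P s) ->
  forall t : R, a <= t <= b -> P t.
Proof.
move=> step; apply: contrapT => NP.
pose bad : set R := [set t | a <= t <= b /\ ~ P t].
have [t0 bad0] : bad !=set0.
  apply: contrapT => N; apply: NP => t tab; apply: contrapT => NPt.
  by apply: N; exists t.
have lb : lbound bad a by move=> t [/andP[]].
have hi : has_inf bad by split; [exists t0 | exists a].
have ca : a <= inf bad by exact: lb_le_inf hi.1 lb.
have ct t : bad t -> inf bad <= t by move=> bt; apply: ge_inf bt; exact: hi.2.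
have cb : inf bad <= b by apply: le_trans (ct _ bad0) _; case: bad0 => /andP[].
have [|s /andP[sa sc]|Pc [d d0 Pd]] := step (inf bad); first by rewrite ca cb.
  apply: contrapT => NPs; suff : bad s by move/ct; lra.
  by split=> //; apply/andP; split; lra.
have [s [/andP[sa sb] NPs] sd] := inf_adherent d0 hi.
have cs : inf bad <= s by apply: ct; split=> //; apply/andP.
have [sE|/eqP sc] := pselect (s = inf bad); first by apply: NPs; rewrite sE.
apply: NPs; apply: Pd => //; apply/andP; split=> //.
by rewrite lt_neqAle cs andbT eq_sym.
Qed.

Lemma dini_le (r : R -> R) (a b : R) : a <= b ->
  (forall t : R, a <= t <= b -> forall e : R, 0 < e -> exists2 d : R, 0 < d &
    forall s : R, a <= s <= b -> `|s - t| < d -> `|r s - r t| < e) ->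
  (forall t : R, a < t < b -> forall e : R, 0 < e -> exists2 d : R, 0 < d &
    forall s : R, t < s < t + d -> s < b -> r s <= r t + e * (s - t)) ->
  r b <= r a.
Proof.
move=> ab rC rD; have [->//|/eqP anb] := eqVneq a b; apply/ler_addgt0Pr => e e0.
have ba : 0 < b - a by lra.
pose e1 := e / (b - a + 1).
have e10 : 0 < e1 by apply: divr_gt0 => //; lra.
have e1E : e1 * (b - a + 1) = e by rewrite divfK // gt_eqF //; lra.
suff: r b <= r a + e1 * (b - a) + e1 by rewrite -e1E; lra.
pose P t := t < b -> r t <= r a + e1 * (t - a) + e1.
have HP : forall t : R, a <= t <= b -> P t.
  apply: real_induction => t /andP[at_ tb] Ps.
  have Pt : P t.
    move=> tb'; have [->|/eqP ta] := eqVneq t a; first by lra.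
    apply/ler_addgt0Pr => e' e'0.
    have [|d d0 rd] := rC t _ _ e'0; first by apply/andP.
    pose s := Num.max a (t - d / 2).
    have s1 : a <= s by rewrite le_max lexx.
    have s2 : t - d / 2 <= s by rewrite le_max lexx orbT.
    have s3 : s < t by rewrite gt_max; apply/andP; split; lra.
    have Pss : P s by apply: Ps; rewrite s1.
    have h3 := Pss (lt_trans s3 tb').
    have : `|r s - r t| < e'.
      by apply: rd; rewrite ?ltr_distlC; apply/andP; split; lra.
    by rewrite ltr_distlC => /andP[h1 h2]; nra.
  split=> //; have [->|/eqP tnb] := eqVneq t b.
    by exists 1 => // s /andP[? ?] ?; lra.
  have tb' : t < b by lra.
  have [ta|/eqP ta] := eqVneq t a.
    have [|d d0 rd] := rC a _ _ e10; first by rewrite lexx ltW //; lra.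
    exists d => // s /andP[s1 s2] sb _.
    have : `|r s - r a| < e1.
      by apply: rd; rewrite ?ltr_distlC; apply/andP; split; lra.
    rewrite ltr_distlC => /andP[h _]; have sa : 0 < s - a by lra.
    by have := mulr_gt0 e10 sa; lra.
  have [|d d0 rd] := rD t _ _ e10; first by apply/andP; split; lra.
  exists d => // s st sb sb'; have := rd s st sb'; have := Pt tb'; lra.
apply/ler_addgt0Pr => e' e'0.
have [|d d0 rd] := rC b _ _ e'0; first by rewrite lexx ab.
pose s := Num.max a (b - d / 2).
have s1 : a <= s by rewrite le_max lexx.
have s2 : b - d / 2 <= s by rewrite le_max lexx orbT.
have s3 : s < b by rewrite gt_max; apply/andP; split; lra.
have : `|r s - r b| < e'.
  by apply: rd; rewrite ?ltr_distlC; apply/andP; split; lra.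
rewrite ltr_distlC => /andP[h1 h2].
have : P s by apply: HP; apply/andP; split; lra.
by move=> /(_ s3); nra.
Qed.

End real_lemmas.

Section curves.
Context {R : realType} {k : scalar_kind} {V : normedModType (scalars R k)}.
Local Notation K := (scalars R k).
Implicit Types (S : set R) (u v : R -> V) (l : V).

Definition cont_on S u := forall t, S t -> forall e : R, 0 < e ->
  exists2 d : R, 0 < d & forall s, S s -> `|s - t| < d -> nrm (u s - u t) < e.

Definition deriv_on S u t l := forall e : R, 0 < e ->
  exists2 d : R, 0 < d & forall s, S s -> `|s - t| < d ->
    nrm (u s - u t - of_real (s - t) *: l) <= e * `|s - t|.

Definition seg (a b : R) : set R := [set t | a <= t <= b].
Definition oseg (a b : R) : set R := [set t | a < t < b].

Lemma cont_onS S S' u : S' `<=` S -> cont_on S u -> cont_on S' u.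
Proof.
move=> SS uS t /SS St e /(uS t St)[d d0 ud]; exists d => // s /SS; exact: ud.
Qed.

Lemma deriv_onS S S' u t l : S' `<=` S -> deriv_on S u t l -> deriv_on S' u t l.
Proof.
by move=> SS uS e /uS[d d0 ud]; exists d => // s /SS; exact: ud.
Qed.

Lemma deriv_on_near S S' u t l (d : R) : 0 < d ->
  (forall s, S' s -> `|s - t| < d -> S s) ->
  deriv_on S u t l -> deriv_on S' u t l.
Proof.
move=> d0 SS uS e /uS[d' d'0 ud]; exists (Num.min d d').
  by rewrite lt_min d0.
by move=> s S's; rewrite lt_min => /andP[s1 s2]; apply: ud => //; exact: SS.
Qed.

Lemma deriv_on_eq S u u' t l : (forall s, S s -> u s = u' s) -> u t = u' t ->
  deriv_on S u t l -> deriv_on S u' t l.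
Proof.
move=> uu ut uS e /uS[d d0 ud]; exists d => // s Ss sd.
by rewrite -uu // -ut; exact: ud.
Qed.

Lemma cont_on_eq S u u' : (forall s, S s -> u s = u' s) ->
  cont_on S u -> cont_on S u'.
Proof.
move=> uu uS t St e /(uS t St)[d d0 ud]; exists d => // s Ss sd.
by rewrite -!uu //; exact: ud.
Qed.

Lemma deriv_cont S u u' : (forall t, S t -> deriv_on S u t (u' t)) -> cont_on S u.
Proof.
move=> du t St e e0; have [d d0 ud] := du t St 1 ltr01.
have n0 := nrm_ge0 (u' t).
pose c := 1 + nrm (u' t); have c0 : 0 < c by rewrite /c; lra.
exists (Num.min d (e / c)); first by rewrite lt_min d0 divr_gt0.
move=> s Ss; rewrite lt_min ltr_pdivlMr // => /andP[s1 s2].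
have := ud s Ss s1; rewrite mul1r => h.
have := nrm_le_dist (u s - u t) (of_real (s - t) *: u' t).
by rewrite nrmZr; move: s2; rewrite /c; lra.
Qed.

Lemma cont_onD S u v : cont_on S u -> cont_on S v ->
  cont_on S (fun t => u t + v t).
Proof.
move=> cu cv t St e e0; have e2 : 0 < e / 2 by lra.
have [d d0 ud] := cu t St _ e2; have [d' d'0 vd] := cv t St _ e2.
exists (Num.min d d'); first by rewrite lt_min d0.
move=> s Ss; rewrite lt_min => /andP[/(ud s Ss) h /(vd s Ss) h'].
by rewrite opprD addrACA; have := nrmD (u s - u t) (v s - v t); lra.
Qed.

Lemma cont_onN S u : cont_on S u -> cont_on S (fun t => - u t).
Proof.
move=> cu t St e e0; have [d d0 ud] := cu t St _ e0; exists d => // s Ss sd.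
by rewrite -opprD nrmN; exact: ud.
Qed.

Lemma cont_onB S u v : cont_on S u -> cont_on S v ->
  cont_on S (fun t => u t - v t).
Proof. by move=> cu cv; apply: cont_onD => //; exact: cont_onN. Qed.

Lemma cont_on_cst S (c : V) : cont_on S (fun=> c).
Proof. by move=> t _ e e0; exists 1 => // s _ _; rewrite subrr nrm0. Qed.

Lemma deriv_onD S u v t l l' : deriv_on S u t l -> deriv_on S v t l' ->
  deriv_on S (fun t => u t + v t) t (l + l').
Proof.
move=> cu cv e e0; have e2 : 0 < e / 2 by lra.
have [d d0 ud] := cu _ e2; have [d' d'0 vd] := cv _ e2.
exists (Num.min d d'); first by rewrite lt_min d0.
move=> s Ss; rewrite lt_min => /andP[/(ud s Ss) h /(vd s Ss) h'].
set c := of_real (s - t); rewrite -/c in h h'.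
have -> : u s + v s - (u t + v t) - c *: (l + l') =
  (u s - u t - c *: l) + (v s - v t - c *: l') by vec (scalars R k).
apply: le_trans (nrmD _ _) _; lra.
Qed.

Lemma deriv_onN S u t l : deriv_on S u t l ->
  deriv_on S (fun t => - u t) t (- l).
Proof.
move=> cu e e0; have [d d0 ud] := cu _ e0; exists d => // s Ss sd.
set c := of_real (s - t).
have -> : - u s - - u t - c *: - l = - (u s - u t - c *: l) by vec (scalars R k).
by rewrite nrmN; exact: ud.
Qed.

Lemma deriv_onB S u v t l l' : deriv_on S u t l -> deriv_on S v t l' ->
  deriv_on S (fun t => u t - v t) t (l - l').
Proof. by move=> cu cv; apply: deriv_onD => //; exact: deriv_onN. Qed.

Lemma deriv_on_cst S (c : V) t : deriv_on S (fun=> c) t 0.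
Proof.
move=> e e0; exists 1 => // s _ _.
by rewrite subrr scaler0 subrr nrm0 mulr_ge0 // ltW.
Qed.

Lemma deriv_on_line S (a : R) (c : V) t :
  deriv_on S (fun s => of_real (s - a) *: c) t c.
Proof.
move=> e e0; exists 1 => // s _ _.
rewrite -scalerBl -rmorphB -scalerBl -rmorphB.
by rewrite (_ : _ - _ - _ = 0) ?rmorph0 ?scale0r ?nrm0 ?mulr_ge0 // ?ltW //; ring.
Qed.

(* Only right derivatives are used, so that [h] may be any real function. *)
Lemma mean_value u (h : R -> R) (a b : R) : a <= b -> cont_on (seg a b) u ->
  (forall t : R, a <= t <= b -> forall e : R, 0 < e -> exists2 d : R, 0 < d &
    forall s : R, a <= s <= b -> `|s - t| < d -> `|h s - h t| < e) ->
  (forall t : R, a < t < b -> forall e : R, 0 < e -> exists2 d : R, 0 < d &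
    forall s : R, t < s < t + d -> s < b ->
      nrm (u s - u t) <= h s - h t + e * (s - t)) ->
  nrm (u b - u a) <= h b - h a.
Proof.
move=> ab cu ch dh.
suff: nrm (u b - u a) - h b <= nrm (u a - u a) - h a by rewrite subrr nrm0; lra.
apply: (dini_le (r := fun t => nrm (u t - u a) - h t)) => // t tab e e0.
  have e2 : 0 < e / 2 by lra.
  have [d d0 ud] := cu t tab _ e2; have [d' d'0 hd] := ch t tab _ e2.
  exists (Num.min d d'); first by rewrite lt_min d0.
  move=> s sab; rewrite lt_min => /andP[/(ud s sab) h1 /(hd s sab) h2].
  have := nrm_trans (u t) (u s) (u a); have := nrm_trans (u s) (u t) (u a).
  rewrite (nrmC (u t) (u s)); move: h2; rewrite !ltr_norml => /andP[h2 h3] h4 h5.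
  by apply/andP; split; lra.
have [d d0 hd] := dh t tab e e0; exists d => // s st sb.
by have := hd s st sb; have := nrm_trans (u t) (u s) (u a); lra.
Qed.

Lemma mean_value_cst u (w : V) (C a b : R) : a <= b -> cont_on (seg a b) u ->
  (forall t : R, a < t < b -> exists2 v, deriv_on (oseg a b) u t v & nrm (v - w) <= C) ->
  nrm (u b - u a - of_real (b - a) *: w) <= C * (b - a).
Proof.
move=> ab cu du; pose u1 t := u t - of_real (t - a) *: w.
have -> : u b - u a - of_real (b - a) *: w = u1 b - u1 a.
  by rewrite /u1 subrr rmorph0; vec (scalars R k).
rewrite [leRHS]mulrBr; apply: mean_value => //.
- apply: cont_onB => //; apply: (deriv_cont (u' := fun=> w)) => t _.
  exact: deriv_on_line.
- move=> t _ e e0; exists (e / (`|C| + 1)).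
    by rewrite divr_gt0 // ltr_wpDl.
  move=> s _; rewrite ltr_pdivlMr ?ltr_wpDl // -mulrBr normrM => h.
  have := normr_ge0 (s - t); have := normr_ge0 C; nra.
- move=> t tab e e0; have [v dv vw] := du t tab.
  have [d d0 ud] := deriv_onB dv (deriv_on_line (oseg a b) a w t) e0.
  exists d => // s /andP[st sd] sb; have /andP[at_ tb] := tab.
  have := ud s; rewrite gtr0_norm; last by lra.
  move=> /(_ _ _) h; have {}h := h _ _.
  have : nrm (u1 s - u1 t - of_real (s - t) *: (v - w)) <= e * (s - t).
    by apply: h; [apply/andP; split; lra|lra].
  have := nrm_le_dist (u1 s - u1 t) (of_real (s - t) *: (v - w)).
  rewrite nrmZr gtr0_norm; last by lra.
  by have st0 : 0 < s - t by [lra]; nra.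
Qed.

Lemma mean_value_bound u (C a b : R) : a <= b -> cont_on (seg a b) u ->
  (forall t : R, a < t < b -> exists2 v, deriv_on (oseg a b) u t v & nrm v <= C) ->
  nrm (u b - u a) <= C * (b - a).
Proof.
move=> ab cu du; have := @mean_value_cst u 0 C a b ab cu.
rewrite scaler0 subr0; apply => t /du[v dv vC]; exists v => //.
by rewrite subr0.
Qed.

Lemma continuous_expR_bound (c t e : R) : 0 < e -> exists2 d : R, 0 < d & forall s,
  `|s - t| < d -> `|expR (c * s) - expR (c * t)| < e.
Proof.
move=> e0; have : {for t, continuous (fun s => expR (c * s))}.
  apply: continuous_comp; last exact: continuous_expR.
  by apply: continuousM; [exact: cst_continuous | move=> ?; exact: cvg_id].
move=> /cvgrPdist_lt /(_ _ e0) /nbhs_ballP[d d0 H]; exists d => // s sd.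
by rewrite distrC; apply: H; rewrite /ball /= distrC.
Qed.

Lemma gronwall u (C a b : R) : a <= b -> 0 <= C -> cont_on (seg a b) u ->
  (forall t : R, a < t < b ->
    exists2 v, deriv_on (oseg a b) u t v & nrm v <= C * nrm (u t)) ->
  nrm (u b) <= nrm (u a) * expR (C * (b - a)).
Proof.
move=> ab C0 cu du.
suff: nrm (u b) * expR (- C * b) <= nrm (u a) * expR (- C * a).
  rewrite -ler_pdivlMr ?expR_gt0 // -expRN -mulrA -expRD.
  by rewrite (_ : _ + _ = C * (b - a)) //; ring.
apply: (dini_le (r := fun t => nrm (u t) * expR (- C * t))) => // t tab e e0.
  have n0 := nrm_ge0 (u t); have E0 := expR_gt0 (- C * t).
  pose M := nrm (u t) + 1.
  have e1 : 0 < e / 2 / M by rewrite !divr_gt0 // /M; lra.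
  have e2 : 0 < Num.min 1 (e / 2 / (expR (- C * t))).
    by rewrite lt_min ltr01 /= !divr_gt0.
  have [d d0 ud] := cu t tab _ e2.
  have [d' d'0 hd] := continuous_expR_bound (- C) t e1.
  exists (Num.min d d'); first by rewrite lt_min d0.
  move=> s sab; rewrite lt_min => /andP[/(ud s sab) + /hd].
  rewrite lt_min ltr_pdivlMr // => /andP[h1 h1'].
  rewrite ltr_pdivlMr /M; last by lra.
  move=> h2.
  have -> : nrm (u s) * expR (- C * s) - nrm (u t) * expR (- C * t) =
    nrm (u s) * (expR (- C * s) - expR (- C * t)) +
    (nrm (u s) - nrm (u t)) * expR (- C * t) by ring.
  apply: le_lt_trans (ler_normD _ _) _; rewrite !normrM.
  rewrite (ger0_norm (nrm_ge0 _)) (gtr0_norm E0).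
  have h3 : `|nrm (u s) - nrm (u t)| <= nrm (u s - u t).
    have := nrm_le_dist (u s) (u t); have := nrm_le_dist (u t) (u s).
    by rewrite (nrmC (u t) (u s)) ler_norml => ? ?; apply/andP; split; lra.
  have h4 : nrm (u s) <= nrm (u t) + 1 by have := nrm_le_dist (u s) (u t); lra.
  have := ler_wpM2r (normr_ge0 (expR (- C * s) - expR (- C * t))) h4.
  by have := ler_wpM2r (ltW E0) h3; lra.
have /andP[at_ tb] := tab.
have [v dv vC] := du t tab; have E0 := expR_gt0 (- C * t).
have e1 : 0 < e / expR (- C * t) by rewrite divr_gt0.
have [d d0 ud] := dv _ e1; exists d => // s /andP[st sd] sb.
have st0 : 0 < s - t by lra.
have := ud s; rewrite gtr0_norm // => H.
have {}H : nrm (u s - u t - of_real (s - t) *: v) <= e / expR (- C * t) * (s - t).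
  by apply: H; [apply/andP; split; lra | lra].
have := nrm_le_dist (u s - u t) (of_real (s - t) *: v).
rewrite nrmZr gtr0_norm // => H1; have := nrm_le_dist (u s) (u t) => H2.
have -> : - C * s = - C * t + - C * (s - t) by ring.
rewrite expRD.
have X0 := expR_gt0 (- C * (s - t)).
have X1 : expR (- C * (s - t)) * (1 + C * (s - t)) <= 1.
  have := expR_ge1Dx (C * (s - t)); rewrite -(ler_pM2l X0) -expRD.
  by rewrite mulNr addNr expR0.
have X2 : expR (- C * (s - t)) <= 1 by rewrite -[leRHS]expR0 ler_expR; nra.
have n0 := nrm_ge0 (u t).
set p := e / expR (- C * t) in e1 H; have pE : e = p * expR (- C * t).
  by rewrite /p divfK // gt_eqF.
rewrite pE.
have H3 : nrm (u s) <= nrm (u t) * (1 + C * (s - t)) + p * (s - t) by nra.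
set X := expR (- C * (s - t)) in X0 X1 X2 *; set E := expR (- C * t) in E0 *.
have H4 : nrm (u s) * X <= nrm (u t) + p * (s - t).
  apply: le_trans (ler_wpM2r (ltW X0) H3) _.
  have := ler_wpM2l n0 X1; have ps : 0 <= p * (s - t) by rewrite mulr_ge0 // ltW.
  by have := ler_wpM2l ps X2; lra.
by have := ler_wpM2r (ltW E0) H4; lra.
Qed.

End curves.

Section primitives.
Context {R : realType} {k : scalar_kind}.
Context {V : completeNormedModType (scalars R k)}.
Implicit Types (u v g : R -> V).

Definition approx_primitive (e a b : R) g u := u a = 0 /\
  forall t : R, a <= t <= b -> exists2 d : R, 0 < d & forall s : R, a <= s <= b ->
    `|s - t| < d -> nrm (u s - u t - of_real (s - t) *: g t) <= e * `|s - t|.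

Lemma approx_primitive_extend (e a c b : R) g u (w : V) :
  a <= c <= b -> 0 <= e -> approx_primitive e a c g u ->
  (forall t, c <= t <= b -> nrm (w - g t) <= e) ->
  exists u', approx_primitive e a b g u'.
Proof.
move=> /andP[ac cb] e0 [ua uP] wg.
pose u' t := if t <= c then u t else u c + of_real (t - c) *: w.
have u'l t : t <= c -> u' t = u t by rewrite /u' => ->.
have u'r t : c <= t -> u' t = u c + of_real (t - c) *: w.
  rewrite le_eqVlt => /predU1P[<-|ct].
    by rewrite u'l // subrr rmorph0 scale0r addr0.
  by rewrite /u' leNgt ct.
have rE s t : c <= s -> c <= t -> c <= t <= b ->
    nrm (u' s - u' t - of_real (s - t) *: g t) <= e * `|s - t|.
  move=> cs ct /wg h; rewrite !u'r //.
  have -> : u c + of_real (s - c) *: w - (u c + of_real (t - c) *: w)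
     - of_real (s - t) *: g t = of_real (s - t) *: (w - g t).
    by rewrite !rmorphB; vec (scalars R k).
  by rewrite nrmZr mulrC ler_wpM2r.
exists u'; split=> [|t /andP[at_ tb]]; first by rewrite u'l.
have [tc|ct|tc] := ltgtP t c.
- have [|d d0 ud] := uP t; first by rewrite at_ ltW.
  exists (Num.min d (c - t)); first by rewrite lt_min d0 subr_gt0.
  move=> s /andP[as_ sb]; rewrite lt_min => /andP[sd sc].
  have {}sc : s <= c.
    by move: sc; rewrite ltr_norml => /andP[_]; rewrite ltrD2r; exact: ltW.
  by rewrite !u'l ?(ltW tc) //; apply: ud => //; rewrite as_.
- exists (t - c); first by rewrite subr_gt0.
  move=> s /andP[as_ sb]; rewrite ltr_norml => /andP[sc _].
  apply: rE; rewrite ?(ltW ct) //.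
  by move: sc; rewrite opprB ltrD2r; exact: ltW.
subst c; have [|d d0 ud] := uP t; first by rewrite at_ lexx.
exists d => // s /andP[as_ sb] sd; have [sc|cs] := leP s t.
  by rewrite !u'l //; apply: ud => //; rewrite as_.
by apply: rE; rewrite ?lexx ?(ltW cs).
Qed.

Lemma approx_primitive_exists (e a b : R) g : a <= b -> 0 < e ->
  cont_on (seg a b) g -> exists u, approx_primitive e a b g u.
Proof.
move=> ab e0 cg.
suff: forall t : R, a <= t <= b -> exists u, approx_primitive e a t g u.
  by apply; rewrite ab lexx.
apply: real_induction => t tab Ps.
have e2 : 0 < e / 2 by rewrite divr_gt0.
have [d d0 gd] := cg t tab _ e2; have /andP[at_ tb] := tab.
have [c [u [/andP[ac ct] tc uP]]] : exists c u,
    [/\ a <= c <= t, t - d < c & approx_primitive e a c g u].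
  have [->|/eqP ta] := eqVneq t a.
    exists a, (fun=> 0); split; [by rewrite lexx | by rewrite ltrBlDr ltrDl |].
    split=> // s /andP[as_ sa]; exists 1 => // r /andP[ar ra] _.
    have -> : r = s by apply: le_anti; rewrite (le_trans ra as_) (le_trans sa ar).
    by rewrite !subrr rmorph0 scale0r subrr nrm0 normr0 mulr0.
  pose c := Num.max a (t - d / 2).
  have d2 : 0 < d / 2 by rewrite divr_gt0.
  have ct : c < t by rewrite gt_max lt_neqAle at_ (introN eqP (not_eq_sym ta)) /= ltrBlDr ltrDl.
  have [|u uP] := Ps c; first by rewrite le_max lexx.
  exists c, u; split=> //; first by rewrite le_max lexx (ltW ct).
  by rewrite /c lt_max; apply/orP; right; lra.
have ext t' : c <= t' < t + d -> t' <= b ->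
    exists u', approx_primitive e a t' g u'.
  move=> /andP[ct' t'd] t'b.
  apply: (approx_primitive_extend (c := c) (w := g t) _ _ uP) => [||s /andP[cs st]].
  - by rewrite ac.
  - exact: ltW.
  have := gd s; rewrite nrmC => H; apply/ltW/(lt_trans (H _ _)); last by lra.
    by rewrite /seg /=; apply/andP; split; lra.
  by rewrite ltr_norml; apply/andP; split; lra.
split; first by apply: ext => //; rewrite ct ltrDl.
exists d => // s /andP[ts sd] sb; apply: ext => //.
by rewrite sd (le_trans ct (ltW ts)).
Qed.

Lemma approx_primitiveB (e e' a b : R) g u v :
  approx_primitive e a b g u -> approx_primitive e' a b g v ->
  forall t : R, a <= t <= b -> exists2 d : R, 0 < d & forall s : R, a <= s <= b ->
    `|s - t| < d -> nrm ((u s - v s) - (u t - v t)) <= (e + e') * `|s - t|.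
Proof.
move=> [_ uP] [_ vP] t tab.
have [d d0 ud] := uP t tab; have [d' d'0 vd] := vP t tab.
exists (Num.min d d'); first by rewrite lt_min d0.
move=> s sab; rewrite lt_min => /andP[/(ud s sab) h /(vd s sab) h'].
set c : scalars R k := of_real (s - t); rewrite -/c in h h'.
have -> : u s - v s - (u t - v t) =
  (u s - u t - c *: g t) - (v s - v t - c *: g t) by vec (scalars R k).
by apply: le_trans (nrmB _ _) _; rewrite mulrDl lerD.
Qed.

Lemma approx_primitive_dist (e e' a b : R) g u v : 0 <= e -> 0 <= e' ->
  approx_primitive e a b g u -> approx_primitive e' a b g v ->
  forall s t, a <= s <= b -> a <= t <= b ->
  nrm ((u t - v t) - (u s - v s)) <= (e + e') * `|t - s|.
Proof.
move=> e0 e'0 uP vP; have ee : 0 <= e + e' by exact: addr_ge0.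
have main s t : a <= s -> s <= t -> t <= b ->
    nrm ((u t - v t) - (u s - v s)) <= (e + e') * `|t - s|.
  move=> as_ st tb; rewrite [`|t - s|]ger0_norm ?subr_ge0 // mulrBr.
  have sub r : s <= r <= t -> a <= r <= b.
    by move=> /andP[sr rt]; rewrite (le_trans as_ sr) (le_trans rt tb).
  apply: (mean_value (u := fun t => u t - v t)) => // r rst.
  - move=> e1 e10; have [d d0 H] := approx_primitiveB uP vP (sub _ rst).
    exists (Num.min d (e1 / (e + e' + 1))).
      by rewrite lt_min d0 divr_gt0 // ltr_wpDl.
    move=> x xst; rewrite lt_min ltr_pdivlMr ?ltr_wpDl // => /andP[xd xe].
    apply: le_lt_trans (H _ (sub _ xst) xd) _; apply: le_lt_trans _ xe.
    by rewrite mulrC ler_wpM2l // lerDl.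
  - move=> e1 e10; exists (e1 / (e + e' + 1)); first by rewrite divr_gt0 // ltr_wpDl.
    move=> x _; rewrite ltr_pdivlMr ?ltr_wpDl // -mulrBr normrM (ger0_norm ee).
    apply: le_lt_trans; by rewrite mulrC ler_wpM2l // lerDl.
  - move=> e1 e10; have rst' : s <= r <= t by case/andP: rst => *; rewrite !ltW.
    have [d d0 H] := approx_primitiveB uP vP (sub _ rst').
    exists d => // x /andP[rx xd] xt.
    have sx : s <= x by case/andP: rst' => + _ => /le_trans; apply; exact: ltW.
    have := H x; rewrite gtr0_norm ?subr_gt0 // -mulrBr.
    have xr : 0 <= x - r by rewrite subr_ge0 ltW.
    have e1x : 0 <= e1 * (x - r) by rewrite mulr_ge0 // ltW.
    move=> h; apply: le_trans (h _ _) _; last by rewrite lerDl.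
      by apply: sub; rewrite sx ltW.
    by rewrite ltrBlDr addrC.
move=> s t /andP[as_ sb] /andP[at_ tb].
have [st|ts] := leP s t; first exact: main.
by rewrite nrmC distrC; apply: main => //; exact: ltW.
Qed.

Lemma primitive_exists (a b : R) g : a <= b -> cont_on (seg a b) g ->
  exists2 u, u a = 0 & forall t : R, a <= t <= b -> deriv_on (seg a b) u t (g t).
Proof.
move=> ab cg; pose e n : R := 2^-1 ^+ n.
have q01 : 0 <= (2^-1 : R) < 1 by apply/andP; split; lra.
have e0 n : 0 < e n by rewrite exprn_gt0 // invr_gt0.
have [U UP] := choice (fun n => approx_primitive_exists ab (e0 n) cg).
have Ulim t : exists l, a <= t <= b -> tends (U ^~ t) l.
  have [tab|N] := pselect (a <= t <= b); last by exists 0.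
  have [||l Ul _] := @geometric_tends _ _ _ (U ^~ t) (2 * (b - a)) _ q01.
  - by rewrite mulr_ge0 ?subr_ge0.
  - move=> n; have aab : a <= a <= b by rewrite lexx.
    have := approx_primitive_dist (ltW (e0 n.+1)) (ltW (e0 n)) (UP n.+1) (UP n) aab tab.
    rewrite (UP n).1 (UP n.+1).1 subrr subr0 => h; apply: le_trans h _.
    case/andP: tab => at_ tb; rewrite ger0_norm ?subr_ge0 //.
    rewrite /e exprS; have := e0 n; rewrite -/(e n) => en.
    have ta : 0 <= t - a by rewrite subr_ge0.
    have tba : t - a <= b - a by rewrite lerD2r.
    have := ler_wpM2l (ltW en) tba; have := mulr_ge0 (ltW en) ta; lra.
  by exists l.
have [u uP] := choice Ulim.
have uU n s t : a <= s <= b -> a <= t <= b ->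
    nrm ((u t - U n t) - (u s - U n s)) <= (e n + e n) * `|t - s|.
  move=> sab tab.
  apply/ler_addgt0Pr => x x0; have x2 : 0 < x / 2 by rewrite divr_gt0.
  have [N1 H1] := uP t tab _ x2; have [N2 H2] := uP s sab _ x2.
  pose m := maxn n (maxn N1 N2).
  have {}H1 := H1 m (leq_trans (leq_maxl _ _) (leq_maxr _ _)).
  have {}H2 := H2 m (leq_trans (leq_maxr _ _) (leq_maxr _ _)).
  have := approx_primitive_dist (ltW (e0 m)) (ltW (e0 n)) (UP m) (UP n) sab tab.
  have -> : u t - U n t - (u s - U n s) =
     (U m t - U n t - (U m s - U n s)) - ((U m t - u t) - (U m s - u s)).
    by vec (scalars R k).
  move=> H3; apply: le_trans (nrmB _ _) _; apply: lerD; last first.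
    by apply: le_trans (nrmB _ _) _; lra.
  apply: le_trans H3 _; rewrite ler_wpM2r // lerD2r.
  by rewrite /e ler_wiXn2l ?leq_maxl //; lra.
exists u.
  apply: (tends_unique (u := U ^~ a)); first by apply: uP; rewrite lexx.
  by move=> x x0; exists 0%N => n _; rewrite (UP n).1 subrr nrm0.
move=> t tab x x0.
have [N HN] := geometric_small 3 q01 x0.
have [d d0 H] := (UP N).2 t tab; exists d => // s sab sd.
have := H s sab sd; have := uU N t s tab sab => H1 H2.
set c : scalars R k := of_real (s - t); rewrite -/c in H2 *.
have -> : u s - u t - c *: g t =
  (u s - U N s - (u t - U N t)) + (U N s - U N t - c *: g t) by vec (scalars R k).
apply: le_trans (nrmD _ _) _; apply: le_trans (lerD H1 H2) _; rewrite -mulrDl.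
by rewrite ler_wpM2r //; have := HN N (leqnn _); rewrite -/(e N); lra.
Qed.

End primitives.

Section ordinary_differential_equations.
Context {R : realType} {k : scalar_kind}.
Context {V : completeNormedModType (scalars R k)}.
Variable Phi : R -> V -> V.
Hypothesis Phi_cont : forall (t : R) w, 0 <= t -> forall e : R, 0 < e ->
  exists2 d : R, 0 < d & forall (s : R) w', 0 <= s -> `|s - t| < d -> nrm (w' - w) < d ->
    nrm (Phi s w' - Phi t w) < e.
Hypothesis Phi_lip : forall (t : R) w, 0 <= t -> exists L d : R, [/\ 0 <= L, 0 < d &
  forall (s : R) w1 w2, 0 <= s -> `|s - t| < d -> nrm (w1 - w) < d ->
    nrm (w2 - w) < d -> nrm (Phi s w1 - Phi s w2) <= L * nrm (w1 - w2)].
Implicit Types u v : R -> V.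

Definition is_sol a b u :=
  forall t : R, a <= t <= b -> deriv_on (seg a b) u t (Phi t (u t)).

Lemma is_sol_cont a b u : is_sol a b u -> cont_on (seg a b) u.
Proof. exact: deriv_cont. Qed.

Lemma is_solS a b a' b' u : a <= a' -> b' <= b -> is_sol a b u -> is_sol a' b' u.
Proof.
move=> aa bb su t /andP[at_ tb]; apply: (@deriv_onS _ _ _ (seg a b)).
  by move=> s /andP[as_ sb]; rewrite /seg/= (le_trans aa as_) (le_trans sb bb).
by apply: su; rewrite (le_trans aa at_) (le_trans tb bb).
Qed.

Lemma oseg_seg (a b : R) : oseg a b `<=` seg a b.
Proof. by move=> t /andP[at_ tb]; rewrite /seg /= !ltW. Qed.

Lemma Phi_cont_on (S : set R) u : S `<=` [set t | 0 <= t] -> cont_on S u ->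
  cont_on S (fun t => Phi t (u t)).
Proof.
move=> S0 cu t St e e0; have [d d0 H] := Phi_cont (u t) (S0 _ St) e0.
have [d' d'0 ud] := cu t St _ d0; exists (Num.min d d'); first by rewrite lt_min d0.
move=> s Ss; rewrite lt_min => /andP[sd sd']; apply: H => //; first exact: S0.
exact: ud.
Qed.

Lemma is_sol_unique a b u v : 0 <= a -> is_sol a b u -> is_sol a b v ->
  u a = v a -> forall t : R, a <= t <= b -> u t = v t.
Proof.
move=> a0 su sv uva; apply: real_induction => t tab IH.
have /andP[at_ tb] := tab.
have cz : cont_on (seg a b) (fun t => u t - v t).
  by apply: cont_onB; exact: is_sol_cont.
have uvt : u t = v t.
  have [->//|ta] := eqVneq t a.
  have {}at_ : a < t by rewrite lt_neqAle eq_sym ta.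
  apply/eqP; rewrite -subr_eq0; apply/eqP/nrm_le0/ler_addgt0Pr => e e0.
  have [d d0 H] := cz t tab _ e0; rewrite add0r.
  pose s := Num.max a (t - d / 2).
  have d2 : 0 < d / 2 by rewrite divr_gt0.
  have st : s < t by rewrite gt_max at_ /= ltrBlDr ltrDl.
  have as_ : a <= s by rewrite le_max lexx.
  have := H s; rewrite (IH s) ?as_ // subrr sub0r nrmN => {}H.
  apply/ltW/H; first by rewrite /seg/= as_ (le_trans (ltW st) tb).
  rewrite ltr0_norm ?subr_lt0 // opprB ltrBlDl -ltrBlDr /s lt_max.
  by apply/orP; right; lra.
split=> //; have t0 : 0 <= t by apply: le_trans a0 at_.
have [L [d [L0 d0 H]]] := Phi_lip (u t) t0.
have [d1 d10 ud] := is_sol_cont su tab d0; have [d2 d20 vd] := is_sol_cont sv tab d0.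
exists (Num.min d (Num.min d1 d2)); first by rewrite !lt_min d0 d10.
move=> s /andP[ts]; rewrite -ltrBlDl !lt_min => /and3P[sd sd1 sd2] sb.
apply/eqP; rewrite -subr_eq0; apply/eqP/nrm_le0.
have sub r : t <= r <= s -> a <= r <= b.
  by move=> /andP[tr rs]; rewrite (le_trans at_ tr) (le_trans rs sb).
rewrite -(mul0r (expR (L * (s - t)))) -(@nrm0 _ _ V) -(subrr (u t)) {2}uvt.
apply: (gronwall (u := fun t => u t - v t)) => //; first exact: ltW.
  by apply: cont_onS cz => r /sub.
move=> r rts; have /andP[tr rs] := rts; have rab : a <= r <= b.
  by apply: sub; exact: oseg_seg.
have rt : `|r - t| < s - t by rewrite gtr0_norm ?subr_gt0 // ltrD2r.
exists (Phi r (u r) - Phi r (v r)).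
  apply: (@deriv_onS _ _ _ (seg a b)); first by move=> x /oseg_seg/sub.
  by apply: deriv_onB; [exact: su | exact: sv].
apply: H; first by apply: le_trans t0 (ltW tr).
- exact: lt_trans rt sd.
- by apply: ud => //; exact: lt_trans rt sd1.
- by rewrite uvt; apply: vd => //; exact: lt_trans rt sd2.
Qed.

Lemma is_sol_glue a c b u v : a <= c -> is_sol a c u -> is_sol c b v ->
  u c = v c -> is_sol a b (fun t => if t <= c then u t else v t).
Proof.
move=> ac su sv uvc; set w := fun _ => _.
have wu t : t <= c -> w t = u t by rewrite /w => ->.
have wv t : c <= t -> w t = v t.
  by rewrite /w le_eqVlt => /predU1P[<-|]; [rewrite lexx | rewrite ltNge => /negbTE->].
move=> t /andP[at_ tb] e e0; have [tc|ct|tc] := ltgtP t c.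
- have tac : a <= t <= c by rewrite at_ ltW.
  have [d d0 H] := su t tac _ e0; exists (Num.min d (c - t)).
    by rewrite lt_min d0 subr_gt0.
  move=> s /andP[as_ sb]; rewrite lt_min => /andP[sd].
  rewrite ltr_norml => /andP[_]; rewrite ltrD2r => sc.
  rewrite !wu ?(ltW sc) ?(ltW tc) //; apply: H => //; rewrite /seg /= as_; exact: ltW.
- have tcb : c <= t <= b by rewrite tb ltW.
  have [d d0 H] := sv t tcb _ e0; exists (Num.min d (t - c)).
    by rewrite lt_min d0 subr_gt0.
  move=> s /andP[as_ sb]; rewrite lt_min => /andP[sd].
  rewrite ltr_norml opprB ltrD2r => /andP[sc _].
  by rewrite !wv ?(ltW sc) ?(ltW ct) //; apply: H => //; rewrite /seg /= sb ltW.
subst c; have [|d d0 H] := su t _ _ e0; first by rewrite at_ lexx.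
have [|d' d'0 H'] := sv t _ _ e0; first by rewrite tb lexx.
exists (Num.min d d'); first by rewrite lt_min d0.
move=> s /andP[as_ sb]; rewrite lt_min => /andP[sd sd']; have [st|/ltW ts] := leP s t.
  by rewrite !wu //; apply: H => //; rewrite /seg /= as_.
by rewrite !wv //; apply: H' => //; rewrite /seg /= sb ts.
Qed.

Lemma picard a w0 : 0 <= a ->
  exists2 tau : R, 0 < tau & exists2 u, u a = w0 & is_sol a (a + tau) u.
Proof.
move=> a0; have [L [d1 [L0 d10 PL]]] := Phi_lip w0 a0.
have [d2 d20 PC] := Phi_cont w0 a0 ltr01.
pose d := Num.min d1 d2; have d0 : 0 < d by rewrite lt_min d10.
pose N := nrm (Phi a w0) + 1; have N0 : 0 < N by rewrite ltr_wpDl // nrm_ge0.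
pose tau := Num.min (d / 2) (Num.min (d / 2 / N) (2^-1 / (L + 1))).
have L10 : 0 < L + 1 by rewrite ltr_wpDl.
have tau0 : 0 < tau by rewrite !lt_min !divr_gt0 ?invr_gt0.
have [tau1 tau2 tau3] : [/\ tau <= d / 2, N * tau <= d / 2 & L * tau <= 2^-1].
  have t1 : tau <= d / 2 by rewrite ge_min lexx.
  have : tau <= d / 2 / N by rewrite !ge_min lexx !orbT.
  have : tau <= 2^-1 / (L + 1) by rewrite !ge_min lexx !orbT.
  rewrite (ler_pdivlMr _ _ N0) (ler_pdivlMr _ _ L10) mulrDr mulr1 => t3 t2.
  by split => //; rewrite mulrC //; lra.
have d12 : d / 2 < d by lra.
have in_d t : a <= t <= a + tau -> `|t - a| < d.
  move=> /andP[at_ tb]; rewrite ger0_norm ?subr_ge0 //; lra.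
have t_ge0 t : a <= t <= a + tau -> 0 <= t by case/andP=> + _; exact: le_trans.
have aat : a <= a + tau by rewrite lerDl ltW.
have aab : a <= a <= a + tau by rewrite lexx.
pose good u := [/\ u a = w0, cont_on (seg a (a + tau)) u &
  forall t : R, a <= t <= a + tau -> nrm (u t - w0) <= d / 2].
have bnd u : good u -> forall t : R, a <= t <= a + tau -> nrm (Phi t (u t)) <= N.
  move=> [_ _ ud] t tab; have := nrm_le_dist (Phi t (u t)) (Phi a w0).
  have : nrm (Phi t (u t) - Phi a w0) < 1.
    apply: PC; first exact: t_ge0.
      by apply: lt_le_trans (in_d _ tab) _; rewrite ge_min lexx orbT.
    by apply: le_lt_trans (ud _ tab) (lt_le_trans d12 _); rewrite ge_min lexx orbT.
  by rewrite /N; lra.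
have lip u v : good u -> good v -> forall t : R, a <= t <= a + tau ->
    nrm (Phi t (u t) - Phi t (v t)) <= L * nrm (u t - v t).
  move=> [_ _ ud] [_ _ vd] t tab; apply: PL; first exact: t_ge0.
  - by apply: lt_le_trans (in_d _ tab) _; rewrite ge_min lexx.
  - by apply: le_lt_trans (ud _ tab) (lt_le_trans d12 _); rewrite ge_min lexx.
  - by apply: le_lt_trans (vd _ tab) (lt_le_trans d12 _); rewrite ge_min lexx.
have step u : exists u', good u -> good u' /\ forall t : R, a <= t <= a + tau ->
    deriv_on (seg a (a + tau)) u' t (Phi t (u t)).
  have [gu|N'] := pselect (good u); last by exists u.
  have [ua uc ud] := gu.
  have [|u' u'a u'd] := primitive_exists (g := fun t => Phi t (u t)) aat.
    by apply: Phi_cont_on => // t /t_ge0.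
  exists (fun t => w0 + u' t) => _; split; last first.
    move=> t tab; rewrite -[Phi _ _]add0r.
    by apply: deriv_onD; [exact: deriv_on_cst | exact: u'd].
  have u'c : cont_on (seg a (a + tau)) u' by exact: deriv_cont u'd.
  split=> [||t tab]; first by rewrite u'a addr0.
    by apply: cont_onD => //; exact: cont_on_cst.
  rewrite addrAC subrr add0r -[u' t]subr0 -u'a.
  case/andP: (tab) => at_ tb.
  have sub r : a <= r <= t -> a <= r <= a + tau.
    by move=> /andP[-> rt]; rewrite (le_trans rt tb).
  apply: le_trans (mean_value_bound (C := N) at_ _ _) _.
  - by apply: cont_onS u'c => r /sub.
  - move=> r /oseg_seg/sub rab; exists (Phi r (u r)); last exact: bnd.
    by apply: deriv_onS (u'd r rab) => x /oseg_seg/sub.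
  - by apply: le_trans tau2; rewrite ler_wpM2l ?(ltW N0) // lerBlDl.
have [F FP] := choice step.
have Fdist u v (C : R) : good u -> good v ->
    (forall t : R, a <= t <= a + tau -> nrm (u t - v t) <= C) ->
    forall t : R, a <= t <= a + tau -> nrm (F u t - F v t) <= C / 2.
  move=> gu gv uvC t tab; case/andP: (tab) => at_ tb.
  have [[Fua Fuc _] Fud] := FP u gu; have [[Fva Fvc _] Fvd] := FP v gv.
  have sub r : a <= r <= t -> a <= r <= a + tau.
    by move=> /andP[-> rt]; rewrite (le_trans rt tb).
  have C0 : 0 <= C by apply: le_trans (nrm_ge0 _) (uvC _ tab).
  rewrite -[F u t - F v t]subr0 -[X in _ - X](subrr w0) -{1}Fua -Fva.
  apply: le_trans (mean_value_bound (u := fun t => F u t - F v t) (C := L * C) at_ _ _) _.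
  - by apply: cont_onB; [apply: cont_onS Fuc | apply: cont_onS Fvc] => r /sub.
  - move=> r /oseg_seg/sub rab; exists (Phi r (u r) - Phi r (v r)).
      apply: (@deriv_onS _ _ _ (seg a (a + tau))) => [x /oseg_seg/sub //|].
      by apply: deriv_onB; [exact: Fud | exact: Fvd].
    by apply: le_trans (lip _ _ gu gv _ rab) _; rewrite ler_wpM2l // uvC.
  - have ta : t - a <= tau by rewrite lerBlDl.
    rewrite mulrAC mulrC; apply: ler_wpM2l => //.
    by apply: le_trans tau3; rewrite ler_wpM2l.
pose u n := iter n F (fun=> w0).
have gu n : good (u n).
  elim: n => [|n IH]; last by rewrite /u iterS; exact: (FP _ IH).1.
  split=> // [|t _]; first exact: cont_on_cst.
  by rewrite subrr nrm0 divr_ge0 // ltW.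
have ud n t : a <= t <= a + tau -> nrm (u n.+1 t - u n t) <= d * 2^-1 ^+ n.
  elim: n t => [|n IH] t tab.
    rewrite expr0 mulr1; apply: le_trans _ (ltW d12).
    by have [_ _] := gu 1%N; exact.
  rewrite exprSr mulrA; apply: (Fdist (u n.+1) (u n)) => //.
have q01 : 0 <= (2^-1 : R) < 1 by apply/andP; split; lra.
have ulim t : exists l, a <= t <= a + tau ->
    forall n, nrm (l - u n t) <= d / (1 - 2^-1) * 2^-1 ^+ n.
  have [tab|N'] := pselect (a <= t <= a + tau); last by exists 0.
  have [l _ Hl] := geometric_tends q01 (ltW d0) (fun n => ud n t tab).
  by exists l.
have [l lP] := choice ulim.
have small e : 0 < e -> exists n, d / (1 - 2^-1) * 2^-1 ^+ n < e.
  by move=> e0; have [n Hn] := geometric_small (d / (1 - 2^-1)) q01 e0; exists n; exact: Hn.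
have gl : good l.
  split.
  - apply/eqP; rewrite -subr_eq0; apply/eqP/nrm_le0/ler_addgt0Pr => e e0.
    have [n Hn] := small e e0; have := lP a aab n.
    by have [-> _ _] := gu n => h; rewrite add0r (le_trans h) // ltW.
  - move=> t tab e e0; have e4 : 0 < e / 4 by rewrite divr_gt0.
    have e2 : 0 < e / 2 by rewrite divr_gt0.
    have [n Hn] := small _ e4; have [_ uc _] := gu n.
    have [d' d'0 H] := uc t tab _ e2; exists d' => // s sab sd.
    have := lP t tab n; have := lP s sab n; have := H s sab sd.
    have := nrm_trans (u n s) (l s) (l t); have := nrm_trans (u n t) (u n s) (l t).
    by rewrite (nrmC (l t) (u n t)); lra.
  - move=> t tab; apply/ler_addgt0Pr => e e0.
    have [n Hn] := small e e0; have := lP t tab n.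
    have [_ _ /(_ t tab)] := gu n.
    by have := nrm_trans (u n t) (l t) w0; lra.
have [[Fla _ _] Fld] := FP l gl.
exists tau => //; exists (F l) => //.
have Fl t : a <= t <= a + tau -> F l t = l t.
  move=> tab; apply/eqP; rewrite -subr_eq0; apply/eqP/nrm_le0/ler_addgt0Pr => e e0.
  have e2 : 0 < e / 2 by rewrite divr_gt0.
  have [n Hn] := small _ e2; rewrite add0r.
  have := Fdist _ _ _ gl (gu n) (fun t tab => lP t tab n) t tab.
  have := lP t tab n.+1; rewrite exprSr mulrA [u n.+1]iterS -/(u n).
  by have := nrm_trans (F (u n) t) (F l t) (l t); rewrite (nrmC (F (u n) t)); lra.
by move=> t tab; rewrite Fl //; exact: Fld.
Qed.

Lemma is_sol_extend a b C u : 0 <= a < b ->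
  (forall s : R, a <= s < b -> is_sol a s u) ->
  (forall s : R, a <= s < b -> nrm (Phi s (u s)) <= C) ->
  exists2 u', forall s : R, a <= s < b -> u' s = u s & is_sol a b u'.
Proof.
move=> /andP[a0 ab] su uC.
have C0 : 0 <= C by apply: le_trans (nrm_ge0 _) (uC a _); rewrite lexx.
have uL s t : a <= s -> s <= t -> t < b -> nrm (u t - u s) <= C * (t - s).
  move=> as_ st tb; have tab : a <= t < b by rewrite tb (le_trans as_ st).
  have sub r : s <= r <= t -> a <= r <= t by case/andP=> sr ->; rewrite (le_trans as_ sr).
  apply: (mean_value_bound st) => [|r /oseg_seg/sub rat].
    by apply: cont_onS (is_sol_cont (su t tab)) => r /sub.
  exists (Phi r (u r)); last first.
    by apply: uC; case/andP: rat => -> rt; rewrite (le_lt_trans rt).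
  by apply: deriv_onS (su t tab r rat) => x /oseg_seg/sub.
pose t n : R := b - (b - a) * 2^-1 ^+ n.
have ba : 0 < b - a by rewrite subr_gt0.
have p0 n : 0 < (2^-1 : R) ^+ n by rewrite exprn_gt0 // invr_gt0.
have tb n : t n < b by rewrite ltrBlDr ltrDl mulr_gt0.
have ta n : a <= t n.
  rewrite lerBrDr -lerBrDl -[leRHS]mulr1 ler_wpM2l ?(ltW ba) //.
  by rewrite exprn_ile1 //; lra.
have q01 : 0 <= (2^-1 : R) < 1 by apply/andP; split; lra.
have tS n : t n <= t n.+1 /\ t n.+1 - t n = (b - a) * 2^-1 * 2^-1 ^+ n.
  have -> : t n.+1 - t n = (b - a) * 2^-1 * 2^-1 ^+ n.
    by rewrite /t exprS; lra.
  by split=> //; rewrite /t exprS; have := mulr_gt0 ba (p0 n); lra.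
have [||l ul _] := @geometric_tends _ _ _ (fun n => u (t n)) (C * ((b - a) * 2^-1)) _ q01.
- by rewrite !mulr_ge0 ?invr_ge0 // ltW.
- move=> n; have [tt tE] := tS n.
  by have := uL _ _ (ta n) tt (tb _); rewrite tE mulrA.
have ublim s : a <= s -> s < b -> nrm (l - u s) <= C * (b - s).
  move=> as_ sb; have sb0 : 0 < b - s by rewrite subr_gt0.
  have [N HN] := geometric_small (b - a) q01 sb0.
  apply: (tends_le (N := N) ul) => n Nn; have := HN n Nn => h.
  apply: le_trans (uL _ _ as_ _ (tb n)) _; first by rewrite /t; lra.
  by rewrite ler_wpM2l // lerD2r ltW.
pose u' s := if s < b then u s else l.
have u'u s : s < b -> u' s = u s by rewrite /u' => ->.
have u'b : u' b = l by rewrite /u' ltxx.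
exists u' => [s /andP[_]|]; first exact: u'u.
have u'c : cont_on (seg a b) u'.
  move=> x /andP[ax xb] e e0; have [->|/eqP xnb] := eqVneq x b.
    exists (e / (C + 1)); first by rewrite divr_gt0 // ltr_wpDl.
    move=> s /andP[as_]; rewrite le_eqVlt => /predU1P[->|sb] sd.
      by rewrite subrr nrm0.
    rewrite u'u // u'b nrmC; apply: le_lt_trans (ublim _ as_ sb) _.
    move: sd; rewrite ltr0_norm ?subr_lt0 // opprB ltr_pdivlMr ?ltr_wpDl //.
    apply: le_lt_trans; rewrite mulrC ler_wpM2l ?lerDl //.
    by rewrite subr_ge0 ltW.
  have {}xb : x < b by rewrite lt_neqAle xb andbT; exact/eqP.
  pose y := (x + b) / 2; have [xy yb] : x < y /\ y < b by rewrite /y; split; lra.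
  have xay : a <= x <= y by rewrite ax ltW.
  have [|d d0 H] := is_sol_cont (su y _) xay e0.
    by rewrite yb (le_trans ax (ltW xy)).
  exists (Num.min d (y - x)); first by rewrite lt_min d0 subr_gt0.
  move=> s /andP[as_ _]; rewrite lt_min => /andP[sd].
  rewrite ltr_norml => /andP[_]; rewrite ltrD2r => sy.
  rewrite !u'u ?(lt_trans sy) //; apply: H => //.
  by rewrite /seg /= as_ ltW.
move=> x /andP[ax xb]; have [xE|/eqP xnb] := eqVneq x b; last first.
  have {}xb : x < b by rewrite lt_neqAle xb andbT; exact/eqP.
  pose y := (x + b) / 2; have [xy yb] : x < y /\ y < b by rewrite /y; split; lra.
  have xay : a <= x <= y by rewrite ax ltW.
  have yab : a <= y < b by rewrite yb (le_trans ax (ltW xy)).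
  have yx0 : 0 < y - x by rewrite subr_gt0.
  rewrite u'u //; apply: (deriv_on_near (S := seg a y) yx0).
    move=> s /andP[as_ sb]; rewrite ltr_norml => /andP[_]; rewrite ltrD2r => /ltW.
    by rewrite /seg /= as_.
  apply: (deriv_on_eq (u := u)) (su y yab x xay) => [s /andP[_ sy]|].
    by rewrite u'u // (le_lt_trans sy).
  by rewrite u'u.
rewrite xE => e e0; rewrite u'b.
have bab : a <= b <= b by rewrite lexx (ltW ab).
have [|d d0 H] := Phi_cont_on _ u'c bab e0.
  by move=> s /andP[as_ _]; exact: le_trans a0 as_.
exists d => // s /andP[as_ sb] sd.
have sub r : s <= r <= b -> a <= r <= b by case/andP=> sr ->; rewrite (le_trans as_ sr).
rewrite -nrmN.
have -> : - (u' s - l - of_real (s - b) *: Phi b l) =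
   u' b - u' s - of_real (b - s) *: Phi b l.
  by rewrite u'b !rmorphB; vec (scalars R k).
rewrite distrC [`|b - s|]ger0_norm ?subr_ge0 //.
apply: (mean_value_cst sb); first by apply: cont_onS u'c => r /sub.
move=> r rsb; have /andP[sr rb] := rsb; have rab : a <= r <= b.
  by apply/sub/oseg_seg.
pose y := (r + b) / 2; have [ry yb] : r < y /\ y < b by rewrite /y; split; lra.
exists (Phi r (u' r)); last first.
  rewrite -u'b; apply/ltW/H => //.
  apply: le_lt_trans sd; rewrite distrC [leRHS]distrC !ger0_norm ?subr_ge0 ?(ltW rb) //.
  by rewrite lerD2l lerN2 ltW.
have yr0 : 0 < y - r by rewrite subr_gt0.
have ray : a <= r <= y by case/andP: rab => -> _; rewrite ltW.
have yab : a <= y < b by rewrite yb andbT; case/andP: ray; exact: le_trans.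
rewrite u'u //; apply: (deriv_on_near (S := seg a y) yr0).
  move=> z /andP[sz zb]; rewrite ltr_norml => /andP[_]; rewrite ltrD2r => /ltW.
  by rewrite /seg /= (le_trans as_ (ltW sz)).
apply: (deriv_on_eq (u := u)) (su y yab r ray) => [z /andP[_ zy]|].
  by rewrite u'u // (le_lt_trans zy).
by rewrite u'u.
Qed.

Lemma global_solution a w0 : 0 <= a ->
  (forall b : R, a <= b -> exists C, forall T u, a <= T <= b -> u a = w0 ->
    is_sol a T u -> forall t : R, a <= t <= T -> nrm (Phi t (u t)) <= C) ->
  exists2 u, u a = w0 & forall b : R, a <= b -> is_sol a b u.
Proof.
move=> a0 bound.
have glue b : (forall s : R, a <= s < b -> exists2 u, u a = w0 & is_sol a s u) ->
    exists2 u, u a = w0 & forall s : R, a <= s < b -> is_sol a s u.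
  move=> ex; have ex' s : exists u, a <= s < b -> u a = w0 /\ is_sol a s u.
    have [/ex[u ua us]|N] := pselect (a <= s < b); first by exists u.
    by exists (fun=> 0).
  have [U UP] := choice ex'; pose m s : R := (s + b) / 2.
  pose u s := if a <= s then U (m s) s else w0.
  have uU s t : a <= s -> s <= t -> t < b -> u s = U t s.
    move=> as_ st tb; have sb := le_lt_trans st tb.
    have [ms1 ms2] : s < m s /\ m s < b by rewrite /m; split; lra.
    have mab : a <= m s < b by rewrite ms2 (le_trans as_ (ltW ms1)).
    have tab : a <= t < b by rewrite tb (le_trans as_ st).
    have [ma msol] := UP _ mab; have [ta tsol] := UP _ tab; rewrite /u as_.
    apply: (is_sol_unique (a := a) (b := s)); rewrite ?ma ?ta ?as_ ?lexx //.
      by apply: is_solS msol => //; exact: ltW.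
    exact: is_solS tsol.
  have [ab|ba] := ltP a b; last first.
    exists (fun=> w0) => // s /andP[as_ sb]; exfalso.
    by have := lt_le_trans sb ba; rewrite ltNge as_.
  exists u; first by rewrite (uU a a) // (UP a _).1 // lexx ab.
  move=> s /andP[as_ sb] t tas; have /andP[at_ ts] := tas.
  rewrite (uU t s) //; have [|_ ssol] := UP s; first by rewrite as_.
  apply: (deriv_on_eq (u := U s)) (ssol t tas) => [x /andP[ax xs]|].
    by rewrite (uU x s).
  by rewrite (uU t s).
have exb b : a <= b -> exists2 u, u a = w0 & is_sol a b u.
  move=> ab; suff: forall s : R, a <= s <= b -> exists2 u, u a = w0 & is_sol a s u.
    by apply; rewrite lexx ab.
  apply: real_induction => t /andP[at_ tb] IH.
  have [u ua tsol] : exists2 u, u a = w0 & is_sol a t u.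
    have [->|/eqP ta] := eqVneq t a.
      have [tau tau0 [u ua usol]] := picard w0 a0; exists u => //.
      by apply: is_solS usol => //; rewrite lerDl ltW.
    have {}at_ : a < t by rewrite lt_neqAle at_ andbT; apply/eqP/nesym.
    have [u ua usol] := glue t IH; have [C HC] := bound b ab.
    have [||u' u'u u'sol] := @is_sol_extend a t C u _ usol.
    - by rewrite a0.
    - move=> s sat; have /andP[as_ st] := sat; apply: (HC s u) => //.
      + by rewrite as_ (le_trans (ltW st)).
      + exact: usol.
      + by rewrite as_ lexx.
    by exists u' => //; rewrite u'u ?lexx.
  split; first by exists u.
  have [tau tau0 [v va vsol]] := picard (u t) (le_trans a0 at_).
  exists tau => // s /andP[ts st] sb; exists (fun x => if x <= t then u x else v x).
    by rewrite at_.
  apply: is_sol_glue => //; apply: is_solS vsol => //; exact: ltW.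
have exs s : exists u, a <= s -> u a = w0 /\ is_sol a s u.
  have [/exb[u ua us]|N] := pselect (a <= s); first by exists u.
  by exists (fun=> 0).
have [U UP] := choice exs.
pose u s := if a <= s then U s s else w0.
have uU s t : a <= s -> s <= t -> u s = U t s.
  move=> as_ st; have [sa ssol] := UP _ as_; have [ta tsol] := UP _ (le_trans as_ st).
  rewrite /u as_; apply: (is_sol_unique (a := a) (b := s)); rewrite ?sa ?ta ?as_ ?lexx //.
  exact: is_solS tsol.
exists u; first by rewrite (uU a a) // (UP a _).1.
move=> b ab t tab; have /andP[at_ tb] := tab; have [_ bsol] := UP b ab.
rewrite (uU t b) //; apply: (deriv_on_eq (u := U b)) (bsol t tab) => [s /andP[as_ sb]|].
  by rewrite (uU s b).
by rewrite (uU t b).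
Qed.

End ordinary_differential_equations.

(** * The Lyapunov bound *)

Section osgood.
Context {R : realType}.
Local Notation mu := (@lebesgue_measure R).

Lemma continuous_primitive (g : R -> R) (a : R) : continuous g ->
  exists2 F : R -> R,
    (forall x : R, a < x -> forall e : R, 0 < e -> exists2 d : R, 0 < d &
       forall y, `|y - x| < d -> `|F y - F x - (y - x) * g x| <= e * `|y - x|) &
    forall x y : R, a < x -> x <= y ->
      (\int[mu]_(t in `[x, y]) (g t)%:E = (F y - F x)%:E)%E.
Proof.
move=> cg; pose F x := (\int[mu]_(t in `[a, x]) g t)%R.
have dF x : a < x -> derivable F x 1 /\ (F^`())%classic x = g x.
  move=> ax; have xx : x < x + 1 by rewrite ltrDl.
  apply: (continuous_FTC1_closed xx) => //; last exact: cg.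
  apply: continuous_compact_integrable; first exact: segment_compact.
  exact: continuous_subspaceT.
exists F => [x ax e e0|x y ax].
  have [dFx F'x] := dF x ax.
  have : h^-1 *: (F (h *: 1 + x) - F x) @[h --> 0^'] --> g x.
    by rewrite -F'x derive1E; exact: dFx.
  move=> /cvgrPdist_le /(_ e e0) /nbhs_ballP[d /= d0 H]; exists d => // y yx.
  have [->|xy] := eqVneq y x; first by rewrite !subrr mul0r subrr normr0 mulr0.
  have y0 : y - x != 0 by rewrite subr_eq0.
  have := H (y - x); rewrite /ball /= sub0r normrN => /(_ yx y0).
  rewrite [_%:A]mulr1 subrK => h.
  have -> : F y - F x - (y - x) * g x =
      - ((y - x) * (g x - (y - x)^-1 * (F y - F x))).
    by rewrite mulrBr mulrA divff // mul1r opprB.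
  by rewrite normrN normrM mulrC ler_wpM2r.
rewrite le_eqVlt => /predU1P[<-|xy].
  by rewrite subrr set_itv1 integral_set1.
apply: continuous_FTC2 => //.
- exact: continuous_subspaceT.
- have cF z : a < z -> {for z, continuous F}.
    by move=> az; apply/differentiable_continuous/derivable1_diffP/(dF z az).1.
  split=> [z|//|//].
  + by rewrite in_itv /= => /andP[xz _]; have [] := dF z (lt_trans ax xz).
  + by apply: cvg_at_right_filter; exact: cF.
  + by apply: cvg_at_left_filter; apply: cF; exact: lt_trans xy.
- move=> z; rewrite in_itv /= => /andP[xz _]; have [] := dF z (lt_trans ax xz); by [].
Qed.

Variable U : R -> R.
Hypothesis U_cont : continuous U.
Hypothesis U_ge0 : forall u, 0 <= U u.

Lemma continuous_invD (c : R) : 0 < c -> continuous (fun u => (U u + c)^-1).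
Proof.
move=> c0 u; apply: cvgV; first by rewrite gt_eqF // ltr_wpDl.
by apply: cvgD; [exact: U_cont | exact: cvg_cst].
Qed.

Lemma osgood_unbounded (u0 M : R) :
  (\int[mu]_(u in `[u0, +oo[) ((U u)%:E)^-1 = +oo)%E ->
  exists n : nat, (M%:E < \int[mu]_(u in `[u0, (u0 + n%:R)%R]) ((U u + n.+1%:R^-1)^-1)%R%:E)%E.
Proof.
move=> Uoo; apply: contrapT => N.
pose f n (u : measurableTypeR R) := (((U u + n.+1%:R^-1)^-1)%:E : \bar R).
pose I n := [set` `[u0, u0 + n%:R]] : set (measurableTypeR R).
have c0 n : (0 : R) < n.+1%:R^-1 by rewrite invr_gt0.
have f0 n u : (0 <= f n u)%E by rewrite lee_fin invr_ge0 addr_ge0 // ltW.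
have fI n : (\int[mu]_(u in `[u0, +oo[) (f n \_ (I n)) u <= M%:E)%E.
  rewrite -integral_mkcondr leNgt; apply/negP => H; apply: N; exists n.
  congr (_ < _)%E : H; congr (integral _ _ _).
  by apply/seteqP; split=> u /=; rewrite !in_itv /= ?andbT; [case | move=> h; split=> //; case/andP: h].
have : (\int[mu]_(u in `[u0, +oo[) (f n \_ (I n)) u)%E @[n --> \oo] -->
    (\int[mu]_(u in `[u0, +oo[) limn (fun n => (f n \_ (I n)) u))%E.
  apply: cvg_monotone_convergence => //.
  - move=> n; apply: (@measurable_funS _ _ _ _ setT) => //.
    have mI : measurable (I n : set (measurableTypeR R)) by exact: measurable_itv.
    have mf : measurable_fun setT (f n).
      by apply/measurable_EFinP; apply: continuous_measurable_fun; exact: continuous_invD.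
    have mfI : measurable_fun (I n) (f n) by exact: measurable_funTS.
    by move/(measurable_restrictT (f n) mI) : mfI; exact.
  - by move=> n u _; apply: erestrict_ge0.
  - move=> u uD m n mn; rewrite /patch; case: ifPn => [/set_mem|]; last first.
      by case: ifPn.
    rewrite /I /= in_itv /= => /andP[u0u um]; rewrite ifT; last first.
      by apply/mem_set; rewrite /= in_itv /= u0u (le_trans um) // lerD2l ler_nat.
    rewrite lee_fin lef_pV2 ?posrE ?ltr_wpDl // lerD2l lef_pV2 ?posrE //.
    by rewrite ler_nat ltnS.
have -> : (\int[mu]_(u in `[u0, +oo[) limn (fun n => (f n \_ (I n)) u) = +oo)%E.
  rewrite -Uoo; apply: eq_integral => u; rewrite inE /= in_itv /= andbT => u0u.
  apply: cvg_lim => //.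
  have fE : \forall n \near \oo, (f n \_ (I n)) u = f n u.
    have [m um] : exists m : nat, u - u0 <= m%:R.
      by exists (Num.bound (u - u0)); apply/ltW/archi_boundP; rewrite subr_ge0.
    exists m => // n /= mn; rewrite /patch ifT //; apply/mem_set.
    rewrite /I /= in_itv /= u0u -lerBlDl (le_trans um) // ler_nat //.
  suff: f ^~ u @ \oo --> (((U u)%:E)^-1)%E.
    by apply: cvg_trans; apply: near_eq_cvg; apply: filterS fE => n /= ->.
  rewrite inver; case: eqVneq => [Uu|Uu].
    apply/cvgeyPge => A; exists (Num.bound `|A|) => // n /= An.
    rewrite /f lee_fin Uu add0r invrK; apply: le_trans (ler_norm _) _.
    apply: le_trans (ltW (archi_boundP (normr_ge0 _))) _.
    by rewrite ler_nat (leq_trans An).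
  apply: cvg_EFin; first by near=> n.
  apply: cvgV => //; rewrite -[X in _ --> X]addr0.
  apply: cvgD; first exact: cvg_cst.
  exact: cvg_harmonic.
move=> /cvgeyPge /(_ (M + 1))[n _ /(_ n (leqnn _))] /= H.
by have := le_trans H (fI n); rewrite lee_fin gerDl ler10.
Unshelve. all: by end_near. Qed.

End osgood.
Section lyapunov.
Context {R : realType} {k : scalar_kind} {V : normedModType (scalars R k)}.
Local Notation mu := (@lebesgue_measure R).

Definition clamp (a b t : R) : R := Num.max a (Num.min t b).

Lemma clamp_in (a b t : R) : a <= b -> a <= clamp a b t <= b.
Proof. by move=> ab; rewrite /clamp le_max lexx ge_max ab ge_min lexx orbT. Qed.

Lemma clamp_id (a b t : R) : a <= t <= b -> clamp a b t = t.
Proof. by move=> /andP[at_ tb]; rewrite /clamp min_l // max_r. Qed.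

Lemma clamp_dist (a b s t : R) : `|clamp a b s - clamp a b t| <= `|s - t|.
Proof.
wlog st : s t / s <= t => [H|].
  by case/orP: (le_total s t) => [/H//|/H]; rewrite distrC [leRHS]distrC.
have m1 : Num.min s b <= Num.min t b by rewrite le_min !ge_min st lexx orbT.
have m2 : Num.min t b - Num.min s b <= t - s.
  by have [sb|sb] := leP s b; have [tb|tb] := leP t b; lra.
have m3 : clamp a b s <= clamp a b t by rewrite /clamp ge_max !le_max lexx m1 orbT.
have m4 : clamp a b t - clamp a b s <= t - s.
  apply: le_trans m2; rewrite /clamp; move: m1.
  move: (Num.min t b) (Num.min s b) => p q pq.
  by have [ap|ap] := leP a p; have [aq|aq] := leP a q; lra.
by rewrite distrC [leRHS]distrC !ger0_norm ?subr_ge0.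
Qed.

Definition rcont_on (S : set R) (h : R -> R) := forall t : R, S t ->
  forall e : R, 0 < e -> exists2 d : R, 0 < d &
    forall s, S s -> `|s - t| < d -> `|h s - h t| < e.

Lemma clamp_continuous (a b : R) (h : R -> R) : a <= b ->
  rcont_on (seg a b) h -> continuous (fun t => h (clamp a b t)).
Proof.
move=> ab ch t; apply/cvgrPdist_lt => e e0.
have [d d0 H] := ch _ (clamp_in t ab) _ e0.
apply/nbhs_ballP; exists d => //= s; rewrite /ball /= => st.
rewrite distrC; apply: H; first exact: clamp_in.
by apply: le_lt_trans (clamp_dist _ _ _ _) _; rewrite distrC.
Qed.

Lemma cont_on_nrm (S : set R) (u : R -> V) : cont_on S u ->
  rcont_on S (fun t => nrm (u t)).
Proof.
move=> cu t St e e0; have [d d0 H] := cu t St _ e0; exists d => // s Ss sd.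
apply: le_lt_trans (H s Ss sd).
have := nrm_le_dist (u s) (u t); have := nrm_le_dist (u t) (u s).
by rewrite (nrmC (u t) (u s)) ler_norml => ? ?; apply/andP; split; lra.
Qed.

Variables (W : set V) (r L : R) (Vf : V -> R) (U psi : R -> R).
Hypothesis L_ge0 : 0 <= L.
Hypothesis Vf_ge0 : forall w, W w -> 0 <= Vf w.
Hypothesis U_cont : {within `[0, +oo[, continuous U}.
Hypothesis U_ge0 : forall u : R, 0 <= u -> 0 <= U u.
Hypothesis psi_ge0 : forall t : R, 0 <= t -> 0 <= psi t.
Hypothesis psi_int : forall a b : R, 0 <= a <= b ->
  mu.-integrable `[a, b] (EFin \o psi).
Hypothesis U_int : forall u0 : R, 0 < u0 ->
  (\int[mu]_(u in `[u0, +oo[) ((U u)%:E)^-1 = +oo)%E.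
Hypothesis Vf_coercive : forall C : R, exists rho : R,
  forall w, W w -> rho <= nrm w -> C <= Vf w.
Hypothesis Vf_lip : forall w w', W w -> W w' -> r <= nrm w -> r <= nrm w' ->
  `|Vf w - Vf w'| <= L * nrm (w - w').

Let U0 (u : R) := U (Num.max 0 u).

Let U0_ge0 u : 0 <= U0 u. Proof. by apply: U_ge0; rewrite le_max lexx. Qed.

Let U0_cont : continuous U0.
Proof.
move=> u; apply/cvgrPdist_lt => e e0.
have max0 x : `[0, +oo[%classic (Num.max 0 x : R).
  by rewrite /= in_itv /= andbT le_max lexx.
have := continuous_within_itvcyP 0 U.
move=> [/(_ U_cont)[cU c0] _].
have [u0|u0|u0] := ltgtP u 0.
- apply/nbhs_ballP; exists (- u); first by rewrite /= oppr_gt0.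
  move=> s; rewrite /ball /= /U0 => us; rewrite max_l ?(ltW u0) //.
  rewrite max_l ?subrr ?normr0 //.
  by move: us; rewrite ltr_norml => /andP[us _]; lra.
- have := cU u; rewrite in_itv /= andbT => /(_ u0)/cvgrPdist_lt/(_ e e0).
  move=> /nbhs_ballP[d d0 H]; apply/nbhs_ballP; exists (Num.min d u).
    by rewrite /= lt_min d0.
  move=> s; rewrite /ball /= lt_min => /andP[sd su]; rewrite /U0.
  rewrite max_r ?(ltW u0) // max_r; first exact: H.
  by move: su; rewrite ltr_norml => /andP[_ su]; lra.
- move: c0 => /cvgrPdist_lt/(_ e e0) /nbhs_ballP[d d0 H].
  apply/nbhs_ballP; exists d => // s; rewrite /ball /= u0 => sd.
  rewrite /U0 maxxx; have [s0|s0] := leP s 0; first by rewrite subrr normr0.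
  by apply: H => //; rewrite /ball /=.
Qed.

(* [F] is a primitive of [1 / (U + c)], evaluated along the curve [w]; the
   derivative of [F (Vf (w t))] is at most [L * psi t]. *)
Lemma lyapunov_segment (F : R -> R) (c b t1 t2 : R) (w w' : R -> V) :
  0 < c -> 0 <= t1 -> t1 <= t2 -> t2 <= b ->
  (forall x : R, -1 < x -> forall e : R, 0 < e -> exists2 d : R, 0 < d &
    forall y, `|y - x| < d ->
      `|F y - F x - (y - x) * (U0 x + c)^-1| <= e * `|y - x|) ->
  (forall t : R, t1 <= t <= t2 -> deriv_on (seg t1 t2) w t (w' t)) ->
  cont_on (seg t1 t2) w' ->
  (forall t : R, t1 <= t <= t2 ->
     [/\ W (w t), r <= nrm (w t) & nrm (w' t) <= U (Vf (w t)) * psi t]) ->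
  F (Vf (w t2)) - F (Vf (w t1)) <= L * fine (\int[mu]_(t in `[0%R, b]) (psi t)%:E)%E.
Proof.
move=> c0 t10 t12 t2b dF dw cw' wP.
have v_lip s t : t1 <= s <= t2 -> t1 <= t <= t2 ->
    `|Vf (w s) - Vf (w t)| <= L * nrm (w s - w t).
  by move=> /wP[Ws rs _] /wP[Wt rt _]; exact: Vf_lip.
have cw := deriv_cont dw.
have cv : rcont_on (seg t1 t2) (fun t => Vf (w t)).
  move=> t tt e e0; have e1 : 0 < e / (L + 1) by rewrite divr_gt0 // ltr_wpDl.
  have [d d0 H] := cw t tt _ e1; exists d => // s ss sd.
  apply: le_lt_trans (v_lip _ _ ss tt) _.
  have := H s ss sd; rewrite ltr_pdivlMr ?ltr_wpDl //; apply: le_lt_trans.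
  by rewrite mulrC ler_wpM2l ?nrm_ge0 // lerDl.
pose g (u : R) := (U0 u + c)^-1.
have cg : continuous g by exact: (continuous_invD U0_cont U0_ge0 c0).
have g0 u : 0 < g u by rewrite invr_gt0 ltr_wpDl.
pose h (t : R) := L * nrm (w' (clamp t1 t2 t)) * g (Vf (w (clamp t1 t2 t))).
have ch : continuous h.
  have cn := clamp_continuous t12 (cont_on_nrm cw').
  have cvc := clamp_continuous t12 cv.
  move=> t; apply: cvgM; first by apply: cvgM; [exact: cvg_cst | exact: cn].
  exact: (cvg_comp _ _ (cvc t) (cg _)).
have [H dH HI] := continuous_primitive (t1 - 1) ch.
have sub1 t : t1 <= t -> t1 - 1 < t by move=> ?; lra.
have HP : H t2 - H t1 <= L * fine (\int[mu]_(t in `[0%R, b]) (psi t)%:E)%E.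
  have b0 : 0 <= b by rewrite (le_trans t10) // (le_trans t12).
  have psib : mu.-integrable `[0, b] (EFin \o psi) by apply: psi_int; rewrite lexx.
  have psit : mu.-integrable `[t1, t2] (EFin \o psi) by apply: psi_int; rewrite t10.
  rewrite -lee_fin -HI ?sub1 // EFinM fineK; last first.
    by apply: integrable_fin_num => //; exact: measurable_itv.
  rewrite -integralZl //.
  apply: (@le_trans _ _ (\int[mu]_(t in `[t1, t2]) (L%:E * (psi t)%:E)))%E.
    apply: ge0_le_integral => //.
    - move=> t _; rewrite lee_fin !mulr_ge0 ?nrm_ge0 // ltW //.
    - apply/measurable_EFinP; apply: measurable_funTS.
      exact: continuous_measurable_fun.
    - have := measurable_int mu psit => mp.
      exact: measurable_funeM.
    move=> t; rewrite /= in_itv /= => tt; rewrite lee_fin /h clamp_id // -mulrA.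
    have [Wt rt w't] := wP t tt; rewrite ler_wpM2l // ler_pdivrMr; last by rewrite ltr_wpDl.
    apply: le_trans w't _; rewrite /U0 max_r ?Vf_ge0 // mulrC mulrDr lerDl.
    rewrite mulr_ge0 ?(ltW c0) // psi_ge0 //.
    by case/andP: tt => t1t _; exact: le_trans t1t.
  apply: ge0_subset_integral => //.
  - have := measurable_int mu psib => mp.
    exact: measurable_funeM.
  - move=> t; rewrite /= in_itv /= => /andP[t0 _].
    by rewrite lee_fin mulr_ge0 ?psi_ge0.
  - by apply: subset_itv; rewrite bnd_simp.
apply: le_trans _ HP.
suff : F (Vf (w t2)) - H t2 <= F (Vf (w t1)) - H t1 by lra.
have v1 t : t1 <= t <= t2 -> -1 < Vf (w t).
  by move=> /wP[/Vf_ge0 ? _ _]; lra.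
apply: (dini_le (r := fun t => F (Vf (w t)) - H t)) => // t tt e e0.
  have e2 : 0 < e / 2 by rewrite divr_gt0.
  have [d1 d10 H1] := dF _ (v1 t tt) 1 ltr01.
  have /andP[t1t _] := tt.
  have [d2 d20 H2] := dH _ (sub1 t t1t) 1 ltr01.
  have gv0 := g0 (Vf (w t)); have ht0 := normr_ge0 (h t).
  pose C1 := (Vf (w t) + c)^-1; pose B := 2 + g (Vf (w t)) + `|h t|.
  have B0 : 0 < B by rewrite /B; lra.
  have e3 : 0 < Num.min d1 (e / 2 / B) by rewrite lt_min d10 divr_gt0.
  have [d3 d30 H3] := cv t tt _ e3.
  exists (Num.min (Num.min d2 d3) (e / 2 / B)).
    by rewrite !lt_min d20 d30 divr_gt0.
  move=> s ss; rewrite !lt_min => /andP[/andP[sd2 sd3] se].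
  have := H3 s ss sd3; rewrite lt_min => /andP[vd ve].
  have := H1 _ vd; have := H2 _ sd2; rewrite !mul1r.
  move: se ve; rewrite !ltr_pdivlMr // => se ve.
  set x := Vf (w s) - Vf (w t) in ve *; set y := s - t in se *.
  have := normr_ge0 x; have := normr_ge0 y => y0 x0.
  move=> h2 h1.
  have h3 : `|F (Vf (w s)) - F (Vf (w t))| <= `|x| * (1 + g (Vf (w t))).
    have := ler_normD (F (Vf (w s)) - F (Vf (w t)) - x * g (Vf (w t))) (x * g (Vf (w t))).
    by rewrite subrK normrM (gtr0_norm gv0) mulrDr mulr1; move: h1; rewrite -/(g _); lra.
  have h4 : `|H s - H t| <= `|y| * (1 + `|h t|).
    have := ler_normD (H s - H t - y * h t) (y * h t).
    by rewrite subrK normrM mulrDr mulr1; move: h2; lra.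
  have -> : F (Vf (w s)) - H s - (F (Vf (w t)) - H t) =
     (F (Vf (w s)) - F (Vf (w t))) - (H s - H t) by ring.
  apply: le_lt_trans (ler_normB _ _) _; apply: le_lt_trans (lerD h3 h4) _.
  have := ler_wpM2l x0 (_ : 1 + g (Vf (w t)) <= B).
  have := ler_wpM2l y0 (_ : 1 + `|h t| <= B).
  by rewrite /B => /(_ _) h5 /(_ _) h6; rewrite /B in se ve; nra.
have tt' : t1 <= t <= t2 by case/andP: tt => *; rewrite !ltW.
have /andP[t1t tt2] := tt.
have t1t' := ltW t1t.
pose n := nrm (w' t); have n0 : 0 <= n by exact: nrm_ge0.
pose gt := g (Vf (w t)); have gt0 : 0 < gt by exact: g0.
have hE : h t = L * n * gt by rewrite /h clamp_id.
pose B := L * gt + L * n + L + 2.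
have B0 : 0 < B by rewrite /B; have := mulr_ge0 L_ge0 n0; have := mulr_ge0 L_ge0 (ltW gt0); have := L_ge0; lra.
pose e1 := Num.min 1 (e / B).
have e10 : 0 < e1 by rewrite lt_min ltr01 divr_gt0.
have [e11 e1B] : e1 <= 1 /\ e1 * B <= e.
  split; first by rewrite ge_min lexx.
  by rewrite -ler_pdivlMr // ge_min lexx orbT.
have [d1 d10 H1] := dF _ (v1 t tt') _ e10.
have [d2 d20 H2] := dH _ (sub1 t t1t') _ e10.
have [d3 d30 H3] := dw t tt' _ e10.
have [d4 d40 H4] := cv t tt' _ d10.
exists (Num.min d2 (Num.min d3 d4)); first by rewrite !lt_min d20 d30.
move=> s /andP[ts]; rewrite -ltrBlDl !lt_min => /and3P[sd2 sd3 sd4] st2.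
have ss : t1 <= s <= t2 by rewrite (le_trans t1t' (ltW ts)) ltW.
pose y := s - t; have y0 : 0 < y by rewrite subr_gt0.
have yE : `|s - t| = y by rewrite gtr0_norm.
have h2 := H2 s; rewrite yE in h2; have {}h2 := h2 sd2.
have h3 := H3 s ss; rewrite yE in h3; have {}h3 := h3 sd3.
have h4 := H4 s ss; rewrite yE in h4; have {}h4 := h4 sd4.
have h1 := H1 _ h4; rewrite -/(g _) -/gt in h1; rewrite -/y hE in h2.
have vl := v_lip s t ss tt'.
pose q := nrm (w s - w t).
have hq : q <= (n + e1) * y.
  have := nrm_le_dist (w s - w t) (of_real (s - t) *: w' t).
  by rewrite nrmZr yE -/q -/n; lra.
pose x := Vf (w s) - Vf (w t); rewrite -/x -/q in vl h1.
have hx : `|x| <= L * (n + e1) * y.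
  by apply: le_trans vl _; rewrite -mulrA ler_wpM2l.
have hF : F (Vf (w s)) - F (Vf (w t)) <= (gt + e1) * `|x|.
  have : x * gt <= `|x| * gt by rewrite ler_wpM2r ?(ltW gt0) // ler_norm.
  by move: h1; rewrite ler_norml => /andP[_ h1]; lra.
have hH : y * (L * n * gt) - e1 * y <= H s - H t.
  by move: h2; rewrite ler_norml => /andP[h2 _]; lra.
have hF2 : F (Vf (w s)) - F (Vf (w t)) <= (gt + e1) * (L * (n + e1) * y).
  by apply: le_trans hF _; rewrite ler_wpM2l // addr_ge0 // ltW.
suff : (gt + e1) * (L * (n + e1)) - L * n * gt + e1 <= e.
  by move=> hh; have := ler_wpM2r (ltW y0) hh; rewrite -/y; lra.
have Le1 : L * e1 * e1 <= L * e1 by rewrite -[leRHS]mulr1 ler_wpM2l // mulr_ge0 // ltW.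
have : e1 * B = e1 * (L * gt) + e1 * (L * n) + e1 * L + e1 * 2 by rewrite /B; ring.
by move=> eB; lra.
Qed.

Lemma last_exit (a b : R) (h : R -> R) : a <= b -> rcont_on (seg a b) h ->
  r < h b -> exists2 c, a <= c <= b & (forall s : R, c <= s <= b -> r <= h s) /\
    (c = a \/ h c = r).
Proof.
move=> ab ch rb; pose S : set R := [set s | a <= s <= b /\ h s < r].
have [[s0 Ss0]|S0] := pselect (S !=set0); last first.
  exists a; first by rewrite lexx.
  split; last by left.
  move=> s sab; rewrite leNgt; apply/negP => hs; apply: S0; exists s; split=> //.
have hS : has_sup S by split; [exists s0 | exists b => s [/andP[]]].
have ubS s : S s -> s <= sup S by move=> Ss; apply: sup_upper_bound.
have c1 : a <= sup S by apply: le_trans (ubS _ Ss0); case: Ss0 => /andP[].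
have c2 : sup S <= b by apply: sup_le_ub => //; [exists s0 | move=> s [/andP[]]].
have cab : a <= sup S <= b by rewrite c1.
have above s : sup S < s -> s <= b -> r <= h s.
  move=> cs sb; rewrite leNgt; apply/negP => hs.
  have : S s by split=> //; rewrite (le_trans c1 (ltW cs)).
  by move/ubS; rewrite leNgt cs.
have hc : h (sup S) <= r.
  apply/ler_addgt0Pr => e e0; have [d d0 H] := ch _ cab _ e0.
  have [s [sab hs] sd] := sup_adherent d0 hS.
  have := H s sab; have := ubS s (conj sab hs) => sc.
  rewrite ler0_norm ?subr_le0 // opprB ltrBlDr -ltrBlDl => /(_ sd).
  by rewrite ltr_norml => /andP[h1 h2]; lra.
have cb : sup S < b.
  rewrite lt_neqAle c2 andbT; apply: contraTneq rb => <-.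
  by rewrite -leNgt.
have hc' : r <= h (sup S).
  apply/ler_addgt0Pr => e e0; have [d d0 H] := ch _ cab _ e0.
  pose s := Num.min b (sup S + d / 2).
  have d2 : 0 < d / 2 by rewrite divr_gt0.
  have cs : sup S < s by rewrite lt_min cb ltrDl.
  have sb : s <= b by rewrite ge_min lexx.
  have sd : s <= sup S + d / 2 by rewrite ge_min lexx orbT.
  have sab : a <= s <= b by rewrite sb (le_trans c1 (ltW cs)).
  have := above s cs sb; have := H s sab; rewrite gtr0_norm ?subr_gt0 //.
  have sd' : s - sup S < d by lra.
  by move=> /(_ sd'); rewrite ltr_norml => /andP[h1 h2]; lra.
exists (sup S) => //; split; last by right; apply: le_anti; rewrite hc.
by move=> s /andP[]; rewrite le_eqVlt => /predU1P[<-|] //; exact: above.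
Qed.

Lemma lyapunov_bound (a b : R) (w0 : V) : 0 <= a <= b ->
  exists rho : R, forall (T : R) (w w' : R -> V), a <= T <= b -> w a = w0 ->
    (forall t : R, a <= t <= T -> W (w t)) ->
    (forall t : R, a <= t <= T -> deriv_on (seg a T) w t (w' t)) ->
    cont_on (seg a T) w' ->
    (forall t : R, a <= t <= T -> r <= nrm (w t) ->
       nrm (w' t) <= U (Vf (w t)) * psi t) ->
    forall t : R, a <= t <= T -> nrm (w t) <= rho.
Proof.
move=> /andP[a0 ab].
have [K HK] : exists K, forall w, W w -> nrm w = r -> Vf w <= K.
  have [[w1 [Ww1 w1r]]|N] := pselect (exists w1, W w1 /\ nrm w1 = r); last first.
    by exists 0 => w Ww wr; case: N; exists w.
  exists (Vf w1 + L * (r + r)) => w Ww wr.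
  have := Vf_lip Ww Ww1; rewrite wr w1r lexx => /(_ isT isT).
  have := ler_wpM2l L_ge0 (nrmB w w1); rewrite wr w1r.
  by rewrite ler_norml => h1 /andP[_ h2]; lra.
pose u0 := `|K| + `|Vf w0| + 1.
have u00 : 0 < u0 by rewrite ltr_wpDl.
have [Ku V0u] : K <= u0 /\ Vf w0 <= u0.
  rewrite /u0; have := ler_norm K; have := ler_norm (Vf w0).
  have := normr_ge0 K; have := normr_ge0 (Vf w0).
  by split; lra.
pose P := fine (\int[mu]_(t in `[0%R, b]) (psi t)%:E)%E.
have U0_int : (\int[mu]_(u in `[u0, +oo[) ((U0 u)%:E)^-1 = +oo)%E.
  rewrite -(U_int u00); apply: eq_integral => u.
  rewrite inE /= in_itv /= andbT => u0u; rewrite /U0 max_r //.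
  exact: le_trans (ltW u00) u0u.
have [n Hn] := osgood_unbounded U0_cont U0_ge0 (L * P) U0_int.
have c0 : (0 : R) < n.+1%:R^-1 by rewrite invr_gt0.
have [F dF FI] := continuous_primitive (-1) (continuous_invD U0_cont U0_ge0 c0).
have m1u0 : -1 < u0 by lra.
have u0n : u0 <= u0 + n%:R by rewrite lerDl.
rewrite FI // lte_fin in Hn.
have F_mono x y : -1 < x -> x <= y -> F x <= F y.
  move=> x1 xy; rewrite -subr_ge0 -lee_fin -FI //; apply: integral_ge0 => u _.
  by rewrite lee_fin invr_ge0 addr_ge0 // ltW.
have [rho Hrho] := Vf_coercive (u0 + n%:R).
exists (Num.max rho r) => T w w' /andP[aT Tb] wa wW dw cw' wU t /andP[at_ tT].
rewrite leNgt; apply/negP; rewrite gt_max => /andP[rhow rw].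
have sub c s : a <= c -> c <= s <= t -> a <= s <= T.
  by move=> ac /andP[cs st]; rewrite (le_trans ac cs) (le_trans st tT).
have cw : rcont_on (seg a t) (fun t => nrm (w t)).
  apply: cont_on_nrm; apply: cont_onS (deriv_cont dw) => s st.
  exact: (sub a).
have [c /andP[ac ct] [wr wc]] := last_exit at_ cw rw.
have caT : a <= c <= T by rewrite ac (le_trans ct tT).
have Vc : Vf (w c) <= u0.
  case: wc => [->|wcr]; first by rewrite wa.
  by apply: le_trans Ku; apply: HK => //; exact: wW.
have Vt : u0 + n%:R <= Vf (w t).
  apply: Hrho; last exact: ltW.
  by apply: wW; rewrite at_.
have : F (Vf (w t)) - F (Vf (w c)) <= L * P.
  apply: (lyapunov_segment (w' := w') c0 (le_trans a0 ac) ct (le_trans tT Tb) dF)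
    => [s sct||s sct].
  - apply: deriv_onS (dw s (sub c s ac sct)) => x; exact: sub.
  - by apply: cont_onS cw' => x; exact: sub.
  - have saT := sub c s ac sct.
    by split; [exact: wW | exact: wr | apply: wU; rewrite ?wr].
rewrite leNgt => /negP; apply; apply: lt_le_trans Hn _.
apply: lerB; first by apply: F_mono => //; exact: lt_le_trans u0n.
by apply: F_mono => //; have := Vf_ge0 (wW c caT); lra.
Qed.

End lyapunov.

(** * Newton iteration and partial derivatives *)

Section subspaces.
Context {R : realType} {k : scalar_kind} {V : normedModType (scalars R k)}.
Local Notation K := (scalars R k).

Definition subspace (E : set V) : Prop :=
  E 0 /\ forall (a : K) u v, E u -> E v -> E (a *: u + v).

Variable E : set V.
Hypothesis sE : subspace E.

Lemma subspaceD u v : E u -> E v -> E (u + v).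
Proof. by move=> Eu Ev; have := sE.2 1 u v Eu Ev; rewrite scale1r. Qed.

Lemma subspaceZ (a : K) u : E u -> E (a *: u).
Proof. by move=> Eu; have := sE.2 a u 0 Eu sE.1; rewrite addr0. Qed.

Lemma subspaceN u : E u -> E (- u).
Proof. by move=> Eu; rewrite -scaleN1r; exact: subspaceZ. Qed.

Lemma subspaceB u v : E u -> E v -> E (u - v).
Proof. by move=> Eu /subspaceN; exact: subspaceD. Qed.

Lemma subspace_sum (I : Type) (s : seq I) (P : pred I) (F : I -> V) :
  (forall i, P i -> E (F i)) -> E (\sum_(i <- s | P i) F i).
Proof. by move=> EF; elim/big_ind : _ => //; [exact: sE.1 | exact: subspaceD]. Qed.

End subspaces.

Section bounded_linear_on_subspaces.
Context {R : realType} {k : scalar_kind} {V W : normedModType (scalars R k)}.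
Local Notation K := (scalars R k).
Variables (E : set V) (T : V -> W).
Hypothesis sE : subspace E.
Hypothesis bT : bounded_linear_on (@nrm R k V) (@nrm R k W) E T.

Lemma bounded_linear0 : T 0 = 0.
Proof.
have := bT.1 (-1) 0 0 sE.1 sE.1; rewrite scaler0 addr0 scaleN1r addNr; exact.
Qed.

Lemma bounded_linearD u v : E u -> E v -> T (u + v) = T u + T v.
Proof. by move=> Eu Ev; have := bT.1 1 u v Eu Ev; rewrite !scale1r. Qed.

Lemma bounded_linearZ (a : K) u : E u -> T (a *: u) = a *: T u.
Proof. by move=> Eu; have := bT.1 a u 0 Eu sE.1; rewrite bounded_linear0 !addr0. Qed.

Lemma bounded_linearN u : E u -> T (- u) = - T u.
Proof. by move=> Eu; rewrite -scaleN1r bounded_linearZ // scaleN1r. Qed.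

Lemma bounded_linearB u v : E u -> E v -> T (u - v) = T u - T v.
Proof.
by move=> Eu Ev; rewrite bounded_linearD ?bounded_linearN //; exact: subspaceN.
Qed.

Lemma bounded_linear_sum (I : Type) (s : seq I) (P : pred I) (F : I -> V) :
  (forall i, P i -> E (F i)) ->
  T (\sum_(i <- s | P i) F i) = \sum_(i <- s | P i) T (F i).
Proof.
move=> EF; elim: s => [|i s IH]; first by rewrite !big_nil bounded_linear0.
rewrite !big_cons; case: ifP => // Pi.
by rewrite bounded_linearD ?IH //; [exact: EF | exact: subspace_sum].
Qed.

Lemma bounded_linear_bound :
  exists2 C : R, 0 < C & forall u, E u -> nrm (T u) <= C * nrm u.
Proof.
have [C HC] := bT.2; exists (`|C| + 1); first by rewrite ltr_wpDl.
move=> u Eu; apply: le_trans (HC u Eu) _; apply: ler_wpM2r; first exact: nrm_ge0.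
by have := ler_norm C; lra.
Qed.

End bounded_linear_on_subspaces.

Section newton.
Context {R : realType} {k : scalar_kind}.
Context {X : completeNormedModType (scalars R k)}.
Context {Y : normedModType (scalars R k)}.
Variables (E : set X) (W : set Y) (Z : X -> Y) (Zi : Y -> X).
Hypothesis sE : subspace E.
Hypothesis sW : subspace W.
Hypothesis E_closed : forall un l, (forall n, E (un n)) -> tends un l -> E l.
Hypothesis ZZi : bounded_inverse (@nrm R k X) (@nrm R k Y) E W Z Zi.

Lemma newton (N q c e : R) (F : X -> Y) (x0 : X) :
  0 <= N -> 0 <= c -> 0 <= q < 1 -> c * N <= q ->
  (forall w, W w -> nrm (Zi w) <= N * nrm w) ->
  (forall u v, E u -> E v -> nrm (u - x0) <= e -> nrm (v - x0) <= e ->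
    nrm (F u - F v - Z (u - v)) <= c * nrm (u - v)) ->
  (forall u, E u -> nrm (u - x0) <= e -> W (F u)) ->
  E x0 -> N * nrm (F x0) <= (1 - q) * e ->
  exists x, [/\ E x, nrm (x - x0) <= N * nrm (F x0) / (1 - q) & F x = 0].
Proof.
move=> N0 c0 q01 cq ZiN FZ FW Ex0 Fx0.
have /andP[q0 q1] := q01; have q10 : 0 < 1 - q by rewrite subr_gt0.
have [ZW ZiL ZiZ ZZ] := ZZi.
pose step x := x - Zi (F x); pose u n := iter n step x0.
pose b := N * nrm (F x0); have b0 : 0 <= b by rewrite mulr_ge0 // nrm_ge0.
have be : b / (1 - q) <= e by rewrite ler_pdivrMr // mulrC.
have u_step n : u n.+1 = u n - Zi (F (u n)) by rewrite /u iterS.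
have qn n : 0 <= q ^+ n by exact: exprn_ge0.
have inv n : [/\ E (u n), nrm (u n - x0) <= b / (1 - q) * (1 - q ^+ n) &
    nrm (F (u n)) <= q ^+ n * nrm (F x0)].
  elim: n => [|n [Eu ux Fu]].
    by split=> //; rewrite /u /= !expr0 ?mul1r // !subrr nrm0 mulr0.
  have b1q : 0 <= b / (1 - q) by rewrite divr_ge0 // ltW.
  have ue : nrm (u n - x0) <= e.
    apply: le_trans ux _; apply: le_trans be; rewrite ler_piMr //.
    by rewrite gerBl.
  have Wu := FW _ Eu ue; have [EZ ZE] := ZiZ _ Wu.
  have Eu1 : E (u n.+1) by rewrite u_step; exact: subspaceB.
  have dist : nrm (u n.+1 - u n) <= b * q ^+ n.
    rewrite u_step addrAC subrr add0r nrmN; apply: le_trans (ZiN _ Wu) _.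
    by rewrite /b -mulrA ler_wpM2l // mulrC.
  have ux1 : nrm (u n.+1 - x0) <= b / (1 - q) * (1 - q ^+ n.+1).
    apply: le_trans (nrm_trans (u n) _ _) _; apply: le_trans (lerD dist ux) _.
    have -> : b * q ^+ n = b / (1 - q) * ((1 - q) * q ^+ n).
      by rewrite mulrA divfK // gt_eqF.
    by rewrite -mulrDr exprS ler_wpM2l //; lra.
  have ue1 : nrm (u n.+1 - x0) <= e.
    apply: le_trans ux1 _; apply: le_trans be; rewrite ler_piMr //.
    by rewrite gerBl.
  split=> //.
  have := FZ _ _ Eu1 Eu ue1 ue.
  have -> : u n.+1 - u n = - Zi (F (u n)) by rewrite u_step addrAC subrr add0r.
  have -> : Z (- Zi (F (u n))) = - F (u n).
    have E1 : E (- Zi (F (u n))) by exact: subspaceN.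
    have W1 : W (- F (u n)) by exact: subspaceN.
    rewrite -[in RHS](ZiZ _ W1).2 (bounded_linearN sW ZiL Wu) //.
  rewrite opprK addrNK nrmN => /le_trans; apply.
  apply: (@le_trans _ _ (c * (N * nrm (F (u n))))); first by rewrite ler_wpM2l // ZiN.
  rewrite mulrA exprS -[leRHS]mulrA; apply: ler_pM => //.
  - exact: mulr_ge0.
  - exact: nrm_ge0.
have dist n : nrm (u n.+1 - u n) <= b * q ^+ n.
  have [Eu ux Fu] := inv n.
  have b1q : 0 <= b / (1 - q) by rewrite divr_ge0 // ltW.
  have ue : nrm (u n - x0) <= e.
    apply: le_trans ux _; apply: le_trans be; rewrite ler_piMr //.
    by rewrite gerBl.
  rewrite u_step addrAC subrr add0r nrmN; apply: le_trans (ZiN _ (FW _ Eu ue)) _.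
  by rewrite /b -mulrA ler_wpM2l // mulrC.
have [x ux xu] := geometric_tends q01 b0 dist.
have Ex : E x by apply: (E_closed (un := u)) ux => n; case: (inv n).
have xx0 : nrm (x - x0) <= b / (1 - q) by have := xu 0%N; rewrite expr0 mulr1.
exists x; split=> //.
have xe := le_trans xx0 be; have Wx := FW _ Ex xe.
suff Zi0 : Zi (F x) = 0.
  have [_ <-] := ZiZ _ Wx; rewrite Zi0 -(bounded_linear0 sW ZiL).
  by have [_] := ZiZ _ sW.1.
apply: nrm_le0; apply/ler_addgt0Pr => eps eps0; rewrite add0r.
have C0 : 0 < (N * c + 1) * (b / (1 - q)) + N * nrm (F x0) + 1.
  rewrite ltr_wpDl // addr_ge0 ?mulr_ge0 ?nrm_ge0 ?invr_ge0 // ?(ltW q10) //.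
  by rewrite addr_ge0 // mulr_ge0.
have [n Hn] := geometric_small ((N * c + 1) * (b / (1 - q)) + N * nrm (F x0) + 1) q01 eps0.
have {}Hn := Hn n (leqnn _); have [Eu uxn Fu] := inv n.
have ue : nrm (u n - x0) <= e.
  apply: le_trans uxn _; apply: le_trans be; rewrite ler_piMr //.
    by rewrite divr_ge0 // ltW.
  by rewrite gerBl.
have Wu := FW _ Eu ue; have Exu := subspaceB sE Ex Eu.
have WZ := ZW _ Exu.
have Wr : W (F x - F (u n) - Z (x - u n)).
  by apply: (subspaceB sW) => //; exact: (subspaceB sW).
have -> : Zi (F x) = Zi (F x - F (u n) - Z (x - u n)) + Zi (F (u n)) + (x - u n).
  rewrite (bounded_linearB sW ZiL (subspaceB sW Wx Wu) WZ).
  by rewrite (bounded_linearB sW ZiL Wx Wu) ZZ //; vec (scalars R k).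
apply: le_trans (nrmD _ _) _; apply: le_trans (lerD (nrmD _ _) (xu n)) _.
apply/ltW; apply: le_lt_trans Hn.
have h1 : nrm (Zi (F x - F (u n) - Z (x - u n))) <= N * (c * (b / (1 - q) * q ^+ n)).
  apply: le_trans (ZiN _ Wr) _; rewrite ler_wpM2l //.
  by apply: le_trans (FZ _ _ Ex Eu xe ue) _; rewrite ler_wpM2l.
have h2 : nrm (Zi (F (u n))) <= N * (q ^+ n * nrm (F x0)).
  by apply: le_trans (ZiN _ Wu) _; rewrite ler_wpM2l.
apply: le_trans (lerD (lerD h1 h2) (lexx _)) _.
by have := qn n; lra.
Qed.

End newton.

Section partial_derivatives.
Context {R : realType} {k : scalar_kind} {X Y : normedModType (scalars R k)}.
Variables (J : set R) (E M : set X) (g : R -> X -> Y).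
Hypothesis sE : subspace E.
Hypothesis M_open : open_in E M.

Lemma open_inP x : M x ->
  exists2 d : R, 0 < d & forall u, E u -> nrm (u - x) < d -> M u.
Proof.
have [U oU ->] := M_open; move=> [Ex Ux].
have /nbhs_nrmP[d d0 dU] : nbhs x U by exact: open_nbhs_nbhs.
by exists d => // u Eu /dU.
Qed.

Lemma open_in_sub x : M x -> E x.
Proof. by have [U _ ->] := M_open; case. Qed.

Lemma small_scale (h : X) (d : R) : 0 < d ->
  exists2 s : R, 0 < s & s * nrm h < d.
Proof.
move=> d0; have n0 := nrm_ge0 h; exists (d / (nrm h + 1)).
  by rewrite divr_gt0 // ltr_wpDl.
by rewrite mulrAC ltr_pdivrMr ?ltr_wpDl // ltr_pM2l // ltrDl.
Qed.

Lemma partial_unique t x L L' : M x -> is_partial_x E M g t x L ->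
  is_partial_x E M g t x L' -> forall h, E h -> L h = L' h.
Proof.
move=> Mx [bL dL] [bL' dL'] h Eh.
apply/eqP; rewrite -subr_eq0; apply/eqP/nrm_le0/ler_addgt0Pr => e e0.
rewrite add0r; have n0 := nrm_ge0 h.
pose e1 := e / (2 * (nrm h + 1)).
have h1 : 0 < 2 * (nrm h + 1) by rewrite mulr_gt0 // ltr_wpDl.
have e10 : 0 < e1 by rewrite divr_gt0.
have e1E : e1 * (2 * (nrm h + 1)) = e by rewrite divfK // gt_eqF.
have [d d0 H] := dL _ e10; have [d' d'0 H'] := dL' _ e10.
have [d2 d20 H2] := open_inP Mx.
have mn : 0 < Num.min d (Num.min d' d2) by rewrite !lt_min d0 d'0.
have [s s0] := small_scale h mn; rewrite !lt_min => /and3P[sd sd' sd2].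
pose u := of_real s *: h.
have nu : nrm u = s * nrm h by rewrite nrmZr gtr0_norm.
have Eu : E u by exact: subspaceZ.
have xu : x + u - x = u by rewrite addrAC subrr add0r.
have Mu : M (x + u).
  by apply: H2; rewrite ?xu ?nu //; apply: subspaceD => //; exact: open_in_sub.
have := H _ Mu; rewrite xu nu => /(_ sd) k1.
have := H' _ Mu; rewrite xu nu => /(_ sd') k2.
have : nrm (L u - L' u) <= 2 * (e1 * (s * nrm h)).
  have -> : L u - L' u = (g t (x + u) - g t x - L' u) - (g t (x + u) - g t x - L u).
    by vec (scalars R k).
  by apply: le_trans (nrmB _ _) _; lra.
rewrite (bounded_linearZ sE bL) // (bounded_linearZ sE bL') // -scalerBr nrmZr.
rewrite gtr0_norm // (_ : 2 * _ = s * (2 * e1 * nrm h)); last by ring.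
by rewrite ler_pM2l // => /le_trans; apply; rewrite -e1E; lra.
Qed.

Lemma partial_xP t x : (exists L, is_partial_x E M g t x L) ->
  is_partial_x E M g t x (partial_x E M g t x).
Proof.
by move=> [L HL]; rewrite /partial_x; case: xgetP => [? -> //|/(_ L)].
Qed.

Lemma strict_partial t x (e : R) :
  continuously_partially_differentiable J E M g -> J t -> M x -> 0 < e ->
  exists2 d : R, 0 < d & forall s u v, J s -> `|s - t| < d -> M u -> M v ->
    nrm (u - x) < d -> nrm (v - x) < d ->
    nrm (g s u - g s v - partial_x E M g t x (u - v)) <= e * nrm (u - v).
Proof.
move=> [ex cp] Jt Mx e0; have [d d0 Hd] := cp t x Jt Mx e e0.
have [d' d'0 Hd'] := open_inP Mx.
exists (Num.min (d / 2) d'); first by rewrite lt_min d'0 divr_gt0.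
move=> s u v Js; rewrite !lt_min => /andP[sd _] Mu Mv /andP[ud ud'] /andP[vd vd'].
have Eu := open_in_sub Mu; have Ev := open_in_sub Mv.
pose h := u - v; have Eh : E h by exact: subspaceB.
pose c r := v + of_real r *: h.
have Ec r : E (c r) by apply: subspaceD => //; exact: subspaceZ.
have c_near r : 0 <= r <= 1 -> M (c r) /\ nrm (c r - x) < d / 2.
  move=> /andP[r0 r1].
  have -> : nrm (c r - x) = nrm (of_real r *: (u - x) + of_real (1 - r) *: (v - x)).
    by congr nrm; rewrite /c /h rmorphB rmorph1; vec (scalars R k).
  suff small (b : R) : nrm (u - x) < b -> nrm (v - x) < b ->
      nrm (of_real r *: (u - x) + of_real (1 - r) *: (v - x)) < b.
    split; last exact: small.
    apply: Hd'; first exact: Ec.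
    have := small d' ud' vd'.
    by congr (nrm _ < _); rewrite /c /h rmorphB rmorph1; vec (scalars R k).
  move=> ub vb; apply: le_lt_trans (nrmD _ _) _; rewrite !nrmZr !ger0_norm ?subr_ge0 //.
  have [->|rn0] := eqVneq r 0; first by rewrite mul0r add0r subr0 mul1r.
  have r0' : 0 < r by rewrite lt_neqAle eq_sym rn0.
  have : r * nrm (u - x) < r * b by rewrite ltr_pM2l.
  have : (1 - r) * nrm (v - x) <= (1 - r) * b.
    by apply: ler_wpM2l; [rewrite subr_ge0 | exact: ltW].
  lra.
have cB r r' : c r - c r' = of_real (r - r') *: h.
  by rewrite /c rmorphB; vec (scalars R k).
have dc r : 0 <= r <= 1 -> deriv_on (seg 0 1) (fun r => g s (c r)) r
    (partial_x E M g s (c r) h).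
  move=> r01 e1 e10; have [Mc _] := c_near r r01.
  have [bL HL] := partial_xP (ex s _ Js Mc).
  have e2 : 0 < e1 / (nrm h + 1) by rewrite divr_gt0 // ltr_wpDl // nrm_ge0.
  have [d1 d10 H1] := HL _ e2.
  exists (d1 / (nrm h + 1)); first by rewrite divr_gt0 // ltr_wpDl // nrm_ge0.
  move=> r' r'01; rewrite ltr_pdivlMr ?ltr_wpDl ?nrm_ge0 // => rr'.
  have nc : nrm (c r' - c r) = `|r' - r| * nrm h by rewrite cB nrmZr.
  have rr0 := normr_ge0 (r' - r); have h0 := nrm_ge0 h.
  have [Mc' _] := c_near r' r'01.
  have := H1 _ Mc'; rewrite nc cB (bounded_linearZ sE bL) // => H; apply: le_trans (H _) _.
    by apply: le_lt_trans rr'; rewrite ler_wpM2l // lerDl.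
  rewrite mulrCA mulrC ler_wpM2r // mulrAC ler_pdivrMr ?ltr_wpDl //.
  by rewrite ler_wpM2l ?(ltW e10) // lerDl.
have := @mean_value_cst _ _ _ (fun r => g s (c r)) (partial_x E M g t x h) (e * nrm h) 0 1.
have c1 : c 1 = u by rewrite /c rmorph1 scale1r /h addrC subrK.
have c0 : c 0 = v by rewrite /c rmorph0 scale0r addr0.
rewrite c1 c0 subr0 rmorph1 mulr1 scale1r.
apply; first exact: ler01.
  exact: deriv_cont dc.
move=> r r01; have r01' : 0 <= r <= 1 by case/andP: r01 => *; rewrite !ltW.
exists (partial_x E M g s (c r) h).
  apply: deriv_onS (dc r r01') => y /andP[y0 y1]; by rewrite /seg /= !ltW.
have [Mc nc] := c_near r r01'.
by apply: Hd => //; lra.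
Qed.

End partial_derivatives.

(** * Curves of class C^r and implicit functions *)

Section curves_of_class_C.
Context {R : realType} {k : scalar_kind}.
Local Notation K := (scalars R k).

Definition half_line : set R := [set t | 0 <= t].

Fixpoint class_Cr {V : normedModType K} (r : nat) (u : R -> V) : Prop :=
  if r is q.+1 then
    exists2 u', forall t : R, 0 <= t -> deriv_on half_line u t (u' t) &
      class_Cr q u'
  else cont_on half_line u.

Section vector_valued.
Context {V : normedModType K}.
Implicit Types (u v : R -> V) (c : R -> K^o).

Lemma class_Cr_cont r u : class_Cr r u -> cont_on half_line u.
Proof. by case: r => // r [u' du _]; exact: deriv_cont du. Qed.

Lemma class_CrW r u : class_Cr r.+1 u -> class_Cr r u.
Proof.
elim: r u => [|r IH] u; first exact: class_Cr_cont.
by move=> [u' du cu']; exists u' => //; exact: IH.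
Qed.

Lemma class_Cr_le q r u : (q <= r)%N -> class_Cr r u -> class_Cr q u.
Proof.
move=> /subnKC <-; elim: (r - q)%N => [|d IH]; first by rewrite addn0.
by rewrite addnS => /class_CrW.
Qed.

Lemma class_Cr_eq r u v : (forall t : R, 0 <= t -> u t = v t) ->
  class_Cr r u -> class_Cr r v.
Proof.
move=> uv; case: r => [|r] /=; first by apply: cont_on_eq.
move=> [u' du cu']; exists u' => // t t0.
by apply: deriv_on_eq (du t t0) => [s s0|]; rewrite uv.
Qed.

Lemma class_CrD r u v : class_Cr r u -> class_Cr r v ->
  class_Cr r (fun t => u t + v t).
Proof.
elim: r u v => [|r IH] u v /=; first exact: cont_onD.
move=> [u' du cu'] [v' dv cv']; exists (fun t => u' t + v' t); last exact: IH.
by move=> t t0; apply: deriv_onD; [exact: du | exact: dv].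
Qed.

Lemma class_Cr_cst r (w : V) : class_Cr r (fun=> w).
Proof.
elim: r w => [|r IH] w /=; first exact: cont_on_cst.
by exists (fun=> 0) => // t _; exact: deriv_on_cst.
Qed.

Lemma class_Cr_sum r (I : Type) (s : seq I) (P : pred I) (F : I -> R -> V) :
  (forall i, P i -> class_Cr r (F i)) ->
  class_Cr r (fun t => \sum_(i <- s | P i) F i t).
Proof.
move=> cF; elim: s => [|i s IH].
  by apply: (class_Cr_eq (u := fun=> 0)) => [t _|]; [rewrite big_nil | exact: class_Cr_cst].
have [Pi|Pi] := boolP (P i).
  apply: (class_Cr_eq (u := fun t => F i t + \sum_(i <- s | P i) F i t)).
    by move=> t _; rewrite big_cons Pi.
  by apply: class_CrD => //; exact: cF.
by apply: class_Cr_eq IH => t _; rewrite big_cons (negbTE Pi).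
Qed.

End vector_valued.

Section scaling.
Context {V : normedModType K}.
Implicit Types (u v : R -> V) (c : R -> K^o).

Lemma cont_onZ (S : set R) c u : cont_on S c -> cont_on S u ->
  cont_on S (fun t => (c t : K) *: u t).
Proof.
move=> cc cu t St e e0.
pose B := nrm (c t) + nrm (u t) + 1.
have c0 := nrm_ge0 (c t); have u0 := nrm_ge0 (u t).
have B0 : 0 < B by rewrite /B; lra.
have e1 : 0 < Num.min 1 (e / B) by rewrite lt_min ltr01 divr_gt0.
have [d d0 Hd] := cc t St _ e1; have [d' d'0 Hd'] := cu t St _ e1.
exists (Num.min d d'); first by rewrite lt_min d0.
move=> s Ss; rewrite lt_min => /andP[/(Hd s Ss) + /(Hd' s Ss)].
rewrite !lt_min !ltr_pdivlMr // => /andP[h1 h2] /andP[h3 h4].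
have -> : c s *: u s - c t *: u t = (c s - c t) *: (u s - u t) +
   (c t *: (u s - u t) + (c s - c t) *: u t) by vec (scalars R k).
apply: le_lt_trans (nrmD _ _) _; apply: le_lt_trans (lerD (lexx _) (nrmD _ _)) _.
rewrite !nrmZ.
have n1 := nrm_ge0 (c s - c t); have n2 := nrm_ge0 (u s - u t).
have h5 : nrm (c s - c t) * nrm (u s - u t) <= nrm (u s - u t).
  by rewrite ler_piMl // ltW.
set x := nrm (c s - c t) in h1 h2 n1 h5 *; set y := nrm (u s - u t) in h3 h4 n2 h5 *.
apply: le_lt_trans (lerD h5 (lexx _)) _.
have [xy|yx] := leP x y.
  by have := ler_wpM2r u0 xy; rewrite /B in h4; lra.
by have := ler_wpM2l c0 (ltW yx); rewrite /B in h2; lra.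
Qed.

Lemma deriv_onZ (S : set R) c u (t : R) (c' : K^o) (u' : V) :
  deriv_on S c t c' -> deriv_on S u t u' ->
  deriv_on S (fun t => (c t : K) *: u t) t ((c' : K) *: u t + (c t : K) *: u').
Proof.
move=> dc du e e0.
pose B := nrm (c t) + nrm (u t) + nrm c' + 2.
have c0 := nrm_ge0 (c t); have u0 := nrm_ge0 (u t); have c'0 := nrm_ge0 c'.
have u'0 := nrm_ge0 u'.
pose A := (nrm c' + 1) * (nrm u' + 1) + nrm (c t) + nrm (u t) + 1.
have A1 : 0 < (nrm c' + 1) * (nrm u' + 1) by rewrite mulr_gt0 // ltr_wpDl.
have A0 : 0 < A by rewrite /A; lra.
have [e1 [e10 e11 e1A]] : exists e1 : R, [/\ 0 < e1, e1 <= 1 & e1 * A <= e].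
  exists (Num.min 1 (e / A)); split.
  - by rewrite lt_min ltr01 divr_gt0.
  - by rewrite ge_min lexx.
  - by rewrite -ler_pdivlMr // ge_min lexx orbT.
have [d d0 Hd] := dc _ e10; have [d' d'0 Hd'] := du _ e10.
exists (Num.min e1 (Num.min d d')); first by rewrite !lt_min e10 d0.
move=> s Ss; rewrite !lt_min => /and3P[se /(Hd s Ss) h1 /(Hd' s Ss) h2].
set y : K := of_real (s - t); set a := `|s - t| in se h1 h2 *.
rewrite -/y in h1 h2.
have a0 : 0 <= a by exact: normr_ge0.
have ny : nrm (y : K^o) = a by rewrite /y /nrm real_part_normr_of_real.
have -> : c s *: u s - c t *: u t - y *: (c' *: u t + c t *: u') =
  ((c s - c t - y * c') : K) *: u t + (c t *: (u s - u t - y *: u') +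
   ((c s - c t) : K) *: (u s - u t)) by vec (scalars R k).
apply: le_trans (nrmD _ _) _; apply: le_trans (lerD (lexx _) (nrmD _ _)) _.
rewrite !nrmZ.
have h3 : nrm (c s - c t : K^o) <= (nrm c' + 1) * a.
  have := nrm_le_dist (c s - c t : K^o) (y *: c'); rewrite nrmZ ny => h.
  apply: le_trans h _; have := ler_wpM2r a0 e11; move: h1; lra.
have h4 : nrm (u s - u t) <= (nrm u' + 1) * a.
  have := nrm_le_dist (u s - u t) (y *: u'); rewrite nrmZ ny => h.
  apply: le_trans h _; have := ler_wpM2r a0 e11; move: h2; lra.
have h5 : nrm (c s - c t : K^o) * nrm (u s - u t) <=
    (nrm c' + 1) * (nrm u' + 1) * e1 * a.
  apply: (@le_trans _ _ (((nrm c' + 1) * a) * ((nrm u' + 1) * a))).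
    by apply: ler_pM => //; exact: nrm_ge0.
  rewrite (_ : _ * _ = (nrm c' + 1) * (nrm u' + 1) * a * a); last by ring.
  by apply: ler_wpM2r => //; apply: ler_wpM2l; exact: ltW.
have h6 := ler_wpM2r u0 h1; have h7 := ler_wpM2l c0 h2.
have h8 := ler_wpM2r a0 e1A; rewrite /A in h8.
have h9 : 0 <= e1 * a by rewrite mulr_ge0 // ltW.
by move: h6 h7; rewrite /GRing.scale /=; lra.
Qed.

Lemma class_CrZ r c u : class_Cr r c -> class_Cr r u ->
  class_Cr r (fun t => (c t : K) *: u t).
Proof.
elim: r c u => [|r IH] c u; first exact: cont_onZ.
move=> cc cu; have cc0 := class_CrW cc; have cu0 := class_CrW cu.
case: cc cu => [c' dc cc'] [u' du cu'].
exists (fun t => (c' t : K) *: u t + (c t : K) *: u' t).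
  by move=> t t0; apply: deriv_onZ; [exact: dc | exact: du].
by apply: class_CrD; exact: IH.
Qed.

Lemma class_CrN r u : class_Cr r u -> class_Cr r (fun t => - u t).
Proof.
move=> cu; have := class_CrZ (class_Cr_cst r (-1 : K^o)) cu.
by apply: class_Cr_eq => t _; rewrite scaleN1r.
Qed.

Lemma class_CrB r u v : class_Cr r u -> class_Cr r v ->
  class_Cr r (fun t => u t - v t).
Proof. by move=> cu cv; apply: class_CrD => //; exact: class_CrN. Qed.

Lemma deriv_on_unique u (t : R) (l l' : V) :
  deriv_on [set s | t < s] u t l -> deriv_on [set s | t < s] u t l' -> l = l'.
Proof.
move=> dl dl'; apply/eqP; rewrite -subr_eq0; apply/eqP/nrm_le0/ler_addgt0Pr => e e0.
rewrite add0r; have e2 : 0 < e / 2 by rewrite divr_gt0.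
have [d d0 H] := dl _ e2; have [d' d'0 H'] := dl' _ e2.
pose y := Num.min d d' / 2; have m0 : 0 < Num.min d d' by rewrite lt_min d0.
have y0 : 0 < y by rewrite divr_gt0.
have ym : y < Num.min d d' by rewrite ltr_pdivrMr // ltr_pMr // ltr1n.
have ys : t + y - t = y by rewrite addrAC subrr add0r.
move: ym; rewrite lt_min => /andP[yd yd'].
have := H (t + y); have := H' (t + y); rewrite ys gtr0_norm //.
rewrite /= ltrDl => /(_ y0 yd') h' /(_ y0 yd) h.
have : nrm (of_real y *: (l - l')) <= e * y.
  have -> : of_real y *: (l - l') = (u (t + y) - u t - of_real y *: l') -
    (u (t + y) - u t - of_real y *: l) by vec (scalars R k).
  by apply: le_trans (nrmB _ _) _; lra.
by rewrite nrmZr gtr0_norm // mulrC ler_pM2r.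
Qed.

End scaling.

Section scalar_valued.
Implicit Types c d : R -> K^o.

Lemma class_CrM r c d : class_Cr r c -> class_Cr r d ->
  class_Cr r (fun t => (c t * d t : K^o)).
Proof. exact: class_CrZ. Qed.

Lemma class_Cr_prod r (I : Type) (s : seq I) (P : pred I) (F : I -> R -> K^o) :
  (forall i, P i -> class_Cr r (F i)) ->
  class_Cr r (fun t => \prod_(i <- s | P i) F i t : K^o).
Proof.
move=> cF; elim: s => [|i s IH].
  apply: (class_Cr_eq (u := fun=> 1 : K^o)); last exact: class_Cr_cst.
  by move=> t _; rewrite big_nil.
have [Pi|Pi] := boolP (P i).
  apply: (class_Cr_eq (u := fun t => F i t * \prod_(i <- s | P i) F i t : K^o)).
    by move=> t _; rewrite big_cons Pi.
  by apply: class_CrM => //; exact: cF.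
by apply: class_Cr_eq IH => t _; rewrite big_cons (negbTE Pi).
Qed.

Lemma nrm_scalarM (a b : K) : nrm (a * b : K^o) = nrm (a : K^o) * nrm (b : K^o).
Proof. exact: (nrmZ a (b : K^o)). Qed.

Lemma nrm_scalarV (a : K) : nrm (a^-1 : K^o) = (nrm (a : K^o))^-1.
Proof.
have [->|a0] := eqVneq a 0; first by rewrite invr0 nrm0 invr0.
have n0 : nrm (a : K^o) != 0 by apply: contra a0 => /eqP/nrm_eq0->.
apply: (mulfI n0); rewrite divff // -nrm_scalarM divff //.
by rewrite /nrm normr1 -(rmorph1 (@of_real R k)) real_part_of_real.
Qed.

Lemma cont_onV (S : set R) c : (forall t, S t -> c t != 0) -> cont_on S c ->
  cont_on S (fun t => (c t)^-1 : K^o).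
Proof.
move=> cn0 cc t St e e0; pose b := nrm (c t).
have b0 : 0 < b.
  rewrite lt_neqAle nrm_ge0 andbT eq_sym; apply: contra (cn0 t St).
  by move=> /eqP/nrm_eq0->.
have e1 : 0 < Num.min (b / 2) (e * (b / 2 * b)).
  by rewrite lt_min !mulr_gt0 ?invr_gt0.
have [d d0 H] := cc t St _ e1; exists d => // s Ss /(H s Ss).
rewrite lt_min => /andP[h1 h2]; have cs := cn0 s Ss; have ct := cn0 t St.
have bs : b / 2 <= nrm (c s).
  by have := nrm_le_dist (c t) (c s); rewrite (nrmC (c t)) -/b; lra.
have -> : (c s)^-1 - (c t)^-1 = ((c s)^-1 * ((c t)^-1 * (c t - c s)) : K^o).
  by rewrite mulrBr mulVf // mulrBr mulr1 mulrCA mulVf // mulr1.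
rewrite !nrm_scalarM !nrm_scalarV -/b nrmC.
have bs0 : 0 < nrm (c s) by apply: lt_le_trans bs; rewrite divr_gt0.
rewrite mulrC ltr_pdivrMr // mulrC ltr_pdivrMr //.
apply: lt_le_trans h2 _; rewrite mulrA; apply: ler_wpM2r; first exact: ltW.
by apply: ler_wpM2l => //; exact: ltW.
Qed.

Lemma class_CrV r c : (forall t : R, 0 <= t -> c t != 0) -> class_Cr r c ->
  class_Cr r (fun t => (c t)^-1 : K^o).
Proof.
move=> cn0; elim: r c cn0 => [|r IH] c cn0; first exact: cont_onV.
move=> cc; have ci := IH _ cn0 (class_CrW cc); case: cc => [c' dc cc'].
exists (fun t => - ((c t)^-1 * ((c t)^-1 * c' t)) : K^o); last first.
  by apply: class_CrN; do 2! apply: class_CrM => //.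
move=> t t0; have ct := cn0 t t0.
have cV : cont_on half_line (fun t => (c t)^-1 : K^o).
  by apply: cont_onV => //; exact: deriv_cont dc.
move=> e e0.
have b0 : 0 < nrm (c t).
  rewrite lt_neqAle nrm_ge0 andbT eq_sym; apply: contra ct.
  by move=> /eqP/nrm_eq0->.
pose i := nrm ((c t)^-1 : K^o); have i0 : 0 < i by rewrite /i nrm_scalarV invr_gt0.
pose n := nrm (c' t); have n0 : 0 <= n := nrm_ge0 _.
pose B := i * (i + 1) + i * n + 1.
have B0 : 0 < B by rewrite ltr_wpDl // addr_ge0 ?mulr_ge0 ?(ltW i0) // addr_ge0 // ltW.
have [e1 [e10 e11 e1B]] : exists e1 : R, [/\ 0 < e1, e1 <= 1 & e1 * B <= e].
  exists (Num.min 1 (e / B)); split.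
  - by rewrite lt_min ltr01 divr_gt0.
  - by rewrite ge_min lexx.
  - by rewrite -ler_pdivlMr // ge_min lexx orbT.
have [d d0 H] := dc t t0 _ e10; have [d' d'0 H'] := cV t t0 _ e10.
exists (Num.min d d'); first by rewrite lt_min d0.
move=> s s0; rewrite lt_min => /andP[/(H s s0) h1 /(H' s s0) h2].
have cs := cn0 s s0; set y : K := of_real (s - t); rewrite -/y in h1.
have ny : nrm (y : K^o) = `|s - t| by rewrite /y /nrm real_part_normr_of_real.
set a := `|s - t| in h1 ny *; have a0 : 0 <= a := normr_ge0 _.
have -> : (c s)^-1 - (c t)^-1 - (y : K) *: (- ((c t)^-1 * ((c t)^-1 * c' t)) : K^o) =
  - ((c s)^-1 * ((c t)^-1 * (c s - c t - y * c' t)) : K^o) -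
    (((c s)^-1 - (c t)^-1) * ((c t)^-1 * (y * c' t)) : K^o).
  have -> : (c s)^-1 - (c t)^-1 = (c s)^-1 * ((c t)^-1 * (c t - c s)) :> K.
    by rewrite mulrBr mulVf // mulrBr mulr1 mulrCA mulVf // mulr1.
  have tt : (c t)^-1 * c t = 1 by rewrite mulVf.
  have ss : (c s)^-1 * c s = 1 by rewrite mulVf.
  rewrite /GRing.scale /=.
  set x := (c s)^-1 in ss *; set z := (c t)^-1 in tt *.
  have -> : y * - (z * (z * c' t)) = - (x * c s * z * z * y * c' t) by rewrite ss; ring.
  have -> : x * (z * (c t - c s)) * (z * (y * c' t)) =
     (z * c t) * x * z * y * c' t - x * c s * z * z * y * c' t by ring.
  by rewrite tt; ring.
apply: le_trans (nrmB _ _) _; rewrite nrmN !nrm_scalarM ny -/i -/n.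
have h3 : nrm ((c s)^-1 : K^o) <= i + 1.
  by have := nrm_le_dist ((c s)^-1 : K^o) ((c t)^-1 : K^o); rewrite -/i; lra.
have h4 : nrm ((c s)^-1 : K^o) * (i * nrm (c s - c t - y * c' t : K^o)) <= (i + 1) * (i * (e1 * a)).
  by apply: ler_pM => //; rewrite ?mulr_ge0 ?nrm_ge0 ?(ltW i0) // ler_wpM2l // ltW.
have h5 : nrm ((c s)^-1 - (c t)^-1 : K^o) * (i * (a * n)) <= e1 * (i * (a * n)).
  by apply: ler_wpM2r; [rewrite !mulr_ge0 // ltW | exact: ltW].
apply: le_trans (lerD h4 h5) _.
have := ler_wpM2r a0 e1B; have : 0 <= e1 * a by rewrite mulr_ge0 // ltW.
by rewrite /B; lra.
Qed.

Lemma class_Cr_det r n (A : R -> 'M[K]_n) :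
  (forall i j, class_Cr r (fun t => A t i j : K^o)) ->
  class_Cr r (fun t => \det (A t) : K^o).
Proof.
move=> cA; apply: class_Cr_sum => s _; apply: class_CrM; first exact: class_Cr_cst.
by apply: class_Cr_prod => i _; exact: cA.
Qed.

Lemma class_Cr_invmx r n (A : R -> 'M[K]_n) :
  (forall i j, class_Cr r (fun t => A t i j : K^o)) ->
  (forall t : R, 0 <= t -> A t \in unitmx) ->
  forall i j, class_Cr r (fun t => invmx (A t) i j : K^o).
Proof.
move=> cA uA i j.
apply: (class_Cr_eq (u := fun t => (\det (A t))^-1 * cofactor (A t) j i : K^o)).
  by move=> t t0; rewrite /invmx uA // !mxE.
apply: class_CrM.
  apply: class_CrV; last exact: class_Cr_det.
  by move=> t t0; rewrite -unitfE -unitmxE uA.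
apply: class_CrM; first exact: class_Cr_cst.
apply: class_Cr_det => i' j'.
by apply: (class_Cr_eq (u := fun t => A t (lift j i') (lift i j') : K^o)) => // t _; rewrite !mxE.
Qed.

End scalar_valued.

End curves_of_class_C.

Section jets.
Context {R : realType} {k : scalar_kind} {X Y : normedModType (scalars R k)}.
Local Notation K := (scalars R k).
Variables (m : nat) (E M : set X) (g : R -> X -> Y).
Variable T : R -> X -> seq (R * X) -> Y.
Hypothesis sE : subspace E.
Hypothesis M_open : open_in E M.
Hypothesis T_jet : is_jet m half_line E M g T.

Section head.
Variables (t : R) (x : X) (hs : seq (R * X)).
Hypotheses (t_ge0 : 0 <= t) (Mx : M x) (hsm : (size hs < m)%N).
Hypothesis Ehs : directions E hs.

Lemma directions_cons h s : E h.2 -> directions E s -> directions E (h :: s).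
Proof. by move=> Eh Es u; rewrite inE => /predU1P[->//|/Es]. Qed.

Lemma jet_head_combine (h h' : R * X) (a : R) : E h.2 -> E h'.2 ->
  T t x ((a * h.1 + h'.1, of_real a *: h.2 + h'.2) :: hs) =
  of_real a *: T t x (h :: hs) + T t x (h' :: hs).
Proof.
move=> Eh Eh'; have [_ H _ _ _] := T_jet t_ge0 Mx.
by apply: (H [::] hs) => //; apply: directions_cons => //; exact: directions_cons.
Qed.

Lemma jet_headD u v : E u -> E v ->
  T t x ((0, u + v) :: hs) = T t x ((0, u) :: hs) + T t x ((0, v) :: hs).
Proof.
move=> Eu Ev; have := @jet_head_combine (0, u) (0, v) 1 Eu Ev.
by rewrite /= mul1r addr0 rmorph1 !scale1r.
Qed.

Lemma jet_headZ (c : K) u : E u ->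
  T t x ((0, c *: u) :: hs) = c *: T t x ((0, u) :: hs).
Proof. by move=> Eu; have [_ _ H _ _] := T_jet t_ge0 Mx; exact: (H [::] hs). Qed.

Lemma jet_head0 : T t x ((0, 0) :: hs) = 0.
Proof. by have := jet_headZ 0 sE.1; rewrite !scale0r. Qed.

Lemma jet_head_sum (I : Type) (s : seq I) (P : pred I) (c : I -> K) (e : I -> X) :
  (forall i, P i -> E (e i)) ->
  T t x ((0, \sum_(i <- s | P i) c i *: e i) :: hs) =
  \sum_(i <- s | P i) c i *: T t x ((0, e i) :: hs).
Proof.
move=> Ee; elim: s => [|i s IH]; first by rewrite !big_nil jet_head0.
rewrite !big_cons; case: ifP => // Pi.
have Ei : E (c i *: e i) by apply: subspaceZ => //; exact: Ee.
rewrite jet_headD ?IH ?jet_headZ //; first exact: Ee.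
by apply: subspace_sum => // j Pj; apply: subspaceZ => //; exact: Ee.
Qed.

Lemma jet_head_split (a : R) u : E u ->
  T t x ((a, u) :: hs) = of_real a *: T t x ((1, 0) :: hs) + T t x ((0, u) :: hs).
Proof.
move=> Eu; have := @jet_head_combine (1, 0) (0, u) a sE.1 Eu.
by rewrite /= mulr1 addr0 scaler0 add0r.
Qed.

End head.

Lemma prod_pair_norm_ge0 (hs : seq (R * X)) : 0 <= \prod_(h <- hs) pair_norm h.
Proof. by apply: prodr_ge0 => h _; rewrite addr_ge0 ?nrm_ge0. Qed.

Lemma jet_bound t x j : 0 <= t -> M x -> (j <= m)%N -> exists2 C : R, 0 < C &
  forall hs, size hs = j -> directions E hs ->
    nrm (T t x hs) <= C * \prod_(h <- hs) pair_norm h.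
Proof.
move=> t0 Mx jm; have [_ _ _ /(_ j jm)[C HC] _] := T_jet t0 Mx.
exists (`|C| + 1); first by rewrite ltr_wpDl.
move=> hs hsj Ehs; apply: le_trans (HC hs hsj Ehs) _.
by apply: ler_wpM2r; [exact: prod_pair_norm_ge0 | have := ler_norm C; lra].
Qed.

Lemma jet_continuous t x j : 0 <= t -> M x -> (j <= m)%N ->
  forall e : R, 0 < e -> exists2 d : R, 0 < d & forall (t' : R) x', 0 <= t' -> M x' ->
    `|t' - t| + nrm (x' - x) < d -> forall hs, size hs = j -> directions E hs ->
    nrm (T t' x' hs - T t x hs) <= e * \prod_(h <- hs) pair_norm h.
Proof.
move=> t0 Mx; rewrite leq_eqVlt => /predU1P[->|jm] e e0.
  have [_ _ _ _ [_ /(_ e e0)[d d0 H]]] := T_jet t0 Mx.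
  by exists d => // t' x' t'0 Mx' tx hs; exact: H.
have [C C0 HC] := jet_bound t0 Mx jm.
have [_ _ _ _ [/(_ j jm 1 ltr01)[d d0 H] _]] := T_jet t0 Mx.
have C10 : 0 < C + 1 by rewrite ltr_wpDl // ltW.
exists (Num.min d (e / (C + 1))); first by rewrite lt_min d0 divr_gt0.
move=> t' x' t'0 Mx'; rewrite lt_min => /andP[tx]; rewrite ltr_pdivlMr // => txe hs hsj Ehs.
have := H t' x' t'0 Mx' tx hs hsj Ehs; rewrite mul1r.
have Ed : directions E ((t' - t, x' - x) :: hs).
  by apply: directions_cons => //; apply: subspaceB => //; exact: (open_in_sub M_open).
have := HC ((t' - t, x' - x) :: hs) (congr1 S hsj) Ed; rewrite big_cons.
set p := pair_norm _; set q := \prod_(h <- hs) _ => h1 h2.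
have q0 : 0 <= q by exact: prod_pair_norm_ge0.
have := nrm_le_dist (T t' x' hs - T t x hs) (T t x ((t' - t, x' - x) :: hs)).
have : p * (C + 1) * q <= e * q by apply: ler_wpM2r => //; exact: ltW.
lra.
Qed.

Lemma jet_partial t x : (0 < m)%N -> 0 <= t -> M x ->
  is_partial_x E M g t x (fun h => T t x [:: (0, h)]).
Proof.
move=> m0 t0 Mx; split.
  split=> [a u v Eu Ev|].
    have Eau : E (a *: u) by exact: subspaceZ.
    by rewrite jet_headD // jet_headZ.
  have [C C0 HC] := jet_bound t0 Mx m0; exists C => u Eu.
  have := HC [:: (0, u)] erefl (directions_cons (h := (0, u)) (s := [::]) Eu _).
  by rewrite big_seq1 /pair_norm /= normr0 add0r; apply.
move=> e e0; have [Tn _ _ _ [/(_ 0%N m0 e e0)[d d0 H] _]] := T_jet t0 Mx.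
exists d => // x' Mx' xx; have [Tn' _ _ _ _] := T_jet t0 Mx'.
have := H t x' t0 Mx'; rewrite /pair_norm /= subrr normr0 add0r => /(_ xx [::] erefl).
by rewrite Tn Tn' big_nil mulr1; apply.
Qed.

Lemma partial_x_jet t x h : (0 < m)%N -> 0 <= t -> M x -> E h ->
  partial_x E M g t x h = T t x [:: (0, h)].
Proof.
move=> m0 t0 Mx Eh; have TP := jet_partial m0 t0 Mx.
apply: (partial_unique (L' := fun h => T t x [:: (0, h)]) sE M_open Mx _ TP Eh).
by apply: partial_xP; exists (fun h => T t x [:: (0, h)]).
Qed.

Lemma jet_partially_differentiable : (0 < m)%N ->
  continuously_partially_differentiable half_line E M g.
Proof.
move=> m0; split=> [t x t0 Mx|t x t0 Mx e e0].
  by exists (fun h => T t x [:: (0, h)]); exact: jet_partial.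
have [d d0 H] := jet_continuous t0 Mx m0 e0; exists d => // t' x' t'0 Mx' tx h Eh.
rewrite !partial_x_jet //.
have := H t' x' t'0 Mx' tx [:: (0, h)] erefl.
by rewrite big_seq1 /pair_norm /= normr0 add0r; apply; exact: directions_cons.
Qed.

Section along_curves.
Variables (I : finType) (S : pred I) (e : I -> X) (zeta : I -> R -> K^o).
Hypothesis Ee : forall a, S a -> E (e a).
Let z t := \sum_(a | S a) (zeta a t : K) *: e a.
Hypothesis Mz : forall t : R, 0 <= t -> M (z t).

Lemma class_Cr_span r : (forall a, S a -> class_Cr r (zeta a)) -> class_Cr r z.
Proof.
move=> cz; apply: class_Cr_sum => a Sa; apply: class_CrZ; first exact: cz.
exact: class_Cr_cst.
Qed.

Lemma deriv_on_span (J : set R) t (zeta' : I -> K^o) :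
  (forall a, S a -> deriv_on J (zeta a) t (zeta' a)) ->
  deriv_on J z t (\sum_(a | S a) (zeta' a : K) *: e a).
Proof.
rewrite /z; elim: (index_enum I) => [|a s IH] dz.
  move=> eps eps0; exists 1 => // s _ _.
  by rewrite !big_nil subrr scaler0 subrr nrm0 mulr_ge0 // ltW.
case: (boolP (S a)) => Sa.
  have := deriv_onD (deriv_onZ (dz a Sa) (deriv_on_cst J (e a) t)) (IH dz).
  rewrite big_cons Sa scaler0 addr0; apply: deriv_on_eq => [u _|]; by rewrite big_cons Sa.
rewrite big_cons (negbTE Sa); apply: deriv_on_eq (IH dz) => [u _|];
  by rewrite big_cons (negbTE Sa).
Qed.

Lemma jet_class_Cr r hs : (forall a, S a -> class_Cr r (zeta a)) ->
  directions E hs -> (size hs + r <= m)%N -> class_Cr r (fun t => T t (z t) hs).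
Proof.
elim: r hs => [|r IH] hs cz Ehs hsm.
  move=> t t0 eps eps0; have q0 := prod_pair_norm_ge0 hs.
  have hsm' : (size hs <= m)%N by rewrite -[size hs]addn0.
  have e1 : 0 < eps / (\prod_(h <- hs) pair_norm h + 1).
    by rewrite divr_gt0 // ltr_wpDl.
  have [d d0 H] := jet_continuous t0 (Mz t0) hsm' e1.
  have d2 : 0 < d / 2 by rewrite divr_gt0.
  have [d' d'0 H'] := class_Cr_cont (class_Cr_span cz) t0 d2.
  exists (Num.min (d / 2) d'); first by rewrite lt_min d2.
  move=> s s0; rewrite lt_min => /andP[sd /(H' s s0) zd].
  have szd : `|s - t| + nrm (z s - z t) < d by lra.
  apply: le_lt_trans (H s (z s) s0 (Mz s0) szd hs erefl Ehs) _.
  rewrite mulrAC ltr_pdivrMr ?ltr_wpDl // ltr_pM2l // ltrDl //.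
have hsm' : (size hs < m)%N by apply: leq_trans hsm; rewrite addnS ltnS leq_addr.
have cz' a : exists z', S a ->
    (forall t : R, 0 <= t -> deriv_on half_line (zeta a) t (z' t)) /\ class_Cr r z'.
  have [/cz[z' dz cz']|_] := boolP (S a); first by exists z'.
  by exists (zeta a).
have {cz'} [zeta' z'P] := choice cz'.
pose z' t := \sum_(a | S a) (zeta' a t : K) *: e a.
have Ez' t : E (z' t).
  by apply: subspace_sum => // a Sa; apply: subspaceZ => //; exact: Ee.
have Ez t : E (z t).
  by apply: subspace_sum => // a Sa; apply: subspaceZ => //; exact: Ee.
have dz t : 0 <= t -> deriv_on half_line z t (z' t).
  by move=> t0; apply: deriv_on_span => a Sa; apply: (z'P a Sa).1.
exists (fun t => T t (z t) ((1, z' t) :: hs)); last first.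
  apply: (class_Cr_eq (u := fun t => T t (z t) ((1, 0) :: hs) +
     \sum_(a | S a) (zeta' a t : K) *: T t (z t) ((0, e a) :: hs))).
    move=> t t0; rewrite [RHS]jet_head_split ?rmorph1 ?scale1r //; last exact: Mz.
    by rewrite jet_head_sum //; exact: Mz.
  have czr a : S a -> class_Cr r (zeta a) by move=> /cz; exact: class_CrW.
  have hsm1 : ((size hs).+1 + r <= m)%N by rewrite addSn -addnS.
  apply: class_CrD.
    by apply: IH => //; apply: directions_cons => //; exact: sE.1.
  apply: class_Cr_sum => a Sa; apply: class_CrZ; first by have [] := z'P a Sa.
  by apply: IH => //; apply: directions_cons => //; exact: Ee.
move=> t t0 eps eps0.
have q0 := prod_pair_norm_ge0 hs; set q := \prod_(h <- hs) pair_norm h in q0.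
have [C C0 HC] := jet_bound t0 (Mz t0) hsm'.
have n0 := nrm_ge0 (z' t).
pose B := (nrm (z' t) + 2 + C) * q + 1.
have B0 : 0 < B by rewrite ltr_wpDl // mulr_ge0 //; lra.
have [e1 [e10 e11 e1B]] : exists e1 : R, [/\ 0 < e1, e1 <= 1 & e1 * B <= eps].
  exists (Num.min 1 (eps / B)); split.
  - by rewrite lt_min ltr01 divr_gt0.
  - by rewrite ge_min lexx.
  - by rewrite -ler_pdivlMr // ge_min lexx orbT.
have [_ _ _ _ [/(_ (size hs) hsm' e1 e10)[d d0 H] _]] := T_jet t0 (Mz t0).
have [d1 d10 H1] := dz t t0 _ e10.
have c0 : 0 < nrm (z' t) + 2 by lra.
exists (Num.min d1 (d / (nrm (z' t) + 2))); first by rewrite lt_min d10 divr_gt0.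
move=> s s0; rewrite lt_min => /andP[/(H1 s s0) h1]; rewrite ltr_pdivlMr // => sd.
have a0 := normr_ge0 (s - t).
have zst : nrm (z s - z t) <= (nrm (z' t) + 1) * `|s - t|.
  have := nrm_le_dist (z s - z t) (of_real (s - t) *: z' t); rewrite nrmZr.
  have := ler_wpM2r a0 e11; lra.
have pn : pair_norm (s - t, z s - z t) <= (nrm (z' t) + 2) * `|s - t|.
  by rewrite /pair_norm /=; lra.
have pnd : pair_norm (s - t, z s - z t) < d.
  by apply: le_lt_trans pn _; rewrite mulrC.
have h2 := H s (z s) s0 (Mz s0) pnd hs erefl Ehs; rewrite -/q in h2.
set w := z s - z t - of_real (s - t) *: z' t in h1.
have Ew : E w by apply: subspaceB; [|exact: subspaceB|exact: subspaceZ].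
have -> : T s (z s) hs - T t (z t) hs - of_real (s - t) *: T t (z t) ((1, z' t) :: hs) =
  (T s (z s) hs - T t (z t) hs - T t (z t) ((s - t, z s - z t) :: hs)) +
  T t (z t) ((0, w) :: hs).
  have := jet_head_combine t0 (Mz t0) hsm' Ehs (h := (1, z' t)) (h' := (0, w)) (s - t) (Ez' t) Ew.
  rewrite /= mulr1 addr0 (_ : _ *: z' t + w = z s - z t); last first.
    by rewrite /w; vec (scalars R k).
  by move=> ->; vec (scalars R k).
apply: le_trans (nrmD _ _) _.
have := HC ((0, w) :: hs) erefl (directions_cons (h := (0, w)) Ew Ehs).
rewrite big_cons -/q /pair_norm /= normr0 add0r => h3.
have h4 : C * (nrm w * q) <= C * (e1 * `|s - t| * q).
  by apply: ler_wpM2l; [exact: ltW | exact: ler_wpM2r].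
have h5 : e1 * pair_norm (s - t, z s - z t) * q <= e1 * ((nrm (z' t) + 2) * `|s - t|) * q.
  by apply: ler_wpM2r => //; apply: ler_wpM2l => //; exact: ltW.
have := ler_wpM2r a0 e1B; rewrite /B.
have : 0 <= e1 * `|s - t| by rewrite mulr_ge0 // ltW.
lra.
Qed.

End along_curves.

End jets.

Section small_remainders.
Context {R : realType}.
Variables (t : R) (H : R -> R).
Hypothesis H_ge0 : forall s, 0 <= H s.

Definition small_rem (phi : R -> R) : Prop := forall e : R, 0 < e ->
  exists2 d : R, 0 < d & forall s : R, 0 <= s -> `|s - t| < d ->
    phi s <= e * (`|s - t| + H s).

Lemma small_rem_le phi psi : small_rem psi ->
  (forall s : R, 0 <= s -> phi s <= psi s) -> small_rem phi.
Proof.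
move=> sp pp e /sp[d d0 Hd]; exists d => // s s0 sd.
by apply: le_trans (pp s s0) (Hd s s0 sd).
Qed.

Lemma small_remD phi psi : small_rem phi -> small_rem psi ->
  small_rem (fun s => phi s + psi s).
Proof.
move=> sp sq e e0; have e2 : 0 < e / 2 by rewrite divr_gt0.
have [d d0 Hd] := sp _ e2; have [d' d'0 Hd'] := sq _ e2.
exists (Num.min d d'); first by rewrite lt_min d0.
move=> s s0; rewrite lt_min => /andP[/(Hd s s0) h /(Hd' s s0) h'].
by apply: le_trans (lerD h h') _; rewrite -mulrDl -splitr.
Qed.

Lemma small_remZ phi (C : R) : 0 <= C -> small_rem phi ->
  small_rem (fun s => C * phi s).
Proof.
move=> C0 sp e e0; have C1 : 0 < C + 1 by rewrite ltr_wpDl.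
have [d d0 Hd] := sp _ (divr_gt0 e0 C1).
exists d => // s s0 sd; apply: le_trans (ler_wpM2l C0 (Hd s s0 sd)) _.
rewrite !mulrA; apply: ler_wpM2r; first by rewrite addr_ge0.
by rewrite ler_pdivrMr // mulrC ler_wpM2l ?lerDl // ltW.
Qed.

Lemma small_rem_sum (I : Type) (s : seq I) (P : pred I) (phi : I -> R -> R) :
  (forall i, P i -> small_rem (phi i)) ->
  small_rem (fun u => \sum_(i <- s | P i) phi i u).
Proof.
move=> sp; elim: s => [|i s IH].
  move=> e e0; exists 1 => // u _ _; rewrite big_nil mulr_ge0 ?addr_ge0 //.
  exact: ltW.
have [Pi|Pi] := boolP (P i).
  apply: small_rem_le (small_remD (sp i Pi) IH) _ => u _.
  by rewrite big_cons Pi.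
by apply: small_rem_le IH _ => u _; rewrite big_cons (negbTE Pi).
Qed.

Lemma small_rem_absorb : small_rem H -> forall e : R, 0 < e ->
  exists2 d : R, 0 < d & forall s : R, 0 <= s -> `|s - t| < d ->
    H s <= e * `|s - t|.
Proof.
move=> sH e e0; have m0 : 0 < Num.min (1 / 2) (e / 2) by rewrite lt_min !divr_gt0.
have [d d0 Hd] := sH _ m0; exists d => // s s0 sd.
have := Hd s s0 sd; have hs := H_ge0 s; have a0 := normr_ge0 (s - t).
have m1 : Num.min (1 / 2) (e / 2) <= 1 / 2 by rewrite ge_min lexx.
have m2 : Num.min (1 / 2) (e / 2) <= e / 2 by rewrite ge_min lexx orbT.
rewrite mulrDr; have := ler_wpM2r hs m1; have := ler_wpM2r a0 m2; lra.
Qed.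

End small_remainders.

Lemma nrm_deriv_small (R : realType) (k : scalar_kind)
    (V : normedModType (scalars R k)) (u : R -> V) (t : R) (l : V) (H : R -> R) :
  (forall s, 0 <= H s) -> deriv_on half_line u t l ->
  small_rem t H (fun s => nrm (u s - u t - of_real (s - t) *: l)).
Proof.
move=> H0 du e e0; have [d d0 Hd] := du e e0; exists d => // s s0 sd.
by apply: le_trans (Hd s s0 sd) _; rewrite ler_wpM2l ?lerDl // ltW.
Qed.

Section implicit_curves.
Context {R : realType} {k : scalar_kind} {X Y : normedModType (scalars R k)}.
Local Notation K := (scalars R k).
Variables (m : nat) (E M : set X) (g : R -> X -> Y).
Variable T : R -> X -> seq (R * X) -> Y.
Hypothesis sE : subspace E.
Hypothesis M_open : open_in E M.
Hypothesis T_jet : is_jet m half_line E M g T.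
Variables (I : finType) (S delta : pred I) (e : I -> X) (q : I -> Y -> K).
Variables (zeta rho : I -> R -> K^o).
Hypothesis m_gt0 : (0 < m)%N.
Hypothesis deltaS : forall a, delta a -> S a.
Hypothesis Ee : forall a, S a -> E (e a).
Hypothesis q_bounded : forall a, delta a -> bounded_functional (q a).
Let z t := \sum_(a | S a) (zeta a t : K) *: e a.
Hypothesis Mz : forall t : R, 0 <= t -> M (z t).
Hypothesis zeta_known : forall a, S a -> ~~ delta a -> class_Cr m (zeta a).
Hypothesis zeta_cont : forall a, delta a -> cont_on half_line (zeta a).
Hypothesis rho_class : forall a, delta a -> class_Cr m (rho a).
Hypothesis zeta_eq : forall (t : R) a, 0 <= t -> delta a ->
  q a (g t (z t)) = (zeta a t : K) + rho a t.
Hypothesis nondegenerate : forall (t : R) (c : I -> K), 0 <= t ->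
  (forall a, delta a ->
     \sum_(b | delta b) c b * q a (T t (z t) [:: (0, e b)]) = c a) ->
  forall a, delta a -> c a = 0.

Let sT : subspace (setT : set Y). Proof. by split. Qed.

Let q_linear a (da : delta a) :
  bounded_linear_on (@nrm R k Y) (@nrm R k K^o) setT (q a : Y -> K^o) :=
  q_bounded da.

Let J t a b : K := q a (T t (z t) [:: (0, e b)]).
Let J0 t a : K := q a (T t (z t) [:: (1, 0)]).

Let B t : 'M[K]_#|I| := \matrix_(i, j)
  ((if delta (enum_val i) && delta (enum_val j)
    then J t (enum_val j) (enum_val i) else 0) - (i == j)%:R).

Let mulB (t : R) (v : I -> K) b :
  (\row_i (if delta (enum_val i) then v (enum_val i) else 0) *m B t) 0 (enum_rank b) =
  (if delta b then \sum_(a | delta a) v a * J t b a - v b else 0).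
Proof.
rewrite !mxE.
under eq_bigr do rewrite !mxE mulrBr enum_rankK.
rewrite sumrB [X in _ - X](bigD1 (enum_rank b)) //= eqxx mulr1 enum_rankK.
rewrite [X in _ - (_ + X)]big1 ?addr0; last first.
  by move=> i /negbTE->; rewrite mulr0.
case: ifP => db; last first.
  by rewrite subr0 big1 // => i _; rewrite andbF mulr0.
congr (_ - _); rewrite (reindex_onto (enum_rank (T := I)) enum_val) /=; last first.
  by move=> i _; exact: enum_valK.
rewrite [RHS]big_mkcond /=; apply: eq_big => [a|a _].
  by rewrite enum_rankK eqxx.
by rewrite enum_rankK; case: ifP => // da; rewrite ?andbT // mul0r.
Qed.

Let B_unit t : 0 <= t -> B t \in unitmx.
Proof.
move=> t0; rewrite -row_free_unit -kermx_eq0; apply/rowV0P => v /sub_kermxP vB.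
pose c a := v 0 (enum_rank a).
have c_out a : ~~ delta a -> c a = 0.
  move=> da; have := congr1 (fun w : 'rV_#|I| => w 0 (enum_rank a)) vB.
  rewrite !mxE (bigD1 (enum_rank a)) //= !mxE eqxx enum_rankK (negbTE da) andbF.
  rewrite big1 ?addr0.
    by rewrite sub0r mulrN1 => /eqP; rewrite oppr_eq0 => /eqP.
  by move=> i /negbTE ia; rewrite !mxE ia enum_rankK (negbTE da) andbF subrr mulr0.
have vE : v = \row_i (if delta (enum_val i) then c (enum_val i) else 0).
  apply/rowP => i; rewrite !mxE; case: ifP => di; first by rewrite /c enum_valK.
  by rewrite -[i in v 0 i]enum_valK -/(c _) c_out // di.
have c_in a : delta a -> c a = 0.
  apply: (nondegenerate t0) => b db.
  have := mulB t c b; rewrite -vE vB mxE db => /esym/eqP.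
  by rewrite subr_eq0 => /eqP.
apply/rowP => i; rewrite !mxE -{1}(enum_valK i) -/(c _).
by case: (boolP (delta (enum_val i))) => [/c_in|/c_out].
Qed.

Let qD a (da : delta a) u v : q a (u + v) = q a u + q a v.
Proof. exact: (bounded_linearD (q_linear da)). Qed.
Let qZ a (da : delta a) (c : K) u : q a (c *: u) = c * q a u.
Proof. exact: (bounded_linearZ sT (q_linear da)). Qed.
Let qB a (da : delta a) u v : q a (u - v) = q a u - q a v.
Proof. exact: (bounded_linearB sT (q_linear da)). Qed.
Let q_sum a (da : delta a) (P : pred I) (F : I -> Y) :
  q a (\sum_(i | P i) F i) = \sum_(i | P i) q a (F i).
Proof. exact: (bounded_linear_sum sT (q_linear da)). Qed.

Let q_class r a (F : R -> Y) : delta a -> class_Cr r F ->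
  class_Cr r (fun t => q a (F t) : K^o).
Proof.
move=> da; have [C C0 HC] := bounded_linear_bound (q_linear da).
elim: r F => [|r IH] F.
  move=> cF t t0 eps eps0; have [d d0 H] := cF t t0 _ (divr_gt0 eps0 C0).
  exists d => // s s0 sd; rewrite -qB //; apply: le_lt_trans (HC _ Logic.I) _.
  by have := H s s0 sd; rewrite ltr_pdivlMr // mulrC.
move=> [F' dF cF']; exists (fun t => q a (F' t)); last exact: IH.
move=> t t0 eps eps0; have [d d0 H] := dF t t0 _ (divr_gt0 eps0 C0).
exists d => // s s0 sd.
have -> : q a (F s) - q a (F t) - of_real (s - t) *: (q a (F' t) : K^o) =
  q a (F s - F t - of_real (s - t) *: F' t) by rewrite !qB // qZ.
apply: le_trans (HC _ Logic.I) _; have := ler_wpM2l (ltW C0) (H s s0 sd).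
by rewrite (_ : C * (eps / C * _) = eps * `|s - t|) //; field; rewrite gt_eqF.
Qed.

Lemma implicit_class_Cr a : delta a -> class_Cr m (zeta a).
Proof.
have zeta_known' b : exists c, S b -> ~~ delta b ->
    (forall t : R, 0 <= t -> deriv_on half_line (zeta b) t (c t)) /\ class_Cr m.-1 c.
  have [Sb|_] := boolP (S b); last by exists (zeta b).
  have [_|db] := boolP (delta b); first by exists (zeta b).
  have := zeta_known Sb db; rewrite -[m in class_Cr m](prednK m_gt0).
  by move=> [c dc cc]; exists c.
have [zeta' zeta'P] := choice zeta_known'.
have rho_class' b : exists c, delta b ->
    (forall t : R, 0 <= t -> deriv_on half_line (rho b) t (c t)) /\ class_Cr m.-1 c.
  have [db|_] := boolP (delta b); last by exists (rho b).
  have := rho_class db; rewrite -[m in class_Cr m](prednK m_gt0).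
  by move=> [c dc cc]; exists c.
have [rho' rho'P] := choice rho_class'.
pose rhs t b : K := if delta b then
  rho' b t - J0 t b - \sum_(c | S c && ~~ delta c) zeta' c t * J t b c else 0.
pose y t b : K := ((\row_i rhs t (enum_val i)) *m invmx (B t)) 0 (enum_rank b).
have yE (t : R) b : 0 <= t -> delta b ->
    \sum_(c | delta c) y t c * J t b c - y t b = rhs t b.
  move=> t0 db; have := mulB t (y t) b; rewrite db => <-.
  have [w wB yw] : exists2 w : 'rV[K]_#|I|, w *m B t = \row_i rhs t (enum_val i) &
      forall c, y t c = w 0 (enum_rank c).
    by exists (\row_i rhs t (enum_val i) *m invmx (B t)); rewrite ?mulmxKV ?B_unit.
  have -> : \row_i (if delta (enum_val i) then y t (enum_val i) else 0) = w.
    apply/rowP => i; rewrite mxE; case: ifP => di; first by rewrite yw enum_valK.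
    have := congr1 (fun v : 'rV_#|I| => v 0 i) wB.
    rewrite !mxE (bigD1 i) //= mxE eqxx di andbF big1 ?addr0.
      have -> : rhs t (enum_val i) = 0 by rewrite /rhs di.
      by rewrite sub0r mulrN1 => /eqP; rewrite oppr_eq0 => /eqP ->.
    by move=> j /negbTE ji; rewrite mxE ji di andbF subrr mulr0.
  by rewrite wB mxE enum_rankK.
have dzeta (t : R) b : 0 <= t -> delta b -> deriv_on half_line (zeta b) t (y t b).
  move=> t0 db.
  pose eta c s : K^o := (zeta c s - zeta c t - of_real (s - t) * y t c : K^o).
  pose H s := \sum_(c | delta c) nrm (eta c s).
  have H0 s : 0 <= H s by apply: sumr_ge0 => c _; exact: nrm_ge0.
  pose Rm s := g s (z s) - g t (z t) - T t (z t) [:: (s - t, z s - z t)].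
  have cz : cont_on half_line z.
    apply: (@class_Cr_cont R k X 0); apply: class_Cr_span => c Sc.
    have [dc|dc] := boolP (delta c); first exact: zeta_cont.
    exact: (class_Cr_cont (zeta_known Sc dc)).
  pose N c := nrm (if delta c then y t c else zeta' c t : K^o).
  pose C1 := 1 + \sum_(c | S c) (N c + 1) * nrm (e c).
  have C10 : 0 < C1.
    by rewrite ltr_pwDl // sumr_ge0 // => c _; rewrite mulr_ge0 ?addr_ge0 ?nrm_ge0.
  have z_big : exists2 d : R, 0 < d & forall s : R, 0 <= s -> `|s - t| < d ->
      `|s - t| + nrm (z s - z t) <= C1 * (`|s - t| + H s).
    have : exists2 d : R, 0 < d & forall s : R, 0 <= s -> `|s - t| < d ->
        forall c, S c -> nrm (zeta c s - zeta c t) <= (N c + 1) * (`|s - t| + H s).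
      have sk : small_rem t H (fun s => \sum_(c | S c && ~~ delta c)
          nrm (zeta c s - zeta c t - of_real (s - t) *: zeta' c t)).
        apply: small_rem_sum => // c /andP[Sc dc]; apply: nrm_deriv_small => //.
        by have [dz _] := zeta'P c Sc dc; exact: dz.
      have [d d0 Hd] := sk 1 ltr01.
      exists d => // s s0 sd c Sc; have a0 := normr_ge0 (s - t); have Hs := H0 s.
      suff: nrm (zeta c s - zeta c t) <= `|s - t| + H s + N c * `|s - t|.
        move=> h; apply: le_trans h _; have := mulr_ge0 (nrm_ge0 _ : 0 <= N c) Hs.
        by rewrite mulrDl mul1r mulrDr; lra.
      have dist (l : K^o) : nrm (zeta c s - zeta c t) <=
          `|s - t| * nrm l + nrm (zeta c s - zeta c t - of_real (s - t) *: l).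
        by rewrite -nrmZr; exact: nrm_le_dist.
      rewrite /N; have [dc|dc] := boolP (delta c).
        apply: le_trans (dist (y t c)) _; rewrite addrC [_ * nrm _]mulrC.
        apply: lerD => //; apply: (@le_trans _ _ (H s)); last by rewrite lerDr.
        rewrite /H (bigD1 c) //= lerDl sumr_ge0 // => c' _; exact: nrm_ge0.
      apply: le_trans (dist (zeta' c t)) _; rewrite addrC [_ * nrm _]mulrC.
      apply: lerD => //; have := Hd s s0 sd; rewrite mul1r; apply: le_trans.
      rewrite (bigD1 c) ?Sc //= lerDl sumr_ge0 // => c' _; exact: nrm_ge0.
    move=> [d d0 Hd]; exists d => // s s0 sd; have := Hd s s0 sd => {}Hd.
    have a0 : 0 <= `|s - t| + H s by rewrite addr_ge0.
    have -> : z s - z t = \sum_(c | S c) (zeta c s - zeta c t : K) *: e c.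
      by rewrite /z -sumrB; apply: eq_bigr => c _; rewrite scalerBl.
    rewrite mulrDl mul1r; apply: lerD; first by rewrite lerDl.
    apply: le_trans (nrm_sum _ _ _) _; rewrite mulr_suml; apply: ler_sum => c Sc.
    by rewrite nrmZ mulrAC; apply: ler_wpM2r; [exact: nrm_ge0 | exact: Hd].
  have sRm : small_rem t H (fun s => nrm (Rm s)).
    move=> eps eps0; have [d1 d10 Hd1] := z_big.
    have [Tt _ _ _ [/(_ 0%N m_gt0 _ (divr_gt0 eps0 C10))[d2 d20 Hd2] _]] := T_jet t0 (Mz t0).
    have d22 : 0 < d2 / 2 by rewrite divr_gt0.
    have [d3 d30 Hd3] := cz t t0 _ d22.
    exists (Num.min d1 (Num.min (d2 / 2) d3)); first by rewrite !lt_min d10 d22.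
    move=> s s0; rewrite !lt_min => /and3P[/(Hd1 s s0) h1 sd2 /(Hd3 s s0) h3].
    have [Ts _ _ _ _] := T_jet s0 (Mz s0).
    have pn : pair_norm (s - t, z s - z t) < d2 by rewrite /pair_norm /=; lra.
    have := Hd2 s (z s) s0 (Mz s0) pn [::] erefl; rewrite Ts Tt big_nil mulr1.
    move=> h; apply: le_trans (h _) _ => //.
    apply: le_trans (ler_wpM2l _ h1) _; first by rewrite divr_ge0 // ltW.
    by rewrite mulrA divfK // gt_eqF.
  pose r c s : K^o := (rho c s - rho c t - of_real (s - t) * rho' c t) -
    \sum_(c' | S c' && ~~ delta c') (zeta c' s - zeta c' t - of_real (s - t) * zeta' c' t) * J t c c'
    - q c (Rm s).
  have rE s c : 0 <= s -> delta c ->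
      \sum_(c' | delta c') eta c' s * J t c c' - eta c s = r c s.
    move=> s0 dc; rewrite /r /Rm !qB // (zeta_eq s0 dc) (zeta_eq t0 dc).
    have zsz : z s - z t = \sum_(c' | S c') (zeta c' s - zeta c' t : K) *: e c'.
      by rewrite /z -sumrB; apply: eq_bigr => c' _; rewrite scalerBl.
    have Ez u : E (z u).
      by apply: subspace_sum => // c' Sc'; apply: subspaceZ => //; exact: Ee.
    have Hn : directions E [::] by [].
    rewrite (jet_head_split sE T_jet t0 (Mz t0) _ Hn) ?zsz //; last first.
      by rewrite -zsz; exact: subspaceB.
    rewrite (jet_head_sum sE T_jet t0 (Mz t0) _ Hn) //.
    rewrite qD // qZ // q_sum // -/(J0 t c).
    have -> : \sum_(c' | S c') q c ((zeta c' s - zeta c' t : K) *: T t (z t) [:: (0, e c')]) =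
      \sum_(c' | delta c') (zeta c' s - zeta c' t : K) * J t c c' +
      \sum_(c' | S c' && ~~ delta c') (zeta c' s - zeta c' t : K) * J t c c'.
      rewrite (bigID delta) /=; congr (_ + _); last by apply: eq_bigr => c' _; rewrite qZ.
      apply: eq_big => [c'|c' _]; last by rewrite qZ.
      by have := @deltaS c'; case: (delta c') => [->|_] //; rewrite andbF.
    have := yE t c t0 dc; rewrite /rhs dc.
    have -> : \sum_(c' | delta c') eta c' s * J t c c' =
      \sum_(c' | delta c') (zeta c' s - zeta c' t : K) * J t c c' -
      of_real (s - t) * \sum_(c' | delta c') y t c' * J t c c'.
      by rewrite mulr_sumr -sumrB; apply: eq_bigr => c' _; rewrite /eta mulrBl mulrA.
    have -> : \sum_(c' | S c' && ~~ delta c')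
        (zeta c' s - zeta c' t - of_real (s - t) * zeta' c' t) * J t c c' =
      \sum_(c' | S c' && ~~ delta c') (zeta c' s - zeta c' t : K) * J t c c' -
      of_real (s - t) * \sum_(c' | S c' && ~~ delta c') zeta' c' t * J t c c'.
      by rewrite mulr_sumr -sumrB; apply: eq_bigr => c' _; rewrite mulrBl mulrA.
    set SA := \sum_(c' | delta c') (zeta c' s - _) * _.
    set SB := \sum_(c' | _ && _) (zeta c' s - _) * _.
    set SC := \sum_(c' | _ && _) zeta' c' t * _.
    set SD := \sum_(c' | _) y t c' * _.
    move=> yc; have {yc} -> : SD = y t c + (rho' c t - J0 t c - SC) by rewrite -yc; ring.
    by rewrite /eta; set D := of_real (s - t); ring.
  have sr c : delta c -> small_rem t H (fun s => nrm (r c s)).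
    move=> dc; have [C C0 HC] := bounded_linear_bound (q_linear dc).
    have s1 : small_rem t H (fun s => nrm (rho c s - rho c t - of_real (s - t) *: rho' c t)).
      by apply: nrm_deriv_small => //; have [dr _] := rho'P c dc; exact: dr.
    have s2 : small_rem t H (fun s => \sum_(c' | S c' && ~~ delta c') nrm (J t c c' : K^o) *
        nrm (zeta c' s - zeta c' t - of_real (s - t) *: zeta' c' t)).
      apply: small_rem_sum => // c' /andP[Sc' dc'].
      apply: small_remZ => //; first exact: nrm_ge0.
      apply: nrm_deriv_small => //.
      by have [dz _] := zeta'P c' Sc' dc'; exact: dz.
    have s3 := small_remZ H0 (ltW C0) sRm.
    apply: small_rem_le (small_remD (small_remD s1 s2) s3) _ => s s0.
    rewrite /r; apply: le_trans (nrmB _ _) _; apply: lerD; last exact: HC.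
    apply: le_trans (nrmB _ _) _; apply: lerD => //.
    apply: le_trans (nrm_sum _ _ _) _; apply: ler_sum => c' _.
    by rewrite nrm_scalarM mulrC.
  have sH : small_rem t H H.
    have etaE s c : 0 <= s -> delta c ->
        eta c s = (\row_i (if delta (enum_val i) then r (enum_val i) s else 0) *m
          invmx (B t)) 0 (enum_rank c).
      move=> s0 dc.
      have <- : \row_i (if delta (enum_val i) then eta (enum_val i) s else 0) *m B t =
          \row_i (if delta (enum_val i) then r (enum_val i) s else 0).
        apply/rowP => i; rewrite -[i in LHS]enum_valK (mulB t (eta^~ s)) [RHS]mxE.
        by case: ifP => // di; rewrite rE.
      by rewrite mulmxK ?B_unit // mxE enum_rankK dc.
    apply: (small_rem_le (psi := fun s => \sum_(c | delta c) \sum_i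
        nrm (invmx (B t) i (enum_rank c) : K^o) *
        (if delta (enum_val i) then nrm (r (enum_val i) s) else 0))).
      apply: small_rem_sum => // c dc; apply: small_rem_sum => // i _.
      apply: small_remZ => //; first exact: nrm_ge0.
      case: (boolP (delta (enum_val i))) => [/sr//|_].
      move=> eps eps0; exists 1 => // s _ _; rewrite mulr_ge0 ?addr_ge0 //; exact: ltW.
    move=> s s0; apply: ler_sum => c dc; rewrite (etaE s c s0 dc) mxE.
    apply: le_trans (nrm_sum _ _ _) _; apply: ler_sum => i _.
    rewrite mxE nrm_scalarM mulrC; apply: ler_wpM2l; first exact: nrm_ge0.
    by case: ifP => // _; rewrite nrm0.
  move=> eps eps0; have [d d0 Hd] := small_rem_absorb H0 sH eps0.
  exists d => // s s0 sd; apply: le_trans _ (Hd s s0 sd).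
  rewrite /H (bigD1 b) //= lerDl sumr_ge0 // => c _; exact: nrm_ge0.
suff: forall r, (r <= m)%N -> forall b, delta b -> class_Cr r (zeta b).
  by move=> H da; exact: (H m).
elim=> [_ b db|r IH rm b db]; first exact: zeta_cont.
exists (fun t => y t b); first by move=> t t0; exact: dzeta.
have cz c : S c -> class_Cr r (zeta c).
  move=> Sc; have [dc|dc] := boolP (delta c); first by apply: IH => //; exact: ltnW.
  by apply: class_Cr_le (zeta_known Sc dc); exact: ltnW.
have rm1 : (r <= m.-1)%N by rewrite -ltnS (prednK m_gt0).
have cJ c c' : delta c -> S c' -> class_Cr r (fun t => J t c c' : K^o).
  move=> dc Sc'; apply: q_class => //.
  apply: (jet_class_Cr sE M_open T_jet Ee Mz cz) => //.
  by move=> h; rewrite inE => /eqP->; exact: Ee.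
have cJ0 c : delta c -> class_Cr r (fun t => J0 t c : K^o).
  move=> dc; apply: q_class => //.
  apply: (jet_class_Cr sE M_open T_jet Ee Mz cz) => //.
  by move=> h; rewrite inE => /eqP->; exact: sE.1.
have crhs c : class_Cr r (fun t => rhs t c : K^o).
  rewrite /rhs; case: (boolP (delta c)) => dc; last exact: class_Cr_cst.
  apply: class_CrB.
    apply: class_CrB; last exact: cJ0.
    by apply: class_Cr_le rm1 _; have [] := rho'P c dc.
  apply: class_Cr_sum => c' /andP[Sc' dc']; apply: class_CrM; last exact: cJ.
  by apply: class_Cr_le rm1 _; have [] := zeta'P c' Sc' dc'.
have cB i j : class_Cr r (fun t => B t i j : K^o).
  apply: (class_Cr_eq (u := fun t => ((if delta (enum_val i) && delta (enum_val j)
    then J t (enum_val j) (enum_val i) else 0) - (i == j)%:R : K^o))).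
    by move=> t _; rewrite mxE.
  apply: class_CrB; last exact: class_Cr_cst.
  case: (boolP (delta (enum_val i) && delta (enum_val j))) => [/andP[di dj]|_].
    by apply: cJ => //; exact: deltaS.
  exact: class_Cr_cst.
apply: (class_Cr_eq (u := fun t => \sum_i rhs t (enum_val i) * invmx (B t) i (enum_rank b) : K^o)).
  by move=> t _; rewrite /y mxE; apply: eq_bigr => i _; rewrite mxE.
apply: class_Cr_sum => i _; apply: class_CrM => //.
by apply: class_Cr_invmx => // t t0; exact: B_unit.
Qed.

End implicit_curves.

Record pencil_setting (R : realType) (k : scalar_kind)
    (X Y : completeNormedModType (scalars R k)) (p : pencil X Y) : Prop := PencilSetting {
  setting_linA : linear_operator (opA p);
  setting_linB : linear_operator (opB p);
  setting_domAB : dom (opA p) `<=` dom (opB p);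
  setting_roots : canonical_root_system p
}.

(** * Root vectors and projectors *)

Section pencil_structure.
Context {R : realType} {k : scalar_kind} {X Y : completeNormedModType (scalars R k)}.
Variable p : pencil X Y.
Local Notation K := (scalars R k).
Local Notation A := (opA p).
Local Notation B := (opB p).
Local Notation nu := (pencil_index p).
Local Notation n := (dim_ker p).
Local Notation D := (domD p).
Local Notation rk := (@root_rank R k X Y p).

(* The pair [(i, s)] stands for the root vector with indices [i] and [s + 1];
   only [s < root_rank i] is meaningful. *)
Local Notation I := ('I_n * 'I_nu)%type.

Implicit Types (a b : I) (S : pred I) (x u v : X).

Definition valid (a : I) : bool := (a.2 < rk a.1)%N.
Definition phi (a : I) : X := root_phi a.1 a.2.+1.
Definition qf (a : I) : Y -> K := root_q a.1 a.2.+1.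
Definition coef (a : I) : X -> K := adjoint B (qf a).
Definition proj (S : pred I) (x : X) : X := \sum_(a | valid a && S a) coef a x *: phi a.
Definition projQ (S : pred I) (y : Y) : Y := \sum_(a | valid a && S a) qf a y *: B (phi a).

Hypothesis hp : pencil_setting p.
Let linA := setting_linA hp.
Let linB := setting_linB hp.
Let domAB := setting_domAB hp.
Let roots := setting_roots hp.

Lemma domDE : D = dom A.
Proof. by apply/seteqP; split=> x; [case | move=> Dx; split=> //; exact: domAB]. Qed.

Lemma rk_bounds i : (1 <= rk i <= nu)%N.
Proof. by have [_ [H _] _ _ _] := roots. Qed.

Lemma valid_bounds a : valid a -> (1 <= a.2.+1 <= rk a.1)%N.
Proof. by []. Qed.

Lemma D_subspace : subspace D.
Proof. by rewrite domDE; have [D0 DL _] := linA. Qed.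

Lemma A_lin (c : K) u v : D u -> D v -> A (c *: u + v) = c *: A u + A v.
Proof. by rewrite domDE; have [_ _ AL] := linA; exact: AL. Qed.

Lemma B_lin (c : K) u v : D u -> D v -> B (c *: u + v) = c *: B u + B v.
Proof. by move=> [_ Bu] [_ Bv]; have [_ _ BL] := linB; exact: BL. Qed.

Lemma phi_D a : valid a -> D (phi a).
Proof. by move=> va; have [_ _ [H _] _ _] := roots; exact/H/valid_bounds. Qed.

Section linear_on_D.
Variable T : X -> Y.
Hypothesis TL : forall (c : K) u v, D u -> D v -> T (c *: u + v) = c *: T u + T v.

Lemma linD0 : T 0 = 0.
Proof.
have := TL (-1) D_subspace.1 D_subspace.1.
by rewrite scaler0 addr0 scaleN1r addNr.
Qed.

Lemma linDD u v : D u -> D v -> T (u + v) = T u + T v.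
Proof. by move=> Du Dv; have := TL 1 Du Dv; rewrite !scale1r. Qed.

Lemma linDZ c u : D u -> T (c *: u) = c *: T u.
Proof. by move=> Du; have := TL c Du D_subspace.1; rewrite linD0 !addr0. Qed.

Lemma linDB u v : D u -> D v -> T (u - v) = T u - T v.
Proof.
move=> Du Dv; rewrite linDD //; last exact: (subspaceN D_subspace).
by rewrite -scaleN1r linDZ // scaleN1r.
Qed.

Lemma linD_sum (J : Type) (s : seq J) (P : pred J) (F : J -> X) :
  (forall i, P i -> D (F i)) ->
  T (\sum_(i <- s | P i) F i) = \sum_(i <- s | P i) T (F i).
Proof.
move=> EF; elim: s => [|i s IH]; first by rewrite !big_nil linD0.
rewrite !big_cons; case: ifP => // Pi.
by rewrite linDD ?IH //; [exact: EF | exact: (subspace_sum D_subspace)].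
Qed.

End linear_on_D.

Definition AZ := linDZ A_lin.
Definition AD := linDD A_lin.
Definition AB := linDB A_lin.
Definition BZ := linDZ B_lin.
Definition BB := linDB B_lin.

Lemma qf_bounded a : valid a -> bounded_functional (qf a).
Proof.
by move=> va; have [_ _ _ [/(_ _ _ (valid_bounds va))[[]]]] := roots.
Qed.

Lemma is_adjoint_adjoint (T : operator X Y) (q : Y -> K) : adjoint_dom T q -> is_adjoint_at T q (adjoint T q).
Proof. by move=> [_ [r Hr]]; rewrite /adjoint; case: xgetP => [? -> //|/(_ r)]. Qed.

Lemma coef_bounded a : valid a -> bounded_functional (coef a).
Proof.
move=> va; have [_ _ _ [/(_ _ _ (valid_bounds va))[_ dB] _ _] _] := roots.
by have [] := is_adjoint_adjoint dB.
Qed.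

Lemma coefE a x : valid a -> D x -> coef a x = qf a (B x).
Proof.
move=> va [_ Dx]; have [_ _ _ [/(_ _ _ (valid_bounds va))[_ dB] _ _] _] := roots.
by have [_] := is_adjoint_adjoint dB; exact.
Qed.

Lemma qf_phi a b : valid a -> valid b -> qf a (B (phi b)) = (a == b)%:R.
Proof.
move=> va vb; have [_ _ _ _ H] := roots.
rewrite /qf /phi H ?valid_bounds // eqSS val_eqE.
by case: a b {va vb} => [i s] [j u] /=; rewrite xpair_eqE eq_sym [u == s]eq_sym.
Qed.

Lemma coef_phi a b : valid a -> valid b -> coef a (phi b) = (a == b)%:R.
Proof. by move=> va vb; rewrite coefE ?qf_phi //; exact: phi_D. Qed.

Let sTX : subspace (setT : set X). Proof. by split. Qed.
Let sTY : subspace (setT : set Y). Proof. by split. Qed.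

Lemma coef_linear a : valid a ->
  bounded_linear_on (@nrm R k X) (@nrm R k K^o) setT (coef a : X -> K^o).
Proof. exact: coef_bounded. Qed.

Lemma qf_linear a : valid a ->
  bounded_linear_on (@nrm R k Y) (@nrm R k K^o) setT (qf a : Y -> K^o).
Proof. exact: qf_bounded. Qed.

Lemma coefD a u v : valid a -> coef a (u + v) = coef a u + coef a v.
Proof. by move=> va; exact: (bounded_linearD (coef_linear va)). Qed.
Lemma coefB a u v : valid a -> coef a (u - v) = coef a u - coef a v.
Proof. by move=> va; exact: (bounded_linearB sTX (coef_linear va)). Qed.
Lemma coefZ a (c : K) u : valid a -> coef a (c *: u) = c * coef a u.
Proof. by move=> va; exact: (bounded_linearZ sTX (coef_linear va)). Qed.
Lemma coef0 a : valid a -> coef a 0 = 0.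
Proof. by move=> va; exact: (bounded_linear0 sTX (coef_linear va)). Qed.
Lemma coef_sum a (J : Type) (s : seq J) (P : pred J) (F : J -> X) : valid a ->
  coef a (\sum_(i <- s | P i) F i) = \sum_(i <- s | P i) coef a (F i).
Proof. by move=> va; exact: (bounded_linear_sum sTX (coef_linear va)). Qed.

Lemma qfD a (u v : Y) : valid a -> qf a (u + v) = qf a u + qf a v.
Proof. by move=> va; exact: (bounded_linearD (qf_linear va)). Qed.
Lemma qfB a (u v : Y) : valid a -> qf a (u - v) = qf a u - qf a v.
Proof. by move=> va; exact: (bounded_linearB sTY (qf_linear va)). Qed.
Lemma qfZ a (c : K) (u : Y) : valid a -> qf a (c *: u) = c * qf a u.
Proof. by move=> va; exact: (bounded_linearZ sTY (qf_linear va)). Qed.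
Lemma qf0 a : valid a -> qf a 0 = 0.
Proof. by move=> va; exact: (bounded_linear0 sTY (qf_linear va)). Qed.
Lemma qf_sum a (J : Type) (s : seq J) (P : pred J) (F : J -> Y) : valid a ->
  qf a (\sum_(i <- s | P i) F i) = \sum_(i <- s | P i) qf a (F i).
Proof. by move=> va; exact: (bounded_linear_sum sTY (qf_linear va)). Qed.

Lemma coef_comb a (S : pred I) (c : I -> K) : valid a ->
  coef a (\sum_(b | valid b && S b) c b *: phi b) = if S a then c a else 0.
Proof.
move=> va; rewrite coef_sum //; case: ifP => Sa.
  rewrite (bigD1 a) ?va //= coefZ // coef_phi // eqxx mulr1 big1 ?addr0 //.
  move=> b /andP[/andP[vb _] ba]; rewrite coefZ // coef_phi // eq_sym (negbTE ba) mulr0 //.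
rewrite big1 // => b /andP[vb Sb]; rewrite coefZ // coef_phi //.
by case: eqP => [ab|_]; [move: Sa; rewrite ab Sb | rewrite mulr0].
Qed.

Lemma qf_comb a (S : pred I) (c : I -> K) : valid a ->
  qf a (\sum_(b | valid b && S b) c b *: B (phi b)) = if S a then c a else 0.
Proof.
move=> va; rewrite qf_sum //; case: ifP => Sa.
  rewrite (bigD1 a) ?va //= qfZ // qf_phi // eqxx mulr1 big1 ?addr0 //.
  move=> b /andP[/andP[vb _] ba]; rewrite qfZ // qf_phi // eq_sym (negbTE ba) mulr0 //.
rewrite big1 // => b /andP[vb Sb]; rewrite qfZ // qf_phi //.
by case: eqP => [ab|_]; [move: Sa; rewrite ab Sb | rewrite mulr0].
Qed.

Lemma coef_proj a S x : valid a -> coef a (proj S x) = if S a then coef a x else 0.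
Proof. by move=> va; rewrite coef_comb. Qed.

Lemma qf_projQ a S y : valid a -> qf a (projQ S y) = if S a then qf a y else 0.
Proof. by move=> va; rewrite qf_comb. Qed.

Lemma proj_D S x : D (proj S x).
Proof.
apply: (subspace_sum D_subspace) => a /andP[va _].
by apply: (subspaceZ D_subspace); exact: phi_D.
Qed.

Lemma eq_proj S S' x : (forall a, valid a -> S a = S' a) -> proj S x = proj S' x.
Proof. by move=> SS; apply: eq_bigl => a; case: (boolP (valid a)) => //= /SS. Qed.

Lemma eq_projQ S S' y : (forall a, valid a -> S a = S' a) -> projQ S y = projQ S' y.
Proof. by move=> SS; apply: eq_bigl => a; case: (boolP (valid a)) => //= /SS. Qed.

Lemma eq_proj_coef S x x' : (forall a, valid a -> S a -> coef a x = coef a x') ->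
  proj S x = proj S x'.
Proof. by move=> H; apply: eq_bigr => a /andP[va Sa]; rewrite H. Qed.

Lemma eq_projQ_qf S y y' : (forall a, valid a -> S a -> qf a y = qf a y') ->
  projQ S y = projQ S y'.
Proof. by move=> H; apply: eq_bigr => a /andP[va Sa]; rewrite H. Qed.

Lemma projI S S' x : proj S (proj S' x) = proj (predI S S') x.
Proof.
rewrite /proj big_mkcond [RHS]big_mkcond; apply: eq_bigr => a _ /=.
case: (boolP (valid a)) => //= va; case: (S a) => //=.
by rewrite coef_comb //; case: ifP => // _; rewrite scale0r.
Qed.

Lemma projQI S S' y : projQ S (projQ S' y) = projQ (predI S S') y.
Proof.
rewrite /projQ big_mkcond [RHS]big_mkcond; apply: eq_bigr => a _ /=.
case: (boolP (valid a)) => //= va; case: (S a) => //=.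
by rewrite qf_comb //; case: ifP => // _; rewrite scale0r.
Qed.

Lemma projD S u v : proj S (u + v) = proj S u + proj S v.
Proof.
by rewrite /proj -big_split; apply: eq_bigr => a /andP[va _]; rewrite coefD // scalerDl.
Qed.
Lemma projB S u v : proj S (u - v) = proj S u - proj S v.
Proof.
by rewrite /proj -sumrB; apply: eq_bigr => a /andP[va _]; rewrite coefB // scalerBl.
Qed.
Lemma projZ S (c : K) u : proj S (c *: u) = c *: proj S u.
Proof.
rewrite /proj scaler_sumr; apply: eq_bigr => a /andP[va _].
by rewrite coefZ // scalerA.
Qed.
Lemma proj0 S : proj S 0 = 0.
Proof. by rewrite /proj big1 // => a /andP[va _]; rewrite coef0 // scale0r. Qed.

Lemma projQD S (u v : Y) : projQ S (u + v) = projQ S u + projQ S v.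
Proof.
by rewrite /projQ -big_split; apply: eq_bigr => a /andP[va _]; rewrite qfD // scalerDl.
Qed.
Lemma projQB S (u v : Y) : projQ S (u - v) = projQ S u - projQ S v.
Proof.
by rewrite /projQ -sumrB; apply: eq_bigr => a /andP[va _]; rewrite qfB // scalerBl.
Qed.
Lemma projQZ S (c : K) (u : Y) : projQ S (c *: u) = c *: projQ S u.
Proof.
rewrite /projQ scaler_sumr; apply: eq_bigr => a /andP[va _].
by rewrite qfZ // scalerA.
Qed.
Lemma projQ0 S : projQ S 0 = 0.
Proof. by rewrite /projQ big1 // => a /andP[va _]; rewrite qf0 // scale0r. Qed.

Lemma B_proj S x : D x -> B (proj S x) = projQ S (B x).
Proof.
move=> Dx; rewrite /proj (linD_sum B_lin).
  by apply: eq_bigr => a /andP[va _]; rewrite BZ ?coefE //; exact: phi_D.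
by move=> a /andP[va _]; apply: (subspaceZ D_subspace); exact: phi_D.
Qed.

Lemma proj_bounded S : bounded_linear_on (@nrm R k X) (@nrm R k X) setT (proj S).
Proof.
split=> [c u v _ _|]; first by rewrite projD projZ.
have ex a : exists C, valid a -> forall x, nrm (coef a x : K^o) <= C * nrm x.
  have [va|_] := boolP (valid a); last by exists 0.
  by have [_ [C HC]] := coef_bounded va; exists C => _ x; exact: HC.
have [C HC] := choice ex; exists (\sum_(a | valid a && S a) C a * nrm (phi a)) => x _.
apply: le_trans (nrm_sum _ _ _) _; rewrite mulr_suml; apply: ler_sum => a /andP[va _].
by rewrite nrmZ mulrAC; apply: ler_wpM2r; [exact: nrm_ge0 | exact: HC].
Qed.

Lemma projQ_bounded S : bounded_linear_on (@nrm R k Y) (@nrm R k Y) setT (projQ S).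
Proof.
split=> [c u v _ _|]; first by rewrite projQD projQZ.
have ex a : exists C, valid a -> forall y, nrm (qf a y : K^o) <= C * nrm y.
  have [va|_] := boolP (valid a); last by exists 0.
  by have [_ [C HC]] := qf_bounded va; exists C => _ y; exact: HC.
have [C HC] := choice ex; exists (\sum_(a | valid a && S a) C a * nrm (B (phi a))) => x _.
apply: le_trans (nrm_sum _ _ _) _; rewrite mulr_suml; apply: ler_sum => a /andP[va _].
by rewrite nrmZ mulrAC; apply: ler_wpM2r; [exact: nrm_ge0 | exact: HC].
Qed.

Lemma proj_image S : proj S @` D = [set x | proj S x = x].
Proof.
apply/seteqP; split=> [_ [x _ <-]|x <-].
  by rewrite /= projI; apply: eq_proj => a _ /=; rewrite andbb.
by exists (proj S x); [exact: proj_D | rewrite projI; apply: eq_proj => a _ /=; rewrite andbb].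
Qed.

Lemma projQ_range S : range (projQ S) = [set y | projQ S y = y].
Proof.
apply/seteqP; split=> [_ [x _ <-]|x /= <-].
  by rewrite /= projQI; apply: eq_projQ => a _ /=; rewrite andbb.
by exists (projQ S x) => //; rewrite projQI; apply: eq_projQ => a _ /=; rewrite andbb.
Qed.

Lemma proj_fix_subspace S : subspace [set x | proj S x = x].
Proof.
by split=> [|c u v /= Pu Pv]; [exact: proj0 | rewrite projD projZ Pu Pv].
Qed.

Lemma projQ_fix_subspace S : subspace [set y | projQ S y = y].
Proof.
by split=> [|c u v /= Pu Pv]; [exact: projQ0 | rewrite projQD projQZ Pu Pv].
Qed.

Lemma proj_fix_closed S un l : (forall j, proj S (un j) = un j) -> tends un l ->
  proj S l = l.
Proof.
move=> un_fix ul; apply: (tends_unique (u := un)) => // e e0.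
have [C C0 HC] := bounded_linear_bound (proj_bounded S).
have [N HN] := ul _ (divr_gt0 e0 C0); exists N => j Nj.
rewrite -un_fix -projB; apply: le_lt_trans (HC _ Logic.I) _.
by have := HN j Nj; rewrite ltr_pdivlMr // mulrC.
Qed.

Lemma fix_coef S x : proj S x = x -> forall a, valid a -> ~~ S a -> coef a x = 0.
Proof. by move=> <- a va /negbTE Sa; rewrite coef_proj // Sa. Qed.

Lemma fix_sub S S' x : (forall a, valid a -> S a -> S' a) -> proj S x = x ->
  proj S' x = x.
Proof.
move=> SS <-; rewrite projI; apply: eq_proj => a va /=.
by have := SS a va; case: (S a) => [->//|]; rewrite andbF.
Qed.

Lemma fixQ_sub S S' y : (forall a, valid a -> S a -> S' a) -> projQ S y = y ->
  projQ S' y = y.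
Proof.
move=> SS <-; rewrite projQI; apply: eq_projQ => a va /=.
by have := SS a va; case: (S a) => [->//|]; rewrite andbF.
Qed.

End pencil_structure.

Section regular_real.
Context {R : realType}.

Lemma regular_pencil_solvable (k : scalar_kind) (X Y : normedModType (scalars R k))
    (D : set X) (A B : X -> Y) (nu : nat) :
  regular_pencil D A B nu -> exists2 r : R, 0 < r & forall l : R, r < l ->
    forall y, exists2 x, D x & of_real l *: A x + B x = y.
Proof.
case: k X Y A B D => X Y A B D [[r r0 H] _]; exists r => // l rl y.
  have ll : (r%:C)%C < `|(l%:C)%C|.
    have l0 : 0 < l by exact: lt_trans rl.
    rewrite ger0_norm; last by rewrite lecE /= eqxx ltW.
    by rewrite ltcE /= eqxx.
  have [S [_ _ /(_ (y, 0) I)[[Dx _] ABx] _]] := H _ ll.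
  exists (S (y, 0)).1 => //; have := congr1 fst ABx.
  by rewrite /= scale0r subr0.
have ll : (r%:C)%C < `|(l%:C)%C|.
  have l0 : 0 < l by exact: lt_trans rl.
  rewrite ger0_norm; last by rewrite lecE /= eqxx ltW.
  by rewrite ltcE /= eqxx.
have [S [_ _ /(_ y I)[Dx ABx] _]] := H _ ll.
by exists (S y).
Qed.

End regular_real.

Section projector_formulas.
Context {R : realType} {k : scalar_kind} {X Y : completeNormedModType (scalars R k)}.
Variable p : pencil X Y.
Local Notation K := (scalars R k).
Local Notation A := (opA p).
Local Notation B := (opB p).
Local Notation nu := (pencil_index p).
Local Notation n := (dim_ker p).
Local Notation D := (domD p).
Local Notation rk := (@root_rank R k X Y p).
Local Notation I := ('I_n * 'I_nu)%type.
Hypothesis hp : pencil_setting p.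

Section sums.
Variables (V : nmodType) (F : 'I_n -> nat -> V).

Lemma sum_level (Q : pred 'I_n) s : (forall i, Q i -> (s < rk i)%N) ->
  \sum_(i | Q i) F i s =
  \sum_(a : I | valid a && ((a.2 == s :> nat) && Q a.1)) F a.1 a.2.
Proof.
move=> Qs; rewrite [RHS]big_mkcond /=.
rewrite -(pair_bigA _ (fun (i : 'I_n) (u : 'I_nu) =>
  if valid (i, u) && ((u == s :> nat) && Q i) then F i u else 0)) /= big_mkcond.
apply: eq_bigr => i _; case: (boolP (Q i)) => Qi; last first.
  by rewrite big1 // => u _; rewrite !andbF.
have snu : (s < nu)%N by apply: leq_trans (Qs i Qi) _; have /andP[] := rk_bounds hp i.
rewrite (bigD1 (Ordinal snu)) //= /valid /= (Qs i Qi) eqxx /= big1 ?addr0 // => u.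
by rewrite -val_eqE /= => /negbTE->; rewrite andbF.
Qed.

Lemma sum_ranks s : \sum_(s.+1 <= j < nu.+1) \sum_(i | rk i == j) F i s =
  \sum_(i | (s < rk i)%N) F i s.
Proof.
under eq_bigr do rewrite big_mkcond /=.
rewrite exchange_big /= [RHS]big_mkcond /=; apply: eq_bigr => i _.
rewrite -big_mkcond /=; under eq_bigl do rewrite eq_sym.
rewrite big_nat1_eq ltnS; have /andP[_ ->] := rk_bounds hp i.
by rewrite andbT.
Qed.

Lemma sum_levels l : \sum_(l <= s < nu) \sum_(i | (s < rk i)%N) F i s =
  \sum_(a : I | valid a && (l <= a.2)%N) F a.1 a.2.
Proof.
rewrite big_geq_mkord /=; under eq_bigr do rewrite big_mkcond /=.
rewrite exchange_big /= [RHS]big_mkcond /=.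
rewrite -(pair_bigA _ (fun (i : 'I_n) (u : 'I_nu) =>
  if valid (i, u) && (l <= u)%N then F i u else 0)) /=.
apply: eq_bigr => i _; rewrite big_mkcond /=; apply: eq_bigr => u _.
by rewrite /valid /=; case: (l <= u)%N; case: (u < rk i)%N.
Qed.

End sums.

Definition level (s : nat) : pred I := fun a : I => a.2 == s :> nat.
Definition diag (s : nat) : pred I := fun a : I => (a.2 == s :> nat) && (rk a.1 == s.+1).
Definition wedge (s : nat) : pred I := fun a : I => (a.2 == s :> nat) && (s.+1 < rk a.1)%N.
Definition from (s : nat) : pred I := fun a : I => (s <= a.2)%N.
Definition diag_from (s : nat) : pred I :=
  fun a : I => (s <= a.2)%N && (rk a.1 == a.2.+1).
Definition wedge_from (s : nat) : pred I :=
  fun a : I => (s <= a.2)%N && (a.2.+1 < rk a.1)%N.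

Lemma P2sjE s j x : (s < j)%N ->
  P2sj p s j x = proj [pred a : I | (a.2 == s :> nat) && (rk a.1 == j)] x.
Proof.
move=> sj; apply: (sum_level (fun i s => adjoint B (root_q i s.+1) x *: root_phi i s.+1)
  (Q := fun i => rk i == j)).
by move=> i /eqP->.
Qed.

Lemma Q2sjE s j y : (s < j)%N ->
  Q2sj p s j y = projQ [pred a : I | (a.2 == s :> nat) && (rk a.1 == j)] y.
Proof.
move=> sj; apply: (sum_level (fun i s => root_q i s.+1 y *: B (root_phi i s.+1))
  (Q := fun i => rk i == j)).
by move=> i /eqP->.
Qed.

Lemma P2diagE s x : P2sj p s s.+1 x = proj (diag s) x.
Proof. exact: P2sjE. Qed.

Lemma Q2diagE s y : Q2sj p s s.+1 y = projQ (diag s) y.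
Proof. exact: Q2sjE. Qed.

Lemma P2sE s x : P2s p s x = proj (level s) x.
Proof.
rewrite /P2s (sum_ranks (fun i s => adjoint B (root_q i s.+1) x *: root_phi i s.+1)).
rewrite (sum_level (fun i s => adjoint B (root_q i s.+1) x *: root_phi i s.+1)
  (Q := fun i => s < rk i)%N) //.
apply: eq_bigl => a; rewrite /valid /level /=; case: eqP => [->|_]; last by rewrite andbF.
by rewrite andbT andbb.
Qed.

Lemma Q2sE s y : Q2s p s y = projQ (level s) y.
Proof.
rewrite /Q2s (sum_ranks (fun i s => root_q i s.+1 y *: B (root_phi i s.+1))).
rewrite (sum_level (fun i s => root_q i s.+1 y *: B (root_phi i s.+1))
  (Q := fun i => s < rk i)%N) //.
apply: eq_bigl => a; rewrite /valid /level /=; case: eqP => [->|_]; last by rewrite andbF.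
by rewrite andbT andbb.
Qed.

Lemma P2E x : P2 p x = proj (@predT I) x.
Proof.
rewrite /P2; under eq_bigr do rewrite /P2s
  (sum_ranks (fun i s => adjoint B (root_q i s.+1) x *: root_phi i s.+1)).
exact: (sum_levels (fun i s => adjoint B (root_q i s.+1) x *: root_phi i s.+1)).
Qed.

Lemma Q2E y : Q2 p y = projQ (@predT I) y.
Proof.
rewrite /Q2; under eq_bigr do rewrite /Q2s
  (sum_ranks (fun i s => root_q i s.+1 y *: B (root_phi i s.+1))).
exact: (sum_levels (fun i s => root_q i s.+1 y *: B (root_phi i s.+1))).
Qed.

Lemma P2SigmaE x : P2Sigma p x = proj (from 1) x.
Proof.
rewrite /P2Sigma; under eq_bigr do rewrite /P2s
  (sum_ranks (fun i s => adjoint B (root_q i s.+1) x *: root_phi i s.+1)).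
exact: (sum_levels (fun i s => adjoint B (root_q i s.+1) x *: root_phi i s.+1)).
Qed.

Lemma level_split s (V : zmodType) (F : I -> V) :
  \sum_(a | valid a && level s a) F a - \sum_(a | valid a && diag s a) F a =
  \sum_(a | valid a && wedge s a) F a.
Proof.
rewrite (bigID (diag s)) /= addrAC [X in X - _](_ : _ = \sum_(a | valid a && diag s a) F a).
  rewrite subrr add0r; apply: eq_bigl => a; rewrite /valid /level /diag /wedge /=.
  case: (eqVneq (a.2 : nat) s) => [->|_]; last by rewrite !andbF.
  by case: (ltngtP s.+1 (rk a.1)).
by apply: eq_bigl => a; rewrite /level /diag /=; case: (a.2 == s :> nat); rewrite ?andbF ?andbT.
Qed.

Lemma P2wedgeE s x : P2wedge p s x = proj (wedge s) x.
Proof. by rewrite /P2wedge P2sE P2diagE; exact: level_split. Qed.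

Lemma Q2SigmaE s y : Q2Sigma p s y = projQ (wedge s) y.
Proof. by rewrite /Q2Sigma Q2sE Q2diagE; exact: level_split. Qed.

End projector_formulas.

Section closed_operators.
Context {R : realType} {k : scalar_kind} {X Y : completeNormedModType (scalars R k)}.

Lemma tends_cvg (V : completeNormedModType (scalars R k)) (u : nat -> V) l :
  tends u l -> u @ \oo --> l.
Proof.
move=> ul; apply/cvg_nrmP => e e0; have [N HN] := ul e e0.
by exists N => // n /HN.
Qed.

Lemma closed_operator_tends (T : operator X Y) (xn : nat -> X) x y :
  closed_operator T -> (forall n, dom T (xn n)) -> tends xn x ->
  tends (fun n => T (xn n)) y -> dom T x /\ y = T x.
Proof.
move=> clT dx xnx Tny.
have : ((fun n => (xn n, T (xn n))) @ \oo --> (x, y)).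
  by apply: cvg_pair; exact: tends_cvg.
by apply: (closed_cvg _ clT); near=> n; split=> //=.
Unshelve. all: by end_near. Qed.

End closed_operators.

Section pencil_inverse.
Context {R : realType} {k : scalar_kind} {X Y : completeNormedModType (scalars R k)}.
Variable p : pencil X Y.
Local Notation K := (scalars R k).
Local Notation A := (opA p).
Local Notation B := (opB p).
Local Notation nu := (pencil_index p).
Local Notation n := (dim_ker p).
Local Notation D := (domD p).
Local Notation rk := (@root_rank R k X Y p).
Local Notation I := ('I_n * 'I_nu)%type.
Hypothesis hp : pencil_setting p.
Implicit Types (a b : I) (x u v : X) (y : Y).

Definition next (a : I) : I := (a.1, insubd a.2 a.2.+1).

Lemma next_val a : (a.2.+1 < rk a.1)%N -> ((next a).2 = a.2.+1 :> nat) /\ valid (next a).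
Proof.
move=> ar; have nu2 : (a.2.+1 < nu)%N.
  by apply: leq_trans ar _; have /andP[] := rk_bounds hp a.1.
by rewrite /valid /= val_insubd nu2.
Qed.

Lemma qf_A a x : valid a -> D x ->
  qf a (A x) = if (a.2.+1 < rk a.1)%N then - coef (next a) x else 0.
Proof.
move=> va Dx; have [_ _ _ [Hd H0 HS] _] := setting_roots hp.
have [dA _] := Hd _ _ (valid_bounds va).
have [_ aE] := is_adjoint_adjoint dA.
rewrite /qf -aE; last by rewrite -(domDE hp).
case: ifP => [ar|ar]; last first.
  have rE : a.2.+1 = rk a.1 by apply/eqP; rewrite eqn_leq (va : (a.2.+1 <= rk a.1)%N) leqNgt ar.
  by rewrite rE H0.
have [nE _] := next_val ar.
by rewrite HS ?ar // /coef /qf nE.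
Qed.

Lemma A_phi0 a : valid a -> a.2 = 0%N :> nat -> A (phi a) = 0.
Proof.
move=> va a0; have [[H _] _ _ _ _] := setting_roots hp.
have [|_ //] := (H (phi a)).2; exists (fun i => (i == a.1)%:R).
rewrite (bigD1 a.1) //= eqxx scale1r big1 ?addr0; first by rewrite /phi a0.
by move=> i /negbTE->; rewrite scale0r.
Qed.

Lemma A_phi_next a : valid a -> (a.2.+1 < rk a.1)%N ->
  A (phi (next a)) = - B (phi a).
Proof.
move=> va ar; have [_ _ [_ H] _ _] := setting_roots hp; have [nE _] := next_val ar.
by rewrite /phi nE H.
Qed.

Lemma valid_next_of a : valid a -> (0 < a.2)%N ->
  exists b, [/\ valid b, (b.2.+1 < rk b.1)%N & a = next b].
Proof.
move=> va a0; have lt_nu : (a.2.-1 < nu)%N by rewrite (leq_ltn_trans (leq_pred _)).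
pose b : I := (a.1, Ordinal lt_nu).
have br : (b.2.+1 < rk b.1)%N by rewrite /= (prednK a0).
exists b; split=> //; first by rewrite /valid; exact: ltnW.
rewrite /next /= [LHS]surjective_pairing; congr pair.
by apply: val_inj; rewrite val_insubd /= (prednK a0) ltn_ord.
Qed.

Lemma phiB_span a : valid a -> projQ (@predT I) (B (phi a)) = B (phi a).
Proof.
move=> va; rewrite /projQ (bigD1 a) ?va //= (qf_phi hp) // eqxx scale1r big1 ?addr0 //.
by move=> b /andP[/andP[vb _] /negbTE ba]; rewrite (qf_phi hp) // ba scale0r.
Qed.

Lemma A_phi_span a : valid a -> projQ (@predT I) (A (phi a)) = A (phi a).
Proof.
move=> va; have [a0|] := posnP a.2; first by rewrite A_phi0 // (projQ0 hp).
move=> /(valid_next_of va)[b [vb br ->]].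
by rewrite A_phi_next // -scaleN1r (projQZ hp) phiB_span.
Qed.

Lemma projP_D x : D x -> D (x - proj (@predT I) x).
Proof. by move=> Dx; apply: (subspaceB (D_subspace hp)) => //; exact: proj_D. Qed.

Lemma Q1_A x : D x -> A x - projQ (@predT I) (A x) = A (x - proj (@predT I) x).
Proof.
move=> Dx; set P := proj _ x; have DP : D P by exact: proj_D.
have -> : A x = A (x - P) + A P.
  by rewrite -(AD hp) ?subrK //; exact: projP_D.
rewrite (projQD hp).
have -> : projQ (@predT I) (A (x - P)) = 0.
  rewrite /projQ big1 // => a /andP[va _].
  rewrite qf_A //; last exact: projP_D.
  case: ifP => [/next_val[_ vn]|_]; last by rewrite scale0r.
  by rewrite (coefB hp) // (coef_proj hp) //= subrr oppr0 scale0r.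
suff -> : projQ (@predT I) (A P) = A P by rewrite add0r addrK.
rewrite /P /proj (linD_sum hp (A_lin hp)); last first.
  move=> a /andP[va _]; apply: (subspaceZ (D_subspace hp)).
  exact: phi_D.
have H : forall (s : seq I), projQ (@predT I) (\sum_(i <- s | valid i && true) A (coef i x *: phi i)) =
    \sum_(i <- s | valid i && true) A (coef i x *: phi i).
  elim=> [|a s IH]; first by rewrite !big_nil (projQ0 hp).
  rewrite !big_cons; case: ifP => // /andP[va _].
  rewrite (projQD hp) IH (AZ hp) ?(projQZ hp) ?A_phi_span //.
  exact: phi_D.
exact: H.
Qed.

Lemma Q1_B x : D x -> B x - projQ (@predT I) (B x) = B (x - proj (@predT I) x).
Proof.
move=> Dx; rewrite (BB hp) ?(B_proj hp) //.
exact: proj_D.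
Qed.

Lemma D1E : D1 p = [set x | D x /\ proj (@predT I) x = 0].
Proof.
apply/seteqP; split=> [_ [x Dx <-]|x [Dx Px]] /=.
  rewrite /P1 (P2E hp); split; first exact: projP_D.
  rewrite (projB hp) (projI hp).
  by rewrite (eq_proj (S' := predT)) // subrr.
by exists x => //; rewrite /P1 (P2E hp) Px subr0.
Qed.

Lemma Y1E : Y1 p = [set y | projQ (@predT I) y = 0].
Proof.
apply/seteqP; split=> [_ [y _ <-]|y Py] /=.
  rewrite /Q1 (Q2E hp) (projQB hp) (projQI hp).
  by rewrite (eq_projQ (S' := predT)) // subrr.
by exists y => //; rewrite /Q1 (Q2E hp) Py subr0.
Qed.

Lemma D1_subspace : subspace (D1 p).
Proof.
rewrite D1E; split=> [|c u v [Du Pu] [Dv Pv]] /=.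
  by split; [exact: (D_subspace hp).1 | exact: (proj0 hp)].
split; first by have [_] := D_subspace hp; apply.
by rewrite (projD hp) (projZ hp) Pu Pv scaler0 addr0.
Qed.

Lemma Y1_subspace : subspace (Y1 p).
Proof.
rewrite Y1E; split=> [|c u v Pu Pv] /=; first exact: (projQ0 hp).
by rewrite (projQD hp) (projQZ hp) Pu Pv scaler0 addr0.
Qed.

Lemma D1_D x : D1 p x -> D x.
Proof. by rewrite D1E => -[]. Qed.

Lemma D1_proj (S : pred I) x : D1 p x -> proj S x = 0.
Proof.
rewrite D1E => -[_ Px]; rewrite -(proj0 hp S) -Px (projI hp).
by apply: eq_proj => a _; rewrite /= andbT.
Qed.

Lemma Y1_projQ (S : pred I) y : Y1 p y -> projQ S y = 0.
Proof.
rewrite Y1E /= => Px; rewrite -(projQ0 hp S) -Px (projQI hp).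
by apply: eq_projQ => a _; rewrite /= andbT.
Qed.

Lemma A_D1 x : D1 p x -> Y1 p (A x).
Proof.
move=> D1x; have Dx := D1_D D1x; rewrite Y1E /=.
have := Q1_A Dx; rewrite (D1_proj _ D1x) subr0 => /eqP.
by rewrite subr_eq addrC -subr_eq subrr eq_sym => /eqP.
Qed.

Lemma B_D1 x : D1 p x -> Y1 p (B x).
Proof.
move=> D1x; have Dx := D1_D D1x; rewrite Y1E /=.
by rewrite -(B_proj hp) // D1_proj // (linD0 hp (B_lin hp)).
Qed.

Lemma A_D1_inj x : D1 p x -> A x = 0 -> x = 0.
Proof.
move=> D1x Ax; have [[H _] [Hr _] _ _ _] := setting_roots hp.
have [c xE] := (H x).1 (conj (D1_D D1x) Ax).
have [n0|n0] := posnP nu.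
  rewrite xE big1 // => i _; have := Hr i; rewrite n0 leqn0.
  by case: (root_rank i).
pose a i : I := (i, Ordinal n0).
have va i : valid (a i) by rewrite /valid /=; have /andP[] := Hr i.
rewrite xE big1 // => i _.
have := coef_proj hp predT x (va i); rewrite (D1_proj _ D1x) (coef0 hp) //=.
rewrite [in RHS]xE (coef_sum hp) // (bigD1 i) //= (coefZ hp) //.
rewrite -/(phi (a i)) (coef_phi hp) // eqxx mulr1 big1 ?addr0.
  by move=> <-; rewrite scale0r.
move=> j ji; rewrite (coefZ hp) // -/(phi (a j)) (coef_phi hp) //.
by rewrite xpair_eqE eq_sym (negbTE ji) mulr0.
Qed.

Hypothesis closedA : closed_operator A.
Hypothesis closedB : closed_operator B.
Hypothesis range_closed : closed (A @` dom A).
Hypothesis regular : regular_pencil D A B nu.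

Lemma D1_closed xn x : (forall j, D1 p (xn j)) -> tends xn x -> D x -> D1 p x.
Proof.
move=> xnD xnx Dx; rewrite D1E; split=> //=.
have [C C0 HC] := bounded_linear_bound (proj_bounded hp (@predT I)).
apply: nrm_le0; apply/ler_addgt0Pr => e e0; rewrite add0r.
have [N HN] := xnx _ (divr_gt0 e0 C0); have := HN N (leqnn _).
rewrite ltr_pdivlMr // mulrC nrmC => h; apply/ltW/(le_lt_trans _ h).
rewrite -[proj _ x]subr0 -(D1_proj predT (xnD N)) -(projB hp).
exact: HC.
Qed.

Lemma range_A_D1_closed yn y : (forall j, exists2 x, D1 p x & A x = yn j) ->
  tends yn y -> exists2 x, D1 p x & A x = y.
Proof.
move=> yn_ran yny; have [x domx Ax] : (A @` dom A) y.
  apply: closed_tends range_closed _ yny => j; have [x D1x <-] := yn_ran j.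
  by exists x => //; rewrite -(domDE hp); exact: D1_D.
have Dx : D x by rewrite (domDE hp).
have Qy : projQ (@predT I) y = 0.
  have [C C0 HC] := bounded_linear_bound (projQ_bounded hp (@predT I)).
  apply: nrm_le0; apply/ler_addgt0Pr => e e0; rewrite add0r.
  have [N HN] := yny _ (divr_gt0 e0 C0); have := HN N (leqnn _).
  rewrite ltr_pdivlMr // mulrC nrmC => h; apply/ltW/(le_lt_trans _ h).
  have [u D1u uE] := yn_ran N.
  rewrite -[projQ _ y]subr0 -(Y1_projQ predT (A_D1 D1u)) uE -(projQB hp).
  exact: HC.
exists (x - proj (@predT I) x).
  by rewrite D1E; split; [exact: projP_D | rewrite /= (projB hp) (projI hp) (eq_proj (S' := predT)) // subrr].
by rewrite -Q1_A // Ax Qy subr0.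
Qed.

Lemma A_D1_bounded_below : exists2 C : R, 0 <= C &
  forall x, D1 p x -> nrm x <= C * nrm (A x).
Proof.
have [||||C C0 HC] := @open_mapping R k Y X (fun y x => D1 p x /\ A x = y).
- by split; [exact: D1_subspace.1 | exact: (linD0 hp (A_lin hp))].
- move=> c y x y' x' [D1x <-] [D1x' <-]; split; first exact: D1_subspace.2.
  by rewrite (A_lin hp) //; exact: D1_D.
- move=> yn xn y x H yny xnx.
  have domx j : dom A (xn j) by rewrite -(domDE hp); exact/D1_D/(H j).1.
  have [|domx' yE] := closed_operator_tends (y := y) closedA domx xnx.
    by move=> e /yny[N HN]; exists N => j /HN; rewrite (H j).2.
  split=> //; apply: D1_closed xnx _ => [j|]; first exact: (H j).1.
  by rewrite (domDE hp).
- move=> yn y H yny; have [j|x D1x Ax] := range_A_D1_closed _ yny.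
    by have [x [D1x xE]] := H j; exists x.
  by exists x.
exists C => // x D1x; have [|x' [D1x' Axx] x'n] := HC (A x); first by exists x.
suff -> : x = x' by rewrite Axx in x'n *.
apply/eqP; rewrite -subr_eq0; apply/eqP/A_D1_inj.
  exact: (subspaceB D1_subspace).
by rewrite (AB hp) ?Axx ?subrr //; exact: D1_D.
Qed.

Lemma B_D1_relatively_bounded : exists2 C : R, 0 <= C &
  forall x, D1 p x -> nrm (B x) <= C * nrm (A x).
Proof.
have [C0 C00 HC0] := A_D1_bounded_below.
have [||||C C1 HC] := @open_mapping R k Y Y (fun y z => exists2 x, D1 p x & A x = y /\ B x = z).
- exists 0; first exact: D1_subspace.1.
  by rewrite (linD0 hp (A_lin hp)) (linD0 hp (B_lin hp)).
- move=> c y z y' z' [x D1x [<- <-]] [x' D1x' [<- <-]].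
  exists (of_real c *: x + x'); first exact: D1_subspace.2.
  by rewrite (A_lin hp) ?(B_lin hp) //; exact: D1_D.
- move=> yn zn y z H yny znz.
  have {}H j : exists x, D1 p x /\ A x = yn j /\ B x = zn j.
    by have [x ? ?] := H j; exists x.
  have [xn Hx] := choice H.
  have [|x xnx] := @cauchy_tends _ _ _ xn.
    move=> e e0; have C1 : 0 < C0 + 1 by rewrite ltr_wpDl.
    have d0 : 0 < e / (C0 + 1) / 2 by rewrite !divr_gt0.
    have [N HN] := yny _ d0; exists N => i j Ni Nj.
    have [D1i [Ai _]] := Hx i; have [D1j [Aj _]] := Hx j.
    apply: le_lt_trans (HC0 _ _) _; first exact: (subspaceB D1_subspace).
    rewrite (AB hp) ?Ai ?Aj; [|exact: D1_D|exact: D1_D].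
    have : nrm (yn i - yn j) < e / (C0 + 1).
      have := nrm_trans y (yn i) (yn j); rewrite (nrmC y).
      have := HN i Ni; have := HN j Nj; lra.
    rewrite ltr_pdivlMr // mulrDr mulr1 mulrC; apply: le_lt_trans.
    by rewrite lerDl nrm_ge0.
  have domx j : dom A (xn j) by rewrite -(domDE hp); exact/D1_D/(Hx j).1.
  have [|domx' yE] := closed_operator_tends (y := y) closedA domx xnx.
    by move=> e /yny[N HN]; exists N => j /HN; rewrite (Hx j).2.1.
  have [j||_ zE] := closed_operator_tends (y := z) closedB _ xnx.
  - exact: (setting_domAB hp).
  - by move=> e /znz[N HN]; exists N => j /HN; rewrite (Hx j).2.2.
  exists x; last by split.
  apply: D1_closed xnx _ => [j|]; first exact: (Hx j).1.
  by rewrite (domDE hp).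
- move=> yn y H yny; have [j|x D1x Ax] := range_A_D1_closed _ yny.
    by have [z [x D1x [xE _]]] := H j; exists x.
  by exists (B x), x.
exists C => // x D1x; have [|z [x' D1x' [Axx Bx']] zn] := HC (A x).
  by exists (B x), x.
suff -> : x = x' by rewrite Bx' Axx.
apply/eqP; rewrite -subr_eq0; apply/eqP/A_D1_inj.
  exact: (subspaceB D1_subspace).
by rewrite (AB hp) ?Axx ?subrr //; exact: D1_D.
Qed.

Lemma A_D1_onto y : Y1 p y -> exists2 x, D1 p x & A x = y.
Proof.
move=> Y1y; have [r r0 Hr] := regular_pencil_solvable regular.
have [C C0 HC] := B_D1_relatively_bounded.
pose l j : R := r + 2 * C + 1 + j%:R.
have l_gt j : [/\ 0 < l j, r < l j, 2 * C <= l j & j%:R <= l j].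
  have j0 : (0 : R) <= j%:R by exact: ler0n.
  by rewrite /l; split; lra.
have ex j : exists x, D1 p x /\ A x + of_real (l j)^-1 *: B x = y.
  have [l0 rl _ _] := l_gt j; have [x Dx xE] := Hr _ rl (of_real (l j) *: y).
  have lu : (of_real (l j) : K) != 0 by rewrite fmorph_eq0 gt_eqF.
  have xE' : A x + of_real (l j)^-1 *: B x = y.
    apply: (scalerI lu); rewrite scalerDr scalerA -rmorphM divff ?gt_eqF //.
    by rewrite rmorph1 scale1r.
  exists (x - proj (@predT I) x); split.
    by rewrite D1E; split; [exact: projP_D | rewrite /= (projB hp) (projI hp) (eq_proj (S' := predT)) // subrr].
  rewrite -Q1_A // -Q1_B // -[in RHS](subr0 y) -(Y1_projQ predT Y1y) -xE'.
  by rewrite (projQD hp) (projQZ hp); vec (scalars R k).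
have [xn Hx] := choice ex.
have bnd j : nrm (A (xn j)) <= 2 * nrm y.
  have [D1x xE] := Hx j; have [l0 _ Cl _] := l_gt j.
  have : nrm (of_real (l j)^-1 *: B (xn j)) <= nrm (A (xn j)) / 2.
    rewrite nrmZr gtr0_norm ?invr_gt0 // mulrC ler_pdivrMr //.
    apply: le_trans (HC _ D1x) _; have := ler_wpM2r (nrm_ge0 (A (xn j))) Cl; lra.
  have := nrmB y (of_real (l j)^-1 *: B (xn j)).
  by rewrite -{1}xE addrK; lra.
apply: (range_A_D1_closed (yn := fun j => A (xn j))).
  by move=> j; exists (xn j) => //; case: (Hx j).
move=> e e0; pose c := C * (2 * nrm y) + 1.
have c0 : 0 < c by rewrite ltr_wpDl // !mulr_ge0 ?nrm_ge0.
exists (Num.bound (c / e)).+1 => j Nj.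
have [D1x xE] := Hx j; have [l0 _ _ jl] := l_gt j.
rewrite -nrmN opprB -{1}xE addrAC subrr add0r nrmZr gtr0_norm ?invr_gt0 //.
rewrite mulrC ltr_pdivrMr //.
have h1 : nrm (B (xn j)) <= C * (2 * nrm y).
  by apply: le_trans (HC _ D1x) _; apply: ler_wpM2l.
have h2 : c < e * l j.
  rewrite -ltr_pdivrMl // mulrC; apply: lt_le_trans jl.
  apply: lt_le_trans (archi_boundP _) _; first by rewrite divr_ge0 // ltW.
  by rewrite ler_nat ltnW.
by apply: le_lt_trans h1 _; apply: lt_trans h2; rewrite /c ltrDl.
Qed.

End pencil_inverse.

(** * The cascade of algebraic equations *)

Section block.
Context {R : realType} {k : scalar_kind} {X Y : completeNormedModType (scalars R k)}.
Variable p : pencil X Y.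
Local Notation K := (scalars R k).
Local Notation A := (opA p).
Local Notation B := (opB p).
Local Notation nu := (pencil_index p).
Local Notation n := (dim_ker p).
Local Notation D := (domD p).
Local Notation I := ('I_n * 'I_nu)%type.
Hypothesis hp : pencil_setting p.

Definition fix_proj (S : pred I) : set X := [set x | proj S x = x].
Definition fix_projQ (S : pred I) : set Y := [set y | projQ S y = y].

Lemma fix_proj_D S x : fix_proj S x -> D x.
Proof. by move=> <-; exact: proj_D. Qed.

Variables (S delta : pred I) (M O : set X) (g : R -> X -> Y) (m : nat).
Variables (z0 : R -> X) (r : R -> Y).
Hypothesis m_gt0 : (0 < m)%N.
Hypothesis deltaS : forall a, valid a -> delta a -> S a.
Hypothesis M_open : open_in (fix_proj S) M.
Hypothesis O_open : open_in (fix_proj delta) O.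
Hypothesis g_class : class_C m half_line (fix_proj S) M g.
Hypothesis g_fix : forall t x, fix_projQ delta (g t x).
Hypothesis z0_fix : forall t, fix_proj (predD S delta) (z0 t).
Hypothesis z0_class : forall a, valid a -> S a -> ~~ delta a ->
  class_Cr m (fun t => coef a (z0 t) : K^o).
Hypothesis r_fix : forall t, fix_projQ delta (r t).
Hypothesis r_class : forall a, valid a -> delta a -> class_Cr m (fun t => qf a (r t) : K^o).
Hypothesis z0_M : forall (t : R) u, 0 <= t -> O u -> M (z0 t + u).
Hypothesis unique_zero : forall t : R, 0 <= t ->
  exists! u, O u /\ g t (z0 t + u) - B u - r t = 0.
Hypothesis invertible : forall (t : R) u, 0 <= t -> O u ->
  g t (z0 t + u) - B u - r t = 0 ->
  has_bounded_inverse (@nrm R k X) (@nrm R k Y) (fix_proj delta) (fix_projQ delta)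
    (fun h => partial_x (fix_proj S) M g t (z0 t + u) (proj delta h)
              - projQ delta (B (proj delta h))).

Let sE : subspace (fix_proj S). Proof. exact: proj_fix_subspace. Qed.
Let sO : subspace (fix_proj delta). Proof. exact: proj_fix_subspace. Qed.
Let sW : subspace (fix_projQ delta). Proof. exact: projQ_fix_subspace. Qed.

Lemma comb_class_Cr (V : normedModType K) (P : pred I) (q : nat) (u : R -> V)
    (c : I -> R -> K) (e : I -> V) :
  (forall t, u t = \sum_(a | valid a && P a) c a t *: e a) ->
  (forall a, valid a -> P a -> class_Cr q (fun t => c a t : K^o)) -> class_Cr q u.
Proof.
move=> uE cc; apply: (class_Cr_eq (u := fun t => \sum_(a | valid a && P a) c a t *: e a)).
  by move=> t _; rewrite uE.
apply: class_Cr_sum => a /andP[va Pa]; apply: class_CrZ; first exact: cc.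
exact: class_Cr_cst.
Qed.

Lemma phi_fix (P : pred I) b : valid b -> P b -> fix_proj P (phi b).
Proof.
move=> vb Pb; rewrite /fix_proj /= /proj (bigD1 b) ?vb ?Pb //= (coef_phi hp) // eqxx.
rewrite scale1r big1 ?addr0 // => a /andP[/andP[va _] ab].
by rewrite (coef_phi hp) // (negbTE ab) scale0r.
Qed.

Lemma z0_class_Cr : class_Cr m z0.
Proof.
apply: (comb_class_Cr (P := predD S delta) (c := fun a t => coef a (z0 t)) (e := phi (p := p))).
  by move=> t; rewrite -[LHS]z0_fix.
by move=> a va /andP[da Sa]; exact: z0_class.
Qed.

Lemma r_class_Cr : class_Cr m r.
Proof.
apply: (comb_class_Cr (P := delta) (c := fun a t => qf a (r t)) (e := fun a => B (phi (p := p) a))).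
  by move=> t; rewrite -[LHS]r_fix.
by move=> a va da; exact: r_class.
Qed.

Lemma class_C_continuous t x : 0 <= t -> M x -> forall e : R, 0 < e ->
  exists2 d : R, 0 < d & forall (s : R) x', 0 <= s -> M x' ->
    `|s - t| + nrm (x' - x) < d -> nrm (g s x' - g t x) <= e.
Proof.
move=> t0 Mx e e0; have [T TJ] := g_class.
have [d d0 H] := jet_continuous sE M_open TJ t0 Mx (leq0n m) e0.
exists d => // s x' s0 Mx' sx; have := H s x' s0 Mx' sx [::] erefl.
have [-> _ _ _ _] := TJ _ _ t0 Mx; have [-> _ _ _ _] := TJ _ _ s0 Mx'.
by rewrite big_nil mulr1; apply.
Qed.

(* Newton's method makes the solution continuous; [implicit_class_Cr] upgrades
   this to class C^m. *)
Lemma block_solution : exists u : R -> X,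
  [/\ forall t : R, O (u t),
      forall t : R, 0 <= t -> g t (z0 t + u t) - B (u t) - r t = 0
    & forall a, valid a -> delta a -> class_Cr m (fun t => coef a (u t) : K^o)].
Proof.
have ex (t : R) : exists u, 0 <= t -> (O u /\ g t (z0 t + u) - B u - r t = 0) /\
    forall u', O u' /\ g t (z0 t + u') - B u' - r t = 0 -> u = u'.
  have [/unique_zero[u uP]|_] := boolP (0 <= t); first by exists u.
  by exists 0.
have [u0 uP] := choice ex; pose u (t : R) := if 0 <= t then u0 t else u0 0.
have u_sol (t : R) : 0 <= t -> O (u t) /\ g t (z0 t + u t) - B (u t) - r t = 0.
  by move=> t0; rewrite /u t0; exact: (uP t t0).1.
have u_unique (t : R) u' : 0 <= t -> O u' -> g t (z0 t + u') - B u' - r t = 0 -> u t = u'.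
  by move=> t0 Ou' eu'; rewrite /u t0; exact: (uP t t0).2.
have Ou t : O (u t).
  have [t0|t0] := boolP (0 <= t); first exact: (u_sol t t0).1.
  by rewrite /u (negbTE t0); exact: (uP 0 (lexx 0)).1.1.
have u_fix t : fix_proj delta (u t) by exact: (open_in_sub O_open).
have O_sub x : fix_proj delta x -> fix_proj S x by exact: fix_sub.
exists u; split=> // [t t0|]; first exact: (u_sol t t0).2.
have cz0 := class_Cr_cont z0_class_Cr; have cr := class_Cr_cont r_class_Cr.
have cu : cont_on half_line u.
  move=> t t0 e e0; have [Out eut] := u_sol t t0.
  have [Zi ZZi] := invertible t0 Out eut; have [_ ZiL _ _] := ZZi.
  have [N N0 HN] := bounded_linear_bound ZiL.
  have [T TJ] := g_class.
  have cpd := jet_partially_differentiable sE M_open TJ m_gt0.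
  have Mx := z0_M t0 Out; have c0 : 0 < 1 / 2 / N by rewrite !divr_gt0.
  have [d d0 Hd] := strict_partial sE M_open cpd t0 Mx c0.
  have [d1 d10 Hd1] := open_inP O_open Out.
  pose e1 := Num.min (e / 2) (Num.min (d / 4) (d1 / 2)).
  have e10 : 0 < e1 by rewrite !lt_min !divr_gt0.
  have [e11 [e12 e13]] : e1 <= e / 2 /\ (e1 <= d / 4 /\ e1 <= d1 / 2).
    by rewrite /e1 !ge_min !lexx !orbT.
  have e2 : 0 < e1 / 2 / N / 4 by rewrite !divr_gt0.
  have [d2 d20 Hd2] := class_C_continuous t0 Mx e2.
  have d2m : 0 < Num.min (d / 4) (d2 / 2) by rewrite lt_min !divr_gt0.
  have [d3 d30 Hd3] := cz0 t t0 _ d2m.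
  have [d4 d40 Hd4] := cr t t0 _ e2.
  exists (Num.min (Num.min d (d2 / 2)) (Num.min d3 d4)).
    by rewrite !lt_min d0 d30 d40 divr_gt0.
  move=> s s0; rewrite !lt_min => /andP[/andP[sd sd2] /andP[/(Hd3 s s0) zs /(Hd4 s s0) rs]].
  move: zs; rewrite lt_min => /andP[zs1 zs2].
  have dist v : z0 s + v - (z0 t + u t) = (z0 s - z0 t) + (v - u t) by vec (scalars R k).
  have near v : nrm (v - u t) <= e1 -> nrm (z0 s + v - (z0 t + u t)) < d.
    move=> ve; rewrite dist; apply: le_lt_trans (nrmD _ _) _; lra.
  have OO v : fix_proj delta v -> nrm (v - u t) <= e1 -> O v.
    by move=> vd ve; apply: Hd1 => //; lra.
  have q01 : 0 <= (1 / 2 : R) < 1 by apply/andP; split; lra.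
  have cN : 1 / 2 / N * N <= 1 / 2 by rewrite divfK // gt_eqF.
  have small : nrm (g s (z0 s + u t) - B (u t) - r s) <= e1 / 2 / N.
    have -> : g s (z0 s + u t) - B (u t) - r s =
       (g s (z0 s + u t) - g t (z0 t + u t)) - (r s - r t).
      by rewrite -[LHS]subr0 -eut; vec (scalars R k).
    apply: le_trans (nrmB _ _) _.
    have h1 : nrm (g s (z0 s + u t) - g t (z0 t + u t)) <= e1 / 2 / N / 4.
      apply: Hd2 => //; first exact: z0_M.
      by rewrite dist subrr addr0; lra.
    have e3 : 0 < e1 / 2 / N by rewrite !divr_gt0.
    by lra.
  have smallN : N * nrm (g s (z0 s + u t) - B (u t) - r s) <= e1 / 2.
    by have := ler_wpM2l (ltW N0) small; rewrite [leRHS]mulrC divfK // gt_eqF.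
  have [||||||v [vd vu v0]] := newton (q := 1 / 2) (c := 1 / 2 / N) (e := e1)
      (F := fun v => g s (z0 s + v) - B v - r s) (x0 := u t) sO sW _ ZZi (ltW N0) (ltW c0) q01 cN.
  - by move=> un l Hun; exact: proj_fix_closed.
  - exact: HN.
  - move=> v w vd wd ve we.
    have vwd : fix_proj delta (v - w) by exact: (subspaceB sO).
    have Ds := D_subspace hp.
    rewrite vwd (BB hp (fix_proj_D vd) (fix_proj_D wd)).
    have Bv : projQ delta (B v) = B v by rewrite -(B_proj hp) ?vd //; exact: fix_proj_D vd.
    have Bw : projQ delta (B w) = B w by rewrite -(B_proj hp) ?wd //; exact: fix_proj_D wd.
    rewrite (projQB hp) Bv Bw.
    have Mv : M (z0 s + v) by apply: z0_M => //; exact: OO.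
    have Mw : M (z0 s + w) by apply: z0_M => //; exact: OO.
    have := Hd s _ _ s0 sd Mv Mw (near v ve) (near w we).
    have -> : z0 s + v - (z0 s + w) = v - w by vec (scalars R k).
    by congr (nrm _ <= _); vec (scalars R k).
  - move=> v vd ve; do 2! apply: (subspaceB sW) => //.
    by rewrite /fix_projQ /= -(B_proj hp) ?vd //; exact: fix_proj_D vd.
  - exact: u_fix.
  - by apply: le_trans smallN _; lra.
  have vu' : nrm (v - u t) <= e1.
    by apply: le_trans vu _; rewrite ler_pdivrMr; lra.
  have -> : u s = v by apply: u_unique => //; exact: OO.
  lra.
have coef_cont (a : I) : valid a -> cont_on half_line (fun t => coef a (u t) : K^o).
  move=> va t t0 e e0; have [C C0 HC] := bounded_linear_bound (coef_linear hp va).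
  have [d d0 H] := cu t t0 _ (divr_gt0 e0 C0); exists d => // s s0 sd.
  rewrite -(coefB hp) //; apply: le_lt_trans (HC _ Logic.I) _.
  by have := H s s0 sd; rewrite ltr_pdivlMr // mulrC.
have coef_z0 (a : I) t : valid a -> delta a -> coef a (z0 t) = 0.
  by move=> va da; apply: (fix_coef hp (z0_fix t)) => //=; rewrite da.
have coef_u (a : I) t : valid a -> ~~ delta a -> coef a (u t) = 0.
  by move=> va da; apply: (fix_coef hp (u_fix t)).
have [T TJ] := g_class.
have zE t : \sum_(a | valid a && S a) coef a (z0 t + u t) *: phi a = z0 t + u t.
  rewrite -/(proj S _); apply: (subspaceD sE); last exact: O_sub.
  by apply: (fix_sub hp) (z0_fix t) => a va /andP[].
move=> a va da.
have := @implicit_class_Cr R k X Y m (fix_proj S) M g T sE M_open TJ I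
  (fun a => valid a && S a) (fun a => valid a && delta a) (@phi _ _ _ _ p) (@qf _ _ _ _ p)
  (fun a t => coef a (z0 t + u t)) (fun a t => qf a (r t)) m_gt0.
move=> H; apply: (class_Cr_eq (u := fun t => coef a (z0 t + u t) : K^o)).
  by move=> t _; rewrite (coefD hp) // coef_z0 // add0r.
apply: H; last by rewrite va.
- by move=> b /andP[vb db]; rewrite vb deltaS.
- by move=> b /andP[vb Sb]; exact: phi_fix.
- by move=> b /andP[vb _]; exact: (qf_bounded hp).
- by move=> t t0; rewrite zE; exact: z0_M.
- move=> b /andP[vb Sb]; rewrite vb /= => db.
  apply: (class_Cr_eq (u := fun t => coef b (z0 t) : K^o)); last exact: z0_class.
  by move=> t _; rewrite (coefD hp) // coef_u // addr0.
- move=> b /andP[vb db]; apply: cont_on_eq (coef_cont b vb) => t _.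
  by rewrite (coefD hp) // coef_z0 // add0r.
- by move=> b /andP[vb db]; exact: r_class.
- move=> t b t0 /andP[vb db]; rewrite zE (coefD hp) // coef_z0 // add0r.
  have [_ /eqP] := u_sol t t0; rewrite subr_eq0 => /eqP ge.
  rewrite -ge (qfB hp) // (coefE hp) //; last exact: fix_proj_D (u_fix t).
  by rewrite [RHS]addrC subrK.
- move=> t c t0 cE b /andP[vb db]; have [Out eut] := u_sol t t0.
  have [Zi [ZW ZiL ZiZ ZZi]] := invertible t0 Out eut.
  pose h := \sum_(b | valid b && delta b) c b *: phi b.
  have hd : fix_proj delta h.
    rewrite /fix_proj /=; apply: (eq_bigr _) => b' /andP[vb' db'].
    by rewrite (coef_comb hp) // db'.
  have Mx := z0_M t0 Out.
  have Zh : partial_x (fix_proj S) M g t (z0 t + u t) (proj delta h) -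
      projQ delta (B (proj delta h)) = 0.
    rewrite -[LHS](ZW _ hd) /projQ big1 // => b' /andP[vb' db'].
    rewrite hd (partial_x_jet sE M_open TJ m_gt0 t0 Mx); last exact: O_sub.
    rewrite (qfB hp) // (qf_projQ hp) // db' -(coefE hp) //; last exact: fix_proj_D hd.
    rewrite /h (coef_comb hp) // db' (jet_head_sum sE TJ t0 Mx) //; last first.
      by move=> b2 /andP[vb2 db2]; apply: phi_fix => //; exact: deltaS.
    rewrite (qf_sum hp) //.
    have /esym := cE b' (introT andP (conj vb' db')); rewrite zE => {1}->.
    under eq_bigr => b2 /andP[vb2 _] do rewrite (qfZ hp) //.
    by rewrite subrr scale0r.
  have := ZZi _ hd; rewrite Zh (bounded_linear0 sW ZiL) => h0.
  have := coef_comb hp delta c vb; rewrite db => <-.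
  by rewrite -/h -h0 (coef0 hp).
Qed.

End block.

Section component_sums.
Context {R : realType} {k : scalar_kind} {X Y : completeNormedModType (scalars R k)}.
Variable p : pencil X Y.
Local Notation K := (scalars R k).
Local Notation nu := (pencil_index p).
Local Notation n := (dim_ker p).
Local Notation rk := (@root_rank R k X Y p).
Local Notation I := ('I_n * 'I_nu)%type.
Local Notation fix_proj := (@fix_proj R k X Y p).
Local Notation fix_projQ := (@fix_projQ R k X Y p).
Local Notation proj := (@proj R k X Y p).
Local Notation projQ := (@projQ R k X Y p).
Hypothesis hp : pencil_setting p.
Implicit Types (S T : pred I) (M : set X).

Lemma open_inI (E O : set X) : O `<=` E ->
  (forall x, O x -> exists2 d : R, 0 < d & forall y, E y -> nrm (y - x) < d -> O y) ->
  open_in E O.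
Proof.
move=> OE near; exists [set y | exists x (d : R), [/\ O x, nrm (y - x) < d &
    forall z, E z -> nrm (z - x) < d -> O z]].
  rewrite openE => y [x [d [Ox yx dO]]]; apply/nbhs_nrmP.
  exists (d - nrm (y - x)); first by rewrite subr_gt0.
  move=> z zy; exists x, d; split=> //; apply: le_lt_trans (nrm_trans y z x) _.
  by rewrite -ltrBrDr.
apply/seteqP; split=> y; last by case=> Ey [x [d [_ yx]]]; exact.
move=> Oy; split; first exact: OE.
by have [d d0 dO] := near y Oy; exists y, d; rewrite subrr nrm0.
Qed.

Lemma fix_projP T u v : fix_proj T u -> fix_proj T v ->
  (forall a : I, valid a -> T a -> coef a u = coef a v) -> u = v.
Proof. by move=> uT vT uv; rewrite -uT -vT; exact: eq_proj_coef. Qed.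

Lemma proj_sum S a b (xs : nat -> X) :
  proj S (\sum_(a <= j < b) xs j) = \sum_(a <= j < b) proj S (xs j).
Proof. by apply: (big_morph _ (projD hp S) (proj0 hp S)). Qed.

Lemma proj_disjoint S S' x : (forall a : I, S a -> ~~ S' a) -> fix_proj S' x -> proj S x = 0.
Proof.
move=> SS' xS'; rewrite /proj big1 // => a /andP[va Sa].
by rewrite (fix_coef hp xS') ?scale0r // SS'.
Qed.

Lemma proj_sub S S' x : (forall a : I, valid a -> S a -> S' a) -> proj S (proj S' x) = proj S x.
Proof.
move=> SS'; rewrite (projI hp); apply: eq_proj => a va /=.
by case: (boolP (S a)) => // /(SS' a va)->.
Qed.

Lemma proj_fix S x : fix_proj S (proj S x).
Proof. by rewrite /fix_proj /= proj_sub. Qed.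

Lemma proj_near S x (d : R) : 0 < d -> exists2 d' : R, 0 < d' &
  forall y, nrm (y - x) < d' -> nrm (proj S y - proj S x) < d.
Proof.
move=> d0; have [C C0 HC] := bounded_linear_bound (proj_bounded hp S).
exists (d / C); first by rewrite divr_gt0.
move=> y; rewrite ltr_pdivlMr // mulrC => yx; rewrite -(projB hp).
by apply: le_lt_trans yx; exact: HC.
Qed.

Section families.
Variables (a b : nat) (S : nat -> pred I) (T : pred I) (M : nat -> set X).
Hypothesis MS : forall j, (a <= j < b)%N -> M j `<=` fix_proj (S j).
Hypothesis S_disjoint : forall c i j, S i c -> S j c -> i = j.
Hypothesis TS : forall c : I, valid c -> T c <-> exists2 j, (a <= j < b)%N & S j c.

Lemma family_sub j c : (a <= j < b)%N -> valid c -> S j c -> T c.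
Proof. by move=> jab vc Sc; apply/TS => //; exists j. Qed.

Lemma family_sum x : fix_proj T x -> x = \sum_(a <= j < b) proj (S j) x.
Proof.
move=> xT; apply: (fix_projP xT).
  rewrite big_nat; apply: subspace_sum => [|j jab]; first exact: proj_fix_subspace.
  by apply: (fix_sub hp (S := S j)) (proj_fix _ _) => c; exact: family_sub.
move=> c vc /(TS vc)[j jab Sc]; rewrite (coef_sum hp) //.
rewrite (bigD1_seq j) /= ?mem_index_iota ?iota_uniq // (coef_proj hp) // Sc.
rewrite big1 ?addr0 // => i ij; rewrite (coef_proj hp) //; case: ifP => // /(S_disjoint Sc) ji.
by rewrite ji eqxx in ij.
Qed.

Lemma sum_setE : sum_set a b M =
  [set x | fix_proj T x /\ forall j, (a <= j < b)%N -> M j (proj (S j) x)].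
Proof.
apply/seteqP; split=> x; last first.
  by move=> [xT xM]; exists (fun j => proj (S j) x) => //; exact: family_sum.
move=> [xs xsM ->]; split.
  rewrite big_nat; apply: subspace_sum => [|j jab]; first exact: proj_fix_subspace.
  by apply: (fix_sub hp) (MS jab (xsM j jab)) => c; exact: family_sub.
move=> j jab; rewrite proj_sum (bigD1_seq j) /= ?mem_index_iota ?iota_uniq //.
rewrite (MS jab (xsM j jab)) big_nat_cond big1 ?addr0; first exact: xsM.
move=> i /andP[iab ij]; apply: (proj_disjoint (S' := S i)); last exact: MS (xsM i iab).
by move=> c Sj; apply/negP => /(S_disjoint Sj) ji; rewrite ji eqxx in ij.
Qed.

Lemma sum_set_open : (forall j, (a <= j < b)%N -> open_in (fix_proj (S j)) (M j)) ->
  open_in (fix_proj T) (sum_set a b M).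
Proof.
move=> Mo; rewrite sum_setE; apply: open_inI => [x []//|x [xT xM]].
have [d d0 H] : exists2 d : R, 0 < d & forall y, nrm (y - x) < d ->
    forall j, (a <= j < b)%N -> M j (proj (S j) y).
  have : forall j, exists d : R, 0 < d /\ ((a <= j < b)%N -> forall y, nrm (y - x) < d ->
      M j (proj (S j) y)).
    move=> j; have [jab|_] := boolP (a <= j < b)%N; last by exists 1.
    have [d d0 dM] := open_inP (Mo j jab) (xM j jab).
    have [d' d'0 H] := proj_near (S j) x d0.
    by exists d'; split=> // _ y /H; apply: dM; exact: proj_fix.
  move=> /choice[d dP]; exists (\big[Num.min/1]_(a <= j < b) d j).
    by elim/big_ind: _ => // [u v u0 v0|j _]; [rewrite lt_min u0 | have [] := dP j].
  move=> y yx j jab; apply: (dP j).2 => //; apply: lt_le_trans yx _.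
  by apply: ge_bigmin_seq => //; rewrite mem_index_iota.
exists d => // y yT yx; split=> //; exact: H.
Qed.

End families.

Section pairs.
Variables (S1 S2 T : pred I) (M1 M2 : set X).
Hypothesis M1S : M1 `<=` fix_proj S1.
Hypothesis M2S : M2 `<=` fix_proj S2.
Hypothesis S_disjoint : forall c, S1 c -> ~~ S2 c.
Hypothesis TS : forall c : I, valid c -> T c = S1 c || S2 c.

Lemma pair_sum x : fix_proj T x -> x = proj S1 x + proj S2 x.
Proof.
have S1T (c : I) : valid c -> S1 c -> T c by move=> vc; rewrite TS // => ->.
have S2T (c : I) : valid c -> S2 c -> T c by move=> vc; rewrite TS // orbC => ->.
move=> xT; apply: (fix_projP xT).
  apply: subspaceD; first exact: proj_fix_subspace.
    exact: fix_sub (proj_fix S1 x).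
  exact: fix_sub (proj_fix S2 x).
move=> c vc; rewrite TS // (coefD hp) // !(coef_proj hp) //.
case: (boolP (S1 c)) => [/S_disjoint/negbTE->|_ /= ->]; last by rewrite add0r.
by rewrite addr0.
Qed.

Lemma sum_set2E : sum_set2 M1 M2 =
  [set x | [/\ fix_proj T x, M1 (proj S1 x) & M2 (proj S2 x)]].
Proof.
have S1T (c : I) : valid c -> S1 c -> T c by move=> vc; rewrite TS // => ->.
have S2T (c : I) : valid c -> S2 c -> T c by move=> vc; rewrite TS // orbC => ->.
apply/seteqP; split=> x; last first.
  by move=> [xT x1 x2]; exists (proj S1 x) => //; exists (proj S2 x) => //; rewrite -pair_sum.
move=> [u uM [v vM <-]]; have uS := M1S uM; have vS := M2S vM; split.
- apply: subspaceD; first exact: proj_fix_subspace.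
    exact: fix_sub uS.
  exact: fix_sub vS.
- by rewrite (projD hp) uS (proj_disjoint (S' := S2)) ?addr0.
- rewrite (projD hp) vS (proj_disjoint (S' := S1)) ?add0r // => c; apply: contraTN => c1.
  exact: S_disjoint.
Qed.

Lemma sum_set2_open : open_in (fix_proj S1) M1 -> open_in (fix_proj S2) M2 ->
  open_in (fix_proj T) (sum_set2 M1 M2).
Proof.
move=> o1 o2; rewrite sum_set2E; apply: open_inI => [x []//|x [xT x1 x2]].
have [d d0 dM] := open_inP o1 x1; have [e e0 eM] := open_inP o2 x2.
have [d' d'0 Hd] := proj_near S1 x d0; have [e' e'0 He] := proj_near S2 x e0.
exists (Num.min d' e'); first by rewrite lt_min d'0.
move=> y yT; rewrite lt_min => /andP[/Hd y1 /He y2]; split=> //.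
  by apply: dM => //; exact: proj_fix.
by apply: eM => //; exact: proj_fix.
Qed.

End pairs.

Definition diag_wedge s : pred I := fun a => diag_from 1 a || wedge_from s a.

Lemma diag_disjoint (c : I) i j : diag i c -> diag j c -> i = j.
Proof. by move=> /andP[/eqP<- _] /andP[/eqP<- _]. Qed.

Lemma wedge_disjoint (c : I) i j : wedge i c -> wedge j c -> i = j.
Proof. by move=> /andP[/eqP<- _] /andP[/eqP<- _]. Qed.

Lemma diag_fromP s (c : I) : valid c ->
  diag_from s c <-> exists2 j, (s <= j < nu)%N & diag j c.
Proof.
move=> vc; split=> [/andP[sc cr]|[j /andP[sj _] /andP[/eqP cj cr]]].
  by exists c.2; rewrite /diag ?eqxx ?sc ?ltn_ord.
by rewrite /diag_from cj sj.
Qed.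

Lemma wedge_fromP s (c : I) : valid c ->
  wedge_from s c <-> exists2 j, (s <= j < nu.-1)%N & wedge j c.
Proof.
move=> vc; split=> [/andP[sc cr]|[j /andP[sj _] /andP[/eqP cj cr]]].
  exists c.2; last by rewrite /wedge eqxx.
  rewrite sc /=; have /andP[_] := rk_bounds hp c.1 => /(leq_trans cr).
  by move/leq_sub2r => /(_ 1%N); rewrite !subn1.
by rewrite /wedge_from cj sj.
Qed.

Lemma diag_wedge_disjoint s s' (c : I) : diag_from s c -> ~~ wedge_from s' c.
Proof. by move=> /andP[_ /eqP h]; rewrite /wedge_from h ltnn andbF. Qed.

Lemma fix_proj_eq S T : (forall c : I, valid c -> S c = T c) ->
  fix_proj S = fix_proj T.
Proof.
by move=> ST; apply/seteqP; split=> x; apply: (fix_sub hp) => c /ST->.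
Qed.

Lemma fix_projQ_eq S T : (forall c : I, valid c -> S c = T c) ->
  fix_projQ S = fix_projQ T.
Proof.
by move=> ST; apply/seteqP; split=> x; apply: (fixQ_sub hp) => c /ST->.
Qed.

Lemma image_eq (U V : Type) (g h : U -> V) (W : set U) : g =1 h -> g @` W = h @` W.
Proof. by move=> /funext->. Qed.

Lemma D2sjE j : D2sj p j j.+1 = fix_proj (diag j).
Proof. by rewrite /D2sj (image_eq _ (P2diagE hp j)); exact: proj_image. Qed.
Lemma D2sE j : D2s p j = fix_proj (level j).
Proof. by rewrite /D2s (image_eq _ (P2sE hp j)); exact: proj_image. Qed.
Lemma D2wedgeE j : D2wedge p j = fix_proj (wedge j).
Proof. by rewrite /D2wedge (image_eq _ (P2wedgeE hp j)); exact: proj_image. Qed.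
Lemma D2SigmaE : D2Sigma p = fix_proj (from 1).
Proof. by rewrite /D2Sigma (image_eq _ (P2SigmaE hp)); exact: proj_image. Qed.
Lemma Y2sjE j : Y2sj p j j.+1 = fix_projQ (diag j).
Proof. by rewrite /Y2sj (image_eq _ (Q2diagE hp j)); exact: projQ_range. Qed.
Lemma Y2sE j : Y2s p j = fix_projQ (level j).
Proof. by rewrite /Y2s (image_eq _ (Q2sE hp j)); exact: projQ_range. Qed.
Lemma Y2SigmaE j : Y2Sigma p j = fix_projQ (wedge j).
Proof. by rewrite /Y2Sigma (image_eq _ (Q2SigmaE hp j)); exact: projQ_range. Qed.

Lemma E2diagE s : E2diag p s = fix_proj (diag_from s).
Proof.
rewrite /E2diag (sum_setE (S := fun j => diag j) (T := diag_from s)).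
- apply/seteqP; split=> x; first by case.
  by move=> xT; split=> // j _; rewrite D2sjE; exact: proj_fix.
- by move=> j _; rewrite D2sjE.
- by move=> c i j; exact: diag_disjoint.
- by move=> c; exact: diag_fromP.
Qed.

Lemma E2wedgeE s : E2wedge p s = fix_proj (wedge_from s).
Proof.
rewrite /E2wedge (sum_setE (S := fun j => wedge j) (T := wedge_from s)).
- apply/seteqP; split=> x; first by case.
  by move=> xT; split=> // j _; rewrite D2wedgeE; exact: proj_fix.
- by move=> j _; rewrite D2wedgeE.
- by move=> c i j; exact: wedge_disjoint.
- by move=> c; exact: wedge_fromP.
Qed.

Lemma E_diag_wedge s :
  sum_set2 (E2diag p 1) (E2wedge p s) = fix_proj (diag_wedge s).
Proof.
rewrite E2diagE E2wedgeE (sum_set2E (S1 := diag_from 1) (S2 := wedge_from s) (T := diag_wedge s)) //.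
  by apply/seteqP; split=> x; [case | split=> //; exact: proj_fix].
by move=> c; exact: diag_wedge_disjoint.
Qed.

Section neighbourhoods.
Variables Md Mw : nat -> set X.
Hypothesis Md_open : forall j, (1 <= j < nu)%N -> open_in (fix_proj (diag j)) (Md j).
Hypothesis Mw_open : forall j, (1 <= j < nu.-1)%N -> open_in (fix_proj (wedge j)) (Mw j).

Definition Mdw s : set X := sum_set2 (M2diag p Md 1) (M2wedge p Mw s).

Lemma M2diagE s : (1 <= s)%N -> M2diag p Md s =
  [set x | fix_proj (diag_from s) x /\ forall j, (s <= j < nu)%N -> Md j (proj (diag j) x)].
Proof.
move=> s1; rewrite /M2diag (sum_setE (S := fun j => diag j) (T := diag_from s)) //.
- move=> j /andP[sj jn] x; apply: open_in_sub; apply: Md_open.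
  by rewrite (leq_trans s1 sj).
- by move=> c i j; exact: diag_disjoint.
- by move=> c; exact: diag_fromP.
Qed.

Lemma M2diag_open s : (1 <= s)%N -> open_in (fix_proj (diag_from s)) (M2diag p Md s).
Proof.
move=> s1; have Mo j : (s <= j < nu)%N -> open_in (fix_proj (diag j)) (Md j).
  by move=> /andP[sj jn]; apply: Md_open; rewrite (leq_trans s1 sj).
apply: (sum_set_open (S := fun j => diag j) (T := diag_from s)) => //.
- by move=> j jn x; apply: open_in_sub; exact: Mo.
- by move=> c i j; exact: diag_disjoint.
- by move=> c; exact: diag_fromP.
Qed.

Lemma M2wedgeE s : (1 <= s)%N -> M2wedge p Mw s =
  [set x | fix_proj (wedge_from s) x /\ forall j, (s <= j < nu.-1)%N -> Mw j (proj (wedge j) x)].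
Proof.
move=> s1; rewrite /M2wedge (sum_setE (S := fun j => wedge j) (T := wedge_from s)) //.
- move=> j /andP[sj jn] x; apply: open_in_sub; apply: Mw_open.
  by rewrite (leq_trans s1 sj).
- by move=> c i j; exact: wedge_disjoint.
- by move=> c; exact: wedge_fromP.
Qed.

Lemma M2wedge_open s : (1 <= s)%N -> open_in (fix_proj (wedge_from s)) (M2wedge p Mw s).
Proof.
move=> s1; have Mo j : (s <= j < nu.-1)%N -> open_in (fix_proj (wedge j)) (Mw j).
  by move=> /andP[sj jn]; apply: Mw_open; rewrite (leq_trans s1 sj).
apply: (sum_set_open (S := fun j => wedge j) (T := wedge_from s)) => //.
- by move=> j jn x; apply: open_in_sub; exact: Mo.
- by move=> c i j; exact: wedge_disjoint.
- by move=> c; exact: wedge_fromP.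
Qed.

Lemma MdwE s : (1 <= s)%N -> Mdw s =
  [set x | [/\ fix_proj (diag_wedge s) x, forall j, (1 <= j < nu)%N -> Md j (proj (diag j) x)
    & forall j, (s <= j < nu.-1)%N -> Mw j (proj (wedge j) x)]].
Proof.
move=> s1; rewrite /Mdw (sum_set2E (S1 := diag_from 1) (S2 := wedge_from s) (T := diag_wedge s)) //.
- rewrite M2diagE // M2wedgeE //; apply/seteqP; split=> x.
    move=> [xT [_ xd] [_ xw]]; split=> // j jn.
      rewrite -(proj_sub (S' := diag_from 1)) => [|c vc cj]; first exact: xd.
      by apply/diag_fromP => //; exists j.
    rewrite -(proj_sub (S' := wedge_from s)) => [|c vc cj]; first exact: xw.
    by apply/wedge_fromP => //; exists j.
  move=> [xT xd xw]; split=> //; (split=> [|j jn]; first exact: proj_fix).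
    rewrite proj_sub => [|c vc cj]; first exact: xd.
    by apply/diag_fromP => //; exists j.
  rewrite proj_sub => [|c vc cj]; first exact: xw.
  by apply/wedge_fromP => //; exists j.
- exact: open_in_sub (M2diag_open _).
- exact: open_in_sub (M2wedge_open _).
- by move=> c; exact: diag_wedge_disjoint.
Qed.

Lemma Mdw_open s : (1 <= s)%N -> open_in (fix_proj (diag_wedge s)) (Mdw s).
Proof.
move=> s1; apply: sum_set2_open (M2diag_open _) (M2wedge_open _) => //.
- exact: open_in_sub (M2diag_open _).
- exact: open_in_sub (M2wedge_open _).
- by move=> c; exact: diag_wedge_disjoint.
Qed.

End neighbourhoods.
End component_sums.

Lemma deriv_on_linear (R : realType) (k : scalar_kind) (V W : normedModType (scalars R k))
    (E : set V) (T : V -> W) (S : set R) (u : R -> V) (t : R) (l : V) :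
  subspace E -> bounded_linear_on (@nrm R k V) (@nrm R k W) E T ->
  (forall s, S s -> E (u s)) -> E (u t) -> E l ->
  deriv_on S u t l -> deriv_on S (fun s => T (u s)) t (T l).
Proof.
move=> sE bT uE ut El du e e0; have [C C0 HC] := bounded_linear_bound bT.
have [d d0 H] := du _ (divr_gt0 e0 C0); exists d => // s Ss st.
have Es := uE s Ss; have Ed := subspaceB sE Es ut; have El' := subspaceZ sE (of_real (s - t)) El.
rewrite -(bounded_linearB sE bT) // -(bounded_linearZ sE bT) // -(bounded_linearB sE bT) //.
apply: le_trans (HC _ _) _; first exact: (subspaceB sE).
by rewrite mulrC -ler_pdivlMr // mulrAC; exact: H.
Qed.

Section cascade.
Context {R : realType} {k : scalar_kind} {X Y : completeNormedModType (scalars R k)}.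
Variable p : pencil X Y.
Local Notation K := (scalars R k).
Local Notation A := (opA p).
Local Notation B := (opB p).
Local Notation nu := (pencil_index p).
Local Notation n := (dim_ker p).
Local Notation rk := (@root_rank R k X Y p).
Local Notation I := ('I_n * 'I_nu)%type.
Local Notation fix_proj := (@fix_proj R k X Y p).
Local Notation fix_projQ := (@fix_projQ R k X Y p).
Local Notation proj := (@proj R k X Y p).
Local Notation projQ := (@projQ R k X Y p).
Hypothesis hp : pencil_setting p.
Variables (f : R -> X -> Y) (Md Mw : nat -> set X).
Local Notation Mdiag := (M2diag p Md).
Local Notation Mdw := (Mdw p Md Mw).

Definition diag_order j := if j == nu.-1 then nu.-1 else nu.-2.
Definition diag_eq j t x : Prop :=
  projQ (diag j) (f t (proj (diag_from j) x)) - B (proj (diag j) x) = 0.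
Definition wedge_eq j t x d : Prop :=
  projQ (wedge j) (f t (proj (diag_wedge j) x)) - B (proj (wedge j) x)
  - A (proj (level j.+1) d) = 0.

Hypothesis Md_open : forall j, (1 <= j < nu)%N -> open_in (fix_proj (diag j)) (Md j).
Hypothesis Mw_open : forall j, (1 <= j < nu.-1)%N -> open_in (fix_proj (wedge j)) (Mw j).
Hypothesis diag_smooth : forall s, (1 <= s < nu)%N ->
  class_C (diag_order s) half_line (fix_proj (diag_from s)) (Mdiag s)
    (fun t x => projQ (diag s) (f t x)).
Hypothesis diag_zero : forall s, (1 <= s < nu)%N -> forall (t : R) z, 0 <= t ->
  Mdiag s.+1 z -> exists! u, Md s u /\ projQ (diag s) (f t (z + u)) - B u = 0.
Hypothesis diag_inv : forall s, (1 <= s < nu)%N -> forall (t : R) z u, 0 <= t ->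
  Mdiag s.+1 z -> Md s u -> projQ (diag s) (f t (z + u)) - B u = 0 ->
  has_bounded_inverse (@nrm R k X) (@nrm R k Y) (fix_proj (diag s)) (fix_projQ (diag s))
    (fun h => partial_x (fix_proj (diag_from s)) (Mdiag s)
       (fun t' x' => projQ (diag s) (f t' x')) t (z + u) (proj (diag s) h)
       - projQ (diag s) (B (proj (diag s) h))).
Hypothesis wedge_smooth : forall s, (1 <= s < nu.-1)%N ->
  class_C s half_line (fix_proj (diag_wedge s)) (Mdw s)
    (fun t x => projQ (wedge s) (f t x)).
Hypothesis wedge_zero : forall s, (1 <= s < nu.-1)%N -> forall (t : R) z d, 0 <= t ->
  Mdw s.+1 z -> fix_proj (level s.+1) d ->
  exists! u, Mw s u /\ projQ (wedge s) (f t (z + u)) - B u - A d = 0.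
Hypothesis wedge_inv : forall s, (1 <= s < nu.-1)%N -> forall (t : R) z u d, 0 <= t ->
  Mdw s.+1 z -> fix_proj (level s.+1) d ->
  Mw s u -> projQ (wedge s) (f t (z + u)) - B u - A d = 0 ->
  has_bounded_inverse (@nrm R k X) (@nrm R k Y) (fix_proj (wedge s)) (fix_projQ (wedge s))
    (fun h => partial_x (fix_proj (diag_wedge s)) (Mdw s)
       (fun t' x' => projQ (wedge s) (f t' x')) t (z + u) (proj (wedge s) h)
       - projQ (wedge s) (B (proj (wedge s) h))).

Lemma wedge_val s (a : I) : wedge s a = (a.2 == s :> nat) && (a.2.+1 < rk a.1)%N.
Proof. by rewrite /wedge; case: eqP => // ->. Qed.

Lemma diag_val s (a : I) : diag s a = (a.2 == s :> nat) && (rk a.1 == a.2.+1).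
Proof. by rewrite /diag; case: eqP => // ->. Qed.

Lemma diag_order_gt0 s : (1 <= s < nu)%N -> (0 < diag_order s)%N.
Proof.
rewrite /diag_order; case: eqP => [<- /andP[]//|].
by case: (nu) => [|[|[|m]]] //=; case: s => [|[|s]].
Qed.

Lemma diag_order_le s j : (s < j < nu)%N -> (diag_order s <= diag_order j)%N.
Proof.
case/andP=> sj jn; rewrite /diag_order [s == _]ltn_eqF; last first.
  by apply: leq_trans sj _; move/leq_sub2r: jn => /(_ 1%N); rewrite !subn1.
by case: ifP => // _; exact: leq_pred.
Qed.

Lemma diag_order_ge s j : (s <= j)%N -> (s < nu.-1)%N -> (j < nu)%N -> (s <= diag_order j)%N.
Proof.
rewrite /diag_order => sj sn jn; case: ifP => _; first exact: ltnW.
by move/leq_sub2r: sn => /(_ 1%N); rewrite !subn1.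
Qed.

Lemma diag_order_geS s : (s < nu.-1)%N -> (s.+1 <= diag_order s.+1)%N.
Proof.
rewrite /diag_order => sn; case: eqP => [<-//|ne].
have {sn ne}: (s.+1 < nu.-1)%N by rewrite ltn_neqAle sn; apply/andP; split=> //; apply/eqP.
by move/leq_sub2r => /(_ 1%N); rewrite !subn1.
Qed.

Lemma Mdiag_add s z u : (1 <= s < nu)%N -> Mdiag s.+1 z -> Md s u -> Mdiag s (z + u).
Proof.
move=> /andP[_ sn] [xs xsM ->] us.
exists (fun j => if j == s then u else xs j) => [j /andP[sj jn]|].
  case: eqP => [->//|js]; apply: xsM; rewrite jn andbT ltn_neqAle sj andbT.
  by rewrite eq_sym; apply/eqP.
rewrite [RHS]big_ltn // eqxx addrC; congr (_ + _); apply: eq_big_nat => j /andP[sj _].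
by rewrite gtn_eqF.
Qed.

Lemma Mdw_add s z u : (1 <= s < nu.-1)%N -> Mdw s.+1 z -> Mw s u -> Mdw s (z + u).
Proof.
move=> /andP[_ sn] [z1 z1M [_ [xs xsM ->] <-]] us; exists z1 => //.
exists (\sum_(s.+1 <= j < nu.-1) xs j + u); last by rewrite addrA.
exists (fun j => if j == s then u else xs j) => [j /andP[sj jn]|].
  case: eqP => [->//|js]; apply: xsM; rewrite jn andbT ltn_neqAle sj andbT.
  by rewrite eq_sym; apply/eqP.
rewrite [RHS]big_ltn // eqxx addrC; congr (_ + _); apply: eq_big_nat => j /andP[sj _].
by rewrite gtn_eqF.
Qed.

Lemma Mdiag_split s x : (1 <= s < nu)%N -> Mdiag s x ->
  [/\ Mdiag s.+1 (proj (diag_from s.+1) x), Md s (proj (diag s) x) &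
      proj (diag_from s) x = proj (diag_from s.+1) x + proj (diag s) x].
Proof.
move=> /andP[s1 sn]; rewrite !(M2diagE hp Md_open) // => -[xT xM]; split.
- split=> [|j /andP[sj jn]]; first exact: proj_fix.
  rewrite (proj_sub hp) => [|a va /andP[/eqP aj ar]]; first by apply: xM; rewrite (ltnW sj).
  by rewrite /diag_from aj sj.
- by apply: xM; rewrite leqnn.
- rewrite [LHS]xT; apply: (fix_projP xT).
    apply: subspaceD; first exact: proj_fix_subspace.
      by apply: fix_sub (proj_fix hp _ _) => // a _ /andP[sa ar]; rewrite /diag_from (ltnW sa).
    by apply: fix_sub (proj_fix hp _ _) => // a _ /andP[/eqP sa ar]; rewrite /diag_from sa leqnn.
  move=> a va /andP[sa ar]; rewrite (coefD hp) // !(coef_proj hp) //.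
  rewrite /diag_from /diag; have /eqP-> := ar; rewrite eqxx !andbT.
  case: ltngtP sa => // [sa|sa] _; first by rewrite addr0.
  by rewrite sa eqxx add0r.
Qed.

Lemma Mdw_split s x : (1 <= s < nu.-1)%N -> Mdw s x ->
  [/\ Mdw s.+1 (proj (diag_wedge s.+1) x), Mw s (proj (wedge s) x) &
      proj (diag_wedge s) x = proj (diag_wedge s.+1) x + proj (wedge s) x].
Proof.
move=> /andP[s1 sn]; rewrite !(MdwE hp Md_open Mw_open) // => -[xT xd xw]; split.
- split=> [|j /andP[j1 jn]|j /andP[sj jn]]; first exact: proj_fix.
    rewrite (proj_sub hp) => [|a va /andP[/eqP aj ar]]; first by apply: xd; rewrite j1.
    by rewrite /diag_wedge /diag_from aj j1 ar.
  rewrite (proj_sub hp) => [|a va /andP[/eqP aj ar]]; first by apply: xw; rewrite (ltnW sj).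
  by rewrite /diag_wedge /wedge_from aj sj ar orbT.
- by apply: xw; rewrite leqnn.
- rewrite [LHS]xT; apply: (fix_projP xT).
    apply: subspaceD; first exact: proj_fix_subspace.
      apply: fix_sub (proj_fix hp _ _) => // a _ /orP[d|/andP[sa ar]].
        by rewrite /diag_wedge d.
      by rewrite /diag_wedge /wedge_from (ltnW sa) ar orbT.
    apply: fix_sub (proj_fix hp _ _) => // a _ /andP[/eqP sa ar].
    by rewrite /diag_wedge /wedge_from sa leqnn ar orbT.
  move=> a va ad; rewrite (coefD hp) // !(coef_proj hp) //.
  move: ad; rewrite /diag_wedge; case: (boolP (diag_from 1 a)) => [d _|_] /=.
    by move: d => /andP[_ /eqP ar]; rewrite wedge_val ar ltnn andbF addr0.
  rewrite /wedge_from wedge_val => /andP[sa ar]; rewrite ar !andbT.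
  case: ltngtP sa => // [sa|sa] _; first by rewrite addr0.
  by rewrite ?sa ?eqxx add0r.
Qed.

Lemma wedge_next s (a : I) : wedge s a -> level s.+1 (next a) /\ valid (next a).
Proof.
move=> /andP[/eqP sa]; rewrite -{1}sa => ar; have [nE vn] := next_val hp ar.
by rewrite /level nE sa eqxx.
Qed.

Lemma A_level s d : fix_proj (level s.+1) d -> fix_projQ (wedge s) (A d).
Proof.
have sW := projQ_fix_subspace hp (wedge s); have sA := A_lin hp.
move=> dE; rewrite -dE /proj.
rewrite (linD_sum hp sA) => [|a /andP[va _]]; last first.
  by apply: (subspaceZ (D_subspace hp)); exact: phi_D.
apply: (subspace_sum sW) => a /andP[va /eqP la].
rewrite (linDZ hp sA); last exact: phi_D.
apply: (subspaceZ sW).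
have [|b [vb br ab]] := valid_next_of va; first by rewrite la.
have [nE _] := next_val hp br.
rewrite ab (A_phi_next hp) //; apply: (subspaceN sW).
apply: (fixQ_sub hp (S := pred1 b)) => [c _ /eqP->|].
  by rewrite wedge_val br andbT; apply/eqP; apply: succn_inj; rewrite -nE -ab.
rewrite /projQ (bigD1 b) ?vb //= ?eqxx // (qf_phi hp) // eqxx scale1r big1 ?addr0 //.
by move=> c /andP[/andP[_ /eqP->]]; rewrite eqxx.
Qed.

Lemma diag_eq_sub j s t z u : (s < j)%N -> fix_proj (diag s) u ->
  diag_eq j t z -> diag_eq j t (z + u).
Proof.
move=> sj us; rewrite /diag_eq !(projD hp) !(proj_disjoint hp _ us) ?addr0 //.
  by move=> a /andP[/eqP aj _]; rewrite /diag aj gtn_eqF.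
by move=> a /andP[ja _]; rewrite /diag gtn_eqF // (leq_trans sj).
Qed.

Lemma diag_cascade d s : (1 <= s)%N -> (nu <= s + d)%N -> exists z : R -> X,
  [/\ forall t : R, Mdiag s (z t),
      forall (t : R) j, 0 <= t -> (s <= j < nu)%N -> diag_eq j t (z t)
    & forall a : I, valid a -> diag_from s a ->
        class_Cr (diag_order a.2) (fun t => coef a (z t) : K^o)].
Proof.
have big_s s' : (nu <= s')%N -> exists z : R -> X,
    [/\ forall t : R, Mdiag s' (z t),
      forall (t : R) j, 0 <= t -> (s' <= j < nu)%N -> diag_eq j t (z t)
    & forall a : I, valid a -> diag_from s' a ->
        class_Cr (diag_order a.2) (fun t => coef a (z t) : K^o)].
  move=> ns; exists (fun=> 0); split.
  - move=> _; exists (fun=> 0) => [j /andP[sj jn]|]; last by rewrite big1.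
    by have := leq_ltn_trans (leq_trans ns sj) jn; rewrite ltnn.
  - by move=> t j _ /andP[sj jn]; have := leq_ltn_trans (leq_trans ns sj) jn; rewrite ltnn.
  - by move=> a _ /andP[sa _]; have := leq_ltn_trans (leq_trans ns sa) (ltn_ord a.2); rewrite ltnn.
elim: d s => [|d IH] s s1; first by rewrite addn0; exact: big_s.
have [ns _|sn] := leqP nu s; first exact: big_s.
rewrite addnS -addSn => /(IH s.+1 (ltnW s1))[z [zM zeq zc]].
have s1n : (1 <= s < nu)%N by rewrite s1.
have z_fix t : fix_proj (diag_from s.+1) (z t).
  by have := zM t; rewrite (M2diagE hp Md_open) // => -[].
have := @block_solution R k X Y p hp (diag_from s) (diag s) (Mdiag s) (Md s)
  (fun t x => projQ (diag s) (f t x)) (diag_order s) z (fun=> 0) (diag_order_gt0 s1n).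
case.
- by move=> a va /andP[/eqP sa ar]; rewrite /diag_from sa leqnn.
- exact: (M2diag_open hp Md_open).
- exact: Md_open.
- exact: diag_smooth.
- by move=> t x; rewrite /fix_projQ /= (projQI hp); apply: eq_projQ => a _ /=; rewrite andbb.
- move=> t; apply: (fix_sub hp) (z_fix t) => a va /andP[sa ar] /=.
  by rewrite /diag /diag_from gtn_eqF // ar (ltnW sa).
- move=> a va /andP[sa ar]; rewrite diag_val ar andbT => sa'.
  have {sa'}sa : (s < a.2)%N by rewrite ltn_neqAle eq_sym sa' sa.
  apply: class_Cr_le (zc a va _); last by rewrite /diag_from sa.
  by apply: diag_order_le; rewrite sa ltn_ord.
- by move=> t; rewrite /fix_projQ /= (projQ0 hp).
- by move=> a va _; apply: class_Cr_eq (class_Cr_cst _ (0 : K^o)) => t _; rewrite (qf0 hp).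
- by move=> t u _; exact: Mdiag_add.
- move=> t t0; have [u [[uM ueq] uu]] := diag_zero s1n t0 (zM t).
  exists u; split=> [|v [vM veq]]; first by rewrite subr0.
  by apply: uu; rewrite subr0 in veq.
- by move=> t u t0 uM; rewrite subr0; exact: diag_inv.
move=> u [uM ueq uc]; have u_fix t : fix_proj (diag s) (u t).
  by apply: (open_in_sub (Md_open s1n)); exact: uM.
exists (fun t => z t + u t); split=> [t|t j t0 /andP[sj jn]|a va /andP[sa ar]].
- exact: Mdiag_add.
- case: (ltngtP s j) sj => // [sj|<-] _.
    by apply: (@diag_eq_sub j s) => //; apply: zeq => //; rewrite sj.
  have [_ _ E] := Mdiag_split s1n (Mdiag_add s1n (zM t) (uM t)).
  rewrite /diag_eq; have := ueq t t0; rewrite subr0.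
  have -> : proj (diag_from s) (z t + u t) = z t + u t.
    by have := Mdiag_add s1n (zM t) (uM t); rewrite (M2diagE hp Md_open) // => -[].
  rewrite (projD hp) u_fix (proj_disjoint hp _ (z_fix t)) ?add0r // => b.
  by move=> /andP[/eqP sb _]; rewrite /diag_from sb ltnn.
- case: (ltngtP s a.2) sa => // [sa|sa] _.
    apply: class_Cr_eq (zc a va _) => [t _|]; last by rewrite /diag_from sa.
    by rewrite (coefD hp) // (fix_coef hp (u_fix t)) ?addr0 // /diag gtn_eqF.
  apply: (class_Cr_eq (u := fun t => coef a (u t) : K^o)) => [t _|].
    by rewrite (coefD hp) // (fix_coef hp (z_fix t)) ?add0r // /diag_from sa ltnn.
  by rewrite -sa; apply: uc => //; rewrite /diag sa eqxx.
Qed.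

Lemma proj_level_from s j d : (s < j)%N -> fix_proj (level s) d -> proj (level j) d = 0.
Proof.
by move=> sj; apply: (proj_disjoint hp) => a /eqP aj; rewrite /level aj gtn_eqF.
Qed.

Lemma wedge_cascade d s : (1 <= s)%N -> (nu.-1 <= s + d)%N -> exists z w : R -> X,
  [/\ [/\ forall t : R, Mdw s (z t),
      forall (t : R) j, 0 <= t -> (1 <= j < nu)%N -> diag_eq j t (z t)
    & forall (t : R) j, 0 <= t -> (s <= j < nu.-1)%N -> wedge_eq j t (z t) (w t)],
      forall a : I, valid a -> diag_from 1 a ->
        class_Cr (diag_order a.2) (fun t => coef a (z t) : K^o),
      forall a : I, valid a -> wedge_from s a ->
        class_Cr a.2 (fun t => coef a (z t) : K^o)
    & forall a : I, valid a -> (s < a.2)%N -> forall t : R, 0 <= t ->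
        deriv_on half_line (fun t => coef a (z t) : K^o) t (coef a (w t))].
Proof.
have big_s s' : (1 <= s')%N -> (nu.-1 <= s')%N -> exists z w : R -> X,
  [/\ [/\ forall t : R, Mdw s' (z t),
      forall (t : R) j, 0 <= t -> (1 <= j < nu)%N -> diag_eq j t (z t)
    & forall (t : R) j, 0 <= t -> (s' <= j < nu.-1)%N -> wedge_eq j t (z t) (w t)],
      forall a : I, valid a -> diag_from 1 a ->
        class_Cr (diag_order a.2) (fun t => coef a (z t) : K^o),
      forall a : I, valid a -> wedge_from s' a ->
        class_Cr a.2 (fun t => coef a (z t) : K^o)
    & forall a : I, valid a -> (s' < a.2)%N -> forall t : R, 0 <= t ->
        deriv_on half_line (fun t => coef a (z t) : K^o) t (coef a (w t))].
  move=> s1 ns; have [|z [zM zeq zc]] := @diag_cascade nu 1 isT; first exact: leq_addl.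
  exists z, (fun=> 0); split=> //.
  - split=> // [t|t j _ /andP[sj jn]].
      exists (z t) => //; exists 0; last by rewrite addr0.
      exists (fun=> 0) => [j /andP[sj jn]|]; last by rewrite big1.
      by have := leq_ltn_trans (leq_trans ns sj) jn; rewrite ltnn.
    by have := leq_ltn_trans (leq_trans ns sj) jn; rewrite ltnn.
  - move=> a va /(wedge_fromP hp s' va)[j /andP[sj jn]].
    by have := leq_ltn_trans (leq_trans ns sj) jn; rewrite ltnn.
  - move=> a va sa; have an : (a.2 <= nu.-1)%N by rewrite -ltnS (ltn_predK (ltn_ord a.2)).
    by have := leq_trans (leq_trans sa an) ns; rewrite ltnn.
elim: d s => [|d IH] s s1; first by rewrite addn0; exact: big_s.
have [ns _|sn] := leqP nu.-1 s; first exact: big_s.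
rewrite addnS -addSn => /(IH s.+1 (ltnW s1))[z [w [[zM zd zw] zcd zcw wd]]].
have s1n : (1 <= s < nu.-1)%N by rewrite s1.
have z_fix t : fix_proj (diag_wedge s.+1) (z t).
  by have := zM t; rewrite (MdwE hp Md_open Mw_open) // => -[].
have lev_class (a : I) : valid a -> level s.+1 a -> class_Cr s.+1 (fun t => coef a (z t) : K^o).
  move=> va /eqP sa; have : diag_from 1 a \/ wedge_from s.+1 a.
    rewrite /diag_from /wedge_from sa leqnn /=.
    move: va; rewrite /valid sa leq_eqVlt => /orP[/eqP->|->]; last by right.
    by left; rewrite eqxx.
  case=> [ad|aw]; last by rewrite -{1}sa; exact: zcw.
  by apply: class_Cr_le (zcd a va ad); rewrite sa; exact: diag_order_geS.
have : forall a : I, exists c' : R -> K^o, valid a -> level s.+1 a ->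
    (forall t : R, 0 <= t -> deriv_on half_line (fun t => coef a (z t) : K^o) t (c' t)) /\
    class_Cr s c'.
  move=> a; have [/andP[va la]|N] := boolP (valid a && level s.+1 a).
    by have [c' dc cc] := lev_class a va la; exists c'.
  by exists (fun=> 0) => va la; rewrite va la in N.
move=> /choice[c' cP].
pose w1 (t : R) : X := \sum_(a | valid a && level s.+1 a) (c' a t : K) *: phi a.
have w1_fix t : fix_proj (level s.+1) (w1 t).
  rewrite /fix_proj /= /proj; apply: eq_bigr => a /andP[va la].
  by rewrite (coef_comb hp) // la.
have := @block_solution R k X Y p hp (diag_wedge s) (wedge s) (Mdw s) (Mw s)
  (fun t x => projQ (wedge s) (f t x)) s z (fun t => A (w1 t)) s1.
case.
- by move=> a va /andP[/eqP sa ar]; rewrite /diag_wedge /wedge_from sa leqnn ar orbT.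
- exact: (Mdw_open hp Md_open Mw_open).
- exact: Mw_open.
- exact: wedge_smooth.
- by move=> t x; rewrite /fix_projQ /= (projQI hp); apply: eq_projQ => a _ /=; rewrite andbb.
- move=> t; apply: (fix_sub hp) (z_fix t) => a va /orP[ad|/andP[sa ar]] /=.
    rewrite /diag_wedge ad /= andbT; have /andP[_ /eqP ar] := ad.
    by rewrite wedge_val ar ltnn andbF.
  by rewrite /wedge /diag_wedge /wedge_from gtn_eqF // ar (ltnW sa) orbT.
- move=> a va /orP[ad _|/andP[sa ar]].
    apply: class_Cr_le (zcd a va ad); have /andP[a1 _] := ad.
    have [sa|sa] := leqP s a.2; first exact: diag_order_ge.
    rewrite /diag_order; case: ifP => [/eqP ea|_]; first by rewrite -ea ltnNge ltnW in sn.
    by move/leq_sub2r: sn => /(_ 1%N); rewrite !subn1.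
  rewrite wedge_val ar andbT => sa'; have {sa'}sa : (s < a.2)%N by rewrite ltn_neqAle eq_sym sa' sa.
  by apply: class_Cr_le (zcw a va _); [exact: ltnW | rewrite /wedge_from sa].
- by move=> t; exact: A_level.
- move=> a va aw; have [ln vn] := wedge_next aw; have [_ cc] := cP _ vn ln.
  apply: class_Cr_eq (class_CrN cc) => t t0.
  rewrite (qf_A hp) //; last exact: fix_proj_D (w1_fix t).
  have := aw; rewrite wedge_val => /andP[_ ->]; rewrite (coef_comb hp) //.
  by rewrite ln.
- by move=> t u _; exact: Mdw_add.
- by move=> t t0; exact: wedge_zero.
- by move=> t u t0 uM; exact: wedge_inv.
move=> u [uM ueq uc]; have u_fix t : fix_proj (wedge s) (u t).
  by apply: (open_in_sub (Mw_open s1n)); exact: uM.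
exists (fun t => z t + u t), (fun t => proj (from s.+2) (w t) + w1 t).
have w_level t j : (s < j)%N -> proj (level j.+1) (proj (from s.+2) (w t) + w1 t) = proj (level j.+1) (w t).
  move=> sj; rewrite (projD hp) (@proj_level_from s.+1 j.+1 (w1 t)) // addr0 (proj_sub hp) //.
  by move=> a _ /eqP aj; rewrite /from aj.
split=> [|a va ad|a va /andP[sa ar]|a va sa t t0].
- split=> [t|t j t0 /andP[j1 jn]|t j t0 /andP[sj jn]].
  + exact: Mdw_add.
  + rewrite /diag_eq !(projD hp) !(proj_disjoint hp _ (u_fix t)) ?addr0.
    * by apply: zd => //; rewrite j1.
    * by move=> a /andP[/eqP aj /eqP ar]; rewrite wedge_val aj ar ltnn andbF.
    * by move=> a /andP[_ /eqP ar]; rewrite wedge_val ar ltnn andbF.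
  case: (ltngtP s j) sj => // [sj|<-] _.
    rewrite /wedge_eq w_level // !(projD hp) !(proj_disjoint hp _ (u_fix t)) ?addr0.
    * by apply: zw => //; rewrite sj.
    * by move=> a /andP[/eqP aj _]; rewrite /wedge aj gtn_eqF.
    * move=> a /orP[/andP[_ /eqP ar]|/andP[ja _]]; rewrite wedge_val; first by rewrite ar ltnn andbF.
      by rewrite gtn_eqF // (leq_trans sj).
  have E : proj (level s.+1) (proj (from s.+2) (w t) + w1 t) = w1 t.
    rewrite (projD hp) w1_fix (proj_disjoint hp (S' := from s.+2)) ?add0r //.
      by move=> a /eqP la; rewrite /from la ltnn.
    exact: proj_fix.
  rewrite /wedge_eq E; have := ueq t t0.
  have -> : proj (diag_wedge s) (z t + u t) = z t + u t.
    by have := Mdw_add s1n (zM t) (uM t); rewrite (MdwE hp Md_open Mw_open) // => -[].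
  rewrite (projD hp) u_fix (proj_disjoint hp _ (z_fix t)) ?add0r // => b.
  move=> /andP[/eqP sb sr]; by rewrite /diag_wedge /wedge_from /diag_from sb ltnn /= orbF (gtn_eqF sr) andbF.
- apply: class_Cr_eq (zcd a va ad) => t _.
  rewrite (coefD hp) // (fix_coef hp (u_fix t)) ?addr0 //.
  by have /andP[_ /eqP ar] := ad; rewrite wedge_val ar ltnn andbF.
- case: (ltngtP s a.2) sa => // [sa|sa] _.
    apply: class_Cr_eq (zcw a va _) => [t _|]; last by rewrite /wedge_from sa.
    by rewrite (coefD hp) // (fix_coef hp (u_fix t)) ?addr0 // /wedge gtn_eqF.
  apply: (class_Cr_eq (u := fun t => coef a (u t) : K^o)) => [t _|].
    rewrite (coefD hp) // (fix_coef hp (z_fix t)) ?add0r //.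
    by rewrite /diag_wedge /wedge_from /diag_from sa ltnn /= orbF (gtn_eqF ar) andbF.
  by rewrite -sa; apply: uc => //; rewrite /wedge sa eqxx.
- have uE : forall r : R, coef a (z r + u r) = coef a (z r).
    by move=> r; rewrite (coefD hp) // (fix_coef hp (u_fix r)) ?addr0 // /wedge gtn_eqF.
  apply: (deriv_on_eq (u := fun t => coef a (z t) : K^o)) => [r _||]; rewrite ?uE //.
  rewrite (coefD hp) // (coef_proj hp) // (coef_comb hp) // /from /level.
  case: (ltngtP s.+1 a.2) sa => // [sa|sa] _; first by rewrite addr0; exact: wd.
  by rewrite add0r; have [|dc _] := cP a va; [rewrite /level sa eqxx | exact: dc].
Qed.

Lemma Mdw1_from x : Mdw 1 x -> fix_proj (from 1) x.
Proof.
rewrite (MdwE hp Md_open Mw_open) // => -[xT _ _]; apply: fix_sub xT => // a _.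
by case/orP=> /andP[].
Qed.

Lemma sigma_solution : exists z z' : R -> X,
  [/\ forall t : R, Mdw 1 (z t),
      forall (t : R) j, 0 <= t -> (1 <= j < nu)%N -> diag_eq j t (z t),
      forall (t : R) j, 0 <= t -> (1 <= j < nu.-1)%N -> wedge_eq j t (z t) (z' t),
      forall t : R, fix_proj (from 1) (z' t)
    & (forall t : R, 0 <= t -> deriv_on half_line z t (z' t)) /\
      cont_on half_line z'].
Proof.
have [|z [w [[zM zd zw] zcd zcw wd]]] := @wedge_cascade nu.-1 1 isT; first exact: leq_addl.
have z_class (a : I) : valid a -> from 1 a -> class_Cr 1 (fun t => coef a (z t) : K^o).
  move=> va a1; have [ar|ar] := eqVneq (rk a.1) a.2.+1.
    apply: class_Cr_le (zcd a va _); last by rewrite /diag_from ar eqxx andbT.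
    by apply: diag_order_gt0; rewrite ltn_ord andbT; exact: a1.
  apply: class_Cr_le (zcw a va _) => //.
  by apply/andP; split; [exact: a1 | rewrite ltn_neqAle eq_sym ar; exact: va].
have : forall a : I, exists c' : R -> K^o, valid a -> from 1 a ->
    (forall t : R, 0 <= t -> deriv_on half_line (fun t => coef a (z t) : K^o) t (c' t)) /\
    cont_on half_line c'.
  move=> a; have [/andP[va la]|N] := boolP (valid a && from 1 a).
    by have [c' dc cc] := z_class a va la; exists c'.
  by exists (fun=> 0) => va la; rewrite va la in N.
move=> /choice[c' cP].
pose z' (t : R) : X := \sum_(a | valid a && from 1 a) (c' a t : K) *: phi a.
have z'_fix t : fix_proj (from 1) (z' t).
  rewrite /fix_proj /= /proj; apply: eq_bigr => a /andP[va la].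
  by rewrite (coef_comb hp) // la.
have zE t : z t = \sum_(a : I | valid a && from 1 a) (coef a (z t) : K) *: phi a.
  exact: esym (Mdw1_from (zM t)).
exists z, z'; split=> //.
  move=> t j t0 /[dup] /andP[j1 _] /(zw t j t0); rewrite /wedge_eq.
  suff -> : proj (level j.+1) (w t) = proj (level j.+1) (z' t) by [].
  apply: eq_proj_coef => a va /eqP la; have a1 : from 1 a by rewrite /from la.
  rewrite (coef_comb hp) // a1; have [dc _] := cP a va a1.
  have sub : [set s : R | t < s] `<=` half_line by move=> s /= /ltW; exact: le_trans.
  apply: (deriv_on_unique (V := K^o) (u := fun t => coef a (z t) : K^o) (t := t)).
    by apply: deriv_onS sub _; apply: wd; rewrite // la.
  by apply: deriv_onS sub _; exact: dc.
split.
  move=> t t0; have H := @deriv_on_span R k X I (fun a => valid a && from 1 a)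
    (@phi R k X Y p) (fun a t => coef a (z t)) half_line t (fun a => c' a t).
  apply: (deriv_on_eq (u := fun t => \sum_(a : I | valid a && from 1 a) (coef a (z t) : K) *: phi a)) => //.
  by apply: H => a /andP[va a1]; have [dc _] := cP a va a1; exact: dc.
apply: (comb_class_Cr (P := from 1) (q := 0) (c := fun a t => c' a t) (e := @phi R k X Y p)) => //.
by move=> a va a1; have [_] := cP a va a1.
Qed.

Lemma sigma_unique (T : set R) (z z' v v' : R -> X) :
  T `<=` half_line -> (forall t s : R, T t -> t < s -> T s) ->
  (forall t, T t -> [/\ Mdw 1 (z t),
      forall j, (1 <= j < nu)%N -> diag_eq j t (z t),
      forall j, (1 <= j < nu.-1)%N -> wedge_eq j t (z t) (z' t)
    & forall a : I, valid a -> from 1 a ->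
        deriv_on T (fun t => coef a (z t) : K^o) t (coef a (z' t))]) ->
  (forall t, T t -> [/\ Mdw 1 (v t),
      forall j, (1 <= j < nu)%N -> diag_eq j t (v t),
      forall j, (1 <= j < nu.-1)%N -> wedge_eq j t (v t) (v' t)
    & forall a : I, valid a -> from 1 a ->
        deriv_on T (fun t => coef a (v t) : K^o) t (coef a (v' t))]) ->
  forall t, T t -> z t = v t.
Proof.
move=> T0 Tup zP vP.
have Mdw_diag s x : (1 <= s)%N -> Mdw 1 x -> Mdiag s (proj (diag_from s) x).
  move=> s1; rewrite (MdwE hp Md_open Mw_open) // (M2diagE hp Md_open) // => -[_ xd _].
  split=> [|j /andP[sj jn]]; first exact: proj_fix.
  rewrite (proj_sub hp) => [|a _ /andP[/eqP aj ar]].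
    by apply: xd; rewrite jn (leq_trans s1 sj).
  by rewrite /diag_from aj sj.
have Mdw_wedge s x : (1 <= s)%N -> Mdw 1 x -> Mdw s (proj (diag_wedge s) x).
  move=> s1; rewrite !(MdwE hp Md_open Mw_open) // => -[_ xd xw].
  split=> [|j /andP[sj jn]|j /andP[sj jn]]; first exact: proj_fix.
    rewrite (proj_sub hp) => [|a _ /andP[/eqP aj ar]]; first by apply: xd; rewrite jn sj.
    by rewrite /diag_wedge /diag_from aj sj ar.
  rewrite (proj_sub hp) => [|a _ /andP[/eqP aj ar]].
    by apply: xw; rewrite jn (leq_trans s1 sj).
  by rewrite /diag_wedge /wedge_from aj sj ar orbT.
have diag_same d s : (1 <= s)%N -> (nu <= s + d)%N -> forall t, T t ->
    proj (diag_from s) (z t) = proj (diag_from s) (v t).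
  have big_s s' t : (nu <= s')%N -> proj (diag_from s') (z t) = proj (diag_from s') (v t).
    move=> ns; apply: eq_proj_coef => a va /andP[sa _].
    by have := leq_ltn_trans (leq_trans ns sa) (ltn_ord a.2); rewrite ltnn.
  elim: d s => [|d IH] s s1; first by rewrite addn0 => ns t _; exact: big_s.
  have [ns _ t _|sn] := leqP nu s; first exact: big_s.
  rewrite addnS -addSn => /(IH s.+1 (ltnW s1)) same t Tt.
  have s1n : (1 <= s < nu)%N by rewrite s1.
  have [zM zd _ _] := zP t Tt; have [vM vd _ _] := vP t Tt.
  have [z1 z2] := Mdiag_split s1n (Mdw_diag s _ s1 zM).
  have [v1 v2] := Mdiag_split s1n (Mdw_diag s _ s1 vM).
  have sub (S S' : pred I) x : (forall a, S a -> S' a) -> proj S (proj S' x) = proj S x.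
    by move=> SS'; apply: (proj_sub hp) => a _; exact: SS'.
  have s1s (a : I) : diag_from s.+1 a -> diag_from s a.
    by move=> /andP[sa ar]; rewrite /diag_from (ltnW sa).
  have sds (a : I) : diag s a -> diag_from s a.
    by move=> /andP[/eqP sa ar]; rewrite /diag_from sa leqnn.
  rewrite !(sub _ _ _ s1s) !(sub _ _ _ sds) !(sub _ _ _ (fun a => id)) in z1 z2 v1 v2 *.
  move=> vE zE; have := zd s s1n; have := vd s s1n; rewrite /diag_eq zE vE -same // => veq zeq.
  have [u [_ uu]] := diag_zero s1n (T0 _ Tt) z1.
  by rewrite -(uu _ (conj v2 veq)) -(uu _ (conj z2 zeq)).
have wedge_same d s : (1 <= s)%N -> (nu.-1 <= s + d)%N -> forall t, T t ->
    proj (diag_wedge s) (z t) = proj (diag_wedge s) (v t).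
  have big_s s' t : (1 <= s')%N -> (nu.-1 <= s')%N -> T t ->
      proj (diag_wedge s') (z t) = proj (diag_wedge s') (v t).
    move=> s1 ns Tt; have E x : proj (diag_wedge s') x = proj (diag_from 1) x.
      apply: eq_proj => a va; rewrite /diag_wedge; case: (boolP (wedge_from s' a)); last by rewrite orbF.
      move=> /(wedge_fromP hp s' va)[j /andP[sj jn]].
      by have := leq_ltn_trans (leq_trans ns sj) jn; rewrite ltnn.
    by rewrite !E; apply: (@diag_same nu) => //; exact: leq_addl.
  elim: d s => [|d IH] s s1; first by rewrite addn0 => ns t; exact: big_s.
  have [ns _ t|sn] := leqP nu.-1 s; first exact: big_s.
  rewrite addnS -addSn => /(IH s.+1 (ltnW s1)) same t Tt.
  have s1n : (1 <= s < nu.-1)%N by rewrite s1.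
  have [zM _ zw dz] := zP t Tt; have [vM _ vw dv] := vP t Tt.
  have [z1 z2] := Mdw_split s1n (Mdw_wedge s _ s1 zM).
  have [v1 v2] := Mdw_split s1n (Mdw_wedge s _ s1 vM).
  have sub (S S' : pred I) x : (forall a, S a -> S' a) -> proj S (proj S' x) = proj S x.
    by move=> SS'; apply: (proj_sub hp) => a _; exact: SS'.
  have s1s (a : I) : diag_wedge s.+1 a -> diag_wedge s a.
    move=> /orP[ad|/andP[sa ar]]; first by rewrite /diag_wedge ad.
    by rewrite /diag_wedge /wedge_from (ltnW sa) ar orbT.
  have sds (a : I) : wedge s a -> diag_wedge s a.
    by move=> /andP[/eqP sa ar]; rewrite /diag_wedge /wedge_from sa leqnn ar orbT.
  rewrite !(sub _ _ _ s1s) !(sub _ _ _ sds) !(sub _ _ _ (fun a => id)) in z1 z2 v1 v2 *.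
  move=> vE zE; have := zw s s1n; have := vw s s1n; rewrite /wedge_eq.
  have -> : proj (level s.+1) (v' t) = proj (level s.+1) (z' t).
    apply: eq_proj_coef => a va /eqP la; have a1 : from 1 a by rewrite /from la.
    have sT : [set s : R | t < s] `<=` T by move=> r; exact: Tup.
    have ad : diag_wedge s.+1 a.
      rewrite /diag_wedge /diag_from /wedge_from la leqnn /= eq_sym -leq_eqVlt -la.
      exact: va.
    have co r : T r -> coef a (v r) = coef a (z r).
      by move=> /same; move=> /(congr1 (coef a)); rewrite !(coef_proj hp) // ad.
    apply: (deriv_on_unique (V := K^o) (u := fun t => coef a (z t) : K^o) (t := t)).
      apply: (deriv_on_eq (u := fun t => coef a (v t) : K^o)) => [r /sT /co->||] //; first exact: co.
      by apply: deriv_onS sT _; exact: dv.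
    by apply: deriv_onS sT _; exact: dz.
  rewrite /wedge_eq zE vE -same // => veq zeq.
  have [u [_ uu]] := wedge_zero s1n (T0 _ Tt) z1 (proj_fix hp _ (z' t)).
  by rewrite -(uu _ (conj v2 veq)) -(uu _ (conj z2 zeq)).
move=> t Tt; have [zM _ _ _] := zP t Tt; have [vM _ _ _] := vP t Tt.
move: zM vM; rewrite (MdwE hp Md_open Mw_open) // => -[zE _ _] [vE _ _].
rewrite -zE -vE; apply: (@wedge_same nu 1%N isT _ t Tt).
exact: leq_trans (leq_pred _) (leq_addl _ _).
Qed.

End cascade.

(** * The differential equation for A x_1 *)

Section within_real_sets.
Context {R : realType} {k : scalar_kind} {V : normedModType (scalars R k)}.
Implicit Types (S J : set R) (u : R -> V) (t : R).

Lemma near_within_realP S t (P : R -> Prop) :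
  (\forall s \near within S (nbhs t), P s) <->
  exists2 d : R, 0 < d & forall s, S s -> `|s - t| < d -> P s.
Proof.
split=> [/nbhs_ballP[d /= d0 dP]|[d d0 dP]].
  by exists d => // s Ss st; apply: dP => //; rewrite /ball /= distrC.
apply/nbhs_ballP; exists d => //= s; rewrite /ball /= distrC => st Ss.
exact: dP.
Qed.

Lemma cont_on_within S u : cont_on S u <-> {within S, continuous u}.
Proof.
split=> [uS|/subspace_continuousP uS t St e e0].
  apply/subspace_continuousP => t St; apply/cvg_nrmP => e e0.
  by apply/near_within_realP; exact: uS.
have /cvg_nrmP/(_ e e0) := uS t St.
by move/near_within_realP.
Qed.

Lemma deriv_on_within J u t (v : V) : has_derivative_within J u t v <-> deriv_on J u t v.
Proof.
have E s : s != t -> u s - u t - of_real (s - t) *: v =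
    of_real (s - t) *: (of_real ((s - t)^-1) *: (u s - u t) - v).
  move=> st; rewrite scalerBr scalerA -rmorphM divff ?subr_eq0 //.
  by rewrite rmorph1 scale1r.
split=> [/cvg_nrmP H e e0|H].
  have /nbhs_ballP[d /= d0 dP] := H e e0; exists d => // s Js st.
  have [->|sne] := eqVneq s t; first by rewrite !subrr rmorph0 scale0r subrr nrm0 normr0 mulr0.
  rewrite E // nrmZr mulrC; apply: ler_wpM2r => //; apply: ltW.
  by apply: dP => //; rewrite /ball /= distrC.
apply/cvg_nrmP => e e0; have [d d0 Hd] := H _ (divr_gt0 e0 (ltr0Sn _ 1)).
apply/nbhs_ballP; exists d => //= s; rewrite /ball /= distrC => st sne Js.
have := Hd s Js st; rewrite E // nrmZr mulrC ler_pM2r ?normr_gt0 ?subr_eq0 // => h.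
by apply: le_lt_trans h _; rewrite ltr_pdivrMr // ltr_pMr // ltr1n.
Qed.

Lemma deriv_on_reflect S u (c t : R) (l : V) : deriv_on S u (c - t) l ->
  deriv_on [set s | S (c - s)] (fun s => u (c - s)) t (- l).
Proof.
move=> du e e0; have [d d0 H] := du e e0; exists d => // s /= Ss st.
have E : c - s - (c - t) = - (s - t) by ring.
have := H _ Ss; rewrite E normrN => /(_ st).
by rewrite rmorphN scaleNr scalerN.
Qed.

End within_real_sets.

Section within_products.
Context {R : realType} {k : scalar_kind} {X Y : normedModType (scalars R k)}.

Lemma within_setX_nrm (S : set R) (D : set X) (g : R -> X -> Y) :
  {within S `*` D, continuous (fun z : R * X => g z.1 z.2)} ->
  forall (t : R) x, S t -> D x -> forall e : R, 0 < e -> exists2 d : R, 0 < d &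
    forall (s : R) y, S s -> D y -> `|s - t| < d -> nrm (y - x) < d ->
      nrm (g s y - g t x) < e.
Proof.
move=> /subspace_continuousP gc t x St Dx e e0.
have /cvg_nrmP/(_ e e0) := gc (t, x) (conj St Dx).
move=> [[U V] /= [/nbhs_ballP[d /= d0 dU] /nbhs_nrmP[d' d'0 dV]] UV].
exists (Num.min d d'); first by rewrite lt_min d0.
move=> s y Ss Dy; rewrite !lt_min => /andP[sd _] /andP[_ yd].
apply: (UV (s, y)) => //; split; last exact: dV.
by apply: dU; rewrite /ball /= distrC.
Qed.

End within_products.

Section inverse_of_Atilde.
Context {R : realType} {k : scalar_kind} {X Y : completeNormedModType (scalars R k)}.
Variable p : pencil X Y.
Local Notation K := (scalars R k).
Local Notation A := (opA p).
Local Notation B := (opB p).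
Local Notation nu := (pencil_index p).
Local Notation n := (dim_ker p).
Local Notation D := (domD p).
Local Notation rk := (@root_rank R k X Y p).
Local Notation I := ('I_n * 'I_nu)%type.
Hypothesis hp : pencil_setting p.

Definition ext_first (i : 'I_n) : I :=
  (i, Ordinal (leq_trans (andP (rk_bounds hp i)).1 (andP (rk_bounds hp i)).2)).

Lemma ext_first_valid i : valid (ext_first i).
Proof. by rewrite /valid /=; have /andP[] := rk_bounds hp i. Qed.

Lemma last_lt i : ((rk i).-1 < nu)%N.
Proof. by have /andP[r0 rn] := rk_bounds hp i; rewrite (leq_trans _ rn) ?prednK. Qed.

Definition ext_last (i : 'I_n) : I := (i, Ordinal (last_lt i)).

Lemma ext_last_valid i : valid (ext_last i).
Proof. by rewrite /valid /=; have /andP[r0 _] := rk_bounds hp i; rewrite prednK. Qed.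

Lemma AtildeE x : Atilde p x =
  A x + \sum_(i < n) coef (ext_first i) x *: B (phi (ext_last i)).
Proof.
rewrite /Atilde; congr (_ + _); apply: eq_bigr => i _.
by rewrite /phi /= prednK //; have /andP[] := rk_bounds hp i.
Qed.

Lemma Atilde_D1 x : D1 p x -> Atilde p x = A x.
Proof.
move=> D1x; rewrite AtildeE big1 ?addr0 // => i _.
suff -> : coef (ext_first i) x = 0 by rewrite scale0r.
have := congr1 (coef (ext_first i)) (D1_proj hp predT D1x).
by rewrite (coef_proj hp) ?(coef0 hp) //; exact: ext_first_valid.
Qed.

Lemma Atilde_Y1 x : D x -> Y1 p (Atilde p x) -> D1 p x.
Proof.
move=> Dx; rewrite (Y1E hp) (D1E hp) /= => Q0; split=> //.
have q0 (a : I) : valid a -> qf a (Atilde p x) = 0.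
  move=> va; have := congr1 (qf a) Q0.
  by rewrite (qf_projQ hp) //= (qf0 hp).
have qsum (a : I) : valid a -> qf a (Atilde p x) = qf a (A x) +
    (if a.2.+1 == rk a.1 then coef (ext_first a.1) x else 0).
  move=> va; rewrite AtildeE (qfD hp) // (qf_sum hp) //; congr (_ + _).
  rewrite (bigD1 a.1) //= big1 ?addr0 => [|i ia].
    rewrite (qfZ hp) // (qf_phi hp) //; last exact: ext_last_valid.
    have -> : (a == ext_last a.1) = (a.2.+1 == rk a.1).
      rewrite -pair_eqE /= eqxx /= -val_eqE /=.
      by rewrite -eqSS prednK //; have /andP[] := rk_bounds hp a.1.
    by case: ifP; rewrite ?mulr1 ?mulr0.
  rewrite (qfZ hp) // (qf_phi hp) //; last exact: ext_last_valid.
  by rewrite -pair_eqE /= eq_sym (negbTE ia) mulr0.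
have coef_first i : coef (ext_first i) x = 0.
  have := qsum _ (ext_last_valid i); rewrite q0; last exact: ext_last_valid.
  rewrite (qf_A hp) //=; last exact: ext_last_valid.
  rewrite prednK; last by have /andP[] := rk_bounds hp i.
  by rewrite ltnn eqxx add0r.
rewrite /proj big1 // => a /andP[va _].
suff -> : coef a x = 0 by rewrite scale0r.
have [a0|/(valid_next_of va)[b [vb br ->]]] := posnP a.2.
  rewrite -(coef_first a.1); congr (coef _ _); rewrite [LHS]surjective_pairing.
  by congr pair; apply: val_inj.
have := qsum b vb; rewrite q0 // (qf_A hp) // br.
by rewrite (ltn_eqF br) addr0 => /eqP; rewrite eq_sym oppr_eq0 => /eqP.
Qed.

Hypothesis closedA : closed_operator A.
Hypothesis closedB : closed_operator B.
Hypothesis range_closed : closed (A @` dom A).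
Hypothesis regular : regular_pencil D A B nu.

Lemma Atilde_invP w : Y1 p w -> D1 p (Atilde_inv p w) /\ A (Atilde_inv p w) = w.
Proof.
move=> Yw; rewrite /Atilde_inv; case: xgetP => [x _ [Dx xw]|N].
  have D1x : D1 p x by apply: Atilde_Y1; rewrite ?xw.
  by split=> //; rewrite -xw Atilde_D1.
have [x D1x xw] := A_D1_onto hp closedA closedB range_closed regular Yw.
by have [] := N x; split; [exact: (D1_D hp) | rewrite Atilde_D1].
Qed.

Lemma Atilde_invK x : D1 p x -> Atilde_inv p (A x) = x.
Proof.
move=> D1x; have [D1y yx] := Atilde_invP (A_D1 hp D1x).
apply/eqP; rewrite -subr_eq0; apply/eqP/(A_D1_inj hp).
  by apply: subspaceB => //; exact: D1_subspace.
by rewrite (AB hp) ?yx ?subrr //; exact: (D1_D hp).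
Qed.

Lemma Atilde_inv_linear :
  bounded_linear_on (@nrm R k Y) (@nrm R k X) (Y1 p) (Atilde_inv p).
Proof.
have [C C0 HC] := A_D1_bounded_below hp closedA range_closed.
split=> [c u v Yu Yv|]; last first.
  by exists C => u Yu; have [D1x {2}<-] := Atilde_invP Yu; exact: HC.
have [Du uE] := Atilde_invP Yu; have [Dv vE] := Atilde_invP Yv.
rewrite -{1}uE -{1}vE -(A_lin hp); try exact: (D1_D hp).
by apply: Atilde_invK; apply: (D1_subspace hp).2.
Qed.

Lemma B_Atilde_inv_linear :
  bounded_linear_on (@nrm R k Y) (@nrm R k Y) (Y1 p) (fun w => B (Atilde_inv p w)).
Proof.
have [C C0 HC] := B_D1_relatively_bounded hp closedA closedB range_closed.
split=> [c u v Yu Yv|]; last first.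
  by exists C => u Yu; have [D1x {2}<-] := Atilde_invP Yu; exact: HC.
rewrite Atilde_inv_linear.1 // (B_lin hp) //; apply: (D1_D hp).
  exact: (Atilde_invP Yu).1.
exact: (Atilde_invP Yv).1.
Qed.

End inverse_of_Atilde.

Section implicit_component.
Context {R : realType} {k : scalar_kind} {X Y : completeNormedModType (scalars R k)}.
Variable p : pencil X Y.
Local Notation K := (scalars R k).
Local Notation A := (opA p).
Local Notation B := (opB p).
Local Notation nu := (pencil_index p).
Local Notation n := (dim_ker p).
Local Notation D := (domD p).
Local Notation I := ('I_n * 'I_nu)%type.
Local Notation fix_proj := (@fix_proj R k X Y p).
Local Notation fix_projQ := (@fix_projQ R k X Y p).
Local Notation proj := (@proj R k X Y p).
Local Notation projQ := (@projQ R k X Y p).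
Hypothesis hp : pencil_setting p.
Variables (f : R -> X -> Y) (M20 : set X) (z : R -> X) (r : R -> Y).
Let E := fix_proj (level 0).
Let W := fix_projQ (level 0).

Definition G20 (t : R) (x1 u : X) : Y :=
  projQ (level 0) (f t (x1 + u + z t)) - B u - r t.

Definition estimate20 (t : R) (x1 u : X) : Prop :=
  exists (Z : X -> Y) (Zi : Y -> X) (c N q d : R),
  [/\ bounded_inverse (@nrm R k X) (@nrm R k Y) E W Z Zi,
      forall w, W w -> nrm (Zi w) <= N * nrm w,
      [/\ 0 <= c, 0 <= N, 0 <= q < 1 & c * N <= q],
      0 < d
    & forall (s : R) x1' v v', 0 <= s -> `|s - t| < d -> D1 p x1' -> nrm (x1' - x1) < d ->
        E v -> E v' -> nrm (v - u) < d -> nrm (v' - u) < d ->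
        nrm (G20 s x1' v - G20 s x1' v' - Z (v - v')) <= c * nrm (v - v')].

Definition lipschitz_near (g : R -> X -> Y) (t : R) (x1 u : X) : Prop :=
  exists L d : R, [/\ 0 <= L, 0 < d &
    forall (s : R) x1' x1'' v v', 0 <= s -> `|s - t| < d ->
      D1 p x1' -> D1 p x1'' -> nrm (x1' - x1) < d -> nrm (x1'' - x1) < d ->
      M20 v -> M20 v' -> nrm (v - u) < d -> nrm (v' - u) < d ->
      nrm (g s (x1' + v + z s) - g s (x1'' + v' + z s)) <=
        L * (nrm (x1' - x1'') + nrm (v - v'))].

Hypothesis M20_open : open_in E M20.
Hypothesis f_cont : forall (t : R) x, 0 <= t -> D x -> forall e : R, 0 < e ->
  exists2 d : R, 0 < d & forall (s : R) y, 0 <= s -> D y -> `|s - t| < d ->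
    nrm (y - x) < d -> nrm (f s y - f t x) < e.
Hypothesis z_D : forall t : R, D (z t).
Hypothesis z_cont : cont_on half_line z.
Hypothesis r_cont : cont_on half_line r.
Hypothesis r_fix : forall t : R, W (r t).
Hypothesis unique20 : forall (t : R) x1, 0 <= t -> D1 p x1 ->
  exists! u, M20 u /\ G20 t x1 u = 0.
Hypothesis estimates : forall (t : R) x1 u, 0 <= t -> D1 p x1 -> M20 u -> G20 t x1 u = 0 ->
  estimate20 t x1 u.
Hypothesis lip1 : forall (t : R) x1 u, 0 <= t -> D1 p x1 -> M20 u ->
  lipschitz_near (fun s x => f s x - projQ predT (f s x)) t x1 u.
Hypothesis lip20 : forall (t : R) x1 u, 0 <= t -> D1 p x1 -> M20 u ->
  lipschitz_near (fun s x => projQ (level 0) (f s x)) t x1 u.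

Let subr_cancel (a b c d : Y) : a - c - d - (b - c - d) = a - b.
Proof. by vec (scalars R k). Qed.

Let subrACA_cancel (a b c d e : Y) : a - c - d - (b - c - e) = a - b - (d - e).
Proof. by vec (scalars R k). Qed.

Lemma x20_exists : exists chi : R -> X -> X, forall (t : R) x1, 0 <= t -> D1 p x1 ->
  [/\ M20 (chi t x1), G20 t x1 (chi t x1) = 0 &
    forall u, M20 u -> G20 t x1 u = 0 -> u = chi t x1].
Proof.
have : forall tx : R * X, exists u, 0 <= tx.1 -> D1 p tx.2 ->
    [/\ M20 u, G20 tx.1 tx.2 u = 0 & forall v, M20 v -> G20 tx.1 tx.2 v = 0 -> v = u].
  move=> [t x1]; have [[t0 D1x]|N] := pselect (0 <= t /\ D1 p x1).
    have [u [[Mu Gu] uu]] := unique20 t0 D1x; exists u => _ _; split=> // v Mv Gv.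
    by rewrite (uu v).
  by exists 0 => t0 D1x; case: N.
by move=> /choice[chi chiP]; exists (fun t x1 => chi (t, x1)) => t x1; exact: (chiP (t, x1)).
Qed.

Variable chi : R -> X -> X.
Hypothesis chiP : forall (t : R) x1, 0 <= t -> D1 p x1 ->
  [/\ M20 (chi t x1), G20 t x1 (chi t x1) = 0 &
    forall u, M20 u -> G20 t x1 u = 0 -> u = chi t x1].

Lemma sum_D x1 u t : D1 p x1 -> E u -> D (x1 + u + z t).
Proof.
move=> /(D1_D hp) Dx Eu; have sD := D_subspace hp.
by apply: (subspaceD sD) => //; apply: (subspaceD sD) => //; exact: fix_proj_D Eu.
Qed.

Lemma f_along_cont t x1 u (e : R) : 0 <= t -> D1 p x1 -> E u -> 0 < e ->
  exists2 d : R, 0 < d & forall (s : R) y1 v, 0 <= s -> D1 p y1 -> E v -> `|s - t| < d ->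
    nrm (y1 - x1) < d -> nrm (v - u) < d ->
    nrm (f s (y1 + v + z s) - f t (x1 + u + z t)) < e.
Proof.
move=> t0 D1x Eu e0; have [d d0 H] := f_cont t0 (sum_D t D1x Eu) e0.
have d3 : 0 < d / 3 by rewrite divr_gt0.
have [d' d'0 H'] := z_cont t0 d3.
exists (Num.min (d / 3) d'); first by rewrite lt_min d3.
move=> s y1 v s0 D1y Ev; rewrite !lt_min => /andP[sd sd'] /andP[yd _] /andP[vd _].
apply: H => //; [exact: sum_D | lra |].
have -> : y1 + v + z s - (x1 + u + z t) = (y1 - x1) + (v - u) + (z s - z t).
  by vec (scalars R k).
have := H' s s0 sd'; have := nrmD (y1 - x1 + (v - u)) (z s - z t).
have := nrmD (y1 - x1) (v - u); lra.
Qed.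

Lemma chi_cont t x1 (e : R) : 0 <= t -> D1 p x1 -> 0 < e -> exists2 d : R, 0 < d &
  forall (s : R) y1, 0 <= s -> D1 p y1 -> `|s - t| < d -> nrm (y1 - x1) < d ->
    nrm (chi s y1 - chi t x1) < e.
Proof.
move=> t0 D1x e0; have [Mu Gu _] := chiP t0 D1x; set u := chi t x1 in Mu Gu *.
have [Z [Zi [c [N [q [d [ZZi ZiN [c0 N0 q01 cN] d0 est]]]]]]] := estimates t0 D1x Mu Gu.
have sE : subspace E by exact: proj_fix_subspace.
have sW : subspace W by exact: projQ_fix_subspace.
have Eu : E u by exact: (open_in_sub M20_open).
have [d1 d10 dM] := open_inP M20_open Mu.
pose e1 := Num.min (e / 2) (Num.min (d / 2) (d1 / 2)).
have e10 : 0 < e1 by rewrite !lt_min !divr_gt0.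
have [ee [ed ed1]] : e1 <= e / 2 /\ (e1 <= d / 2 /\ e1 <= d1 / 2).
  by rewrite /e1 !ge_min !lexx !orbT.
have /andP[q0 q1] := q01; have q10 : 0 < 1 - q by rewrite subr_gt0.
have N1 : 0 < N + 1 by rewrite ltr_wpDl.
have e2 : 0 < (1 - q) * e1 / (N + 1) / 2 by rewrite !divr_gt0 // mulr_gt0.
have [C C0 HC] := bounded_linear_bound (projQ_bounded hp (level 0)).
have [d2 d20 Hf] := f_along_cont t0 D1x Eu (divr_gt0 e2 C0).
have [d3 d30 Hr] := r_cont t0 e2.
exists (Num.min d (Num.min d2 d3)); first by rewrite !lt_min d0 d20.
move=> s y1 s0 D1y; rewrite !lt_min => /andP[sd /andP[sd2 sd3]] /andP[yd /andP[yd2 _]].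
have small : nrm (G20 s y1 u) <= (1 - q) * e1 / (N + 1).
  have -> : G20 s y1 u = projQ (level 0) (f s (y1 + u + z s) - f t (x1 + u + z t)) - (r s - r t).
    by rewrite -[LHS]subr0 -Gu (projQB hp); exact: subrACA_cancel.
  have h1 : nrm (projQ (level 0) (f s (y1 + u + z s) - f t (x1 + u + z t))) <=
      (1 - q) * e1 / (N + 1) / 2.
    apply: le_trans (HC _ Logic.I) _; rewrite mulrC -ler_pdivlMr //; apply: ltW.
    by apply: Hf => //; rewrite subrr nrm0.
  have := Hr s s0 sd3; have := nrmB (projQ (level 0) (f s (y1 + u + z s) - f t (x1 + u + z t))) (r s - r t).
  by lra.
have smallN : N * nrm (G20 s y1 u) <= (1 - q) * e1.
  apply: le_trans (ler_wpM2l N0 small) _; rewrite mulrC mulrAC ler_pdivrMr //.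
  by apply: ler_wpM2l; [rewrite ltW // mulr_gt0 | rewrite lerDl].
have [||||||v [Ev vu v0]] := newton sE sW _ ZZi N0 c0 q01 cN (e := e1) (F := G20 s y1) (x0 := u).
- by move=> un l Hun; exact: proj_fix_closed.
- exact: ZiN.
- by move=> v w Ev Ew ve we; apply: est => //; lra.
- move=> v Ev _; apply: (subspaceB sW); last exact: r_fix.
  apply: (subspaceB sW).
    by rewrite /W /fix_projQ /= (projQI hp); apply: eq_projQ => a _ /=; rewrite andbb.
  by rewrite /W /fix_projQ /= -(B_proj hp) ?Ev //; exact: fix_proj_D Ev.
- exact: Eu.
- exact: smallN.
have vu' : nrm (v - u) <= e1.
  by apply: le_trans vu _; rewrite ler_pdivrMr // [e1 * _]mulrC.
have [_ _ uu] := chiP s0 D1y.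
by rewrite -(uu v) //; [lra | apply: dM => //; lra].
Qed.

Lemma chi_lip t x1 : 0 <= t -> D1 p x1 -> exists L d : R, [/\ 0 <= L, 0 < d &
  forall (s : R) y1 y2, 0 <= s -> `|s - t| < d -> D1 p y1 -> D1 p y2 ->
    nrm (y1 - x1) < d -> nrm (y2 - x1) < d ->
    nrm (chi s y1 - chi s y2) <= L * nrm (y1 - y2)].
Proof.
move=> t0 D1x; have [Mu Gu _] := chiP t0 D1x; set u := chi t x1 in Mu Gu *.
have [Z [Zi [c [N [q [d [ZZi ZiN [c0 N0 /andP[q0 q1] cN] d0 est]]]]]]] := estimates t0 D1x Mu Gu.
have [L [d1 [L0 d10 HL]]] := lip20 t0 D1x Mu.
have [ZW _ ZiZ ZZ] := ZZi; have sE : subspace E by exact: proj_fix_subspace.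
have m0 : 0 < Num.min d d1 by rewrite lt_min d0.
have [d2 d20 Hc] := chi_cont t0 D1x m0.
have q10 : 0 < 1 - q by rewrite subr_gt0.
exists (N * L / (1 - q)), (Num.min d (Num.min d1 d2)); split.
- by rewrite divr_ge0 ?mulr_ge0 // ltW.
- by rewrite !lt_min d0 d10.
move=> s y1 y2 s0; rewrite !lt_min => /andP[sd /andP[sd1 sd2]] D1y D1y'.
move=> /andP[yd /andP[yd1 yd2]] /andP[yd' /andP[yd1' yd2']].
have := Hc s y1 s0 D1y sd2 yd2; have := Hc s y2 s0 D1y' sd2 yd2'.
rewrite !lt_min => /andP[v2d v2d1] /andP[v1d v1d1].
have [Mv1 Gv1 _] := chiP s0 D1y; have [Mv2 Gv2 _] := chiP s0 D1y'.
set v1 := chi s y1 in v1d v1d1 Mv1 Gv1 *; set v2 := chi s y2 in v2d v2d1 Mv2 Gv2 *.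
have Ev1 : E v1 by exact: (open_in_sub M20_open).
have Ev2 : E v2 by exact: (open_in_sub M20_open).
have h1 := est s y2 v1 v2 s0 sd D1y' yd' Ev1 Ev2 v1d v2d.
have h2 : nrm (G20 s y2 v1) <= L * nrm (y1 - y2).
  have -> : G20 s y2 v1 = projQ (level 0) (f s (y2 + v1 + z s)) - projQ (level 0) (f s (y1 + v1 + z s)).
    by rewrite -[LHS]subr0 -Gv1; exact: subr_cancel.
  have := HL s y2 y1 v1 v1 s0 sd1 D1y' D1y yd1' yd1 Mv1 Mv1 v1d1 v1d1.
  by rewrite subrr nrm0 addr0 (nrmC y2).
have h3 : nrm (Z (v1 - v2)) <= c * nrm (v1 - v2) + L * nrm (y1 - y2).
  have -> : Z (v1 - v2) = G20 s y2 v1 - (G20 s y2 v1 - G20 s y2 v2 - Z (v1 - v2)).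
    by rewrite Gv2; vec (scalars R k).
  by apply: le_trans (nrmB _ _) _; lra.
have Ev := subspaceB sE Ev1 Ev2.
have h4 : nrm (v1 - v2) <= N * (c * nrm (v1 - v2) + L * nrm (y1 - y2)).
  by rewrite -{1}(ZZ _ Ev); apply: le_trans (ZiN _ (ZW _ Ev)) _; exact: ler_wpM2l.
have h5 : c * N * nrm (v1 - v2) <= q * nrm (v1 - v2) by apply: ler_wpM2r; rewrite ?nrm_ge0.
rewrite mulrAC ler_pdivlMr //.
by move: h4 h5; rewrite mulrDr !mulrA (mulrC N c) => h4 h5; lra.
Qed.

Definition psi20 (t : R) (x1 : X) : Y :=
  f t (x1 + chi t x1 + z t) - projQ predT (f t (x1 + chi t x1 + z t)).

Lemma chi_E t x1 : 0 <= t -> D1 p x1 -> E (chi t x1).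
Proof. by move=> t0 D1x; have [Mu _ _] := chiP t0 D1x; exact: (open_in_sub M20_open). Qed.

Lemma psi20_cont t x1 (e : R) : 0 <= t -> D1 p x1 -> 0 < e -> exists2 d : R, 0 < d &
  forall (s : R) y1, 0 <= s -> D1 p y1 -> `|s - t| < d -> nrm (y1 - x1) < d ->
    nrm (psi20 s y1 - psi20 t x1) < e.
Proof.
move=> t0 D1x e0; have [C C0 HC] := bounded_linear_bound (projQ_bounded hp predT).
have C1 : 0 < 1 + C by rewrite addr_gt0.
have [d d0 H] := f_along_cont t0 D1x (chi_E t0 D1x) (divr_gt0 e0 C1).
have [d' d'0 H'] := chi_cont t0 D1x d0.
exists (Num.min d d'); first by rewrite lt_min d0.
move=> s y1 s0 D1y; rewrite !lt_min => /andP[sd sd'] /andP[yd yd'].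
have := H s y1 (chi s y1) s0 D1y (chi_E s0 D1y) sd yd (H' s y1 s0 D1y sd' yd').
rewrite ltr_pdivlMr // mulrDr mulr1.
set v := f s _; set w := f t _ => h.
have -> : psi20 s y1 - psi20 t x1 = (v - w) - projQ predT (v - w).
  by rewrite /psi20 -/v -/w (projQB hp); vec (scalars R k).
apply: le_lt_trans (nrmB _ _) _; apply: le_lt_trans h; rewrite lerD2l mulrC.
exact: HC.
Qed.

Lemma psi20_lip t x1 : 0 <= t -> D1 p x1 -> exists L d : R, [/\ 0 <= L, 0 < d &
  forall (s : R) y1 y2, 0 <= s -> `|s - t| < d -> D1 p y1 -> D1 p y2 ->
    nrm (y1 - x1) < d -> nrm (y2 - x1) < d ->
    nrm (psi20 s y1 - psi20 s y2) <= L * nrm (y1 - y2)].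
Proof.
move=> t0 D1x; have [Mu _ _] := chiP t0 D1x.
have [L [d [L0 d0 HL]]] := lip1 t0 D1x Mu.
have [L' [d' [L'0 d'0 HL']]] := chi_lip t0 D1x.
have [d2 d20 Hc] := chi_cont t0 D1x d0.
exists (L * (1 + L')), (Num.min d (Num.min d' d2)); split.
- by rewrite mulr_ge0 // addr_ge0.
- by rewrite !lt_min d0 d'0.
move=> s y1 y2 s0; rewrite !lt_min => /andP[sd /andP[sd' sd2]] D1y D1y'.
move=> /andP[yd /andP[yd1 yd2]] /andP[yd' /andP[yd1' yd2']].
have [Mv1 _ _] := chiP s0 D1y; have [Mv2 _ _] := chiP s0 D1y'.
apply: le_trans (HL _ _ _ _ _ s0 sd D1y D1y' yd yd' Mv1 Mv2 _ _) _; try exact: Hc.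
rewrite -mulrA; apply: ler_wpM2l => //; rewrite mulrDl mul1r lerD2l.
exact: HL'.
Qed.

End implicit_component.

Section backward_uniqueness.
Context {R : realType} {k : scalar_kind} {V : completeNormedModType (scalars R k)}.

(* Gronwall's inequality, run backwards in time, bounds z near t0; z is then
   Lipschitz continuous and has a limit at t0, although z itself is not assumed
   to be continuous there. *)
Lemma vanishes_from_limit (z z' : R -> V) (C t0 t1 : R) : t0 < t1 -> 0 <= C ->
  (forall t : R, t0 < t <= t1 -> deriv_on [set s | t0 < s <= t1] z t (z' t)) ->
  (forall t : R, t0 < t <= t1 -> nrm (z' t) <= C * nrm (z t)) ->
  (forall l, tends (fun j => z (t0 + (t1 - t0) * 2^-1 ^+ j)) l -> l = 0) ->
  forall t : R, t0 < t <= t1 -> z t = 0.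
Proof.
move=> t01 C0 dz z'z lim0.
have sub (a b : R) : t0 < a -> b <= t1 -> seg a b `<=` [set s | t0 < s <= t1].
  by move=> ta bt s /andP[as_ sb]; rewrite /= (lt_le_trans ta as_) (le_trans sb bt).
have osub (a b : R) : t0 < a -> b <= t1 -> oseg a b `<=` [set s | t0 < s <= t1].
  by move=> ta bt; apply: subset_trans (sub a b ta bt); exact: oseg_seg.
have cz : cont_on [set s | t0 < s <= t1] z by exact: deriv_cont dz.
pose N := nrm (z t1) * expR (C * (t1 - t0)).
have zN (s : R) : t0 < s <= t1 -> nrm (z s) <= N.
  move=> /[dup] s01 /andP[ts st].
  have refl (t : R) : s <= t <= t1 -> s <= t1 + s - t <= t1.
    by move=> /andP[h1 h2]; apply/andP; split; lra.
  have := @gronwall R k V (fun t => z (t1 + s - t)) C s t1 st C0.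
  have -> : t1 + s - t1 = s by ring.
  have -> : t1 + s - s = t1 by ring.
  move=> H; apply: (@le_trans _ _ (nrm (z t1) * expR (C * (t1 - s)))); last first.
    apply: ler_wpM2l; first exact: nrm_ge0.
    by rewrite ler_expR; apply: ler_wpM2l => //; lra.
  apply: H => [t tst e e0|t /andP[st' tt1]].
    have [d d0 H] := cz _ (sub s t1 ts (lexx _) _ (refl t tst)) e e0.
    exists d => // u ust ut; apply: H; first exact: (sub s t1 ts (lexx _) _ (refl u ust)).
    by rewrite -normrN; congr (`|_| < _): ut; ring.
  have tin : t0 < t1 + s - t <= t1 by apply/andP; split; lra.
  exists (- z' (t1 + s - t)); last by rewrite nrmN; exact: z'z.
  apply: deriv_onS (deriv_on_reflect (dz _ tin)) => u /andP[su ut] /=.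
  by apply/andP; split; lra.
have N0 : 0 <= N by rewrite mulr_ge0 ?nrm_ge0 // expR_ge0.
have lip (s t : R) : t0 < s -> s <= t -> t <= t1 -> nrm (z t - z s) <= C * N * (t - s).
  move=> ts st tt; apply: mean_value_bound => //.
    by apply: cont_onS cz; exact: sub.
  move=> u /andP[su ut]; have uin : t0 < u <= t1 by apply/andP; split; lra.
  exists (z' u); first by apply: deriv_onS (dz u uin); exact: osub.
  by apply: le_trans (z'z u uin) _; apply: ler_wpM2l => //; exact: zN.
pose s j : R := t0 + (t1 - t0) * 2^-1 ^+ j.
have s_in j : t0 < s j <= t1.
  have p0 : (0 : R) < 2^-1 ^+ j by rewrite exprn_gt0 // invr_gt0.
  have p1 : (2^-1 : R) ^+ j <= 1 by rewrite exprn_ile1 // ?invr_ge0 // invf_le1 ?ler1n.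
  have t10 : 0 < t1 - t0 by rewrite subr_gt0.
  have h1 := mulr_gt0 t10 p0.
  have h2 : (t1 - t0) * 2^-1 ^+ j <= (t1 - t0) * 1 by rewrite ler_pM2l.
  by rewrite /s; apply/andP; split; lra.
have q01 : 0 <= (2^-1 : R) < 1 by rewrite invr_ge0 ler0n invf_lt1 // ltr1n.
have dist (i j : nat) : (i <= j)%N -> nrm (z (s i) - z (s j)) <= C * N * (t1 - t0) * 2^-1 ^+ i.
  move=> ij; have /andP[ti it] := s_in i; have /andP[tj jt] := s_in j.
  have ji : s j <= s i.
    rewrite /s lerD2l; apply: ler_wpM2l; first by rewrite subr_ge0 ltW.
    by rewrite ler_wiXn2l // ?invr_ge0 // invf_le1 ?ler1n.
  apply: le_trans (lip (s j) (s i) tj ji it) _.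
  rewrite -[leRHS]mulrA; apply: ler_wpM2l; first exact: mulr_ge0.
  by move: tj; rewrite /s; lra.
have [|l zl] := @cauchy_tends R k V (fun j => z (s j)).
  move=> e e0; have [M HM] := geometric_small (C * N * (t1 - t0)) q01 e0.
  exists M => i j Mi Mj; have [ij|ji] := leqP i j.
    by apply: le_lt_trans (dist i j ij) _; exact: HM.
  by rewrite nrmC; apply: le_lt_trans (dist j i (ltnW ji)) _; exact: HM.
have l0 := lim0 l zl; rewrite l0 in zl.
move=> t /andP[t0t tt1]; apply: nrm_le0; apply/ler_addgt0Pr => e e0; rewrite add0r.
pose P := expR (C * (t1 - t0)); have P0 : 0 < P by exact: expR_gt0.
have [M HM] := zl _ (divr_gt0 e0 P0).
have tt0 : 0 < t - t0 by rewrite subr_gt0.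
have [M' HM'] := geometric_small (t1 - t0) q01 tt0.
pose j := maxn M M'; have sjt : s j < t.
  by have := HM' j (leq_maxr _ _); rewrite /s; lra.
have /andP[tj jt] := s_in j.
have := @gronwall R k V z C (s j) t (ltW sjt) C0 (cont_onS (sub _ _ tj tt1) cz).
move=> H; apply: (@le_trans _ _ (nrm (z (s j)) * expR (C * (t - s j)))).
  apply: H => u /andP[su ut]; have uin : t0 < u <= t1 by apply/andP; split; lra.
  by exists (z' u); [apply: deriv_onS (dz u uin); exact: osub | exact: z'z].
have := HM j (leq_maxl _ _); rewrite subr0 ltr_pdivlMr // => h.
apply: le_trans _ (ltW h); apply: ler_wpM2l; first exact: nrm_ge0.
by rewrite ler_expR; apply: ler_wpM2l => //; lra.
Qed.

End backward_uniqueness.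

Section reduced_equation.
Context {R : realType} {k : scalar_kind} {X Y : completeNormedModType (scalars R k)}.
Variable p : pencil X Y.
Local Notation K := (scalars R k).
Local Notation A := (opA p).
Local Notation B := (opB p).
Local Notation nu := (pencil_index p).
Local Notation n := (dim_ker p).
Local Notation D := (domD p).
Local Notation I := ('I_n * 'I_nu)%type.
Local Notation projQ := (@projQ R k X Y p).
Local Notation S := (Atilde_inv p).
Hypothesis hp : pencil_setting p.
Hypothesis closedA : closed_operator A.
Hypothesis closedB : closed_operator B.
Hypothesis range_closed : closed (A @` dom A).
Hypothesis regular : regular_pencil D A B nu.

Variable psi : R -> X -> Y.
Hypothesis psi_Y1 : forall (t : R) x1, Y1 p (psi t x1).
Hypothesis psi_cont : forall (t : R) x1 (e : R), 0 <= t -> D1 p x1 -> 0 < e ->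
  exists2 d : R, 0 < d &
  forall (s : R) y1, 0 <= s -> D1 p y1 -> `|s - t| < d -> nrm (y1 - x1) < d ->
    nrm (psi s y1 - psi t x1) < e.
Hypothesis psi_lip : forall (t : R) x1, 0 <= t -> D1 p x1 -> exists L d : R,
  [/\ 0 <= L, 0 < d &
  forall (s : R) y1 y2, 0 <= s -> `|s - t| < d -> D1 p y1 -> D1 p y2 ->
    nrm (y1 - x1) < d -> nrm (y2 - x1) < d ->
    nrm (psi s y1 - psi s y2) <= L * nrm (y1 - y2)].

Definition Q1pr (w : Y) : Y := w - projQ predT w.

Lemma Q1pr_Y1 w : Y1 p (Q1pr w).
Proof. by rewrite (Y1E hp) /= /Q1pr (projQB hp) (projQI hp) (eq_projQ (S' := predT)) // subrr. Qed.

Lemma Q1pr_id w : Y1 p w -> Q1pr w = w.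
Proof. by move=> Yw; rewrite /Q1pr (Y1_projQ hp) ?subr0. Qed.

Lemma Q1pr_linear : bounded_linear_on (@nrm R k Y) (@nrm R k Y) setT Q1pr.
Proof.
split=> [c u v _ _|]; first by rewrite /Q1pr (projQD hp) (projQZ hp); vec (scalars R k).
have [C C0 HC] := bounded_linear_bound (projQ_bounded hp predT).
exists (1 + C) => u _; apply: le_trans (nrmB _ _) _; rewrite mulrDl mul1r lerD2l.
exact: HC.
Qed.

Lemma bounded_linear_Q1pr (V : normedModType K) (T : Y -> V) :
  bounded_linear_on (@nrm R k Y) (@nrm R k V) (Y1 p) T ->
  bounded_linear_on (@nrm R k Y) (@nrm R k V) setT (fun w => T (Q1pr w)).
Proof.
move=> bT; have [lT _] := bT; have [C C0 HC] := bounded_linear_bound bT.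
split=> [c u v _ _|].
  by rewrite Q1pr_linear.1 // lT //; exact: Q1pr_Y1.
have [C' C'0 HC'] := bounded_linear_bound Q1pr_linear.
exists (C * C') => u _; apply: le_trans (HC _ (Q1pr_Y1 u)) _.
by rewrite -mulrA ler_pM2l //; exact: HC'.
Qed.

Let linS := bounded_linear_Q1pr (Atilde_inv_linear hp closedA closedB range_closed regular).
Let linBS := bounded_linear_Q1pr (B_Atilde_inv_linear hp closedA closedB range_closed regular).
Let sT : subspace (setT : set Y). Proof. by split. Qed.

Definition reduced_field (t : R) (w : Y) : Y := psi t (S (Q1pr w)) - B (S (Q1pr w)).
Local Notation Phi := reduced_field.

Lemma S_D1 w : D1 p (S (Q1pr w)).
Proof. exact: (Atilde_invP hp closedA closedB range_closed regular (Q1pr_Y1 w)).1. Qed.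

Lemma reduced_field_Y1 t w : Y1 p (Phi t w).
Proof. by apply: (subspaceB (Y1_subspace hp)) => //; apply: (B_D1 hp); exact: S_D1. Qed.

Lemma reduced_field_cont (t : R) w : 0 <= t -> forall e : R, 0 < e ->
  exists2 d : R, 0 < d & forall (s : R) w', 0 <= s -> `|s - t| < d -> nrm (w' - w) < d ->
    nrm (Phi s w' - Phi t w) < e.
Proof.
move=> t0 e e0; have e2 : 0 < e / 2 by rewrite divr_gt0.
have [d d0 H] := psi_cont t0 (S_D1 w) e2.
have [C C0 HC] := bounded_linear_bound linS; have [C' C'0 HC'] := bounded_linear_bound linBS.
exists (Num.min d (Num.min (d / C) (e / 2 / C'))); first by rewrite !lt_min d0 !divr_gt0.
move=> s w' s0; rewrite !lt_min => /andP[sd _] /andP[_ /andP[]].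
rewrite !ltr_pdivlMr // ![_ * C]mulrC ![_ * C']mulrC => wd we.
have h1 := HC (w' - w) Logic.I; have h2 := HC' (w' - w) Logic.I.
rewrite (bounded_linearB sT linS) // in h1; rewrite (bounded_linearB sT linBS) // in h2.
have h3 := H s _ s0 (S_D1 w') sd (le_lt_trans h1 wd).
have -> : Phi s w' - Phi t w = (psi s (S (Q1pr w')) - psi t (S (Q1pr w))) -
  (B (S (Q1pr w')) - B (S (Q1pr w))) by rewrite /Phi; vec (scalars R k).
by apply: le_lt_trans (nrmB _ _) _; lra.
Qed.

Lemma reduced_field_lip_near (t : R) x1 : 0 <= t -> D1 p x1 -> exists L d : R,
  [/\ 0 <= L, 0 < d & forall (s : R) w1 w2, 0 <= s -> `|s - t| < d ->
    nrm (S (Q1pr w1) - x1) < d -> nrm (S (Q1pr w2) - x1) < d ->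
    nrm (Phi s w1 - Phi s w2) <= L * nrm (w1 - w2)].
Proof.
move=> t0 D1x; have [L [d [L0 d0 H]]] := psi_lip t0 D1x.
have [C C0 HC] := bounded_linear_bound linS; have [C' C'0 HC'] := bounded_linear_bound linBS.
exists (L * C + C'), d; split=> //; first by rewrite addr_ge0 ?mulr_ge0 // ltW.
move=> s w1 w2 s0 sd w1d w2d.
have h1 := HC (w1 - w2) Logic.I; have h2 := HC' (w1 - w2) Logic.I.
rewrite (bounded_linearB sT linS) // in h1; rewrite (bounded_linearB sT linBS) // in h2.
have h3 := H s _ _ s0 sd (S_D1 w1) (S_D1 w2) w1d w2d.
have -> : Phi s w1 - Phi s w2 = (psi s (S (Q1pr w1)) - psi s (S (Q1pr w2))) -
  (B (S (Q1pr w1)) - B (S (Q1pr w2))) by rewrite /Phi; vec (scalars R k).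
apply: le_trans (nrmB _ _) _; rewrite mulrDl; apply: lerD => //.
by apply: le_trans h3 _; rewrite -mulrA; exact: ler_wpM2l.
Qed.

Lemma reduced_field_lip (t : R) w : 0 <= t -> exists L d : R, [/\ 0 <= L, 0 < d &
  forall (s : R) w1 w2, 0 <= s -> `|s - t| < d -> nrm (w1 - w) < d ->
    nrm (w2 - w) < d -> nrm (Phi s w1 - Phi s w2) <= L * nrm (w1 - w2)].
Proof.
move=> t0; have [L [d [L0 d0 H]]] := reduced_field_lip_near t0 (S_D1 w).
have [C C0 HC] := bounded_linear_bound linS.
exists L, (Num.min d (d / C)); split=> //; first by rewrite lt_min d0 divr_gt0.
move=> s w1 w2 s0; rewrite !lt_min => /andP[sd _] /andP[_ w1d] /andP[_ w2d].
have small w' : nrm (w' - w) < d / C -> nrm (S (Q1pr w') - S (Q1pr w)) < d.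
  rewrite ltr_pdivlMr // mulrC -(bounded_linearB sT linS) // => h.
  by apply: le_lt_trans (HC _ Logic.I) h.
by apply: H => //; exact: small.
Qed.

Lemma reduced_sol_Y1 (a b : R) w : 0 <= a -> Y1 p (w a) -> is_sol Phi a b w ->
  forall t : R, a <= t <= b -> Y1 p (w t).
Proof.
move=> a0 Ya sw t /andP[at_ tb].
have lQ := projQ_bounded hp predT; have sTY : subspace (setT : set Y) by split.
have dQ (s : R) : a <= s <= b -> deriv_on (seg a b) (fun s => projQ predT (w s)) s 0.
  move=> sab; rewrite -(Y1_projQ hp predT (reduced_field_Y1 s (w s))).
  exact: deriv_on_linear sTY lQ _ _ _ (sw s sab).
have := @mean_value_bound R k Y (fun s => projQ predT (w s)) 0 a t at_.
rewrite mul0r => H; rewrite (Y1E hp) /=; apply: nrm_le0.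
rewrite -[X in nrm X]subr0 -[X in _ - X](Y1_projQ hp predT Ya); apply: H.
  have sub : seg a t `<=` seg a b by move=> s /andP[h1 h2]; rewrite /seg /= h1 (le_trans h2).
  by apply: cont_onS sub _; apply: (deriv_cont (u' := fun=> 0)) => s; exact: dQ.
move=> s /andP[as_ st]; exists 0; last by rewrite nrm0.
have sab : a <= s <= b by apply/andP; split; lra.
by apply: deriv_onS (dQ s sab) => u /andP[h1 h2]; apply/andP; split; lra.
Qed.

Section global_existence.
Variables (r L : R) (V : Y -> R) (U ps : R -> R).
Hypothesis V_ge0 : forall w, Y1 p w -> 0 <= V w.
Hypothesis U_cont : {within `[0, +oo[, continuous U}.
Hypothesis U_ge0 : forall u : R, 0 <= u -> 0 <= U u.
Hypothesis ps_ge0 : forall t : R, 0 <= t -> 0 <= ps t.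
Hypothesis ps_int : forall a b : R, 0 <= a <= b ->
  (@lebesgue_measure R).-integrable `[a, b] (EFin \o ps).
Hypothesis U_int : forall u0 : R, 0 < u0 ->
  (\int[@lebesgue_measure R]_(u in `[u0, +oo[) ((U u)%:E)^-1 = +oo)%E.
Hypothesis V_coercive : forall C : R, exists rho : R,
  forall w, Y1 p w -> rho <= nrm w -> C <= V w.
Hypothesis V_lip : forall w w', Y1 p w -> Y1 p w' -> r <= nrm w -> r <= nrm w' ->
  `|V w - V w'| <= L * nrm (w - w').
Hypothesis growth : forall (t : R) w, 0 <= t -> Y1 p w -> r <= nrm w ->
  nrm (psi t (S w) - B (S w)) <= U (V w) * ps t.
Hypothesis psi_bounded : forall a1 a2 : R, 0 < a1 -> 0 < a2 -> exists C : R,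
  forall (t : R) x1, 0 <= t <= a1 -> D1 p x1 -> nrm x1 <= a2 -> nrm (psi t x1) <= C.

Lemma reduced_global (a : R) w0 : 0 <= a -> Y1 p w0 ->
  exists w, [/\ w a = w0, forall b : R, a <= b -> is_sol Phi a b w &
    forall t : R, a <= t -> Y1 p (w t)].
Proof.
move=> a0 Yw0; have := @global_solution R k Y Phi reduced_field_cont reduced_field_lip a w0 a0.
have [C C0 HC] := bounded_linear_bound linS; have [C' C'0 HC'] := bounded_linear_bound linBS.
case.
  move=> b ab.
  have V_lip' w w' : Y1 p w -> Y1 p w' -> r <= nrm w -> r <= nrm w' ->
      `|V w - V w'| <= `|L| * nrm (w - w').
    move=> Yw Yw' rw rw'; apply: le_trans (V_lip Yw Yw' rw rw') _.
    by apply: ler_wpM2r; [exact: nrm_ge0 | exact: ler_norm].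
  have ab' : 0 <= a <= b by rewrite a0.
  have [rho Hrho] := lyapunov_bound (normr_ge0 L) V_ge0 U_cont U_ge0 ps_ge0 ps_int U_int
    V_coercive V_lip' w0 ab'.
  have b1 : 0 < b + 1 by rewrite ltr_wpDl // (le_trans a0).
  have c1 : 0 < C * `|rho| + 1 by rewrite ltr_wpDl // mulr_ge0 // ltW.
  have [C2 HC2] := psi_bounded b1 c1.
  exists (C2 + C' * `|rho|) => T u aTb ua su.
  have u_rho (t : R) : a <= t <= T -> nrm (u t) <= `|rho|.
    move=> taT; apply: le_trans (ler_norm rho).
    apply: (Hrho T u (fun t => Phi t (u t))) taT => //.
    - by move=> s; apply: (reduced_sol_Y1 a0) su _; rewrite ua.
    - apply: (Phi_cont_on reduced_field_cont); last exact: is_sol_cont su.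
      by move=> s /andP[as_ _]; exact: le_trans as_.
    - move=> s saT rs; have /andP[as_ _] := saT.
      have Yu : Y1 p (u s) by apply: (reduced_sol_Y1 a0) su _ saT; rewrite ua.
      by rewrite /Phi (Q1pr_id Yu); apply: growth => //; exact: le_trans as_.
  move=> t taT; have /andP[at_ tT] := taT; have /andP[aT Tb] := aTb.
  apply: le_trans (nrmB _ _) _; apply: lerD; last first.
    by apply: le_trans (HC' _ Logic.I) _; rewrite ler_pM2l //; exact: u_rho.
  apply: HC2; [by apply/andP; split; lra | exact: S_D1 |].
  apply: le_trans (HC _ Logic.I) _; have := u_rho t taT; rewrite -(ler_pM2l C0); lra.
move=> w wa sw; exists w; split=> // t at_.
by apply: (reduced_sol_Y1 a0 _ (sw t at_)); rewrite ?wa // at_ lexx.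
Qed.

End global_existence.

Lemma reduced_unique (t0 : R) x01 (w v : R -> Y) : 0 <= t0 -> D1 p x01 ->
  w t0 = A x01 -> (forall b : R, t0 <= b -> is_sol Phi t0 b w) ->
  (forall t : R, t0 < t -> Y1 p (v t)) ->
  (forall t : R, t0 < t -> deriv_on [set s | t0 < s] v t (Phi t (v t))) ->
  (forall e : R, 0 < e -> exists2 d : R, 0 < d &
     forall t : R, t0 < t < t0 + d -> nrm (S (v t) - x01) < e) ->
  forall t : R, t0 < t -> v t = w t.
Proof.
move=> t00 D1x wt0 sw vY dv v_lim.
have wY (t : R) : t0 <= t -> Y1 p (w t).
  by move=> t0t; apply: (reduced_sol_Y1 t00 _ (sw t t0t)); rewrite ?wt0 ?t0t ?lexx //; exact: (A_D1 hp).
have Sx : S (A x01) = x01 by exact: (Atilde_invK hp closedA closedB range_closed regular).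
have [L [d [L0 d0 HL]]] := reduced_field_lip_near t00 D1x.
have [C C0 HC] := bounded_linear_bound linS.
have w_lim (e : R) : 0 < e -> exists2 d' : R, 0 < d' &
    forall t : R, t0 < t < t0 + d' -> nrm (S (w t) - x01) < e.
  move=> e0; have t01 : t0 <= t0 + 1 by rewrite lerDl.
  have t0in : seg t0 (t0 + 1) t0 by rewrite /seg /= lexx t01.
  have [d' d'0 H] := is_sol_cont (sw _ t01) t0in (divr_gt0 e0 C0).
  exists (Num.min 1 d'); first by rewrite lt_min ltr01.
  move=> t /andP[tt]; rewrite -ltrBlDl lt_min => /andP[t1 td].
  have tin : seg t0 (t0 + 1) t by rewrite /seg /=; apply/andP; split; lra.
  have := H t tin; rewrite gtr0_norm ?subr_gt0 // => /(_ td).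
  have Yw := wY t (ltW tt); have Yx := A_D1 hp D1x.
  rewrite wt0 ltr_pdivlMr // mulrC; apply: le_lt_trans.
  have := HC (w t - A x01) Logic.I.
  by rewrite (bounded_linearB sT linS) // !Q1pr_id // Sx.
have [d1 d10 Hv] := v_lim _ d0; have [d2 d20 Hw] := w_lim _ d0.
pose d3 := Num.min d (Num.min d1 d2); have d30 : 0 < d3 by rewrite !lt_min d0 d10.
have [d3d [d3d1 d3d2]] : d3 <= d /\ (d3 <= d1 /\ d3 <= d2).
  by rewrite /d3 !ge_min !lexx !orbT.
pose t1 := t0 + d3 / 2; have t01 : t0 < t1 by rewrite ltrDl divr_gt0.
have dw (t : R) : t0 < t -> deriv_on [set s | t0 < s] w t (Phi t (w t)).
  move=> tt; have tt1 : t0 <= t + 1 by lra.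
  have tin : t0 <= t <= t + 1 by apply/andP; split; lra.
  apply: (deriv_on_near ltr01) (sw _ tt1 t tin) => s /= ts st.
  by rewrite /seg /=; apply/andP; split; [lra | move: st; rewrite ltr_norml => /andP[_]; lra].
have near (t : R) : t0 < t <= t1 -> v t = w t.
  move=> tin; apply/eqP; rewrite -subr_eq0; apply/eqP; move: t tin.
  apply: (@vanishes_from_limit R k Y (fun t => v t - w t)
      (fun t => Phi t (v t) - Phi t (w t)) L t0 t1 t01 L0).
  - move=> t /andP[tt _]; apply: (@deriv_onS _ _ _ [set s | t0 < s]); first by move=> s /andP[].
    by apply: deriv_onB; [exact: dv | exact: dw].
  - move=> t /andP[tt tt1]; apply: HL; first lra.
    + rewrite gtr0_norm ?subr_gt0 //; move: tt1; rewrite /t1; lra.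
    + by rewrite Q1pr_id; [apply: Hv; apply/andP; split => //; move: tt1; rewrite /t1; lra | exact: vY].
    + by rewrite Q1pr_id; [apply: Hw; apply/andP; split => //; move: tt1; rewrite /t1; lra | exact/wY/ltW].
  move=> l zl; pose s j : R := t0 + (t1 - t0) * 2^-1 ^+ j.
  have s_gt j : t0 < s j by rewrite /s ltrDl mulr_gt0 ?subr_gt0 // exprn_gt0 // invr_gt0.
  have Yl : Y1 p l.
    rewrite (Y1E hp) /=; apply: nrm_le0.
    have [CQ CQ0 HQ] := bounded_linear_bound (projQ_bounded hp predT).
    apply/ler_addgt0Pr => e e0; rewrite add0r.
    have [N HN] := zl _ (divr_gt0 e0 CQ0).
    have := HN N (leqnn _); rewrite ltr_pdivlMr // mulrC nrmC => h.
    apply: le_trans (ltW h); rewrite -[X in nrm X]subr0.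
    have Yz : Y1 p (v (s N) - w (s N)).
      by apply: (subspaceB (Y1_subspace hp)); [exact: vY | exact/wY/ltW].
    by rewrite -(Y1_projQ hp predT Yz) -(projQB hp); exact: HQ.
  suff Sl : S l = 0.
    have [_ <-] := Atilde_invP hp closedA closedB range_closed regular Yl.
    by rewrite Sl (linD0 hp (A_lin hp)).
  apply: nrm_le0; apply/ler_addgt0Pr => e e0; rewrite add0r.
  have e3 : 0 < e / 3 by rewrite divr_gt0.
  have [N HN] := zl _ (divr_gt0 e3 C0).
  have [d4 d40 Hv'] := v_lim _ e3; have [d5 d50 Hw'] := w_lim _ e3.
  have q01 : 0 <= (2^-1 : R) < 1 by rewrite invr_ge0 ler0n invf_lt1 // ltr1n.
  have m0 : 0 < Num.min d4 d5 by rewrite lt_min d40.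
  have [N' HN'] := geometric_small (t1 - t0) q01 m0.
  pose j := maxn N N'.
  have := HN' j (leq_maxr _ _); rewrite lt_min => /andP[j4 j5].
  have h1 : nrm (S (v (s j)) - x01) < e / 3 by apply: Hv'; rewrite s_gt /s ltrD2l.
  have h2 : nrm (S (w (s j)) - x01) < e / 3 by apply: Hw'; rewrite s_gt /s ltrD2l.
  have Yv := vY _ (s_gt j); have Yw := wY _ (ltW (s_gt j)).
  have := HN j (leq_maxl _ _); rewrite -/(s j) ltr_pdivlMr // mulrC => h3.
  have h4 : nrm (S (v (s j)) - S (w (s j)) - S l) < e / 3.
    apply: le_lt_trans h3; have := HC (v (s j) - w (s j) - l) Logic.I.
    by rewrite (bounded_linearB sT linS) // (bounded_linearB sT linS) // !Q1pr_id.
  have -> : S l = (S (v (s j)) - x01) - (S (w (s j)) - x01) - (S (v (s j)) - S (w (s j)) - S l).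
    by vec (scalars R k).
  apply: le_trans (nrmB _ _) _; have := nrmB (S (v (s j)) - x01) (S (w (s j)) - x01); lra.
move=> t tt; have [tt1|t1t] := leP t t1; first by apply: near; rewrite tt.
have t10 : 0 <= t1 by apply: le_trans (ltW t01).
have t1b : t1 <= t <= t by rewrite lexx andbT ltW.
have U := @is_sol_unique R k Y Phi reduced_field_lip t1 t v w t10 _ _ _ t t1b.
apply: U => //.
- move=> s /andP[ts st]; have t0s : t0 < s by exact: lt_le_trans ts.
  by apply: deriv_onS (dv s t0s) => u /andP[tu _]; exact: lt_le_trans tu.
- by apply: is_solS (sw t (ltW tt)); rewrite ?lexx // ltW.
- by apply: near; rewrite t01 lexx.
Qed.

End reduced_equation.

(** * Assembly *)

Section components.
Context {R : realType} {k : scalar_kind} {X Y : completeNormedModType (scalars R k)}.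
Variable p : pencil X Y.
Local Notation K := (scalars R k).
Local Notation A := (opA p).
Local Notation B := (opB p).
Local Notation nu := (pencil_index p).
Local Notation n := (dim_ker p).
Local Notation D := (domD p).
Local Notation rk := (@root_rank R k X Y p).
Local Notation I := ('I_n * 'I_nu)%type.
Local Notation fix_proj := (@fix_proj R k X Y p).
Local Notation fix_projQ := (@fix_projQ R k X Y p).
Local Notation proj := (@proj R k X Y p).
Local Notation projQ := (@projQ R k X Y p).
Hypothesis hp : pencil_setting p.

Lemma P2diagF s : P2sj p s s.+1 = proj (diag s).
Proof. by apply/funext => x; exact: P2diagE. Qed.
Lemma Q2diagF s : Q2sj p s s.+1 = projQ (diag s).
Proof. by apply/funext => x; exact: Q2diagE. Qed.
Lemma P2sF s : P2s p s = proj (level s).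
Proof. by apply/funext => x; exact: P2sE. Qed.
Lemma Q2sF s : Q2s p s = projQ (level s).
Proof. by apply/funext => x; exact: Q2sE. Qed.
Lemma P2wedgeF s : P2wedge p s = proj (wedge s).
Proof. by apply/funext => x; exact: P2wedgeE. Qed.
Lemma Q2SigmaF s : Q2Sigma p s = projQ (wedge s).
Proof. by apply/funext => x; exact: Q2SigmaE. Qed.
Lemma P2SigmaF : P2Sigma p = proj (from 1).
Proof. by apply/funext => x; exact: P2SigmaE. Qed.
Lemma Q1F : Q1 p = Q1pr p.
Proof. by apply/funext => y; rewrite /Q1 (Q2E hp). Qed.
Lemma P1F : P1 p = fun x => x - proj predT x.
Proof. by apply/funext => y; rewrite /P1 (P2E hp). Qed.

Lemma half_lineE : `[(0 : R), +oo[%classic = half_line.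
Proof. by apply/seteqP; split=> t; rewrite /= in_itv /= andbT. Qed.

Lemma rayE (t0 : R) : `[t0, +oo[%classic = [set t | t0 <= t].
Proof. by apply/seteqP; split=> t; rewrite /= in_itv /= andbT. Qed.

Lemma qf_Y1 (a : I) y : valid a -> Y1 p y -> qf a y = 0.
Proof.
move=> va /(Y1_projQ hp predT)/(congr1 (qf a)).
by rewrite (qf_projQ hp) //= (qf0 hp).
Qed.

Lemma coef_D1 (a : I) x : valid a -> D1 p x -> coef a x = 0.
Proof.
move=> va /(D1_proj hp predT)/(congr1 (coef a)).
by rewrite (coef_proj hp) //= (coef0 hp).
Qed.

Lemma projQ_disjoint (S S' : pred I) y : (forall a, S a -> ~~ S' a) ->
  projQ S (projQ S' y) = 0.
Proof.
move=> SS'; rewrite (projQI hp) /projQ big1 // => a /andP[_ /andP[/SS' N]].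
by move=> S'a; rewrite S'a in N.
Qed.

Lemma projQ_sum (S : pred I) a b (ys : nat -> Y) :
  projQ S (\sum_(a <= j < b) ys j) = \sum_(a <= j < b) projQ S (ys j).
Proof. by apply: (big_morph _ (projQD hp S) (projQ0 hp S)). Qed.

Lemma projQ_id (S : pred I) y : projQ S (projQ S y) = projQ S y.
Proof. by rewrite (projQI hp); apply: eq_projQ => a _ /=; rewrite andbb. Qed.

Lemma projQ_Q1 (S : pred I) y : projQ S (Q1pr p y) = 0.
Proof. by apply: (Y1_projQ hp); exact: Q1pr_Y1. Qed.

Lemma sum_diag_components s x : sum_diag p s (diag_components p x) = proj (diag_from s) x.
Proof.
have fam := family_sum hp (S := fun j => diag j) (T := diag_from s) (a := s) (b := nu)
  (@diag_disjoint _ _ _ _ p) (diag_fromP s) (proj_fix hp (diag_from s) x).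
rewrite [RHS]fam /sum_diag; apply: eq_big_nat => j /andP[sj _].
rewrite /diag_components P2diagF (proj_sub hp) // => a _ /andP[/eqP aj ar].
by rewrite /diag_from aj sj.
Qed.

Lemma sum_wedge_components s x : sum_wedge p s (wedge_components p x) = proj (wedge_from s) x.
Proof.
have fam := family_sum hp (S := fun j => wedge j) (T := wedge_from s) (a := s) (b := nu.-1)
  (@wedge_disjoint _ _ _ _ p) (wedge_fromP hp s) (proj_fix hp (wedge_from s) x).
rewrite [RHS]fam /sum_wedge; apply: eq_big_nat => j /andP[sj _].
rewrite /wedge_components P2wedgeF (proj_sub hp) // => a _ /andP[/eqP aj ar].
by rewrite /wedge_from aj sj ar.
Qed.

Lemma proj_diag_wedge s x : proj (diag_from 1) x + proj (wedge_from s) x = proj (diag_wedge s) x.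
Proof.
rewrite [RHS](pair_sum hp (S1 := diag_from 1) (S2 := wedge_from s) _ _ (proj_fix hp _ _)) //.
  by rewrite !(proj_sub hp) // => a _ h; rewrite /diag_wedge h ?orbT.
by move=> c; exact: diag_wedge_disjoint.
Qed.

Lemma proj_level1 x : proj (diag 1) x + proj (wedge 1) x = proj (level 1) x.
Proof.
rewrite [RHS](pair_sum hp (S1 := diag 1) (S2 := wedge 1) _ _ (proj_fix hp _ _)).
- by rewrite !(proj_sub hp) // => a _ /andP[].
- by move=> c /andP[/eqP c1 /eqP cr]; rewrite /wedge cr ltnn andbF.
- move=> c vc; rewrite /level /diag /wedge -andb_orr; case: eqP => //= c1.
  by move: vc; rewrite /valid c1 leq_eqVlt eq_sym => ->.
Qed.

Lemma proj_all x : proj predT x = proj (level 0) x + proj (from 1) x.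
Proof.
rewrite [LHS](pair_sum hp (S1 := level 0) (S2 := from 1) _ _ (proj_fix hp _ _)).
- by rewrite !(proj_sub hp).
- by move=> c /eqP c0; rewrite /from c0.
- by move=> c _; rewrite /level /from; case: (nat_of_ord c.2).
Qed.

Section structure.
Variable f : R -> X -> Y.
Hypothesis f_struct : structured p f.

Lemma struct_diag s (t : R) x : 0 <= t -> D x -> (1 <= s < nu)%N ->
  projQ (diag s) (f t x) = projQ (diag s) (f t (proj (diag_from s) x)).
Proof.
move=> t0 Dx /andP[s1 sn]; rewrite {1}f_struct // Q1F Q2sF 3!(projQD hp) projQ_Q1 !projQ_sum.
rewrite projQ_disjoint => [|a /andP[/eqP a2 _]]; last by rewrite /level a2 gtn_eqF.
rewrite addr0 big_nat_cond big1 => [|j _]; last first.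
  rewrite Q2SigmaF projQ_disjoint // => a; rewrite diag_val => /andP[_ /eqP ar].
  by rewrite wedge_val ar ltnn andbF.
rewrite !add0r (bigD1_seq s) /= ?mem_index_iota ?s1 ?iota_uniq //.
rewrite Q2diagF projQ_id sum_diag_components big1 ?addr0 // => j js.
rewrite Q2diagF projQ_disjoint // => a /andP[/eqP a2 _].
by rewrite /diag a2 eq_sym (negbTE js).
Qed.

Lemma struct_wedge s (t : R) x : 0 <= t -> D x -> (1 <= s < nu.-1)%N ->
  projQ (wedge s) (f t x) = projQ (wedge s) (f t (proj (diag_wedge s) x)).
Proof.
move=> t0 Dx /andP[s1 sn]; rewrite {1}f_struct // Q1F Q2sF 3!(projQD hp) projQ_Q1 !projQ_sum.
rewrite projQ_disjoint => [|a /andP[/eqP a2 _]]; last by rewrite /level a2 gtn_eqF.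
rewrite addr0 add0r [X in _ + X]big_nat_cond [X in _ + X]big1 => [|j _]; last first.
  rewrite Q2diagF projQ_disjoint // => a /andP[/eqP a2 ar].
  by rewrite /diag a2; case: eqP => //= <-; rewrite gtn_eqF.
rewrite addr0 (bigD1_seq s) /= ?mem_index_iota ?s1 ?iota_uniq //.
rewrite Q2SigmaF projQ_id sum_diag_components sum_wedge_components proj_diag_wedge.
rewrite big1 ?addr0 // => j js.
rewrite Q2SigmaF projQ_disjoint // => a /andP[/eqP a2 _].
by rewrite /wedge a2 eq_sym (negbTE js).
Qed.

Lemma diag_eqP s (t : R) x : 0 <= t -> D x -> (1 <= s < nu)%N -> diag_eq p f s t x <->
  forall a : I, valid a -> diag s a -> qf a (f t x) = coef a x.
Proof.
move=> t0 Dx s1n; rewrite /diag_eq -struct_diag //; split.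
  move=> E a va da; have := congr1 (qf a) E.
  rewrite (qfB hp) // (qf_projQ hp) // da -(coefE hp) //; last exact: proj_D.
  by rewrite (coef_proj hp) // da (qf0 hp) // => /eqP; rewrite subr_eq0 => /eqP.
move=> E; rewrite (B_proj hp) //; apply/eqP; rewrite subr_eq0; apply/eqP.
by apply: eq_projQ_qf => a va da; rewrite E // (coefE hp).
Qed.

Lemma wedge_eqP s (t : R) x d : 0 <= t -> D x -> (1 <= s < nu.-1)%N ->
  wedge_eq p f s t x d <->
  forall a : I, valid a -> wedge s a -> coef a x - coef (next a) d = qf a (f t x).
Proof.
move=> t0 Dx s1n; have DP := proj_D hp.
have qE (a : I) : valid a -> wedge s a -> qf a (A (proj (level s.+1) d)) = - coef (next a) d.
  move=> va wa; have [ln vn] := wedge_next hp wa.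
  by rewrite (qf_A hp) //; move: wa; rewrite wedge_val => /andP[_ ->]; rewrite (coef_proj hp) // ln.
rewrite /wedge_eq -struct_wedge //; split.
  move=> E a va wa; have := congr1 (qf a) E.
  rewrite !(qfB hp) // (qf_projQ hp) // wa -(coefE hp) // (coef_proj hp) // wa (qf0 hp) //.
  by rewrite qE // opprK => E'; apply/eqP; rewrite -subr_eq0 -oppr_eq0 -E'; apply/eqP; ring.
move=> E; rewrite (B_proj hp) //.
have -> : A (proj (level s.+1) d) = projQ (wedge s) (A (proj (level s.+1) d)).
  by rewrite [RHS](A_level hp (proj_fix hp _ d)).
rewrite -!(projQB hp) -(projQ0 hp (wedge s)); apply: eq_projQ_qf => a va wa.
by rewrite !(qfB hp) // (qf0 hp) // qE // -(coefE hp) // -E //; ring.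
Qed.

End structure.

Section total_set.
Variables (M20 : set X) (Md Mw : nat -> set X).
Hypothesis M20_open : open_in (fix_proj (level 0)) M20.
Hypothesis Md_open : forall j, (1 <= j < nu)%N -> open_in (fix_proj (diag j)) (Md j).
Hypothesis Mw_open : forall j, (1 <= j < nu.-1)%N -> open_in (fix_proj (wedge j)) (Mw j).
Local Notation Mdw1 := (Mdw p Md Mw 1).

Lemma Mdw1_open : open_in (fix_proj (from 1)) Mdw1.
Proof.
have -> : fix_proj (from 1) = fix_proj (diag_wedge 1).
  apply: (fix_proj_eq hp) => c vc; rewrite /from /diag_wedge /diag_from /wedge_from -andb_orr.
  by move: vc; rewrite /valid leq_eqVlt eq_sym => ->; rewrite andbT.
exact: Mdw_open.
Qed.

Lemma MsetE : Mset p M20 Md Mw =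
  [set x | [/\ D x, M20 (proj (level 0) x) & Mdw1 (proj (from 1) x)]].
Proof.
apply/seteqP; split=> x.
  move=> [_ [x1 D1x [u Mu <-]] [v Mv <-]].
  have Eu : fix_proj (level 0) u by exact: (open_in_sub M20_open).
  have Ev : fix_proj (from 1) v by exact: (open_in_sub Mdw1_open).
  have sD := D_subspace hp; split.
  - apply: (subspaceD sD); last exact: fix_proj_D Ev.
    by apply: (subspaceD sD); [exact: (D1_D hp) | exact: fix_proj_D Eu].
  - rewrite !(projD hp) (D1_proj hp) // add0r Eu (proj_disjoint hp _ Ev) ?addr0 //.
    by move=> a /eqP a0; rewrite /from a0.
  - rewrite !(projD hp) (D1_proj hp) // add0r Ev (proj_disjoint hp _ Eu) ?add0r //.
    by move=> a a1; rewrite /level gtn_eqF.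
move=> [Dx Mu Mv]; exists (x - proj predT x + proj (level 0) x).
  exists (x - proj predT x); last by exists (proj (level 0) x).
  by exists x => //; rewrite P1F.
by exists (proj (from 1) x) => //; rewrite proj_all; vec (scalars R k).
Qed.

Lemma Mset_open : open_in D (Mset p M20 Md Mw).
Proof.
rewrite MsetE; apply: open_inI => [x []//|x [Dx Mu Mv]].
have [d d0 dM] := open_inP M20_open Mu; have [e e0 eM] := open_inP Mdw1_open Mv.
have [d' d'0 Hd] := proj_near hp (level 0) x d0; have [e' e'0 He] := proj_near hp (from 1) x e0.
exists (Num.min d' e'); first by rewrite lt_min d'0.
move=> y Dy; rewrite lt_min => /andP[/Hd y1 /He y2]; split=> //.
  by apply: dM => //; exact: proj_fix.
by apply: eM => //; exact: proj_fix.
Qed.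

Lemma Mset_sum x1 u v : D1 p x1 -> M20 u -> Mdw1 v -> Mset p M20 Md Mw (x1 + u + v).
Proof.
move=> D1x Mu Mv; exists (x1 + u); last by exists v.
by exists x1 => //; exists u.
Qed.

End total_set.

Lemma A_level0 u : fix_proj (level 0) u -> A u = 0.
Proof.
move=> <-; rewrite (linD_sum hp (A_lin hp)) => [|a /andP[va _]].
  rewrite big1 // => a /andP[va /eqP a0]; rewrite (AZ hp); last exact: phi_D.
  by rewrite A_phi0 // scaler0.
by apply: (subspaceZ (D_subspace hp)); exact: phi_D.
Qed.

Lemma A_proj_linear (S : pred I) :
  bounded_linear_on (@nrm R k X) (@nrm R k Y) setT (fun x => A (proj S x)).
Proof.
split=> [c u v _ _|].
  by rewrite (projD hp) (projZ hp) (A_lin hp) //; exact: proj_D.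
have ex (a : I) : exists C : R, valid a -> forall x, nrm (coef a x : K^o) <= C * nrm x.
  have [va|_] := boolP (valid a); last by exists 0.
  have [C C0 HC] := bounded_linear_bound (coef_linear hp va).
  by exists C => _ x; exact: HC.
have [C CP] := choice ex.
exists (\sum_(a | valid a && S a) C a * nrm (A (phi a))) => x _.
rewrite /proj (linD_sum hp (A_lin hp)) => [|a /andP[va _]]; last first.
  by apply: (subspaceZ (D_subspace hp)); exact: phi_D.
apply: le_trans (nrm_sum _ _ _) _; rewrite mulr_suml; apply: ler_sum => a /andP[va _].
rewrite (AZ hp); last exact: phi_D.
rewrite nrmZ mulrAC; apply: ler_wpM2r; first exact: nrm_ge0.
exact: CP.
Qed.

End components.

Lemma differentiable_locally_lipschitz (R : realType) (k : scalar_kind)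
    (X Y : normedModType (scalars R k)) (c : X -> X) (J : set R) (E M : set X)
    (g : R -> X -> Y) : subspace E -> open_in E M ->
  continuously_partially_differentiable J E M g -> locally_lipschitz_fixing c J M g.
Proof.
move=> sE Mo cpd t0 x0 Jt0 Mx0.
have [d d0 H] := strict_partial sE Mo cpd Jt0 Mx0 ltr01.
have [bL _] := partial_xP (cpd.1 t0 x0 Jt0 Mx0).
have [C C0 HC] := bounded_linear_bound bL.
exists [set s | `|s - t0| < d], [set x | nrm (x - x0) < d], (C + 1); split.
- by apply/nbhs_ballP; exists d => // s; rewrite /ball /= distrC.
- by apply/nbhs_nrmP; exists d.
- by rewrite addr_ge0 // ltW.
move=> t x1 x2 Jt td Mx1 x1d Mx2 x2d _.
have Ex : E (x1 - x2) by apply: (subspaceB sE); exact: (open_in_sub Mo).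
have h1 := H t x1 x2 Jt td Mx1 Mx2 x1d x2d; have h2 := HC _ Ex.
have := nrm_le_dist (g t x1 - g t x2) (partial_x E M g t0 x0 (x1 - x2)).
by rewrite mulrDl mul1r; lra.
Qed.

Lemma op_norm_bound (R : realType) (k : scalar_kind) (E F : normedModType (scalars R k))
    (U : set E) (T : E -> F) : subspace U ->
  bounded_linear_on (@nrm R k E) (@nrm R k F) U T ->
  0 <= op_norm U T /\ forall u, U u -> nrm (T u) <= op_norm U T * nrm u.
Proof.
move=> sU bT; have [C C0 HC] := bounded_linear_bound bT.
have ub : has_sup [set nrm (T u) | u in [set u | U u /\ nrm u <= 1]].
  split; first by exists (nrm (T 0)), 0 => //; split; [exact: sU.1 | rewrite nrm0].
  exists C => _ [u [Uu u1] <-]; apply: le_trans (HC u Uu) _.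
  by rewrite -[leRHS]mulr1 ler_pM2l.
have le1 u : U u -> nrm u <= 1 -> nrm (T u) <= op_norm U T.
  by move=> Uu u1; apply: sup_upper_bound => //; exists u.
have n0 : 0 <= op_norm U T.
  by apply: le_trans (nrm_ge0 (T 0)) (le1 0 sU.1 _); rewrite nrm0.
split=> // u Uu; have [/eqP u0|u0] := boolP (nrm u == 0).
  by rewrite (nrm_eq0 u0) (bounded_linear0 sU bT) !nrm0 mulr0.
have up : 0 < nrm u by rewrite lt0r u0 nrm_ge0.
have := le1 (of_real (nrm u)^-1 *: u) (subspaceZ sU _ Uu).
rewrite (bounded_linearZ sU bT) // !nrmZr ger0_norm ?invr_ge0 ?nrm_ge0 //.
by rewrite mulVf // lexx => /(_ isT); rewrite mulrC ler_pdivrMr.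
Qed.

Section first_component_estimates.
Context {R : realType} {k : scalar_kind} {X Y : completeNormedModType (scalars R k)}.
Variable p : pencil X Y.
Local Notation K := (scalars R k).
Local Notation A := (opA p).
Local Notation B := (opB p).
Local Notation nu := (pencil_index p).
Local Notation n := (dim_ker p).
Local Notation D := (domD p).
Local Notation I := ('I_n * 'I_nu)%type.
Local Notation fix_proj := (@fix_proj R k X Y p).
Local Notation fix_projQ := (@fix_projQ R k X Y p).
Local Notation proj := (@proj R k X Y p).
Local Notation projQ := (@projQ R k X Y p).
Hypothesis hp : pencil_setting p.
Variables (f : R -> X -> Y) (M20 : set X) (Md Mw : nat -> set X).
Hypothesis M20_open : open_in (fix_proj (level 0)) M20.
Hypothesis Md_open : forall j, (1 <= j < nu)%N -> open_in (fix_proj (diag j)) (Md j).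
Hypothesis Mw_open : forall j, (1 <= j < nu.-1)%N -> open_in (fix_proj (wedge j)) (Mw j).
Local Notation Mdw1 := (Mdw p Md Mw 1).
Local Notation M := (Mset p M20 Md Mw).
Variables (z z' : R -> X).
Hypothesis zM : forall t : R, Mdw1 (z t).
Hypothesis z_cont : cont_on half_line z.
Hypothesis z'_cont : cont_on half_line z'.
Let r t := projQ (level 0) (A (proj (level 1) (z' t))).

Let sD := D_subspace hp.

Lemma z_from t : fix_proj (from 1) (z t).
Proof. by apply: (open_in_sub (Mdw1_open hp Md_open Mw_open)); exact: zM. Qed.

Lemma M20_level u : M20 u -> fix_proj (level 0) u.
Proof. exact: (open_in_sub M20_open). Qed.

Lemma point_M t x1 u : D1 p x1 -> M20 u -> M (x1 + u + z t).
Proof. by move=> D1x Mu; exact: Mset_sum. Qed.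

Lemma points_near t x1 u (d : R) : 0 <= t -> 0 < d -> exists2 d' : R, 0 < d' &
  forall (s : R) y1 v, 0 <= s -> `|s - t| < d' -> nrm (y1 - x1) < d' -> nrm (v - u) < d' ->
    nrm (y1 + v + z s - (x1 + u + z t)) < d.
Proof.
move=> t0 d0; have d3 : 0 < d / 3 by rewrite divr_gt0.
have [d' d'0 H'] := z_cont t0 d3.
exists (Num.min (d / 3) d'); first by rewrite lt_min d3.
move=> s y1 v s0; rewrite !lt_min => /andP[_ sd'] /andP[yd _] /andP[vd _].
have -> : y1 + v + z s - (x1 + u + z t) = (y1 - x1) + (v - u) + (z s - z t).
  by vec (scalars R k).
have := H' s s0 sd'; have := nrmD (y1 - x1 + (v - u)) (z s - z t).
have := nrmD (y1 - x1) (v - u); lra.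
Qed.

Lemma lipschitz_near_of (g : R -> X -> Y) :
  locally_lipschitz_fixing (P2Sigma p) half_line M g ->
  forall (t : R) x1 u, 0 <= t -> D1 p x1 -> M20 u -> lipschitz_near p M20 z g t x1 u.
Proof.
move=> gl t x1 u t0 D1x Mu; have Mx := point_M t D1x Mu.
have [U [V [L [/nbhs_ballP[d /= d0 dU] /nbhs_nrmP[d1 d10 dV] L0 H]]]] := gl _ _ t0 Mx.
have [d2 d20 near] := points_near x1 u t0 d10.
exists L, (Num.min d d2); split=> //; first by rewrite lt_min d0.
move=> s y1 y2 v1 v2 s0; rewrite !lt_min => /andP[sd sd2] D1y1 D1y2.
move=> /andP[_ yd1] /andP[_ yd2] Mv1 Mv2 /andP[_ vd1] /andP[_ vd2].
have := H s (y1 + v1 + z s) (y2 + v2 + z s) s0.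
have comp y v : D1 p y -> M20 v -> P2Sigma p (y + v + z s) = z s.
  move=> D1y /M20_level Ev; rewrite (P2SigmaF hp) !(projD hp) (D1_proj hp) // add0r.
  rewrite (proj_disjoint hp _ Ev) ?add0r ?z_from // => a a1.
  by rewrite /level gtn_eqF.
rewrite !comp // => h; apply: le_trans (h _ _ _ _ _ _) _ => //.
- by apply: dU; rewrite /ball /= distrC.
- exact: point_M.
- by apply: dV; exact: near.
- exact: point_M.
- by apply: dV; exact: near.
apply: ler_wpM2l => //; apply: le_trans (nrmD _ _).
have -> // : y1 - y2 + (v1 - v2) = y1 + v1 + z s - (y2 + v2 + z s) by vec (scalars R k).
Qed.

Lemma r_fix t : fix_projQ (level 0) (r t).
Proof. exact: projQ_id. Qed.

Lemma r_cont : cont_on half_line r.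
Proof.
move=> t t0 e e0; have [C C0 HC] := bounded_linear_bound (A_proj_linear hp (level 1)).
have [C' C'0 HC'] := bounded_linear_bound (projQ_bounded hp (level 0)).
have [d d0 H] := z'_cont t0 (divr_gt0 e0 (mulr_gt0 C'0 C0)).
have sT : subspace (setT : set X) by split.
exists d => // s s0 sd; rewrite /r -(projQB hp).
rewrite -(bounded_linearB sT (A_proj_linear hp (level 1))) //.
apply: le_lt_trans (HC' _ Logic.I) _.
apply: (@le_lt_trans _ _ (C' * (C * nrm (z' s - z' t)))); first by rewrite ler_pM2l //; exact: HC.
by have := H s s0 sd; rewrite ltr_pdivlMr ?mulr_gt0 // mulrC mulrA.
Qed.

Lemma G20E t x1 u : G20 p f z r t x1 u =
  F20 p f t x1 u (z t) (proj (diag 1) (z' t)) (proj (wedge 1) (z' t)).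
Proof. by rewrite /F20 (Q2sF hp) (proj_level1 hp). Qed.

Lemma estimate20_of_F20_estimate (t : R) x1 u : 0 <= t -> D1 p x1 ->
  F20_estimate p f t x1 u (z t) (proj (diag 1) (z' t)) (proj (wedge 1) (z' t)) ->
  estimate20 p f z r t x1 u.
Proof.
move=> t0 D1x [Z [Zi [c [l [r0 [ZL ZZi [r00 est] climit l_lt]]]]]].
rewrite (D2sE hp) (Y2sE hp) in ZZi.
have sW : subspace (fix_projQ (level 0)) by exact: projQ_fix_subspace.
have [_ ZiL _ _] := ZZi; have [N0 HN] := op_norm_bound sW ZiL.
rewrite (Y2sE hp) in l_lt; set N := op_norm _ _ in N0 HN l_lt.
have [eta eta0 [q [c0 c0l /andP[q0 q1] cN]]] : exists2 eta : R, 0 < eta & exists q : R,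
    [/\ 0 <= Num.max (l + eta) 0, l + eta <= Num.max (l + eta) 0, 0 <= q < 1 &
        Num.max (l + eta) 0 * N <= q].
  pose eta := (N^-1 - l) / 2; have eta0 : 0 < eta by rewrite divr_gt0 // subr_gt0.
  exists eta => //; exists (Num.max (l + eta) 0 * N).
  have m0 : 0 <= Num.max (l + eta) 0 by rewrite le_max lexx orbT.
  split=> //; first by rewrite le_max lexx.
  rewrite mulr_ge0 //=; have [->|Nn0] := eqVneq N 0; first by rewrite mulr0.
  have Np : 0 < N by rewrite lt0r Nn0.
  rewrite -ltr_pdivlMr // div1r gt_max invr_gt0 Np andbT /eta; lra.
have [rho rho0 Hc] := climit eta eta0.
pose e := Num.min r0 rho / 2.
have m0 : 0 < Num.min r0 rho by rewrite lt_min r00.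
have e0 : 0 < e by rewrite divr_gt0.
have em : e < Num.min r0 rho by rewrite ltr_pdivrMr // ltr_pMr // ltr1n.
move: em; rewrite lt_min => /andP[er0 erho].
have [d1 d10 H1] := z_cont t0 e0.
have [C1 C10 HC1] := bounded_linear_bound (proj_bounded hp (diag 1)).
have [C2 C20 HC2] := bounded_linear_bound (proj_bounded hp (wedge 1)).
have [d3 d30 H3] := z'_cont t0 (divr_gt0 e0 C10).
have [d4 d40 H4] := z'_cont t0 (divr_gt0 e0 C20).
exists Z, Zi, (Num.max (l + eta) 0), N, q, (Num.min e (Num.min d1 (Num.min d3 d4))).
split=> //; first by split=> //; rewrite q0.
  by rewrite !lt_min e0 d10 d30.
move=> s y1 v v' s0; rewrite !lt_min => /andP[se /andP[sd1 /andP[sd3 sd4]]] D1y.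
move=> /andP[ye _] Ev Ev' /andP[ve _] /andP[ve' _].
have radii i : 0 < (fun _ : 'I_5 => e) i < r0 by rewrite e0.
have radii' i : 0 < (fun _ : 'I_5 => e) i < rho by rewrite e0.
have := est (fun=> e) e radii; rewrite e0 er0 => /(_ isT) H.
rewrite !G20E; apply: le_trans (H _ _ _ _ _ _ _ _ _ _ _ _ _) _.
- split=> //.
  + by rewrite (D2SigmaE hp); exact: z_from.
  + by rewrite (D2sjE hp); exact: proj_fix.
  + by rewrite (D2wedgeE hp); exact: proj_fix.
- split=> //; first exact: H1.
  + rewrite -(projB hp); apply: le_lt_trans (HC1 _ Logic.I) _.
    by have := H3 s s0 sd3; rewrite ltr_pdivlMr // mulrC.
  + rewrite -(projB hp); apply: le_lt_trans (HC2 _ Logic.I) _.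
    by have := H4 s s0 sd4; rewrite ltr_pdivlMr // mulrC.
- by rewrite (D2sE hp).
- exact: ve.
- by rewrite (D2sE hp).
- exact: ve'.
apply: ler_wpM2r; first exact: nrm_ge0.
apply: le_trans c0l; have := Hc (fun=> e) e radii'; rewrite e0 erho => /(_ isT).
by rewrite ltr_norml ltrBlDl => /andP[_ /ltW].
Qed.

Let difference_cancel (a b c d e y : Y) : a - c - y - (b - d - y) - (e - (c - d)) = a - b - e.
Proof. by vec (scalars R k). Qed.

Lemma estimate20_of_derivative (t : R) x1 u : 0 <= t -> D1 p x1 -> M20 u ->
  continuously_partially_differentiable half_line D M (fun t x => projQ (level 0) (f t x)) ->
  has_bounded_inverse (@nrm R k X) (@nrm R k Y) (fix_proj (level 0)) (fix_projQ (level 0))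
    (fun h => partial_x D M (fun t' x' => projQ (level 0) (f t' x')) t (x1 + u + z t)
       (proj (level 0) h) - projQ (level 0) (B (proj (level 0) h))) ->
  estimate20 p f z r t x1 u.
Proof.
move=> t0 D1x Mu cpd [Zi ZZi]; have [_ ZiL _ _] := ZZi.
have [N N0 HN] := bounded_linear_bound ZiL.
have Mo := Mset_open hp M20_open Md_open Mw_open.
have c0 : 0 < 1 / 2 / N by rewrite !divr_gt0.
have [d d0 H] := strict_partial sD Mo cpd t0 (point_M t D1x Mu) c0.
have [d1 d10 dM] := open_inP M20_open Mu.
have [d2 d20 near] := points_near x1 u t0 d0.
exists (fun h => partial_x D M (fun t' x' => projQ (level 0) (f t' x')) t (x1 + u + z t)
       (proj (level 0) h) - projQ (level 0) (B (proj (level 0) h))), Zi, (1 / 2 / N), N, (1 / 2).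
exists (Num.min d (Num.min d1 d2)); split=> //.
- split; [exact: ltW | exact: ltW | by apply/andP; split; lra | by rewrite divfK // gt_eqF].
- by rewrite !lt_min d0 d10.
move=> s y1 v v' s0; rewrite !lt_min => /andP[sd /andP[_ sd2]] D1y.
move=> /andP[_ /andP[_ yd2]] Ev Ev' /andP[_ /andP[vd1 vd2]] /andP[_ /andP[vd1' vd2']].
have Mv := point_M s D1y (dM _ Ev vd1); have Mv' := point_M s D1y (dM _ Ev' vd1').
have := H s _ _ s0 sd Mv Mv' (near s y1 v s0 sd2 yd2 vd2) (near s y1 v' s0 sd2 yd2 vd2').
have -> : y1 + v + z s - (y1 + v' + z s) = v - v' by vec (scalars R k).
have sE := proj_fix_subspace hp (level 0).
rewrite (subspaceB sE Ev Ev' : proj (level 0) (v - v') = v - v').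
rewrite (BB hp (fix_proj_D hp Ev) (fix_proj_D hp Ev')) (projQB hp) -!(B_proj hp) ?Ev ?Ev' //.
- by rewrite -[X in nrm X <= _](difference_cancel _ _ (B v) (B v') _ (r s)).
- exact: fix_proj_D Ev'.
- exact: fix_proj_D Ev.
Qed.

End first_component_estimates.

Section solvability.
Context {R : realType} {k : scalar_kind} {X Y : completeNormedModType (scalars R k)}.
Variable p : pencil X Y.
Local Notation K := (scalars R k).
Local Notation A := (opA p).
Local Notation B := (opB p).
Local Notation nu := (pencil_index p).
Local Notation n := (dim_ker p).
Local Notation D := (domD p).
Local Notation rk := (@root_rank R k X Y p).
Local Notation I := ('I_n * 'I_nu)%type.
Local Notation fix_proj := (@fix_proj R k X Y p).
Local Notation fix_projQ := (@fix_projQ R k X Y p).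
Local Notation proj := (@proj R k X Y p).
Local Notation projQ := (@projQ R k X Y p).
Local Notation S := (Atilde_inv p).
Hypothesis hp : pencil_setting p.
Hypothesis closedA : closed_operator A.
Hypothesis closedB : closed_operator B.
Hypothesis range_closed : closed (A @` dom A).
Hypothesis regular : regular_pencil D A B nu.
Variables (f : R -> X -> Y) (M20 : set X) (Md Mw : nat -> set X).
Hypothesis f_struct : structured p f.
Hypothesis M20_open : open_in (fix_proj (level 0)) M20.
Hypothesis Md_open : forall j, (1 <= j < nu)%N -> open_in (fix_proj (diag j)) (Md j).
Hypothesis Mw_open : forall j, (1 <= j < nu.-1)%N -> open_in (fix_proj (wedge j)) (Mw j).
Local Notation Mdw1 := (Mdw p Md Mw 1).
Local Notation M := (Mset p M20 Md Mw).
Variables (z z' : R -> X).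
Hypothesis zM : forall t : R, Mdw1 (z t).
Hypothesis z_diag : forall (t : R) j, 0 <= t -> (1 <= j < nu)%N -> diag_eq p f j t (z t).
Hypothesis z_wedge : forall (t : R) j, 0 <= t -> (1 <= j < nu.-1)%N ->
  wedge_eq p f j t (z t) (z' t).
Hypothesis z'_from : forall t, fix_proj (from 1) (z' t).
Hypothesis z_deriv : forall t : R, 0 <= t -> deriv_on half_line z t (z' t).
Hypothesis z'_cont : cont_on half_line z'.
Local Notation r := (fun t => projQ (level 0) (A (proj (level 1) (z' t)))).
Variable chi : R -> X -> X.
Hypothesis chiP : forall (t : R) x1, 0 <= t -> D1 p x1 ->
  [/\ M20 (chi t x1), G20 p f z r t x1 (chi t x1) = 0 &
    forall u, M20 u -> G20 p f z r t x1 u = 0 -> u = chi t x1].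
Local Notation psi := (psi20 p f z chi).
Local Notation Phi := (reduced_field p psi).
Hypothesis psi_cont : forall (t : R) x1 (e : R), 0 <= t -> D1 p x1 -> 0 < e ->
  exists2 d : R, 0 < d &
  forall (s : R) y1, 0 <= s -> D1 p y1 -> `|s - t| < d -> nrm (y1 - x1) < d ->
    nrm (psi s y1 - psi t x1) < e.
Hypothesis psi_lip : forall (t : R) x1, 0 <= t -> D1 p x1 -> exists L d : R,
  [/\ 0 <= L, 0 < d &
  forall (s : R) y1 y2, 0 <= s -> `|s - t| < d -> D1 p y1 -> D1 p y2 ->
    nrm (y1 - x1) < d -> nrm (y2 - x1) < d ->
    nrm (psi s y1 - psi s y2) <= L * nrm (y1 - y2)].
Hypothesis chi_cont : forall (t : R) x1 (e : R), 0 <= t -> D1 p x1 -> 0 < e ->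
  exists2 d : R, 0 < d &
  forall (s : R) y1, 0 <= s -> D1 p y1 -> `|s - t| < d -> nrm (y1 - x1) < d ->
    nrm (chi s y1 - chi t x1) < e.
Variables (t0 : R) (x01 : X) (w : R -> Y).
Hypothesis t0_ge0 : 0 <= t0.
Hypothesis D1x01 : D1 p x01.
Hypothesis w_start : w t0 = A x01.
Hypothesis w_sol : forall b : R, t0 <= b -> is_sol Phi t0 b w.
Hypothesis w_Y1 : forall t : R, t0 <= t -> Y1 p (w t).

Let sD := D_subspace hp.
Let sTX : subspace (setT : set X). Proof. by split. Qed.
Let sTY : subspace (setT : set Y). Proof. by split. Qed.
Let SP (t : R) : t0 <= t -> D1 p (S (w t)) /\ A (S (w t)) = w t.
Proof. by move=> t0t; apply: Atilde_invP => //; exact: w_Y1. Qed.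
Let t_ge0 (t : R) : t0 <= t -> 0 <= t. Proof. exact: le_trans. Qed.
Let z_fix t : fix_proj (from 1) (z t).
Proof. exact: (z_from hp Md_open Mw_open zM). Qed.

Let psi_Y1 (t : R) x1 : Y1 p (psi t x1). Proof. exact: Q1pr_Y1. Qed.
Let Phi_cont := reduced_field_cont hp closedA closedB range_closed regular psi_cont.

Definition glued_solution (t : R) : X := S (w t) + chi t (S (w t)) + z t.
Definition glued_velocity (t : R) : Y := Phi t (w t) + A (z' t).
Local Notation x := glued_solution.
Local Notation v := glued_velocity.

Lemma chi_level t : t0 <= t -> fix_proj (level 0) (chi t (S (w t))).
Proof.
move=> t0t; have [D1x _] := SP t0t; have [Mu _ _] := chiP (t_ge0 t0t) D1x.
exact: (open_in_sub M20_open).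
Qed.

Lemma proj_parts x1 u zt : D1 p x1 -> fix_proj (level 0) u -> fix_proj (from 1) zt ->
  [/\ proj predT (x1 + u + zt) = u + zt, proj (level 0) (x1 + u + zt) = u &
      proj (from 1) (x1 + u + zt) = zt].
Proof.
move=> D1x Eu Ez; rewrite !(projD hp) !(D1_proj hp _ D1x) !add0r Eu Ez.
have uT : proj predT u = u by apply: (fix_sub hp) Eu.
have zT : proj predT zt = zt by apply: (fix_sub hp) Ez.
split; first by rewrite uT zT.
  by rewrite (proj_disjoint hp _ Ez) ?addr0 // => a /eqP a0; rewrite /from a0.
by rewrite (proj_disjoint hp _ Eu) ?add0r // => a a1; rewrite /level gtn_eqF.
Qed.

Lemma glued_D t : t0 <= t -> D (x t).
Proof.
move=> t0t; have [D1x _] := SP t0t; apply: (subspaceD sD); last exact: fix_proj_D (z_fix t).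
apply: (subspaceD sD); first exact: (D1_D hp).
exact: fix_proj_D (chi_level t0t).
Qed.

Lemma glued_M t : t0 <= t -> M (x t).
Proof.
move=> t0t; have [D1x _] := SP t0t; have [Mu _ _] := chiP (t_ge0 t0t) D1x.
exact: Mset_sum.
Qed.

Lemma A_glued t : t0 <= t -> A (x t) = w t + A (proj (from 1) (z t)).
Proof.
move=> t0t; have [D1x wE] := SP t0t; have Ec := chi_level t0t.
have Dx := D1_D hp D1x; have Dc := fix_proj_D hp Ec; have Dz := fix_proj_D hp (z_fix t).
rewrite (AD hp) ?(AD hp) //; last exact: (subspaceD sD).
by rewrite wE (A_level0 hp Ec) addr0 z_fix.
Qed.

Lemma w_deriv t : t0 <= t -> deriv_on [set s | t0 <= s] w t (Phi t (w t)).
Proof.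
move=> t0t; have tt1 : t0 <= t + 1 by lra.
have tin : t0 <= t <= t + 1 by apply/andP; split; lra.
apply: (deriv_on_near ltr01) (w_sol tt1 tin) => s /= ts st.
by rewrite /seg /=; apply/andP; split; [lra | move: st; rewrite ltr_norml => /andP[_]; lra].
Qed.

Lemma ray_sub : [set s : R | t0 <= s] `<=` half_line.
Proof. by move=> s /=; exact: t_ge0. Qed.

Lemma w_cont : cont_on [set s | t0 <= s] w.
Proof. by apply: deriv_cont => t; exact: w_deriv. Qed.

Lemma glued_deriv t : t0 <= t -> deriv_on [set s | t0 <= s] (fun s => A (x s)) t (v t).
Proof.
move=> t0t; apply: (deriv_on_eq (u := fun s => w s + A (proj (from 1) (z s)))).
- by move=> s t0s; rewrite A_glued.
- by rewrite A_glued.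
apply: deriv_onD; first exact: w_deriv.
rewrite -[in X in deriv_on _ _ _ X](z'_from t).
apply: (deriv_on_linear sTX (A_proj_linear hp (from 1))) => //.
by apply: deriv_onS ray_sub _; apply: z_deriv; exact: t_ge0.
Qed.

Lemma glued_velocity_cont : cont_on [set s | t0 <= s] v.
Proof.
apply: cont_onD; first by apply: (Phi_cont_on Phi_cont); [exact: ray_sub | exact: w_cont].
move=> t t0t e e0; have [C C0 HC] := bounded_linear_bound (A_proj_linear hp (from 1)).
have [d d0 H] := z'_cont (t_ge0 t0t) (divr_gt0 e0 C0).
exists d => // s t0s sd; rewrite -(z'_from s) -(z'_from t).
rewrite -(bounded_linearB sTX (A_proj_linear hp (from 1))) //.
apply: le_lt_trans (HC _ Logic.I) _.
by have := H s (t_ge0 t0s) sd; rewrite ltr_pdivlMr // mulrC.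
Qed.

Lemma Sw_cont : cont_on [set s | t0 <= s] (fun s => S (w s)).
Proof.
have Sl := Atilde_inv_linear hp closedA closedB range_closed regular.
move=> t t0t e e0; have [C C0 HC] := bounded_linear_bound Sl.
have [d d0 H] := w_cont t0t (divr_gt0 e0 C0); exists d => // s t0s sd.
have Yt := w_Y1 t0t; have Ys := w_Y1 t0s.
rewrite -(bounded_linearB (Y1_subspace hp) Sl) //.
apply: le_lt_trans (HC _ (subspaceB (Y1_subspace hp) Ys Yt)) _.
by have := H s t0s sd; rewrite ltr_pdivlMr // mulrC.
Qed.

Lemma glued_cont : cont_on [set s | t0 <= s] x.
Proof.
apply: cont_onD; last by apply: cont_onS ray_sub _; exact: deriv_cont z_deriv.
apply: cont_onD; first exact: Sw_cont.
move=> t t0t e e0; have [D1x _] := SP t0t.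
have [d d0 H] := chi_cont (t_ge0 t0t) D1x e0.
have [d' d'0 H'] := Sw_cont t0t d0.
exists (Num.min d d'); first by rewrite lt_min d0.
move=> s t0s; rewrite lt_min => /andP[sd sd']; have [D1y _] := SP t0s.
by apply: H => //; [exact: t_ge0 | exact: H'].
Qed.

Lemma qf_A_level1 (a : I) d : valid a -> level 0 a -> fix_proj (from 1) d ->
  qf a (A (proj (level 1) d)) = qf a (A d).
Proof.
move=> va /eqP a0 dE; rewrite !(qf_A hp) //; try exact: proj_D; try exact: fix_proj_D dE.
case: ifP => // ar; have [nE vn] := next_val hp ar.
by rewrite (coef_proj hp) // /level nE a0.
Qed.

Lemma G20P t x1 u zt : 0 <= t -> D1 p x1 -> fix_proj (level 0) u -> zt = z t ->
  G20 p f z r t x1 u = 0 <->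
  forall a : I, valid a -> level 0 a ->
    qf a (f t (x1 + u + zt)) = coef a u + qf a (A (z' t)).
Proof.
move=> t0' D1x Eu ->; split=> [G0 a va la|H].
  have := congr1 (qf a) G0; rewrite /G20 !(qfB hp) // !(qf_projQ hp) // la (qf0 hp) //.
  rewrite qf_A_level1 // -(coefE hp) //; last exact: fix_proj_D Eu.
  by move=> E; apply/eqP; rewrite -subr_eq0 -E; apply/eqP; ring.
have BE : B u = projQ (level 0) (B u).
  by rewrite -(B_proj hp) ?Eu //; exact: fix_proj_D Eu.
rewrite /G20 BE.
rewrite -!(projQB hp) -(projQ0 hp (level 0)); apply: eq_projQ_qf => a va la.
rewrite !(qfB hp) // H // (qf0 hp) // qf_A_level1 // -(coefE hp) //; first ring.
exact: fix_proj_D Eu.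
Qed.

Lemma coord_split (y y' : Y) : Q1pr p y = Q1pr p y' ->
  (forall a : I, valid a -> qf a y = qf a y') -> y = y'.
Proof.
move=> yy E; have {}E : projQ predT y = projQ predT y' by apply: eq_projQ_qf => a va _; exact: E.
by rewrite -[y](subrK (projQ predT y)) -[y'](subrK (projQ predT y')) -/(Q1pr p y) yy E.
Qed.

Lemma index_cases (a : I) : valid a ->
  [\/ level 0 a,
      exists2 s, (1 <= s < nu)%N & diag s a
    | exists2 s, (1 <= s < nu.-1)%N & wedge s a].
Proof.
move=> va; have [a0|a0] := posnP a.2; first by apply: Or31; rewrite /level a0.
have [ar|ar] := eqVneq (rk a.1) a.2.+1.
  by apply: Or32; exists a.2; rewrite ?diag_val ?a0 ?ltn_ord ?ar ?eqxx.
apply: Or33; have ar' : (a.2.+1 < rk a.1)%N by rewrite ltn_neqAle eq_sym ar; exact: va.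
exists a.2; last by rewrite wedge_val ar' eqxx.
rewrite a0 /=; have /andP[_] := rk_bounds hp a.1 => /(leq_trans ar').
by move/leq_sub2r => /(_ 1%N); rewrite !subn1.
Qed.

Lemma diag_eq_ext s t x1 u zt : D1 p x1 -> fix_proj (level 0) u -> (1 <= s)%N ->
  diag_eq p f s t (x1 + u + zt) <-> diag_eq p f s t zt.
Proof.
move=> D1x Eu s1; rewrite /diag_eq !(projD hp) !(D1_proj hp _ D1x) !add0r.
rewrite !(proj_disjoint hp _ Eu) ?add0r // => a /andP[].
  by move=> /eqP sa _; rewrite /level sa gtn_eqF.
by move=> sa _; rewrite /level gtn_eqF // (leq_trans s1 sa).
Qed.

Lemma wedge_eq_ext s t x1 u zt d : D1 p x1 -> fix_proj (level 0) u -> (1 <= s)%N ->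
  wedge_eq p f s t (x1 + u + zt) d <-> wedge_eq p f s t zt d.
Proof.
move=> D1x Eu s1; rewrite /wedge_eq !(projD hp) !(D1_proj hp _ D1x) !add0r.
rewrite !(proj_disjoint hp _ Eu) ?add0r // => a.
  by move=> /andP[/eqP sa _]; rewrite /level sa gtn_eqF.
move=> /orP[/andP[sa _]|/andP[sa _]]; rewrite /level gtn_eqF //.
exact: leq_trans s1 sa.
Qed.

Lemma glued_equation t : t0 <= t -> v t + B (x t) = f t (x t).
Proof.
move=> t0t; have [D1x wE] := SP t0t; have Ec := chi_level t0t; have t0' := t_ge0 t0t.
have Dx := glued_D t0t; have [PT _ _] := proj_parts D1x Ec (z_fix t).
have Dz' : D (z' t) by exact: fix_proj_D (z'_from t).
apply: coord_split.
  rewrite /Q1pr (projQD hp predT (v t)) (projQD hp predT (Phi t (w t)) (A (z' t))).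
  have -> : projQ predT (A (z' t)) = A (z' t).
    have Q := Q1_A hp Dz'; have P0 : proj predT (z' t) = z' t by apply: (fix_sub hp) (z'_from t).
    rewrite P0 subrr (linD0 hp (A_lin hp)) in Q.
    by apply/esym/eqP; rewrite -subr_eq0 Q.
  have -> : projQ predT (Phi t (w t)) = 0.
    by apply: (Y1_projQ hp); exact: reduced_field_Y1.
  rewrite add0r /v -/(psi t (S (w t))).
  have -> : Phi t (w t) + A (z' t) + B (x t) - (A (z' t) + projQ predT (B (x t))) =
    Phi t (w t) + (B (x t) - projQ predT (B (x t))) by vec (scalars R k).
  rewrite (Q1_B hp Dx) PT.
  have -> : x t - (chi t (S (w t)) + z t) = S (w t) by rewrite /x; vec (scalars R k).
  by rewrite /reduced_field (Q1pr_id hp (w_Y1 t0t)) subrK.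
move=> a va; rewrite (qfD hp (v t) (B (x t)) va) (qfD hp (Phi t (w t)) (A (z' t)) va).
rewrite (qf_Y1 hp va (reduced_field_Y1 hp closedA closedB range_closed regular psi_Y1 t (w t))) add0r.
rewrite -(coefE hp va Dx); case: (index_cases va) => [a0|[s s1 sa]|[s s1 sa]].
- have [_ G0 _] := chiP t0' D1x.
  have /(_ a va a0) -> := (G20P t0' D1x Ec erefl).1 G0.
  rewrite addrC; congr (_ + _); rewrite !(coefD hp) // (coef_D1 hp) // add0r.
  by rewrite (fix_coef hp (z_fix t)) ?addr0 // /from -ltnNge (eqP a0).
- have /andP[s10 _] := s1.
  have E := (diag_eq_ext _ _ D1x Ec s10).2 (z_diag t0' s1).
  rewrite ((diag_eqP hp f_struct t0' Dx s1).1 E a va sa) (qf_A hp) //.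
  by move: sa; rewrite diag_val => /andP[_ /eqP->]; rewrite ltnn add0r.
- have /andP[s10 _] := s1.
  have E := (wedge_eq_ext _ _ _ D1x Ec s10).2 (z_wedge t0' s1).
  rewrite -((wedge_eqP hp f_struct _ t0' Dx s1).1 E a va sa) (qf_A hp) //.
  by move: sa; rewrite wedge_val => /andP[_ ->]; rewrite addrC.
Qed.

Lemma glued_is_solution : solution p f `[t0, +oo[ M x /\ P1 p (x t0) = x01.
Proof.
have subT : equation_times `[t0, +oo[ `<=` [set s : R | t0 <= s].
  by move=> t []; rewrite rayE.
split; last first.
  have [D1x _] := SP (lexx t0); have Ec := chi_level (lexx t0).
  have [PT _ _] := proj_parts D1x Ec (z_fix t0).
  have -> : x01 = S (w t0).
    by rewrite w_start (Atilde_invK hp closedA closedB range_closed regular).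
  by rewrite (P1F hp) PT /x; vec (scalars R k).
split.
- by move=> t; rewrite rayE => t0t; split; [exact: glued_D | exact: glued_M].
- by apply/cont_on_within; rewrite rayE; exact: glued_cont.
exists v; split.
- move=> t /subT t0t; apply/deriv_on_within; apply: deriv_onS subT _.
  exact: glued_deriv.
- by apply/cont_on_within; apply: cont_onS subT _; exact: glued_velocity_cont.
- by move=> t /subT; exact: glued_equation.
Qed.

Lemma next_inj (a b : I) : valid a -> valid b -> (a.2.+1 < rk a.1)%N ->
  (b.2.+1 < rk b.1)%N -> next a = next b -> a = b.
Proof.
move=> va vb ar br ab; have [na _] := next_val hp ar; have [nb _] := next_val hp br.
rewrite [a]surjective_pairing [b]surjective_pairing; congr pair; first by have /= := congr1 fst ab.
by apply: val_inj; apply: succn_inj; rewrite -na -nb ab.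
Qed.

Hypothesis z_unique : forall y y' : R -> X,
  (forall t : R, t0 < t -> [/\ Mdw1 (y t),
      forall j, (1 <= j < nu)%N -> diag_eq p f j t (y t),
      forall j, (1 <= j < nu.-1)%N -> wedge_eq p f j t (y t) (y' t)
    & forall a : I, valid a -> from 1 a ->
        deriv_on [set s | t0 < s] (fun t => coef a (y t) : K^o) t (coef a (y' t))]) ->
  forall t : R, t0 < t -> z t = y t.

Section other_solution.
Variables (y : R -> X) (vy : R -> Y).
Hypothesis y_M : forall t : R, t0 <= t -> M (y t).
Hypothesis y_cont : cont_on [set s | t0 <= s] y.
Hypothesis y_deriv : forall t : R, t0 < t ->
  deriv_on [set s | t0 < s] (fun s => A (y s)) t (vy t).
Hypothesis y_eq : forall t : R, t0 < t -> vy t + B (y t) = f t (y t).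
Hypothesis y_start : y t0 - proj predT (y t0) = x01.

Let y1 t := y t - proj predT (y t).
Let u t := proj (level 0) (y t).
Let yz t := proj (from 1) (y t).

Let yE t : y t = y1 t + u t + yz t.
Proof. by rewrite /y1 (proj_all hp) /u /yz; vec (scalars R k). Qed.

Let y_parts (t : R) : t0 <= t ->
  [/\ D (y t), D1 p (y1 t), M20 (u t), Mdw1 (yz t) & fix_proj (level 0) (u t)].
Proof.
move=> t0t; have := y_M t0t.
rewrite (MsetE hp M20_open Md_open Mw_open) => -[Dy Mu Mz]; split=> //.
  by exists (y t) => //; rewrite (P1F hp).
exact: proj_fix.
Qed.

Let T_ge0 (t : R) : t0 < t -> 0 <= t. Proof. by move=> /ltW/t_ge0. Qed.

Let dq (a : I) t : valid a -> t0 < t ->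
  deriv_on [set s | t0 < s] (fun s => qf a (A (y s)) : K^o) t (qf a (vy t)).
Proof. by move=> va tt; apply: (deriv_on_linear sTY (qf_linear hp va)) => //; exact: y_deriv. Qed.

Let q_last (a : I) t : valid a -> (a.2.+1 < rk a.1)%N = false -> t0 < t -> qf a (vy t) = 0.
Proof.
move=> va ar tt; have q0 s : t0 <= s -> qf a (A (y s)) = 0.
  by move=> t0s; have [Dy _ _ _ _] := y_parts t0s; rewrite (qf_A hp) // ar.
have sub : [set s : R | t < s] `<=` [set s | t0 < s] by move=> s; exact: lt_trans.
apply: (deriv_on_unique (V := K^o) (u := fun s => qf a (A (y s))) (t := t)).
  exact: deriv_onS sub (dq va tt).
apply: (deriv_on_eq (u := fun=> 0 : K^o)); last exact: deriv_on_cst.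
  by move=> s /sub/ltW/q0.
by rewrite q0 ?ltW.
Qed.

Let q_eq (a : I) t : valid a -> t0 < t -> qf a (f t (y t)) = qf a (vy t) + coef a (y t).
Proof.
move=> va tt; have [Dy _ _ _ _] := y_parts (ltW tt).
by rewrite -y_eq // (qfD hp) // (coefE hp).
Qed.

Let previous_exists : exists pr : I -> I, forall a : I, valid a -> from 1 a ->
  [/\ valid (pr a), ((pr a).2.+1 < rk (pr a).1)%N & a = next (pr a)].
Proof.
suff : forall a : I, exists b : I, valid a -> from 1 a ->
    [/\ valid b, (b.2.+1 < rk b.1)%N & a = next b].
  by move=> /choice[pr prP]; exists pr => a; exact: prP.
move=> a.
have [/andP[va a1]|N] := boolP (valid a && from 1 a).
  by have [b bP] := valid_next_of va a1; exists b.
by exists a => va a1; rewrite va a1 in N.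
Qed.

(* The sigma components of an arbitrary solution are differentiable because
   they are, up to sign, coordinates of A y. *)
Let sigma_velocity : exists y' : R -> X,
  (forall (a : I) t, valid a -> (a.2.+1 < rk a.1)%N -> coef (next a) (y' t) = - qf a (vy t)) /\
  (forall (a : I) t, valid a -> from 1 a -> t0 < t ->
    deriv_on [set s | t0 < s] (fun s => coef a (yz s) : K^o) t (coef a (y' t))).
Proof.
have [pr prP] := previous_exists.
pose y' t : X := \sum_(a : I | valid a && from 1 a) (- qf (pr a) (vy t)) *: phi a.
have y'c (a : I) t : valid a -> from 1 a -> coef a (y' t) = - qf (pr a) (vy t).
  by move=> va a1; rewrite (coef_comb hp (from 1) (fun a => - qf (pr a) (vy t))) // a1.
exists y'; split=> [a t va ar|a t va a1 tt].
  have [nE vn] := next_val hp ar; have n1 : from 1 (next a) by rewrite /from nE.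
  rewrite y'c //; have [vp pr_lt pE] := prP _ vn n1.
  by rewrite (next_inj vp va pr_lt ar (esym pE)).
rewrite y'c //; have [vp pr_lt pE] := prP _ va a1.
have cE s : t0 < s -> - qf (pr a) (A (y s)) = coef a (yz s).
  move=> ts; have [Dy _ _ _ _] := y_parts (ltW ts).
  by rewrite (qf_A hp) // pr_lt -pE opprK /yz (coef_proj hp) // a1.
apply: (deriv_on_eq (u := fun s => - qf (pr a) (A (y s)) : K^o)) => //; first exact: cE.
exact: deriv_onN (dq vp tt).
Qed.

Let sigma_equal : (forall t : R, t0 < t -> z t = yz t) /\
  forall (a : I) t, valid a -> t0 < t -> qf a (vy t) = qf a (A (z' t)).
Proof.
have [y' [y'_next dy']] := sigma_velocity.
have zy : forall t : R, t0 < t -> z t = yz t.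
  apply: (z_unique (y' := y')) => t tt; have [Dy D1y Mu Mz Eu] := y_parts (ltW tt).
  split=> // [j jn|j jn|a va a1]; last exact: dy'.
    have /andP[j1 _] := jn; apply: (diag_eq_ext _ _ D1y Eu j1).1; rewrite -yE.
    apply: (diag_eqP hp f_struct (T_ge0 tt) Dy jn).2 => a va; rewrite diag_val => /andP[_ /eqP ar].
    by rewrite q_eq // q_last ?add0r // ar ltnn.
  have /andP[j1 _] := jn; apply: (wedge_eq_ext _ _ _ D1y Eu j1).1; rewrite -yE.
  apply: (wedge_eqP hp f_struct _ (T_ge0 tt) Dy jn).2 => a va; rewrite wedge_val => /andP[_ ar].
  by rewrite q_eq // y'_next // opprK addrC.
split=> // a t va tt; have Dz' : D (z' t) by exact: fix_proj_D (z'_from t).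
rewrite (qf_A hp) //; case: ifP => [ar|ar]; last exact: q_last.
have [nE vn] := next_val hp ar; have n1 : from 1 (next a) by rewrite /from nE.
rewrite -[qf a _]opprK -y'_next //; congr (- _).
have sub : [set s : R | t < s] `<=` [set s | t0 < s] by move=> s; exact: lt_trans.
apply: (deriv_on_unique (V := K^o) (u := fun s => coef (next a) (z s)) (t := t)).
  apply: (deriv_on_eq (u := fun s => coef (next a) (yz s) : K^o)).
  - by move=> s /sub/zy->.
  - by rewrite zy.
  by apply: deriv_onS sub _; exact: dy'.
have sub' : [set s : R | t < s] `<=` half_line by move=> s /sub; exact: T_ge0.
apply: (deriv_on_linear sTX (coef_linear hp vn)) => //.
by apply: deriv_onS sub' _; apply: z_deriv; exact: T_ge0.
Qed.

Let x20_equal t : t0 < t -> u t = chi t (y1 t).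
Proof.
move=> tt; have [Dy D1y Mu _ Eu] := y_parts (ltW tt).
have [zy qz] := sigma_equal.
have [_ _] := chiP (T_ge0 tt) D1y; apply=> //.
apply: (G20P (T_ge0 tt) D1y Eu (esym (zy t tt))).2 => a va a0.
by rewrite -yE q_eq // qz // addrC /u (coef_proj hp) // a0.
Qed.

Lemma solution_determined t : t0 < t -> y t = x t.
Proof.
have Sy1 s : t0 <= s -> S (A (y1 s)) = y1 s.
  by move=> ts; have [_ D1y _ _ _] := y_parts ts; exact: Atilde_invK.
have Ay1 s : t0 <= s -> Q1pr p (A (y s)) = A (y1 s).
  by move=> ts; have [Dy _ _ _ _] := y_parts ts; exact: Q1_A.
have key : forall s : R, t0 < s -> A (y1 s) = w s.
  have H := reduced_unique hp closedA closedB range_closed regular psi_Y1 psi_lip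
    (v := fun s => A (y1 s)) t0_ge0 D1x01 w_start w_sol.
  apply: H.
  - by move=> s ts; have [_ D1y _ _ _] := y_parts (ltW ts); exact: A_D1.
  - move=> s ts; have [Dy D1y _ _ _] := y_parts (ltW ts).
    apply: (deriv_on_eq (u := fun s => Q1pr p (A (y s)))).
    + by move=> s' /ltW; exact: Ay1.
    + by rewrite Ay1 ?ltW.
    have -> : Phi s (A (y1 s)) = Q1pr p (vy s).
      rewrite /reduced_field (Q1pr_id hp (A_D1 hp D1y)) Sy1 ?ltW // /psi20 -x20_equal //.
      have [zy _] := sigma_equal; rewrite zy // -yE -y_eq // -(Q1_B hp Dy) /Q1pr (projQD hp).
      by vec (scalars R k).
    by apply: (deriv_on_linear sTY (Q1pr_linear hp)) => //; exact: y_deriv.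
  - move=> e e0; have [C C0 HC] := bounded_linear_bound (proj_bounded hp predT).
    have C1 : 0 < 1 + C by rewrite addr_gt0.
    have [d d0 H] := y_cont (lexx t0 : [set s | t0 <= s] t0) (divr_gt0 e0 C1).
    exists d => // s /andP[ts sd]; rewrite Sy1 ?ltW // -y_start.
    have := H s (ltW ts); rewrite gtr0_norm ?subr_gt0 // ltrBlDl => /(_ sd).
    rewrite ltr_pdivlMr // mulrDr mulr1; apply: le_lt_trans.
    have -> : y1 s - (y t0 - proj predT (y t0)) = (y s - y t0) - proj predT (y s - y t0).
      by rewrite /y1 (projB hp); vec (scalars R k).
    apply: le_trans (nrmB _ _) _; rewrite lerD2l mulrC; exact: HC.
move=> tt; have [zy _] := sigma_equal.
by rewrite /x -key // Sy1 ?ltW // -x20_equal // zy // -yE.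
Qed.

Lemma solution_determined_start : y t0 = x t0.
Proof.
apply/eqP; rewrite -subr_eq0; apply/eqP/nrm_le0/ler_addgt0Pr => e e0; rewrite add0r.
have e2 : 0 < e / 2 by rewrite divr_gt0.
have t0in : [set s : R | t0 <= s] t0 by rewrite /=.
have [d d0 H] := y_cont t0in e2; have [d' d'0 H'] := glued_cont t0in e2.
pose s := t0 + Num.min d d' / 2; have m0 : 0 < Num.min d d' by rewrite lt_min d0.
have ts : t0 < s by rewrite ltrDl divr_gt0.
have : `|s - t0| < Num.min d d'.
  by rewrite /s addrAC subrr add0r gtr0_norm ?divr_gt0 // ltr_pdivrMr // ltr_pMr // ltr1n.
rewrite lt_min => /andP[sd sd'].
have h1 := H s (ltW ts) sd; have h2 := H' s (ltW ts) sd'.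
have -> : y t0 - x t0 = (x s - x t0) - (y s - y t0).
  by rewrite (solution_determined ts); vec (scalars R k).
by apply: le_trans (nrmB _ _) _; lra.
Qed.

End other_solution.

Lemma glued_unique y : solution p f `[t0, +oo[ M y /\ P1 p (y t0) = x01 ->
  forall t : R, t0 <= t -> y t = x t.
Proof.
move=> [[yM yc [vy [dvy _ eqy]]] y0].
have sub : [set s : R | t0 < s] `<=` equation_times `[t0, +oo[.
  move=> s /= ts; split; first by rewrite rayE; exact: ltW.
  by move=> _; exact: le_lt_trans ts.
have y_M (t : R) : t0 <= t -> M (y t).
  by move=> t0t; have [] := yM t; rewrite ?rayE.
have y_cont : cont_on [set s | t0 <= s] y by rewrite -rayE; apply/cont_on_within.
have y_deriv (t : R) : t0 < t -> deriv_on [set s | t0 < s] (fun s => A (y s)) t (vy t).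
  by move=> tt; apply: (deriv_onS sub); apply/deriv_on_within; apply: dvy; exact: sub.
have y_eq (t : R) : t0 < t -> vy t + B (y t) = f t (y t) by move=> tt; apply: eqy; exact: sub.
have y_start : y t0 - proj predT (y t0) = x01 by rewrite -y0 (P1F hp).
move=> t; rewrite le_eqVlt => /orP[/eqP<-|tt].
  exact: (solution_determined_start y_M y_cont y_deriv y_eq y_start).
exact: (solution_determined y_M y_cont y_deriv y_eq y_start tt).
Qed.

End solvability.

Section last_level.
Context {R : realType} {k : scalar_kind} {X Y : completeNormedModType (scalars R k)}.
Variable p : pencil X Y.
Local Notation nu := (pencil_index p).
Local Notation n := (dim_ker p).
Local Notation rk := (@root_rank R k X Y p).
Local Notation I := ('I_n * 'I_nu)%type.
Local Notation fix_proj := (@fix_proj R k X Y p).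
Local Notation fix_projQ := (@fix_projQ R k X Y p).
Local Notation proj := (@proj R k X Y p).
Local Notation projQ := (@projQ R k X Y p).
Hypothesis hp : pencil_setting p.

Lemma level_last (c : I) : valid c -> level nu.-1 c = diag nu.-1 c.
Proof.
move=> vc; rewrite /level diag_val; case: eqP => //= c2.
have nE : c.2.+1 = nu by rewrite c2 (ltn_predK (ltn_ord c.2)).
apply/esym/eqP/anti_leq; rewrite nE; have /andP[_ ->] := rk_bounds hp c.1.
by have := vc; rewrite /valid nE.
Qed.

Lemma diag_from_last (c : I) : valid c -> diag_from nu.-1 c = diag nu.-1 c.
Proof.
move=> vc; rewrite /diag_from diag_val; congr (_ && _).
have cn : (c.2 <= nu.-1)%N by rewrite -ltnS (ltn_predK (ltn_ord c.2)).
by rewrite eqn_leq cn.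
Qed.

Lemma P2s_last : P2s p nu.-1 = proj (diag nu.-1).
Proof. by apply/funext => x; rewrite (P2sF hp); apply: eq_proj => c /level_last. Qed.

Lemma Q2s_last : Q2s p nu.-1 = projQ (diag nu.-1).
Proof. by apply/funext => x; rewrite (Q2sF hp); apply: eq_projQ => c /level_last. Qed.

Lemma D2s_last : D2s p nu.-1 = fix_proj (diag nu.-1).
Proof. by rewrite (D2sE hp); apply: (fix_proj_eq hp) => c /level_last. Qed.

Lemma Y2s_last : Y2s p nu.-1 = fix_projQ (diag nu.-1).
Proof. by rewrite (Y2sE hp); apply: (fix_projQ_eq hp) => c /level_last. Qed.

Lemma sum_set1 a (N : nat -> set X) : sum_set a a.+1 N = N a.
Proof.
apply/seteqP; split=> x.
  by move=> [xs xsN ->]; rewrite big_nat1; apply: xsN; rewrite leqnn /=.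
move=> Nx; exists (fun=> x) => [j|]; last by rewrite big_nat1.
by rewrite ltnS -eqn_leq => /eqP<-.
Qed.

Lemma M2diag_last (Md : nat -> set X) : (0 < nu)%N -> M2diag p Md nu.-1 = Md nu.-1.
Proof. by move=> nu0; rewrite /M2diag -{2}(prednK nu0) sum_set1. Qed.

Lemma sum_diag_with s (xs : nat -> X) x : (s < nu)%N ->
  sum_diag p s [eta xs with s |-> x] = \sum_(s.+1 <= j < nu) xs j + x.
Proof.
move=> sn; rewrite /sum_diag big_ltn //= eqxx addrC; congr (_ + _).
by apply: eq_big_nat => j /andP[sj _]; rewrite gtn_eqF.
Qed.

Lemma sum_wedge_with s (xs : nat -> X) x : (s < nu.-1)%N ->
  sum_wedge p s [eta xs with s |-> x] = \sum_(s.+1 <= j < nu.-1) xs j + x.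
Proof.
move=> sn; rewrite /sum_wedge big_ltn //= eqxx addrC; congr (_ + _).
by apply: eq_big_nat => j /andP[sj _]; rewrite gtn_eqF.
Qed.

Lemma with_in (s b : nat) (N : nat -> set X) (xs : nat -> X) x :
  (forall j, (s.+1 <= j < b)%N -> N j (xs j)) -> N s x ->
  forall j, (s <= j < b)%N -> N j ([eta xs with s |-> x] j).
Proof.
move=> xsN Nx j /andP[sj jb] /=; case: eqP => [->//|js]; apply: xsN.
by rewrite jb andbT ltn_neqAle sj andbT eq_sym; apply/eqP.
Qed.

Lemma proj_level_split s d : fix_proj (level s) d ->
  proj (diag s) d + proj (wedge s) d = d.
Proof.
move=> dE; rewrite [RHS](pair_sum hp (S1 := diag s) (S2 := wedge s) _ _ dE) //.
- by move=> c; rewrite diag_val wedge_val => /andP[_ /eqP->]; rewrite ltnn andbF.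
- move=> c vc; rewrite diag_val wedge_val /level -andb_orr; case: eqP => //= _.
  by move: vc; rewrite /valid leq_eqVlt eq_sym => ->.
Qed.

End last_level.

Theorem theorem4p9 (R : realType) (k : scalar_kind)
    (X Y : completeNormedModType (scalars R k))
    (p : pencil X Y) (f : R -> X -> Y)
    (A := opA p) (B := opB p) (nu := pencil_index p) (D := domD p)
    (Rplus := `[(0 : R), +oo[%classic)
    (linA : linear_operator A) (linB : linear_operator B)
    (closedA : closed_operator A) (closedB : closed_operator B)
    (denseA : dense (dom A)) (denseB : dense (dom B))
    (range_closed : closed (A @` dom A))
    (D_nontrivial : exists2 x, D x & x != 0)
    (domAB : dom A `<=` dom B)
    (nu_gt0 : (0 < nu)%N)
    (regular : regular_pencil D A B nu)
    (roots : canonical_root_system p)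
    (f_cont : {within Rplus `*` D, continuous (fun z : R * X => f z.1 z.2)})
    (f_struct : structured p f)
    (M20 : set X) (Md Mw : nat -> set X)
    (M2S := M2Sigma p Md Mw) (M := Mset p M20 Md Mw)
    (M20_open : open_in (D2s p 0) M20)
    (Md_open : forall j, (1 <= j < nu)%N -> open_in (D2sj p j j.+1) (Md j))
    (Mw_open : forall j, (1 <= j < nu.-1)%N -> open_in (D2wedge p j) (Mw j))
    (smooth_diag : forall s, (1 <= s < nu.-1)%N ->
       class_C nu.-2 Rplus (E2diag p s) (M2diag p Md s)
         (fun t x => Q2sj p s s.+1 (f t x)))
    (smooth_Sigma : forall s, (1 <= s < nu.-1)%N ->
       class_C s Rplus (sum_set2 (E2diag p 1) (E2wedge p s))
         (sum_set2 (M2diag p Md 1) (M2wedge p Mw s))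
         (fun t x => Q2Sigma p s (f t x)))
    (smooth_last : (2 <= nu)%N ->
       class_C nu.-1 Rplus (D2s p nu.-1) (Md nu.-1)
         (fun t x => Q2s p nu.-1 (f t x)))
    (cond1a : (2 <= nu)%N -> forall t, Rplus t ->
       exists! x, Md nu.-1 x /\ F2last p f t x = 0)
    (cond1b : forall s, (1 <= s < nu.-1)%N ->
       forall t (xd : nat -> X), Rplus t ->
       (forall j, (s < j < nu)%N -> Md j (xd j)) ->
       exists! x, Md s x /\ F2diag p f s t [eta xd with s |-> x] = 0)
    (cond1c : (3 <= nu)%N ->
       forall t (xd : nat -> X) (d : X), Rplus t ->
       (forall j, (1 <= j < nu)%N -> Md j (xd j)) -> D2s p nu.-1 d ->
       exists! x, Mw nu.-2 x /\ F2Sigma_last p f t xd x d = 0)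
    (cond1d : forall s, (1 <= s < nu.-2)%N ->
       forall t (xd xw : nat -> X) (dd dw : X), Rplus t ->
       (forall j, (1 <= j < nu)%N -> Md j (xd j)) ->
       (forall i, (s < i < nu.-1)%N -> Mw i (xw i)) ->
       D2wedge p s.+1 dw -> D2sj p s.+1 s.+2 dd ->
       exists! x, Mw s x /\ F2Sigma p f s t xd [eta xw with s |-> x] dd dw = 0)
    (cond1e : forall t (x1 x2S dd dw : X), Rplus t ->
       D1 p x1 -> M2S x2S -> D2wedge p 1 dw -> D2sj p 1 2 dd ->
       exists! x20, M20 x20 /\ F20 p f t x1 x20 x2S dd dw = 0)
    (cond2a : (2 <= nu)%N ->
       forall t x, Rplus t -> Md nu.-1 x -> F2last p f t x = 0 ->
       has_bounded_inverse (@nrm R k X) (@nrm R k Y)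
         (D2s p nu.-1) (Y2s p nu.-1)
         (fun h => partial_x (D2s p nu.-1) (Md nu.-1)
                     (fun t' x' => Q2s p nu.-1 (f t' x')) t x (P2s p nu.-1 h)
                   - Q2s p nu.-1 (B (P2s p nu.-1 h))))
    (cond2b : forall s, (1 <= s < nu.-1)%N ->
       forall t (xd : nat -> X), Rplus t ->
       (forall j, (s <= j < nu)%N -> Md j (xd j)) -> F2diag p f s t xd = 0 ->
       has_bounded_inverse (@nrm R k X) (@nrm R k Y)
         (D2sj p s s.+1) (Y2sj p s s.+1)
         (fun h => partial_x (E2diag p s) (M2diag p Md s)
                     (fun t' x' => Q2sj p s s.+1 (f t' x')) t (sum_diag p s xd)
                     (P2sj p s s.+1 h)
                   - Q2sj p s s.+1 (B (P2sj p s s.+1 h))))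
    (cond2c : (3 <= nu)%N ->
       forall t (xd : nat -> X) (x d : X), Rplus t ->
       (forall j, (1 <= j < nu)%N -> Md j (xd j)) -> Mw nu.-2 x ->
       D2s p nu.-1 d -> F2Sigma_last p f t xd x d = 0 ->
       has_bounded_inverse (@nrm R k X) (@nrm R k Y)
         (D2wedge p nu.-2) (Y2Sigma p nu.-2)
         (fun h => partial_x (sum_set2 (E2diag p 1) (E2wedge p nu.-2))
                     (sum_set2 (M2diag p Md 1) (M2wedge p Mw nu.-2))
                     (fun t' x' => Q2Sigma p nu.-2 (f t' x')) t
                     (sum_diag p 1 xd + x) (P2wedge p nu.-2 h)
                   - Q2Sigma p nu.-2 (B (P2wedge p nu.-2 h))))
    (cond2d : forall s, (1 <= s < nu.-2)%N ->
       forall t (xd xw : nat -> X) (dd dw : X), Rplus t ->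
       (forall j, (1 <= j < nu)%N -> Md j (xd j)) ->
       (forall i, (s <= i < nu.-1)%N -> Mw i (xw i)) ->
       D2wedge p s.+1 dw -> D2sj p s.+1 s.+2 dd ->
       F2Sigma p f s t xd xw dd dw = 0 ->
       has_bounded_inverse (@nrm R k X) (@nrm R k Y)
         (D2wedge p s) (Y2Sigma p s)
         (fun h => partial_x (sum_set2 (E2diag p 1) (E2wedge p s))
                     (sum_set2 (M2diag p Md 1) (M2wedge p Mw s))
                     (fun t' x' => Q2Sigma p s (f t' x')) t
                     (sum_diag p 1 xd + sum_wedge p s xw) (P2wedge p s h)
                   - Q2Sigma p s (B (P2wedge p s h))))
    (cond2e :
       [/\ locally_lipschitz_fixing (P2Sigma p) Rplus M
             (fun t x => Q1 p (f t x)),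
           locally_lipschitz_fixing (P2Sigma p) Rplus M
             (fun t x => Q2s p 0 (f t x))
         & forall t (x1 x20 x2S dd dw : X), Rplus t ->
             D1 p x1 -> M20 x20 -> M2S x2S -> D2sj p 1 2 dd -> D2wedge p 1 dw ->
             F20 p f t x1 x20 x2S dd dw = 0 ->
             F20_estimate p f t x1 x20 x2S dd dw]
       \/
       [/\ continuously_partially_differentiable Rplus D M
             (fun t x => Q1 p (f t x)),
           continuously_partially_differentiable Rplus D M
             (fun t x => Q2s p 0 (f t x))
         & forall t (x1 x20 x2S dd dw : X), Rplus t ->
             D1 p x1 -> M20 x20 -> M2S x2S -> D2sj p 1 2 dd -> D2wedge p 1 dw ->
             F20 p f t x1 x20 x2S dd dw = 0 ->
             has_bounded_inverse (@nrm R k X) (@nrm R k Y) (D2s p 0) (Y2s p 0)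
               (fun h => partial_x D M (fun t' x' => Q2s p 0 (f t' x')) t
                           (x1 + x20 + x2S) (P2s p 0 h)
                         - Q2s p 0 (B (P2s p 0 h)))])
    (cond3 : forall a1 a2 : R, 0 < a1 -> 0 < a2 ->
       exists C : R, forall t x, 0 <= t <= a1 -> M x -> nrm (P1 p x) <= a2 ->
         nrm (Q1 p (f t x)) <= C)
    (cond4 : exists (r : R) (V : Y -> R) (U psi : R -> R),
       [/\ 0 < r,
           [/\ {within Y1 p, continuous V}, forall w, Y1 p w -> 0 <= V w,
               {within Rplus, continuous U}, forall u, Rplus u -> 0 <= U u
             & forall t, Rplus t -> 0 <= psi t],
           (forall a b : R, 0 <= a <= b ->
              (@lebesgue_measure R).-integrable `[a, b] (EFin \o psi)) /\
           (forall u0 : R, 0 < u0 ->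
              (\int[@lebesgue_measure R]_(u in `[u0, +oo[) ((U u)%:E)^-1
                 = +oo)%E),
           (forall C : R, exists rho : R,
              forall w, Y1 p w -> rho <= nrm w -> C <= V w) /\
           (exists L : R, forall w w', Y1 p w -> Y1 p w' ->
              r <= nrm w -> r <= nrm w' -> `|V w - V w'| <= L * nrm (w - w'))
         & forall t (x20 x2S : X) (w : Y), Rplus t -> M20 x20 -> M2S x2S ->
             Y1 p w -> r <= nrm w ->
             nrm (Q1 p (f t (Atilde_inv p w + x20 + x2S))
                  - Q1 p (B (Atilde_inv p w))) <= U (V w) * psi t]) :
  forall (t0 : R) (x01 : X), Rplus t0 -> D1 p x01 ->
    exists2 x : R -> X,
      solution p f `[t0, +oo[ M x /\ P1 p (x t0) = x01
      & forall x' : R -> X,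
          solution p f `[t0, +oo[ M x' /\ P1 p (x' t0) = x01 ->
          forall t, t0 <= t -> x' t = x t.
Proof.
have hp : pencil_setting p by exact: PencilSetting linA linB domAB roots.
have RE : Rplus = half_line by exact: half_lineE.
have Rp (t : R) : 0 <= t -> Rplus t by rewrite RE.
have M20o : open_in (@fix_proj R k X Y p (level 0)) M20 by rewrite -(D2sE hp).
have Mdo j : (1 <= j < nu)%N -> open_in (@fix_proj R k X Y p (diag j)) (Md j).
  by move=> jn; rewrite -(D2sjE hp); exact: Md_open.
have Mwo j : (1 <= j < nu.-1)%N -> open_in (@fix_proj R k X Y p (wedge j)) (Mw j).
  by move=> jn; rewrite -(D2wedgeE hp); exact: Mw_open.
have last_case s : (1 <= s < nu)%N -> s <> nu.-1 -> (1 <= s < nu.-1)%N.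
  move=> /andP[s1 sn] /eqP sl; rewrite s1 /= ltn_neqAle sl /=.
  by rewrite -ltnS prednK.
have from_last : @fix_proj R k X Y p (diag_from nu.-1) = @fix_proj R k X Y p (diag nu.-1).
  by apply: (fix_proj_eq hp) => c; exact: diag_from_last.
have diag_smooth s : (1 <= s < nu)%N ->
    class_C (diag_order p s) half_line (@fix_proj R k X Y p (diag_from s)) (M2diag p Md s)
      (fun t x => @projQ R k X Y p (diag s) (f t x)).
  move=> sn; have [sE|/eqP sl] := eqVneq s nu.-1; last first.
    have := smooth_diag _ (last_case s sn sl); rewrite RE (E2diagE hp) (Q2diagF hp).
    by rewrite /diag_order; case: eqP.
  have nu2 : (2 <= nu)%N by case/andP: sn => s1 s2; exact: leq_ltn_trans s1 s2.
  have := smooth_last nu2.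
  by rewrite sE /diag_order eqxx M2diag_last // from_last RE (Q2s_last hp) (D2s_last hp).
have sum_last z : M2diag p Md nu.-1.+1 z -> z = 0.
  by move=> [xs _ ->]; rewrite prednK // big_geq.
have diag_zero s : (1 <= s < nu)%N -> forall (t : R) z, 0 <= t -> M2diag p Md s.+1 z ->
    exists! u, Md s u /\ @projQ R k X Y p (diag s) (f t (z + u)) - B u = 0.
  move=> sn t z t0 Mz; have [sE|/eqP sl] := eqVneq s nu.-1.
    have nu2 : (2 <= nu)%N by case/andP: sn => s1 s2; exact: leq_ltn_trans s1 s2.
    rewrite sE in Mz *; rewrite (sum_last z Mz).
    have [u [[Mu Fu] uu]] := cond1a nu2 t (Rp t t0).
    rewrite /F2last (Q2s_last hp) in Fu uu.
    exists u; split; first by rewrite add0r.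
    by move=> v; rewrite add0r; exact: uu.
  have sn' := last_case s sn sl; have /andP[_ sn2] := sn; move: Mz => [xs xsM ->].
  have [u [[Mu Fu] uu]] := cond1b s sn' t xs (Rp t t0) xsM.
  rewrite /F2diag (Q2diagF hp) sum_diag_with //= eqxx in Fu.
  exists u; split=> // v [Mv Fv]; apply: uu; split=> //.
  by rewrite /F2diag (Q2diagF hp) sum_diag_with //= eqxx.
have diag_inv s : (1 <= s < nu)%N -> forall (t : R) z u, 0 <= t ->
  M2diag p Md s.+1 z -> Md s u -> @projQ R k X Y p (diag s) (f t (z + u)) - B u = 0 ->
  has_bounded_inverse (@nrm R k X) (@nrm R k Y) (@fix_proj R k X Y p (diag s)) (@fix_projQ R k X Y p (diag s))
    (fun h => partial_x (@fix_proj R k X Y p (diag_from s)) (M2diag p Md s)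
       (fun t' x' => @projQ R k X Y p (diag s) (f t' x')) t (z + u) (@proj R k X Y p (diag s) h)
       - @projQ R k X Y p (diag s) (B (@proj R k X Y p (diag s) h))).
  move=> sn t z u t0 Mz Mu Fu; have [sE|/eqP sl] := eqVneq s nu.-1.
    have nu2 : (2 <= nu)%N by case/andP: sn => s1 s2; exact: leq_ltn_trans s1 s2.
    rewrite sE in Mz Mu Fu *; rewrite (sum_last z Mz) add0r in Fu *.
    have := cond2a nu2 t u (Rp t t0) Mu.
    rewrite /F2last (Q2s_last hp) (P2s_last hp) (D2s_last hp) (Y2s_last hp).
    by rewrite from_last M2diag_last //; apply.
  have sn' := last_case s sn sl; have /andP[_ sn2] := sn; move: Mz Fu => [xs xsM ->] Fu.
  have := cond2b s sn' t [eta xs with s |-> u] (Rp t t0) (with_in xsM Mu).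
  rewrite /F2diag sum_diag_with //= eqxx (Q2diagF hp) (P2diagF hp) (D2sjE hp) (Y2sjE hp) (E2diagE hp).
  by apply.
have wedge_smooth s : (1 <= s < nu.-1)%N ->
    class_C s half_line (@fix_proj R k X Y p (diag_wedge s)) (Mdw p Md Mw s)
      (fun t x => @projQ R k X Y p (wedge s) (f t x)).
  by move=> sn; have := smooth_Sigma s sn; rewrite RE (E_diag_wedge hp) (Q2SigmaF hp).
have nu_pred s : (1 <= s < nu.-1)%N -> (1 <= s < nu)%N.
  by move=> /andP[-> sn]; rewrite (leq_trans sn) // leq_pred.
have wedge_case s : (1 <= s < nu.-1)%N -> s <> nu.-2 -> (1 <= s < nu.-2)%N.
  move=> /andP[s1 sn] /eqP sl; rewrite s1 /= ltn_neqAle sl /=.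
  by rewrite -ltnS prednK // (leq_trans _ sn).
have nu3 s : (1 <= s < nu.-1)%N -> (3 <= nu)%N.
  move=> /andP[s1 sn]; rewrite -(prednK nu_gt0) ltnS; exact: leq_ltn_trans s1 sn.
have nu2S s : (1 <= s < nu.-1)%N -> nu.-2.+1 = nu.-1.
  by move=> /andP[s1 sn]; rewrite prednK // (leq_trans _ sn).
have wedge_zero s : (1 <= s < nu.-1)%N -> forall (t : R) z d, 0 <= t ->
    Mdw p Md Mw s.+1 z -> @fix_proj R k X Y p (level s.+1) d ->
    exists! u, Mw s u /\ @projQ R k X Y p (wedge s) (f t (z + u)) - B u - A d = 0.
  move=> sn t _ d t0 [_ [xd xdM ->] [_ [xw xwM ->] <-]] dE.
  have [sE|/eqP sl] := eqVneq s nu.-2.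
    have nuS := nu2S s sn; rewrite sE nuS -(D2sE hp) in dE xwM *.
    have [u [[Mu Fu] uu]] := cond1c (nu3 s sn) t xd d (Rp t t0) xdM dE.
    rewrite /F2Sigma_last (Q2SigmaF hp) in Fu uu.
    rewrite [X in _ + X]big_geq // addr0.
    by exists u.
  have sn' := wedge_case s sn sl; have /andP[_ sn2] := sn.
  have dsplit := proj_level_split hp dE.
  have [||u [[Mu Fu] uu]] := cond1d s sn' t xd xw (@proj R k X Y p (diag s.+1) d) (@proj R k X Y p (wedge s.+1) d)
    (Rp t t0) xdM xwM.
  - by rewrite (D2wedgeE hp); exact: proj_fix.
  - by rewrite (D2sjE hp); exact: proj_fix.
  rewrite /F2Sigma (Q2SigmaF hp) sum_wedge_with //= eqxx dsplit addrA in Fu.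
  exists u; split=> // v [Mv Fv]; apply: uu; split=> //.
  by rewrite /F2Sigma (Q2SigmaF hp) sum_wedge_with //= eqxx dsplit addrA.
have wedge_inv s : (1 <= s < nu.-1)%N -> forall (t : R) z u d, 0 <= t ->
  Mdw p Md Mw s.+1 z -> @fix_proj R k X Y p (level s.+1) d ->
  Mw s u -> @projQ R k X Y p (wedge s) (f t (z + u)) - B u - A d = 0 ->
  has_bounded_inverse (@nrm R k X) (@nrm R k Y) (@fix_proj R k X Y p (wedge s)) (@fix_projQ R k X Y p (wedge s))
    (fun h => partial_x (@fix_proj R k X Y p (diag_wedge s)) (Mdw p Md Mw s)
       (fun t' x' => @projQ R k X Y p (wedge s) (f t' x')) t (z + u) (@proj R k X Y p (wedge s) h)
       - @projQ R k X Y p (wedge s) (B (@proj R k X Y p (wedge s) h))).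
  move=> sn t _ u d t0 [_ [xd xdM ->] [_ [xw xwM ->] <-]] dE Mu.
  have [sE|/eqP sl] := eqVneq s nu.-2.
    have nuS := nu2S s sn; rewrite sE nuS -(D2sE hp) in dE xwM Mu *.
    have -> : \sum_(nu.-1 <= j < nu.-1) xw j = 0 by rewrite big_geq.
    rewrite addr0 => Fu.
    have := cond2c (nu3 s sn) t xd u d (Rp t t0) xdM Mu dE.
    rewrite /F2Sigma_last (Q2SigmaF hp) (P2wedgeF hp) (D2wedgeE hp) (Y2SigmaE hp) (E_diag_wedge hp).
    by apply.
  have sn' := wedge_case s sn sl; have /andP[_ sn2] := sn.
  have dsplit := proj_level_split hp dE => Fu.
  have := cond2d s sn' t xd [eta xw with s |-> u] (@proj R k X Y p (diag s.+1) d) (@proj R k X Y p (wedge s.+1) d)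
    (Rp t t0) xdM (with_in xwM Mu).
  rewrite /F2Sigma sum_wedge_with //= eqxx dsplit addrA.
  rewrite (Q2SigmaF hp) (P2wedgeF hp) (D2wedgeE hp) (D2wedgeE hp) (D2sjE hp) (Y2SigmaE hp) (E_diag_wedge hp).
  by apply=> //; exact: proj_fix.
have [z [z' [zM zd zw z'f [dz z'c]]]] := sigma_solution hp Mdo Mwo diag_smooth diag_zero
  diag_inv wedge_smooth wedge_zero wedge_inv.
have zc : cont_on half_line z by exact: deriv_cont dz.
have zD t : D (z t) by exact: fix_proj_D (z_from hp Mdo Mwo zM t).
have fc := within_setX_nrm f_cont; rewrite RE in fc.
pose r (t : R) := @projQ R k X Y p (level 0) (A (@proj R k X Y p (level 1) (z' t))).
have rc : cont_on half_line r by exact: r_cont.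
have rf t : @fix_projQ R k X Y p (level 0) (r t) by exact: r_fix.
have dd t : D2sj p 1 2 (@proj R k X Y p (diag 1) (z' t)) by rewrite (D2sjE hp); exact: proj_fix.
have dw t : D2wedge p 1 (@proj R k X Y p (wedge 1) (z' t)) by rewrite (D2wedgeE hp); exact: proj_fix.
have unique20 (t : R) x1 : 0 <= t -> D1 p x1 -> exists! u, M20 u /\ G20 p f z r t x1 u = 0.
  move=> t0 D1x; have [u [[Mu Fu] uu]] := cond1e t x1 _ _ _ (Rp t t0) D1x (zM t) (dw t) (dd t).
  exists u; split; first by rewrite (G20E hp).
  by move=> v; rewrite (G20E hp); exact: uu.
have Mo := Mset_open hp M20o Mdo Mwo.
have [lip1 lip20 est] : [/\ locally_lipschitz_fixing (P2Sigma p) half_line M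
      (fun t x => Q1pr p (f t x)),
    locally_lipschitz_fixing (P2Sigma p) half_line M (fun t x => @projQ R k X Y p (level 0) (f t x))
  & forall (t : R) x1 u, 0 <= t -> D1 p x1 -> M20 u -> G20 p f z r t x1 u = 0 ->
      estimate20 p f z r t x1 u].
  case: cond2e => -[]; rewrite RE (Q2sF hp) (Q1F hp) => c1 c2 c3.
    split=> // t x1 u t0 D1x Mu; rewrite (G20E hp) => F0.
    exact: (estimate20_of_F20_estimate hp Mdo Mwo zM zc z'c t0 D1x
      (c3 t x1 u (z t) _ _ t0 D1x Mu (zM t) (dd t) (dw t) F0)).
  have sD := D_subspace hp.
  split; [exact: differentiable_locally_lipschitz c1 | exact: differentiable_locally_lipschitz c2 |].
  move=> t x1 u t0 D1x Mu; rewrite (G20E hp) => F0.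
  have inv := c3 t x1 u (z t) _ _ t0 D1x Mu (zM t) (dd t) (dw t) F0.
  rewrite (D2sE hp) (Y2sE hp) (P2sF hp) in inv.
  apply: (estimate20_of_derivative hp M20o Mdo Mwo z' zM zc t0 D1x Mu c2).
  exact: inv.
have lip1n := lipschitz_near_of hp M20o Mdo Mwo zM zc lip1.
have lip20n := lipschitz_near_of hp M20o Mdo Mwo zM zc lip20.
have [chi chiP] := x20_exists unique20.
have cc := chi_cont hp M20o fc zD zc rc rf est chiP.
have pc := psi20_cont hp M20o fc zD zc rc rf est chiP.
have pl := psi20_lip hp M20o fc zD zc rc rf est lip1n lip20n chiP.
move=> t0 x01; rewrite RE => t00 D1x01.
have [rho [V [U [ps [rho0 [_ V0 Uc U0 ps0] [psi_i U_int] [Vc [L VL]] gr]]]]] := cond4.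
have psi_Y1 (t : R) x1 : Y1 p (psi20 p f z chi t x1) by exact: Q1pr_Y1.
have growth (t : R) w : 0 <= t -> Y1 p w -> rho <= nrm w ->
    nrm (psi20 p f z chi t (Atilde_inv p w) - B (Atilde_inv p w)) <= U (V w) * ps t.
  move=> t0' Yw rw; have [D1x _] := Atilde_invP hp closedA closedB range_closed regular Yw.
  have [Mu _ _] := chiP t _ t0' D1x.
  have := gr t _ _ w (Rp t t0') Mu (zM t) Yw rw.
  by rewrite (Q1F hp) (Q1pr_id hp (B_D1 hp D1x)).
have bounded (a1 a2 : R) : 0 < a1 -> 0 < a2 -> exists C : R, forall (t : R) x1,
    0 <= t <= a1 -> D1 p x1 -> nrm x1 <= a2 -> nrm (psi20 p f z chi t x1) <= C.
  move=> a10 a20; have [C HC] := cond3 a1 a2 a10 a20; exists C => t x1 ta D1x xa.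
  have /andP[t0' _] := ta; have [Mu _ _] := chiP t x1 t0' D1x.
  have := HC t (x1 + chi t x1 + z t) ta (Mset_sum D1x Mu (zM t)).
  have Eu := open_in_sub M20o Mu.
  have [PT _ _] := proj_parts hp D1x Eu (z_from hp Mdo Mwo zM t).
  have -> : P1 p (x1 + chi t x1 + z t) = x1 by rewrite (P1F hp) PT; vec (scalars R k).
  by rewrite (Q1F hp); apply.
have [w [w0 ws wY]] := reduced_global hp closedA closedB range_closed regular psi_Y1 pc pl
  V0 Uc (fun u u0 => U0 u (Rp u u0)) (fun t tt => ps0 t (Rp t tt)) psi_i U_int Vc VL growth bounded t00 (A_D1 hp D1x01).
exists (glued_solution p z chi w).
  exact: (glued_is_solution hp closedA closedB range_closed regular f_struct M20o Mdo Mwo zM zd zw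
    z'f dz z'c chiP pc cc t00 D1x01 w0 ws wY).
move=> y ysol; apply: (glued_unique hp closedA closedB range_closed regular f_struct M20o Mdo Mwo
    z'f dz chiP pl cc t00 D1x01 w0 ws wY _ ysol).
move=> v v' vP; apply: (sigma_unique hp Mdo Mwo diag_zero wedge_zero (z' := z') (v' := v')) => //.
- by move=> t /= tt; apply: le_trans (ltW tt).
- by move=> t s /= tt; exact: lt_trans.
move=> t /= tt; have t0' : 0 <= t by apply: le_trans (ltW tt).
split=> // [j jn|j jn|a va a1]; [exact: zd | exact: zw |].
have sub : [set s : R | t0 < s] `<=` half_line by move=> s /= /ltW; exact: le_trans.
have sT : subspace (setT : set X) by split.
apply: (deriv_on_linear sT (coef_linear hp va)) => //.
by apply: (deriv_onS sub); exact: dz.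
Qed.
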